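(* Let $\Omega\subset M$ be a domain in the class $\mathcal{O}^+$ such that $\mathrm{vol}(\Omega)\le\rho$, $\mathrm{Ric}_x(\xi,\xi)\ge-\kappa|\xi|^2$ for all $x\in\Omega$, $\xi\in T_xM$, and the Sobolev constant $C_{\rm Sob}(\Omega)$ can be chosen with $C_{\rm Sob}(\Omega)\le\sigma$. Let $\gamma>1$, $f\in\mathcal{C}^1(\Omega,\mathbb{R})\cap\mathcal{C}^0(\overline\Omega,\mathbb{R})$, and let $B\in\mathcal{C}^1(\Omega,TM|_\Omega)\cap\mathcal{C}^0(\overline\Omega,TM|_{\overline\Omega})$ be a vector field such that $\|B\|_{L^s(\Omega)}\le\theta$ for some $s>d$. Here $\kappa,\rho,\sigma,\theta$ are given positive constants. Let $u\in\mathcal{C}^3(\Omega,\mathbb{R})\cap\mathcal{C}^2(\overline\Omega,\mathbb{R})$ be a solution of the Neumann problem $$\begin{cases}-\Delta u+\tfrac1\gamma|\nabla u|^\gamma+g(B,\nabla u)=f&\text{in }\Omega,\\ \partial_\nu u=0&\text{on }\partial\Omega.\end{cases}$$ Then there exists $\bar r=\bar r(d,\gamma)>1$ such that, for any $r>\bar r$, there exist a constant $C=C(d,\gamma,\kappa,\rho,\sigma,\theta,r,s)>0$ and an exponent $q=q(d,r)$ with $1<q<d$ such that $$\|\nabla u\|_{L^r(\Omega,TM|_\Omega)}\le C\big(1+\|f\|_{L^q(\Omega,\mathbb{R})}\big),\qquad \lim_{r\to+\infty}q(d,r)=d^-.$$ (The notation $\bar r(d,\gamma)$, $C(\dots)$,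 $q(d,r)$ means that the quantity depends only on the listed data.)
   Context: $(M^d,g)$ is a smooth, connected, orientable, not necessarily complete Riemannian manifold of dimension $d\ge3$; $\nabla$ is the gradient, $\Delta=\mathrm{div}\,\nabla$ the Laplacian, $\mathrm{Ric}$ the Ricci tensor, $D$ the Levi-Civita connection, $\omega_{\rm vol}$ the Riemannian volume form, and $\mathrm{vol}(E)=\int_E\omega_{\rm vol}$. For a tensor field $T$, $\|T\|_{L^p(\Omega)}=\big(\int_\Omega|T|^p\omega_{\rm vol}\big)^{1/p}$. A domain is a non-empty connected open subset. The class $\mathcal{O}$ consists of the domains $\Omega\subset M$ with compact closure whose boundary $\partial\Omega$ is an orientable embedded hypersurface of class $\mathcal{C}^\infty$; $\nu$ is the outward unit normal field on $\partial\Omega$, $\partial_\nu u=g(\nabla u,\nu)$, and the second fundamental form is $\mathrm{II}(X,Y)=-g(D_XY,\nu)$ for $X,Y$ tangent to $\partial\Omega$. The class $\mathcal{O}^+$ consists of those $\Omega\in\mathcal{O}$ for which $\mathrm{II}$ is non-negative definite. The Sobolev constant $C_{\rm Sob}(\Omega)>0$ is any constant such that $\|v\|_{L^{2d/(d-2)}(\Omega)}\le C_{\rm Sob}(\Omega)\big(\|\nabla v\|_{L^2(\Omega)}+\|v\|_{L^2(\Omega)}\big)$ for all $v\in W^{1,2}(\Omega,\mathbb{R})$. *)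

(* Defs.v *)
From HB Require Import structures.
From mathcomp Require Import all_boot all_order all_algebra.
From mathcomp Require Import all_classical all_reals all_analysis.

Set Implicit Arguments.
Unset Strict Implicit.
Unset Printing Implicit Defensive.
Import Order.TTheory GRing.Theory Num.Theory.
Import numFieldNormedType.Exports.
Local Open Scope classical_set_scope.
Local Open Scope ring_scope.

Section Euclidean.
Context {R : realType}.

Definition partial {d} (i : 'I_d) (f : 'rV[R]_d -> R) (y : 'rV[R]_d) : R :=
  'D_(delta_mx 0 i) f y.

Fixpoint Ck {d} (k : nat) (U : set 'rV[R]_d) (f : 'rV[R]_d -> R) : Prop :=
  (forall y, U y -> {for y, continuous f}) /\
  match k with
  | 0 => True
  | k'.+1 => forall i : 'I_d,
      (forall y, U y -> derivable f y (delta_mx 0 i)) /\ Ck k' U (partial i f)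
  end.

Definition smooth {d} (U : set 'rV[R]_d) (f : 'rV[R]_d -> R) : Prop :=
  forall k, Ck k U f.

(* All partial derivatives of f of order at most k extend continuously
   from U to E. *)
Fixpoint Ck_ext {d} (k : nat) (U E : set 'rV[R]_d) (f : 'rV[R]_d -> R) : Prop :=
  (exists2 h : 'rV[R]_d -> R,
     {within E, continuous h} & forall y, U y -> f y = h y) /\
  match k with
  | 0 => True
  | k'.+1 => forall i : 'I_d, Ck_ext k' U E (partial i f)
  end.

(* Integral against d-dimensional Lebesgue measure, as an iterated integral;
   it is only applied to non-negative Borel functions (Tonelli). *)
Fixpoint lebesgue_int (d : nat) : ('rV[R]_d -> \bar R) -> \bar R :=
  match d with
  | 0 => fun F => F 0
  | d'.+1 => fun F => (\int[lebesgue_measure]_(t in [set: R])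
      @lebesgue_int d' (fun y : 'rV[R]_d' =>
         F (row_mx (t%:M : 'rV[R]_1) y)))%E
  end.

End Euclidean.

(* The coordinate map and its inverse are total functions; their values off
   cdom and off the image of cdom are irrelevant. *)
Record chart (R : realType) (d : nat) (T : topologicalType) := Chart {
  cdom : set T;
  cfun : T -> 'rV[R]_d;
  cinv : 'rV[R]_d -> T;
  cdom_open : open cdom;
  cimg_open : open (cfun @` cdom);
  cfunK : forall p, cdom p -> cinv (cfun p) = p;
  cfun_continuous : {within cdom, continuous cfun};
  cinv_continuous : {within cfun @` cdom, continuous cinv}
}.

Section Charts.
Context {R : realType} {d : nat} {T : topologicalType}.
Implicit Types c : chart R d T.

Definition transition c c' : 'rV[R]_d -> 'rV[R]_d := cfun c' \o cinv c.

Definition chart_image c (A : set T) : set 'rV[R]_d :=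
  cfun c @` (cdom c `&` A).

Definition transition_smooth c c' : Prop :=
  forall j : 'I_d,
    smooth (chart_image c (cdom c')) (fun y => transition c c' y 0 j).

Definition compatible c c' : Prop :=
  transition_smooth c c' /\ transition_smooth c' c.

End Charts.

Record manifold (R : realType) (d : nat) := Manifold {
  mspace :> ptopologicalType;
  mspace_hausdorff : hausdorff_space mspace;
  mspace_second_countable : @second_countable mspace;
  atlas : set (chart R d mspace);
  atlas_compatible : forall c c', atlas c -> atlas c' -> compatible c c';
  atlas_maximal : forall c,
    (forall c', atlas c' -> compatible c c') -> atlas c;
  chart_at : mspace -> chart R d mspace;
  chart_at_atlas : forall p, atlas (chart_at p);
  chart_at_dom : forall p, cdom (chart_at p) p
}.

Arguments atlas {R d m}.

(* A tangent vector at p is represented by the row of its components in the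
   distinguished chart chart_at p, so that T_pM is 'rV[R]_d, and a vector field
   is a function M -> 'rV[R]_d.  Since chart_at need not depend continuously on
   p, regularity of a field is a condition on its components in the charts of
   the atlas. *)
Section Manifold.
Context {R : realType} {d : nat} {M : manifold R d}.
Implicit Types (c : chart R d M) (p : M) (u : M -> R) (X : M -> 'rV[R]_d).

Definition tcomp c p (v : 'rV[R]_d) : 'rV[R]_d :=
  v *m 'J (transition (chart_at p) c) (cfun (chart_at p) p).

Definition field_in c X (y : 'rV[R]_d) : 'rV[R]_d :=
  tcomp c (cinv c y) (X (cinv c y)).

Definition Ck_fun (k : nat) (D : set M) u : Prop :=
  forall c, atlas c -> Ck k (chart_image c D) (u \o cinv c).

Definition Ck_fun_closure (k : nat) (D : set M) u : Prop :=
  {within closure D, continuous u} /\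
  forall c, atlas c ->
    Ck_ext k (chart_image c D) (chart_image c (closure D)) (u \o cinv c).

Definition Ck_field (k : nat) (D : set M) X : Prop :=
  forall c, atlas c -> forall i : 'I_d,
    Ck k (chart_image c D) (fun y => field_in c X y 0 i).

Definition C0_field_closure (D : set M) X : Prop :=
  forall c, atlas c -> forall i : 'I_d,
    {within chart_image c (closure D),
       continuous (fun y => field_in c X y 0 i)}.

Definition smooth_field X : Prop := forall k, Ck_field k [set: M] X.

Definition differential u p : 'rV[R]_d :=
  \row_i partial i (u \o cinv (chart_at p)) (cfun (chart_at p) p).

(* The differential at points of the closure of D, where the partial
   derivatives are understood as limits from inside D. *)
Definition differential_closure (D : set M) u p : 'rV[R]_d :=
  let c := chart_at p in
  \row_i lim (partial i (u \o cinv c) @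
                within (chart_image c D) (nbhs (cfun c p))).

Definition domain (D : set M) : Prop := [/\ D !=set0, connected D & open D].

Definition bdry (D : set M) : set M := closure D `\` interior D.

(* c is a slice chart, with transverse coordinate number k, for the boundary
   of D. *)
Definition slice_chart (D : set M) (k : 'I_d) c : Prop :=
  atlas c /\ forall p, cdom c p -> (bdry D p <-> cfun c p 0 k = 0).

Definition bdry_embedded (D : set M) : Prop :=
  forall p, bdry D p -> exists k c, slice_chart D k c /\ cdom c p.

(* The restrictions of slice charts to the boundary are charts of the boundary;
   the Jacobian matrix of a change of such charts is the minor obtained by
   deleting the transverse coordinate. *)
Definition bdry_orientable (D : set M) : Prop :=
  exists (k : 'I_d) (A : set (chart R d M)),
    [/\ A `<=` slice_chart D k,
        (forall p, bdry D p -> exists2 c, A c & cdom c p) &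
        (forall c c', A c -> A c' ->
           forall p, bdry D p -> cdom c p -> cdom c' p ->
           0 < \det (row' k (col' k ('J (transition c c') (cfun c p)))))].

Definition bdry_tangent (D : set M) p (v : 'rV[R]_d) : Prop :=
  exists k c, [/\ slice_chart D k c, cdom c p & tcomp c p v 0 k = 0].

Definition bdry_outward (D : set M) p (v : 'rV[R]_d) : Prop :=
  exists k c, [/\ slice_chart D k c, cdom c p,
    (forall x, cdom c x -> (D x <-> cfun c x 0 k < 0)) &
    0 < tcomp c p v 0 k].

Definition class_O (D : set M) : Prop :=
  [/\ domain D, compact (closure D), bdry_embedded D & bdry_orientable D].

End Manifold.

Definition orientable (R : realType) (d : nat) (M : manifold R d) : Prop :=
  exists A : set (chart R d M),
    [/\ A `<=` atlas,
        (forall p, exists2 c, A c & cdom c p) &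
        (forall c c', A c -> A c' -> forall p, cdom c p -> cdom c' p ->
           0 < \det ('J (transition c c') (cfun c p)))].

(* The matrix, in chart c, of the bilinear forms g p on the tangent spaces. *)
Definition metric_in (R : realType) (d : nat) (M : manifold R d)
    (g : M -> 'M[R]_d) (c : chart R d M) (y : 'rV[R]_d) : 'M[R]_d :=
  let p := cinv c y in
  let J := 'J (transition c (chart_at p)) y in J *m g p *m J^T.

Record riemannian (R : realType) (d : nat) := Riemannian {
  rman :> manifold R d;
  metric : rman -> 'M[R]_d;
  metric_sym : forall p, (metric p)^T = metric p;
  metric_pos : forall p (v : 'rV[R]_d),
    v != 0 -> 0 < (v *m metric p *m v^T) 0 0;
  metric_smooth : forall c, atlas c -> forall i j : 'I_d,
    smooth (chart_image c [set: rman]) (fun y => metric_in metric c y i j)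
}.

Notation borel T := (g_sigma_algebraType (@open T)).

Section Riemannian.
Context {R : realType} {d : nat} {M : riemannian R d}.
Implicit Types (c : chart R d M) (p : M) (u f : M -> R).
Implicit Types (X Y V : M -> 'rV[R]_d) (D : set M) (y : 'rV[R]_d).

Definition inner p (v w : 'rV[R]_d) : R := (v *m metric p *m w^T) 0 0.

Definition tnorm p (v : 'rV[R]_d) : R := Num.sqrt (inner p v v).

Definition gmx c y : 'M[R]_d := metric_in (@metric R d M) c y.

Definition christoffel c (k i j : 'I_d) y : R :=
  2^-1 * \sum_(l < d) invmx (gmx c y) k l *
    (partial i (fun z => gmx c z j l) y + partial j (fun z => gmx c z i l) y
     - partial l (fun z => gmx c z i j) y).

(* D_v X = v *m covD X p for v in T_pM. *)
Definition covD X p : 'M[R]_d :=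
  let c := chart_at p in let y := cfun c p in
  \matrix_(i, k) (partial i (fun z => field_in c X z 0 k) y
                  + \sum_(j < d) christoffel c k i j y * field_in c X y 0 j).

Definition divergence X p : R := \tr (covD X p).

Definition grad u p : 'rV[R]_d := differential u p *m invmx (metric p).

Definition grad_closure D u p : 'rV[R]_d :=
  differential_closure D u p *m invmx (metric p).

Definition laplacian u p : R := divergence (grad u) p.

(* Component l of R(e_i, e_j) e_k, where
   R(X, Y) Z = D_X D_Y Z - D_Y D_X Z - D_[X, Y] Z. *)
Definition curvature c (l i j k : 'I_d) y : R :=
  partial i (christoffel c l j k) y - partial j (christoffel c l i k) y
  + \sum_(m < d) (christoffel c l i m y * christoffel c m j k y
                  - christoffel c l j m y * christoffel c m i k y).

(* Ric(Y, Z) is the trace of X |-> R(X, Y) Z. *)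
Definition ricci p (v w : 'rV[R]_d) : R :=
  let c := chart_at p in
  \sum_(j < d) \sum_(k < d) v 0 j * w 0 k *
    \sum_(i < d) curvature c i i j k (cfun c p).

Definition outward_unit_normal D (nu : M -> 'rV[R]_d) : Prop :=
  forall p, bdry D p ->
    [/\ inner p (nu p) (nu p) = 1,
        (forall v, bdry_tangent D p v -> inner p (nu p) v = 0) &
        bdry_outward D p (nu p)].

Definition second_ff (nu X Y : M -> 'rV[R]_d) p : R :=
  - inner p (X p *m covD Y p) (nu p).

(* The tangent fields on the boundary are taken to be restrictions of smooth
   fields on M, on which the second fundamental form does not depend. *)
Definition class_Oplus D (nu : M -> 'rV[R]_d) : Prop :=
  class_O D /\
  forall X, smooth_field X ->
    (forall p, bdry D p -> bdry_tangent D p (X p)) ->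
    forall p, bdry D p -> 0 <= second_ff nu X X p.

Definition normal_derivative D (nu : M -> 'rV[R]_d) u p : R :=
  inner p (grad_closure D u p) (nu p).

Definition riemannian_volume
    (vol : {measure set (borel M) -> \bar R}) : Prop :=
  forall c, atlas c -> forall E : set (borel M), measurable E -> E `<=` cdom c ->
    vol E = lebesgue_int (fun y : 'rV[R]_d =>
      (\1_(cfun c @` E) y * Num.sqrt (\det (gmx c y)))%:E).

Section Norms.
Variable vol : {measure set (borel M) -> \bar R}.

Definition Lp_norm (p : R) D (h : M -> R) : \bar R :=
  ('N[vol]_(p%:E)[((EFin \o h) \_ D : borel M -> \bar R)])%E.

Definition Lp_norm_field (p : R) D X : \bar R :=
  Lp_norm p D (fun x => tnorm x (X x)).

Definition measurable_field D X : Prop :=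
  forall c, atlas c -> forall i : 'I_d,
    measurable_fun (D `&` cdom c : set (borel M))
      (fun p : borel M => tcomp c p (X p) 0 i).

Definition weak_gradient D u V : Prop :=
  forall Y, smooth_field Y ->
    (exists K, [/\ compact K, K `<=` D & forall p, ~ K p -> Y p = 0]) ->
    (\int[vol]_(p in D) (u p * divergence Y p)%:E =
     - \int[vol]_(p in D) (inner p (V p) (Y p))%:E)%E.

(* u is in W^{1,2}(D), with weak gradient V. *)
Definition W12 D u V : Prop :=
  [/\ measurable_fun (D : set (borel M)) (u : borel M -> R) /\
      measurable_field D V,
      (Lp_norm 2 D u < +oo)%E, (Lp_norm_field 2 D V < +oo)%E &
      weak_gradient D u V].

Definition sobolev_constant D (S : R) : Prop :=
  0 < S /\
  forall u V, W12 D u V ->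
    (Lp_norm (2 * d%:R / (d%:R - 2)) D u
     <= S%:E * (Lp_norm_field 2 D V + Lp_norm 2 D u))%E.

End Norms.
End Riemannian.

(* Main.v *)
(* Integral Bernstein method. Put X = grad u and w = |X|^2. Bochner's formula reads
   div (D_X X - (div X) X) = tr ((D X)^2) - (div X)^2 + Ric (X, X). For large b and
   c = b / (gamma (b + gamma / 2)) consider
     Z = w^b (D_X X - (div X) X) + c w^(b + gamma / 2) X.
   In div Z the terms in w^(gamma / 2) g(D_X X, X) cancel, and since
   div X = w^(gamma / 2) / gamma + g(B, X) - f, the remaining ones dominate
   c1 w^(b + gamma) + b w^(b - 1) |D_X X|^2 up to kappa w^(b + 1) and a multiple of
   (g(B, X) - f)^2 w^b. On the boundary g(X, nu) = 0 and
   g(Z, nu) = w^b g(D_X X, nu) = - w^b II (X, X) <= 0, so the integral of div Z is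
   non-positive. Sobolev's inequality for w^((b + 1) / 2), whose gradient is
   (b + 1) w^((b - 1) / 2) D_X X, turns this into a bound on the norm of w in
   L^((b + 1) d / (d - 2)): the term in w^(b + 1) is absorbed by w^(b + gamma) as
   gamma > 1, the drift by Hoelder's inequality as s > d, and f enters through
   its norm in L^q with q = r d / (d + r). As Z is only known to be C^1 inside Omega
   with limits at the boundary, the divergence inequality is proved chart by chart,
   with a smooth ramp that vanishes near the boundary and tends to 1. *)
Require Import Defs.
From HB Require Import structures.
From mathcomp Require Import all_boot all_order all_algebra.
From mathcomp Require Import perm.
From mathcomp Require Import all_classical all_reals all_analysis.
From mathcomp Require Import measurable_realfun ring lra.
Set Implicit Arguments.
Unset Strict Implicit.
Unset Printing Implicit Defensive.
Import Order.TTheory GRing.Theory Num.Theory.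
Import numFieldNormedType.Exports.
Local Open Scope classical_set_scope.
Local Open Scope ring_scope.

(** * Functions of class C^k on row vectors *)

(** The obstacle is regularity at the boundary. Z contains second derivatives of u, which extend to
    the closure, so div Z formally contains third ones, which do not. Bochner's formula removes
    them: div Z has limits at the boundary. Every quantity is carried with two facts, continuity
    inside Omega and existence of limits from inside; compactness of the closure makes it bounded,
    so all integrals are finite and terms can be absorbed. No boundary integral occurs; the boundary
    enters only as the sign of a limit. Two demands on b = r (d - 2) / (2 d) - 1 fix the threshold
    for r: b >= 4 d gamma keeps 1 - c gamma below 1 / (8 d), so that (div X)^2 <= d tr ((D X)^2)
    leaves a positive multiple of w^(b + gamma); b >= 7 makes w^((b + 1) / 2) and its gradient C^1
    across the zeros of w. The exponent q satisfies 1 / q = 1 / r + 1 / d, that is, r is its Sobolev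
    conjugate. To keep the constant independent of the manifold, the closing step is an inequality
    on an abstract measure space. *)

#[global] Instance rV_nbhs_filter (R : realType) (d : nat) (y : 'rV[R]_d) :
  ProperFilter (nbhs y) := nbhs_pfilter y.

Section Lines.
Context {R : realType} {V : normedModType R}.
Implicit Types (f : V -> R) (a v : V).

Lemma is_derive_line f a v (t : R) : derivable f (a + t *: v) v ->
  is_derive t 1 (fun s => f (a + s *: v)) ('D_v f (a + t *: v)).
Proof.
have E : (fun h : R => h^-1 *: (((fun s => f (a + s *: v)) \o shift t) (h *: 1)
    - f (a + t *: v))) =
   (fun h : R => h^-1 *: ((f \o shift (a + t *: v)) (h *: v) - f (a + t *: v))).
  apply/funext => h /=; congr (_ *: (f _ - _)).
  by rewrite [h *: 1]mulr1 scalerDl addrCA.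
by move=> dv; split; rewrite /derivable /derive E.
Qed.
End Lines.

Section MeanValue.
Context {R : realType} {V : normedModType R}.

(** The segment from a to a + c v is parametrized by [0, 1], so that c may have either sign or
    vanish. *)
Lemma mvt_line (f : V -> R) (a v : V) (c : R) :
  (forall t : R, 0 <= t <= 1 -> derivable f (a + (t * c) *: v) v) ->
  exists2 t : R, 0 <= t <= 1 &
    f (a + c *: v) - f a = c * 'D_v f (a + (t * c) *: v).
Proof.
move=> df; pose g := fun s : R => f (a + (s * c) *: v).
have dg (t : R) : 0 <= t <= 1 -> is_derive t 1 g ('D_v f (a + (t * c) *: v) * c).
  move=> t01; have /is_derive_line h := df t t01.
  have h2 : is_derive t 1 (fun s : R => s * c) c.
    have := @is_deriveM R _ id (cst c) t 1 1 0 _ _.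
    by move=> /(_ _ _)/is_derive_eq; apply; rewrite scaler0 add0r [_ *: _]mulr1.
  exact: (@is_derive1_comp _ (fun s => f (a + s *: v)) (fun s => s * c)).
have [||t] := @MVT_segment R g (fun t => 'D_v f (a + (t * c) *: v) * c) 0 1 ler01.
- by move=> t t01; apply: dg; move: t01; rewrite in_itv/= => /andP[/ltW-> /ltW->].
- apply: derivable_within_continuous => t; rewrite in_itv/= => t01.
  by have [] := dg t t01.
- rewrite in_itv/= => t01; rewrite /g mul1r mul0r scale0r addr0 subr0 mulr1 => ->.
  by exists t => //; rewrite mulrC.
Qed.

Lemma cvg_sumr {T : Type} {F : set_system T} {FF : Filter F} I (r : seq I)
    (P : pred I) (f : I -> T -> V) (l : I -> V) :
  (forall i, P i -> f i x @[x --> F] --> l i) ->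
  \sum_(i <- r | P i) f i x @[x --> F] --> \sum_(i <- r | P i) l i.
Proof. by move=> fl; apply: cvg_big => //; exact: add_continuous. Qed.

(** The candidate for a differential: the linear map sending the coordinate vectors to the values
    [a i]. *)
Definition sumform d (a : 'I_d -> V) (v : 'rV[R]_d) : V := \sum_i v 0 i *: a i.

Lemma sumform_is_linear d (a : 'I_d -> V) : linear (sumform a).
Proof.
move=> k u v; rewrite /sumform scaler_sumr -big_split; apply: eq_bigr => i _ /=.
by rewrite !mxE scalerDl scalerA.
Qed.
HB.instance Definition _ d (a : 'I_d -> V) :=
  GRing.isLinear.Build R 'rV[R]_d V _ (sumform a) (sumform_is_linear a).

Lemma sumform_continuous d (a : 'I_d -> V) : continuous (sumform a).
Proof.
move=> v; rewrite /sumform.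
apply: (@cvg_sumr _ (nbhs v) _ _ _ _ (fun i x => x 0 i *: a i)) => i _.
by apply: cvgZr_tmp; exact: coord_continuous.
Qed.

End MeanValue.

Section C1.
Context {R : realType} {d : nat}.
Implicit Types (f : 'rV[R]_d -> R) (U : set 'rV[R]_d) (y h : 'rV[R]_d).

Let trunc (m : nat) h : 'rV[R]_d := \row_i (if (i < m)%N then h 0 i else 0).

Lemma normr_row_le h (c : R) : 0 <= c -> (forall i, `|h 0 i| <= c) -> `|h| <= c.
Proof.
move=> c0 hc; rewrite [ `|_| ]/Num.Def.normr/= mx_normrE.
by apply: bigmax_le => // -[i j] _ /=; rewrite ord1.
Qed.

Lemma normr_coord_le h i : `|h 0 i| <= `|h|.
Proof.
rewrite [leRHS]/Num.Def.normr/= mx_normrE.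
exact: (le_bigmax _ (fun ij : 'I_1 * 'I_d => `|h ij.1 ij.2|) (0, i)).
Qed.

(** The increment from y to y + h is telescoped along the truncations [trunc m h], which switch on
    one coordinate at a time; each step is a mean value of one partial derivative. Truncation does
    not increase the sup norm, so the path stays in the ball where the partial derivatives are close
    to their values at y. *)
Lemma partial_differentiable_of_continuous f y :
  (\forall z \near y, forall i, derivable f z (delta_mx 0 i)) ->
  (forall i, {for y, continuous (partial i f)}) ->
  differentiable f y.
Proof.
move=> df cf; pose L := sumform (fun i => partial i f y).
suff dif : forall e : R, 0 < e -> \forall h \near (0 : 'rV[R]_d),
    `|(f \o shift y - (cst (f y) + L)) h| <= e * `|h|.
  have dif2 := (@eqaddoP _ _ _ _ _ _ _ _).2 dif.
  have dL := diff_unique (@sumform_continuous _ _ _ _) dif2.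
  apply/diff_locallyP; rewrite dL; split => //; exact: sumform_continuous.
move=> e e0.
have d1 : 0 < (d%:R + 1 : R) by rewrite ltr_wpDl.
(* The denominator d + 1 rather than d keeps the quotient meaningful for d = 0. *)
have : \forall z \near y, (forall i, derivable f z (delta_mx 0 i)) /\
    (forall i, `|partial i f y - partial i f z| < e / (d%:R + 1)).
  have cf2 : \forall z \near y, forall i : 'I_d,
      `|partial i f y - partial i f z| < e / (d%:R + 1).
    apply: (@filter_forall _ _ (fun i z => `|partial i f y - partial i f z| <
       e / (d%:R + 1)) _ (nbhs_filter y)) => i.
    by move/cvgrPdist_lt : (cf i); apply; rewrite divr_gt0.
  exact: filterI df cf2.
move=> /nbhs_ballP[r /= r0 hr]; apply/nbhs_ballP; exists r => //= h.
rewrite -!ball_normE /= sub0r normrN => hr'.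
have tb m : `|trunc m h| <= `|h|.
  apply: normr_row_le => // i; rewrite mxE; case: ifP => // _.
  - exact: normr_coord_le.
  - by rewrite normr0.
have truncS (m : 'I_d) : trunc m.+1 h = trunc m h + h 0 m *: delta_mx 0 m.
  apply/rowP => i; rewrite !mxE /= ltnS leq_eqVlt.
  have [->|im] := eqVneq i m; first by rewrite eqxx ltnn add0r mulr1.
  have im' : (i == m :> nat) = false by apply/negbTE.
  by rewrite im' mulr0 addr0.
have step (m : 'I_d) : `|f (trunc m.+1 h + y) - f (trunc m h + y) -
    h 0 m * partial m f y| <= `|h| * (e / (d%:R + 1)).
  have tr (t : R) : 0 <= t <= 1 ->
      ball y r (trunc m h + y + (t * h 0 m) *: delta_mx 0 m).
    move=> /andP[t0 t1]; rewrite -ball_normE /= distrC [_ + y + _]addrAC addrK.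
    rewrite (le_lt_trans _ hr') //; apply: normr_row_le => // i.
    rewrite !mxE; have [->|im] := eqVneq i m.
      rewrite /= ltnn add0r mulr1 normrM (ger0_norm t0).
      by rewrite (le_trans (ler_piMl _ t1)) ?normr_ge0 // normr_coord_le.
    rewrite /= mulr0 addr0; case: ifP => _; first exact: normr_coord_le.
    by rewrite normr0.
  rewrite truncS [trunc m h + _ + y]addrAC.
  have [t t01|t t01 ->] := @mvt_line R _ f (trunc m h + y)
     (delta_mx 0 m) (h 0 m); first by case: (hr _ (tr t t01)).
  rewrite -mulrBr normrM ler_pM ?normr_coord_le // distrC ltW //.
  by case: (hr _ (tr t t01)).
have -> : (f \o shift y - (cst (f y) + L)) h =
    \sum_(m < d) (f (trunc m.+1 h + y) - f (trunc m h + y) - h 0 m * partial m f y).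
  rewrite sumrB -(big_mkord xpredT (fun m => f (trunc m.+1 h + y) - f (trunc m h + y))).
  rewrite telescope_sumr // /L /sumform !fctE /= opprD addrA; congr (f (_ + _) - f _ - _).
    by apply/rowP => i; rewrite mxE ltn_ord.
  by rewrite -[LHS]add0r; congr (_ + _); apply/rowP => i; rewrite !mxE.
apply: le_trans (ler_norm_sum _ _ _) _.
apply: le_trans (ler_sum _ (fun m _ => step m)) _.
rewrite sumr_const card_ord -[_ *+ d]mulr_natl mulrCA [leRHS]mulrC.
apply: ler_wpM2l => //.
by rewrite mulrCA ger_pMr // ler_pdivrMr // mul1r lerDl.
Qed.

End C1.

Section Partial.
Context {R : realType} {d e : nat}.
Implicit Types (f g : 'rV[R]_d -> R) (U : set 'rV[R]_d) (y : 'rV[R]_d).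

Lemma rV_cvg {T : Type} {F : set_system T} {FF : Filter F} (h : T -> 'rV[R]_d)
    (l : 'rV[R]_d) : (forall j, h z 0 j @[z --> F] --> l 0 j) -> h @ F --> l.
Proof.
move=> hl; have -> : h = fun z => \sum_(j < d) h z 0 j *: (delta_mx 0 j : 'rV[R]_d).
  by apply/funext => z; rewrite [LHS]row_sum_delta.
rewrite [l in _ --> l]row_sum_delta.
by apply: cvg_sumr => j _; apply: cvgZr_tmp; exact: hl.
Qed.

Lemma derive_sum_partial g (x v : 'rV[R]_d) :
  differentiable g x -> 'D_v g x = \sum_j v 0 j * partial j g x.
Proof.
move=> dg; rewrite deriveE // {1}[v]row_sum_delta linear_sum /=.
by apply: eq_bigr => j _; rewrite linearZ /= /partial deriveE.
Qed.

Lemma differentiable_rV (F : 'rV[R]_e -> 'rV[R]_d) (y : 'rV[R]_e) :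
  (forall j, differentiable (fun z => F z 0 j) y) -> differentiable F y.
Proof.
move=> dF; have -> : F = \sum_(j < d) (fun z => F z 0 j *: (delta_mx 0 j : 'rV[R]_d)).
  by apply/funext => z; rewrite fct_sumE [LHS]row_sum_delta.
by apply: differentiable_sum => j; apply: differentiableZl.
Qed.

Lemma jacobian_partial (F : 'rV[R]_e -> 'rV[R]_d) (y : 'rV[R]_e) i j :
  differentiable F y -> 'J F y i j = partial i (fun z => F z 0 j) y.
Proof.
move=> dF; have dFd := diff_derivable (v := delta_mx 0 i) dF.
rewrite /partial; have := derive_mx dFd; rewrite deriveEjacobian // => /rowP/(_ j).
by rewrite -rowE !mxE.
Qed.

Lemma partial_comp (F : 'rV[R]_e -> 'rV[R]_d) g (y : 'rV[R]_e) i :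
  differentiable F y -> differentiable g (F y) ->
  partial i (g \o F) y = \sum_j partial i (fun z => F z 0 j) y * partial j g (F y).
Proof.
move=> dF dg; rewrite /partial deriveE; last exact: differentiable_comp.
rewrite diff_comp //= -deriveE // -deriveE // derive_sum_partial //.
apply: eq_bigr => j _; congr (_ * _).
by rewrite (derive_mx (diff_derivable dF)) mxE.
Qed.

Lemma partial_comp1 (phi : R -> R) (a : R) g y i :
  differentiable g y -> is_derive (g y) 1 phi a ->
  derivable (phi \o g) y (delta_mx 0 i) /\
  partial i (phi \o g) y = a * partial i g y.
Proof.
move=> dg [dphi phia]; have dphi' : differentiable phi (g y) by apply/derivable1_diffP.
have dc : differentiable (phi \o g) y by exact: differentiable_comp.
split; first exact: diff_derivable.
rewrite /partial [in LHS]deriveE // diff_comp //= [in RHS]deriveE //.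
rewrite -[X in 'd phi (g y) X]mulr1 -[_ * 1]/(_ *: (1 : R)) linearZ /=.
by rewrite -(deriveE _ dphi') phia [LHS]mulrC.
Qed.

End Partial.

Lemma dist_le_half (R : realType) (a b c e : R) :
  `|a - c| < e / 2 -> `|b - c| < e / 2 -> `|a - b| <= e.
Proof.
move=> h1 h2; rewrite [e]splitr -(subrK c a) -addrA.
by apply: le_trans (ler_normD _ _) _; rewrite lerD ?ltW // distrC.
Qed.

Section CkTheory.
Context {R : realType} {d : nat}.
Implicit Types (f g : 'rV[R]_d -> R) (U V : set 'rV[R]_d) (y : 'rV[R]_d).

Lemma Ck_continuous k U f : Ck k U f -> forall y, U y -> {for y, continuous f}.
Proof. by case: k => [|k] []. Qed.

Lemma Ck_derivable k U f : Ck k.+1 U f ->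
  forall i y, U y -> derivable f y (delta_mx 0 i).
Proof. by move=> [_ h] i y Uy; case: (h i) => + _; exact. Qed.

Lemma Ck_partial k U f i : Ck k.+1 U f -> Ck k U (partial i f).
Proof. by move=> [_ h]; case: (h i). Qed.

Lemma CkW k U f : Ck k.+1 U f -> Ck k U f.
Proof.
elim: k f => [|k IH] f; first by case.
by move=> [cf h]; split=> // i; case: (h i) => h1 h2; split => //; exact: IH.
Qed.

Lemma Ck_leq k l U f : (k <= l)%N -> Ck l U f -> Ck k U f.
Proof.
move=> /subnK <-; elim: (l - k)%N => // m IH /CkW; exact: IH.
Qed.

Lemma CkSub k U V f : V `<=` U -> Ck k U f -> Ck k V f.
Proof.
move=> VU; elim: k f => [|k IH] f [cf h]; split=> //; first by move=> y /VU/cf.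
  by move=> y /VU/cf.
by move=> i; case: (h i) => h1 h2; split; [move=> y /VU/h1|exact: IH].
Qed.

(** The sets V may be arbitrary: continuity and derivability in [Ck] are conditions at points with
    respect to the ambient space. *)
Lemma Ck_local k U f : (forall y, U y -> exists2 V, V y & Ck k V f) -> Ck k U f.
Proof.
elim: k f => [|k IH] f h; split=> //.
- by move=> y /h[V Vy /Ck_continuous]; exact.
- by move=> y /h[V Vy /Ck_continuous]; exact.
- move=> i; split; first by move=> y /h[V Vy /Ck_derivable]; exact.
  by apply: IH => y /h[V Vy hV]; exists V => //; exact: Ck_partial.
Qed.

Lemma open_near_eq U f g y : open U -> U y -> (forall z, U z -> f z = g z) ->
  {near y, f =1 g}.
Proof.
move=> oU Uy fg; have Un : nbhs y U by exact: open_nbhs_nbhs.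
by apply: filterS Un => z; exact: fg.
Qed.

Lemma partial_near f g y i : {near y, f =1 g} -> partial i f y = partial i g y.
Proof. exact: near_eq_derive. Qed.

Lemma partial_near_eq U f g y i : open U -> U y ->
  (forall z, U z -> f z = g z) -> partial i f y = partial i g y.
Proof. by move=> oU Uy fg; apply: partial_near; exact: open_near_eq fg. Qed.

Lemma Ck_eq k U f g : open U -> (forall y, U y -> f y = g y) -> Ck k U f -> Ck k U g.
Proof.
move=> oU; have cc f' g' : (forall y, U y -> f' y = g' y) ->
    (forall y, U y -> {for y, continuous f'}) ->
    forall y, U y -> {for y, continuous g'}.
  move=> fg cf y Uy; have fgn := open_near_eq oU Uy fg.
  change (g' @ y --> g' y); rewrite -(fg y Uy); apply: cvg_trans (cf y Uy).
  exact: near_eq_cvg.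
elim: k f g => [|k IH] f g fg [cf h]; split=> //; try exact: cc fg cf.
move=> i; case: (h i) => h1 h2; split.
  by move=> y Uy; apply: near_eq_derivable (h1 y Uy); exact: open_near_eq fg.
by apply: IH h2 => y Uy; exact: partial_near_eq fg.
Qed.

Lemma Ck_differentiable k U f y : open U -> Ck k.+1 U f -> U y -> differentiable f y.
Proof.
move=> oU h Uy; apply: partial_differentiable_of_continuous.
  have Un : nbhs y U by exact: open_nbhs_nbhs.
  by apply: filterS Un => z Uz i; exact: Ck_derivable h i z Uz.
by move=> i; exact: Ck_continuous (Ck_partial i h) y Uy.
Qed.

Lemma partialD f g y i : derivable f y (delta_mx 0 i) -> derivable g y (delta_mx 0 i) ->
  partial i (fun z => f z + g z) y = partial i f y + partial i g y.
Proof. exact: (@deriveD _ _ _ f g). Qed.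

Lemma partialM f g y i : derivable f y (delta_mx 0 i) -> derivable g y (delta_mx 0 i) ->
  partial i (fun z => f z * g z) y = f y * partial i g y + g y * partial i f y.
Proof. exact: (@deriveM _ _ f g). Qed.

Lemma partialV f y i : f y != 0 -> derivable f y (delta_mx 0 i) ->
  partial i (fun z => (f z)^-1) y = - ((f y)^-1 * (f y)^-1) * partial i f y.
Proof.
by move=> f0 df; have := deriveV f0 df; rewrite -exprVn expr2.
Qed.

Lemma partial_cst (c : R) y i : partial i (fun=> c) y = 0.
Proof. exact: derive_cst. Qed.

Lemma partial_coord i j y : partial i (fun z : 'rV[R]_d => z 0 j) y = (i == j)%:R.
Proof.
rewrite /partial deriveE; last exact: differentiable_coord.
have lin : linear (fun z : 'rV[R]_d => z 0 j) by move=> k u v; rewrite !mxE.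
pose L := GRing.isLinear.Build R 'rV[R]_d R _ _ lin.
pose l : {linear 'rV[R]_d -> R} := HB.pack (fun z : 'rV[R]_d => z 0 j) L.
rewrite (@diff_lin _ _ _ l y); last exact: coord_continuous.
by rewrite /l /= mxE eqxx eq_sym.
Qed.

Section Open.
Variable U : set 'rV[R]_d.
Hypothesis oU : open U.

Lemma Ck_cst k (c : R) : Ck k U (fun=> c).
Proof.
have cc (a : R) y : U y -> {for y, continuous (fun=> a : R)} by move=> _ ?; exact: cvg_cst.
elim: k c => [|k IH] c; split=> //; try exact: cc.
move=> i; split; first by move=> y _; exact: derivable_cst.
have -> : partial i (fun=> c) = (fun=> 0) :> ('rV[R]_d -> R).
  by apply/funext => y; exact: partial_cst.
exact: IH.
Qed.

Lemma Ck_coord k i : Ck k U (fun y => y 0 i).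
Proof.
have cc y : U y -> {for y, continuous (fun z : 'rV[R]_d => z 0 i)}.
  by move=> _; exact: coord_continuous.
case: k => [|k]; split=> //; try exact: cc.
move=> j; split.
  by move=> y _; apply: diff_derivable; exact: differentiable_coord.
have -> : partial j (fun y : 'rV[R]_d => y 0 i) = (fun=> (j == i)%:R).
  by apply/funext => y; exact: partial_coord.
exact: Ck_cst.
Qed.

Lemma Ck_add k f g : Ck k U f -> Ck k U g -> Ck k U (fun y => f y + g y).
Proof.
have cc k' f' g' : Ck k' U f' -> Ck k' U g' ->
    forall y, U y -> {for y, continuous (fun y => f' y + g' y)}.
  move=> hf hg y Uy.
  exact: cvgD (Ck_continuous hf Uy) (Ck_continuous hg Uy).
elim: k f g => [|k IH] f g hf hg; split=> //; try exact: cc hf hg.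
move=> i; split.
  by move=> y Uy; exact: (derivableD (Ck_derivable hf Uy) (Ck_derivable hg Uy)).
apply: (@Ck_eq k U (fun y => partial i f y + partial i g y)) => //.
  by move=> y Uy; rewrite (partialD (Ck_derivable hf Uy) (Ck_derivable hg Uy)).
by apply: IH; exact: Ck_partial.
Qed.

Lemma Ck_mul k f g : Ck k U f -> Ck k U g -> Ck k U (fun y => f y * g y).
Proof.
have cc k' f' g' : Ck k' U f' -> Ck k' U g' ->
    forall y, U y -> {for y, continuous (fun y => f' y * g' y)}.
  move=> hf hg y Uy.
  exact: cvgM (Ck_continuous hf Uy) (Ck_continuous hg Uy).
elim: k f g => [|k IH] f g hf hg; split=> //; try exact: cc hf hg.
move=> i; split.
  by move=> y Uy; exact: (derivableM (Ck_derivable hf Uy) (Ck_derivable hg Uy)).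
apply: (@Ck_eq k U (fun y => f y * partial i g y + g y * partial i f y)) => //.
  by move=> y Uy; rewrite (partialM (Ck_derivable hf Uy) (Ck_derivable hg Uy)).
by apply: Ck_add; apply: IH; by [exact: CkW|exact: Ck_partial].
Qed.

Lemma Ck_opp k f : Ck k U f -> Ck k U (fun y => - f y).
Proof.
move=> hf; apply: (@Ck_eq k U (fun y => -1 * f y)) => // [y _|]; first exact: mulN1r.
by apply: Ck_mul => //; exact: Ck_cst.
Qed.

Lemma Ck_inv k f : (forall y, U y -> f y != 0) -> Ck k U f -> Ck k U (fun y => (f y)^-1).
Proof.
move=> f0; have cc k' : Ck k' U f ->
    forall y, U y -> {for y, continuous (fun y => (f y)^-1)}.
  move=> hf y Uy; exact: cvgV (f0 y Uy) (Ck_continuous hf Uy).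
elim: k => [|k IH] hf; split=> //; try exact: cc hf.
move=> i; split.
  by move=> y Uy; exact: (derivableV (f0 y Uy) (Ck_derivable hf Uy)).
apply: (@Ck_eq k U (fun y => - ((f y)^-1 * (f y)^-1) * partial i f y)) => //.
  by move=> y Uy; rewrite (partialV (f0 y Uy) (Ck_derivable hf Uy)).
apply: Ck_mul; last exact: Ck_partial.
by apply: Ck_opp; apply: Ck_mul; apply: IH; exact: CkW.
Qed.

Lemma Ck_sum k I (r : seq I) (P : pred I) (f : I -> 'rV[R]_d -> R) :
  (forall i, P i -> Ck k U (f i)) -> Ck k U (fun y => \sum_(i <- r | P i) f i y).
Proof.
move=> hf; elim: r => [|a r IH].
  have -> : (fun y => \sum_(i <- [::] | P i) f i y) = (fun=> 0).
    by apply/funext => y; rewrite big_nil.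
  exact: Ck_cst.
case: (boolP (P a)) => Pa; last first.
  by under eq_fun do rewrite big_cons (negbTE Pa).
under eq_fun do rewrite big_cons Pa.
by apply: Ck_add => //; exact: hf.
Qed.

Lemma Ck_prod k I (r : seq I) (P : pred I) (f : I -> 'rV[R]_d -> R) :
  (forall i, P i -> Ck k U (f i)) -> Ck k U (fun y => \prod_(i <- r | P i) f i y).
Proof.
move=> hf; elim: r => [|a r IH].
  have -> : (fun y => \prod_(i <- [::] | P i) f i y) = (fun=> 1).
    by apply/funext => y; rewrite big_nil.
  exact: Ck_cst.
case: (boolP (P a)) => Pa; last first.
  by under eq_fun do rewrite big_cons (negbTE Pa).
under eq_fun do rewrite big_cons Pa.
by apply: Ck_mul => //; exact: hf.
Qed.

(** The outer function comes with its tower of derivatives [F n], ..., [F (n + k)], the last one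
    merely continuous; the induction on k then only shifts n. *)
Lemma Ck_comp1 k n (F : nat -> R -> R) f :
  (forall m (t : R), (n <= m < n + k)%N -> is_derive t 1 (F m) (F m.+1 t)) ->
  continuous (F (n + k)%N) ->
  Ck k U f -> Ck k U (fun y => F n (f y)).
Proof.
elim: k n => [|k IH] n dF cF hf.
  split=> // y Uy; rewrite addn0 in cF.
  by apply: continuous_comp; [exact: (Ck_continuous hf Uy)|exact: cF].
have dfy y : U y -> differentiable f y by exact: Ck_differentiable hf.
have h y : U y -> forall i, derivable (F n \o f) y (delta_mx 0 i) /\
    partial i (F n \o f) y = F n.+1 (f y) * partial i f y.
  move=> Uy i; apply: partial_comp1; first exact: dfy.
  by apply: dF; rewrite leqnn addnS ltnS leq_addr.
split.
  move=> y Uy; apply: continuous_comp; first exact: (Ck_continuous hf Uy).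
  apply: differentiable_continuous; apply/derivable1_diffP.
  by apply: ex_derive; apply: dF; rewrite leqnn addnS ltnS leq_addr.
move=> i; split; first by move=> y Uy; case: (h y Uy i).
apply: (@Ck_eq k U (fun y => F n.+1 (f y) * partial i f y)) => //.
  by move=> y Uy; case: (h y Uy i).
apply: Ck_mul; last exact: Ck_partial.
apply: IH; last exact: CkW.
  by move=> m t /andP[nm mk]; apply: dF; rewrite (ltnW nm) -addSnnS.
by rewrite addSnnS.
Qed.

(** Two mean values, first in direction i for the increment of f in direction j, then in direction j
    for the partial derivative of f. The left side is symmetric in i and j up to rearrangement,
    which yields the symmetry of second derivatives. *)
Lemma second_difference (f : 'rV[R]_d -> R) y (h r : R) i j :
  Ck 2 U f -> ball y r `<=` U -> 0 < h -> 2 * h < r ->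
  exists2 z, ball y r z &
    f (y + h *: delta_mx 0 i + h *: delta_mx 0 j) - f (y + h *: delta_mx 0 i)
    - (f (y + h *: delta_mx 0 j) - f y) = h * (h * partial j (partial i f) z).
Proof.
move=> hf yU h0 hr.
have nd (k : 'I_d) : `|delta_mx 0 k : 'rV[R]_d| <= 1.
  by apply: normr_row_le => // l; rewrite mxE eqxx /= normr_nat lern1 leq_b1.
have inb (s t : R) : 0 <= s <= 1 -> 0 <= t <= 1 ->
    ball y r (y + (s * h) *: delta_mx 0 i + (t * h) *: delta_mx 0 j).
  move=> /andP[s0 s1] /andP[t0 t1].
  rewrite -ball_normE /= distrC -[y + _ + _]addrA [y + _]addrC addrK.
  apply: le_lt_trans hr; apply: le_trans (ler_normD _ _) _.
  rewrite mulr2n mulrDl mul1r !normrZ lerD // -[leRHS]mulr1 ler_pM ?normr_ge0 //.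
    by rewrite -normrM ger0_norm ?ger_pMl // mulr_ge0 // ltW.
  by rewrite -normrM ger0_norm ?ger_pMl // mulr_ge0 // ltW.
pose phi z := f (z + h *: delta_mx 0 j) - f z.
have dphi (s : R) : 0 <= s <= 1 ->
    derivable phi (y + (s * h) *: delta_mx 0 i) (delta_mx 0 i) /\
    partial i phi (y + (s * h) *: delta_mx 0 i) =
    partial i f (y + (s * h) *: delta_mx 0 i + h *: delta_mx 0 j) -
    partial i f (y + (s * h) *: delta_mx 0 i).
  move=> s01.
  have U1 : U (y + (s * h) *: delta_mx 0 i + h *: delta_mx 0 j).
    by apply: yU; have := inb s 1 s01; rewrite mul1r; apply; rewrite ler01 lexx.
  have U0 : U (y + (s * h) *: delta_mx 0 i).
    by apply: yU; have := inb s 0 s01; rewrite mul0r scale0r addr0; apply; rewrite ler01 lexx.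
  have D1 : is_derive (y + (s * h) *: delta_mx 0 i) (delta_mx 0 i)
      (fun z => f (z + h *: delta_mx 0 j))
      (partial i f (y + (s * h) *: delta_mx 0 i + h *: delta_mx 0 j)).
    have := derivableP (Ck_derivable (i := i) hf U1).
    move=> [D E]; rewrite /partial; split.
      by move: D; rewrite /derivable; under eq_fun do rewrite /= addrA.
    by rewrite /derive; under [in RHS]eq_fun do rewrite /= addrA.
  have D2 := derivableP (Ck_derivable (i := i) hf U0).
  have [D E] := is_deriveB D1 D2.
  by split => //; rewrite /partial -E.
have [s s01|s s01] := @mvt_line R _ phi y (delta_mx 0 i) h; first by case: (dphi s s01).
rewrite /phi => ->; rewrite -/(partial i phi _); have [_ ->] := dphi s s01.
have [t t01|t t01 ->] := @mvt_line R _ (partial i f) (y + (s * h) *: delta_mx 0 i)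
    (delta_mx 0 j) h.
  by apply: (Ck_derivable (Ck_partial i hf)); apply: yU; exact: inb.
by exists (y + (s * h) *: delta_mx 0 i + (t * h) *: delta_mx 0 j) => //; exact: inb.
Qed.

(** One and the same second difference equals both mixed derivatives, each at some point near y;
    continuity of the two at y concludes. *)
Lemma partial_swap (f : 'rV[R]_d -> R) y i j : Ck 2 U f -> U y ->
  partial i (partial j f) y = partial j (partial i f) y.
Proof.
move=> hf Uy; apply/eqP; rewrite -subr_eq0 -normr_le0; apply/ler_addgt0Pl => e e0.
rewrite addr0.
have e20 : 0 < e / 2 by rewrite divr_gt0.
have cij : \forall z \near y, `|partial i (partial j f) y - partial i (partial j f) z| < e / 2.
  by have /cvgrPdist_lt := Ck_continuous (Ck_partial i (Ck_partial j hf)) Uy; apply.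
have cji : \forall z \near y, `|partial j (partial i f) y - partial j (partial i f) z| < e / 2.
  by have /cvgrPdist_lt := Ck_continuous (Ck_partial j (Ck_partial i hf)) Uy; apply.
have Un : nbhs y U by exact: open_nbhs_nbhs.
have H : \forall z \near y, U z /\
    (`|partial i (partial j f) y - partial i (partial j f) z| < e / 2 /\
     `|partial j (partial i f) y - partial j (partial i f) z| < e / 2).
  exact: filterI Un (filterI cij cji).
move: H => /nbhs_ballP[r /= r0 hr].
have rU : ball y r `<=` U by move=> z /hr[].
have h0 : 0 < r / 4 by rewrite divr_gt0.
have hr4 : 2 * (r / 4) < r by lra.
have [z /hr[_ [_ zji]] Ez] := second_difference i j hf rU h0 hr4.
have [z' /hr[_ [z'ij _]] Ez'] := second_difference j i hf rU h0 hr4.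
have : partial j (partial i f) z = partial i (partial j f) z'.
  have h' : r / 4 != 0 by rewrite gt_eqF.
  have : r / 4 * (r / 4 * partial j (partial i f) z) =
         r / 4 * (r / 4 * partial i (partial j f) z').
    have aux (A B C D k a b : R) : A - B - (C - D) = k * a ->
        A - C - (B - D) = k * b -> k * a = k * b by move=> <- <-; ring.
    rewrite [y + _ + _]addrAC in Ez'; exact: aux Ez Ez'.
  by move=> /(mulfI h')/(mulfI h').
move=> E; rewrite E in zji.
exact: dist_le_half z'ij zji.
Qed.

End Open.
End CkTheory.

Lemma Ck_comp (R : realType) d e k (U : set 'rV[R]_d) (W : set 'rV[R]_e)
  (F : 'rV[R]_d -> 'rV[R]_e) (g : 'rV[R]_e -> R) :
  open U -> open W -> (forall y, U y -> W (F y)) ->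
  (forall j, Ck k U (fun y => F y 0 j)) -> Ck k W g -> Ck k U (g \o F).
Proof.
move=> oU oW UW; elim: k g => [|k IH] g hF hg.
  split=> // y Uy; apply: (@continuous_comp _ _ _ F g); last exact: (Ck_continuous hg (UW y Uy)).
  by apply: rV_cvg => j; exact: (Ck_continuous (hF j) Uy).
have dF y : U y -> differentiable F y.
  by move=> Uy; apply: differentiable_rV => j; exact: Ck_differentiable oU (hF j) Uy.
have dg y : U y -> differentiable g (F y).
  by move=> Uy; exact: Ck_differentiable oW hg (UW _ Uy).
split.
  move=> y Uy; apply: differentiable_continuous.
  by apply: differentiable_comp; [exact: dF|exact: dg].
move=> i; split.
  move=> y Uy; apply: diff_derivable.
  by apply: differentiable_comp; [exact: dF|exact: dg].
apply: (@Ck_eq _ _ k U (fun y => \sum_j partial i (fun z => F z 0 j) y *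
    (partial j g \o F) y)) => //.
  by move=> y Uy; rewrite partial_comp //; [exact: dF|exact: dg].
apply: (Ck_sum oU) => j _; apply: (Ck_mul oU); first exact: Ck_partial.
by apply: IH; [move=> l; exact: CkW|exact: Ck_partial].
Qed.

(** * Charts, tangent vectors and the metric *)

Section Jacobian.
Context {R : realType}.

Lemma jacobian_comp d e n (F : 'rV[R]_d -> 'rV[R]_e) (G : 'rV[R]_e -> 'rV[R]_n)
    (y : 'rV[R]_d) : differentiable F y -> differentiable G (F y) ->
  'J (G \o F) y = 'J F y *m 'J G (F y).
Proof.
move=> dF dG; apply/row_matrixP => i; rewrite row_mul !rowE.
by rewrite /jacobian !mul_rV_lin1 /= diff_comp.
Qed.

Opaque jacobian diff derive partial.

Lemma jacobian_near_eq d e (F G : 'rV[R]_d -> 'rV[R]_e) (y : 'rV[R]_d) :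
  differentiable F y -> differentiable G y -> (\forall z \near y, F z = G z) ->
  'J F y = 'J G y.
Proof.
move=> dF dG FG; apply/matrixP => i j; apply: etrans (jacobian_partial _ _ dF) _; apply: etrans _ (esym (jacobian_partial _ _ dG)).
by apply: partial_near; apply: filterS FG => z ->.
Qed.

Lemma jacobian_id d (y : 'rV[R]_d) : 'J id y = 1%:M.
Proof.
apply/matrixP => i j; rewrite jacobian_partial; last exact: ex_diff.
by rewrite partial_coord mxE.
Qed.

End Jacobian.

Section ChartTopology.
Context {R : realType} {d : nat} {T : topologicalType}.
Implicit Types (c : chart R d T) (D : set T) (p : T) (y : 'rV[R]_d).

Lemma chart_image_cfun c D p : cdom c p -> D p -> chart_image c D (cfun c p).
Proof. by move=> cp Dp; exists p. Qed.

Lemma chart_imageP c D y : chart_image c D y ->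
  [/\ cdom c (cinv c y), D (cinv c y) & cfun c (cinv c y) = y].
Proof. by move=> [p [cp Dp] <-]; rewrite cfunK. Qed.

Lemma chart_imageS c D D' : D `<=` D' -> chart_image c D `<=` chart_image c D'.
Proof. by move=> DD' y [p [cp Dp] <-]; exists p => //; split => //; exact: DD'. Qed.

Lemma chart_imageT c : chart_image c setT = cfun c @` cdom c.
Proof. by rewrite /chart_image setIT. Qed.

Lemma chart_imageE c D :
  chart_image c D = (cfun c @` cdom c) `&` cinv c @^-1` D.
Proof.
rewrite eqEsubset; split => [y yD|y [[p cp <-]]] /=.
  have [cy Dy <-] := chart_imageP yD; split; last by rewrite /= cfunK.
  by exists (cinv c y).
by rewrite cfunK // => Dp; exact: chart_image_cfun.
Qed.

Lemma cinv_continuous_at c y : chart_image c setT y -> {for y, continuous (cinv c)}.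
Proof.
rewrite chart_imageT => yc.
have := cinv_continuous (c := c).
by rewrite continuous_open_subspace; [apply; rewrite inE|exact: cimg_open].
Qed.

Lemma cfun_continuous_at c p : cdom c p -> {for p, continuous (cfun c)}.
Proof.
move=> cp; have := cfun_continuous (c := c).
by rewrite continuous_open_subspace; [apply; rewrite inE|exact: cdom_open].
Qed.

Lemma open_chart_image c D : open D -> open (chart_image c D).
Proof.
move=> oD; rewrite openE => y yD.
have [cy Dy cyy] := chart_imageP yD; have yT : chart_image c setT y.
  by apply: chart_imageS yD.
have n1 : nbhs y (chart_image c setT).
  by apply: open_nbhs_nbhs; split => //; rewrite chart_imageT; exact: cimg_open.
have n2 : nbhs y (cinv c @^-1` D).
  by apply: (cinv_continuous_at yT); exact: open_nbhs_nbhs.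
rewrite /interior /= chart_imageE -chart_imageT; exact: filterI.
Qed.

Lemma near_chart c p (P : T -> Prop) : cdom c p -> (\forall q \near p, P q) ->
  \forall y \near cfun c p, P (cinv c y).
Proof.
move=> cp Pp; have := @cinv_continuous_at c (cfun c p) (chart_image_cfun cp I).
by rewrite /prop_for /continuous_at cfunK // => /(_ _ Pp).
Qed.

Lemma near_cfun c p (Q : 'rV[R]_d -> Prop) : cdom c p ->
  (\forall y \near cfun c p, Q y) -> \forall q \near p, Q (cfun c q).
Proof. by move=> cp; apply: cfun_continuous_at. Qed.

Lemma transition_cfun c c' p : cdom c p -> transition c c' (cfun c p) = cfun c' p.
Proof. by move=> cp; rewrite /transition /= cfunK. Qed.

End ChartTopology.

Section Transition.
Context {R : realType} {d : nat} {M : manifold R d}.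
Implicit Types (c a : chart R d M) (p : M) (y : 'rV[R]_d) (X : M -> 'rV[R]_d).

Lemma overlap_open c c' : open (chart_image c (cdom c')).
Proof. by apply: open_chart_image; exact: cdom_open. Qed.

Lemma transition_Ck c c' k j : atlas c -> atlas c' ->
  Ck k (chart_image c (cdom c')) (fun y => transition c c' y 0 j).
Proof. by move=> ac ac'; have [h _] := atlas_compatible ac ac'; exact: h. Qed.

Lemma transition_differentiable c c' y : atlas c -> atlas c' ->
  chart_image c (cdom c') y -> differentiable (transition c c') y.
Proof.
move=> ac ac' yc; apply: differentiable_rV => j.
exact: (Ck_differentiable (@overlap_open c c') (transition_Ck 1%N j ac ac') yc).
Qed.

Lemma jacobian_transition_partial c c' y i j : atlas c -> atlas c' ->
  chart_image c (cdom c') y ->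
  'J (transition c c') y i j = partial i (fun z => transition c c' z 0 j) y.
Proof.
by move=> ac ac' yc; rewrite jacobian_partial //; exact: transition_differentiable.
Qed.

Lemma jacobian_transition_Ck c c' k i j : atlas c -> atlas c' ->
  Ck k (chart_image c (cdom c')) (fun y => 'J (transition c c') y i j).
Proof.
move=> ac ac'; have h := Ck_partial i (transition_Ck k.+1 j ac ac').
apply: Ck_eq h; first exact: overlap_open.
by move=> y yc; rewrite jacobian_transition_partial.
Qed.

Lemma transition_image c c' y : chart_image c (cdom c') y ->
  chart_image c' (cdom c) (transition c c' y) /\
  cinv c' (transition c c' y) = cinv c y.
Proof.
move=> /chart_imageP[cy c'y E]; rewrite /transition /= cfunK //; split=> //.
exact: chart_image_cfun.
Qed.

Lemma jacobian_transition_comp c c' c'' p : atlas c -> atlas c' -> atlas c'' ->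
  cdom c p -> cdom c' p -> cdom c'' p ->
  'J (transition c c'') (cfun c p) =
  'J (transition c c') (cfun c p) *m 'J (transition c' c'') (cfun c' p).
Proof.
move=> ac ac' ac'' cp c'p c''p.
have d1 : differentiable (transition c c') (cfun c p).
  by apply: transition_differentiable => //; exact: chart_image_cfun.
have d2 : differentiable (transition c' c'') (transition c c' (cfun c p)).
  by rewrite transition_cfun //; apply: transition_differentiable => //; exact: chart_image_cfun.
rewrite -(@transition_cfun _ _ _ c c' p cp) -(jacobian_comp d1 d2).
apply: jacobian_near_eq; last first.
- have n : \forall q \near p, cdom c' q.
    by apply: open_nbhs_nbhs; split => //; exact: cdom_open.
  by apply: filterS (near_chart cp n) => y c'y; rewrite /transition /= cfunK.
- exact: differentiable_comp.
- by apply: transition_differentiable => //; exact: chart_image_cfun.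
Qed.

Lemma jacobian_transition_id c p : atlas c -> cdom c p ->
  'J (transition c c) (cfun c p) = 1%:M.
Proof.
move=> ac cp; rewrite -(jacobian_id (cfun c p)); apply: jacobian_near_eq.
- by apply: transition_differentiable => //; exact: chart_image_cfun.
- exact: ex_diff.
- have n : \forall y \near cfun c p, chart_image c setT y.
    apply: open_nbhs_nbhs; split; last exact: chart_image_cfun.
    by apply: open_chart_image; exact: openT.
  by apply: filterS n => y /chart_imageP[].
Qed.

Lemma jacobian_transitionK c c' p : atlas c -> atlas c' -> cdom c p -> cdom c' p ->
  'J (transition c c') (cfun c p) *m 'J (transition c' c) (cfun c' p) = 1%:M.
Proof.
by move=> *; rewrite -jacobian_transition_comp // jacobian_transition_id.
Qed.

Lemma tcomp_transition c c' p v : atlas c -> atlas c' -> cdom c p -> cdom c' p ->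
  tcomp c' p v = tcomp c p v *m 'J (transition c c') (cfun c p).
Proof.
move=> ac ac' cp c'p; rewrite /tcomp -mulmxA; congr (_ *m _).
apply: jacobian_transition_comp => //; first exact: chart_at_atlas.
exact: chart_at_dom.
Qed.

Lemma tcomp_chart_at p v : tcomp (chart_at p) p v = v.
Proof.
rewrite /tcomp jacobian_transition_id ?mulmx1 //; last exact: chart_at_dom.
exact: chart_at_atlas.
Qed.

Lemma tcompD c p v w : tcomp c p (v + w) = tcomp c p v + tcomp c p w.
Proof. exact: mulmxDl. Qed.

Lemma tcompZ c p k v : tcomp c p (k *: v) = k *: tcomp c p v.
Proof. by rewrite /tcomp -scalemxAl. Qed.

Lemma tcompN c p v : tcomp c p (- v) = - tcomp c p v.
Proof. exact: mulNmx. Qed.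

Lemma field_in_cfun c X p : cdom c p -> field_in c X (cfun c p) = tcomp c p (X p).
Proof. by move=> cp; rewrite /field_in cfunK. Qed.

Lemma field_in_transition c c' X y : atlas c -> atlas c' ->
  chart_image c (cdom c') y ->
  field_in c' X (transition c c' y) = field_in c X y *m 'J (transition c c') y.
Proof.
move=> ac ac' /chart_imageP[cp c'p E].
rewrite -{1}E (transition_cfun _ cp) (field_in_cfun _ c'p).
by rewrite (tcomp_transition _ ac ac' cp c'p) E.
Qed.

End Transition.

Section Metric.
Context {R : realType} {d : nat} {M : riemannian R d}.
Implicit Types (c : chart R d M) (p : M) (y : 'rV[R]_d) (X : M -> 'rV[R]_d).

Lemma gmx_cfun c p : cdom c p -> gmx c (cfun c p) =
  'J (transition c (chart_at p)) (cfun c p) *m metric p *m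
  ('J (transition c (chart_at p)) (cfun c p))^T.
Proof. by move=> cp; rewrite /gmx /metric_in cfunK. Qed.

Lemma gmx_transition c c' y : atlas c -> atlas c' ->
  chart_image c (cdom c') y ->
  gmx c y = 'J (transition c c') y *m gmx c' (transition c c' y) *m
    ('J (transition c c') y)^T.
Proof.
move=> ac ac' /chart_imageP[cp c'p E]; move: (cinv c y) cp c'p E => p cp c'p <-.
rewrite (transition_cfun _ cp) (gmx_cfun cp) (gmx_cfun c'p).
rewrite (jacobian_transition_comp ac ac' (chart_at_atlas p) cp c'p (chart_at_dom p)).
by rewrite trmx_mul !mulmxA.
Qed.

Lemma inner_chart c p v w : atlas c -> cdom c p ->
  inner p v w = (tcomp c p v *m gmx c (cfun c p) *m (tcomp c p w)^T) 0 0.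
Proof.
move=> ac cp; rewrite /inner gmx_cfun //.
have aa := @chart_at_atlas _ _ M p; have ad := @chart_at_dom _ _ M p.
have JK := jacobian_transitionK aa ac ad cp.
rewrite /tcomp; move: ('J (transition c (chart_at p)) _) JK => K.
move: ('J (transition (chart_at p) c) _) => L JK.
rewrite trmx_mul !mulmxA -[v *m L *m K]mulmxA JK mulmx1.
rewrite -[v *m _ *m _ *m _]mulmxA -trmx_mul JK trmx1.
by rewrite mulmx1.
Qed.

Lemma gmx_sym c y : (gmx c y)^T = gmx c y.
Proof.
by rewrite /gmx /metric_in !trmx_mul trmxK Defs.metric_sym mulmxA.
Qed.

Lemma gmx_pos c y (v : 'rV[R]_d) : atlas c -> chart_image c setT y -> v != 0 ->
  0 < (v *m gmx c y *m v^T) 0 0.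
Proof.
move=> ac /chart_imageP[cp _ E] v0; move: (cinv c y) cp E => p cp E.
have aa := @chart_at_atlas _ _ M p; have ad := @chart_at_dom _ _ M p.
rewrite -E (gmx_cfun cp); have JK := jacobian_transitionK ac aa cp ad.
move: ('J (transition c (chart_at p)) _) JK => K.
move: ('J (transition (chart_at p) c) _) => L JK.
have -> : v *m (K *m metric p *m K^T) *m v^T =
    (v *m K) *m metric p *m (v *m K)^T by rewrite trmx_mul !mulmxA.
apply: Defs.metric_pos; apply: contra_neq v0 => vK.
by rewrite -[v]mulmx1 -JK mulmxA vK mul0mx.
Qed.

Lemma gmx_unit c y : atlas c -> chart_image c setT y -> gmx c y \in unitmx.
Proof.
move=> ac yc; rewrite unitmxE unitfE; apply/negP => /det0P[v v0 vg].
by have := gmx_pos ac yc v0; rewrite vg mul0mx mxE ltxx.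
Qed.

Lemma gmx_Ck c k i j : atlas c -> Ck k (chart_image c setT) (fun y => gmx c y i j).
Proof. by move=> ac; exact: metric_smooth. Qed.

Lemma inner_sym p v w : inner p v w = inner p w v.
Proof.
rewrite /inner -[LHS]trace_mx11 -mxtrace_tr trace_mx11.
by rewrite !trmx_mul trmxK Defs.metric_sym mulmxA.
Qed.

Lemma innerDl p u v w : inner p (u + v) w = inner p u w + inner p v w.
Proof. by rewrite /inner !mulmxDl mxE. Qed.

Lemma innerZl p k v w : inner p (k *: v) w = k * inner p v w.
Proof. by rewrite /inner -!scalemxAl mxE. Qed.

Lemma innerDr p u v w : inner p w (u + v) = inner p w u + inner p w v.
Proof. by rewrite inner_sym innerDl ![inner p _ w]inner_sym. Qed.

Lemma innerZr p k v w : inner p v (k *: w) = k * inner p v w.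
Proof. by rewrite inner_sym innerZl inner_sym. Qed.

Lemma inner_ge0 p v : 0 <= inner p v v.
Proof.
have [->|v0] := eqVneq v 0; first by rewrite /inner mul0mx mul0mx mxE.
exact/ltW/Defs.metric_pos.
Qed.

Lemma inner_cauchy_schwarz p v w : inner p v w ^+ 2 <= inner p v v * inner p w w.
Proof.
have [->|w0] := eqVneq w 0.
  by rewrite /inner trmx0 !mulmx0 mxE expr0n /= mulr0.
have ww : 0 < inner p w w by exact: Defs.metric_pos.
(* The minimizer of the squared norm of v + t w. *)
pose t := - (inner p v w / inner p w w).
have := inner_ge0 p (v + t *: w).
rewrite innerDl !innerDr !innerZl !innerZr [inner p w v]inner_sym.
have -> : inner p v v + t * inner p v w + (t * inner p v w + t * (t * inner p w w))
  = (inner p v v * inner p w w - inner p v w ^+ 2) / inner p w w.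
  by rewrite /t; field; rewrite gt_eqF.
by rewrite pmulr_lge0 ?invr_gt0 // subr_ge0.
Qed.

End Metric.

(** * The Levi-Civita connection in coordinates *)

(* pd, tjac, gm, gi, fld and chris are opaque copies: without them unification
   unfolds the limits hidden in the notions they stand for. *)
HB.lock Definition pd (R : realType) (d : nat) (i : 'I_d) (f : 'rV[R]_d -> R)
  (y : 'rV[R]_d) : R := partial i f y.

Section LockedPartial.
Context {R : realType} {d : nat}.
Implicit Types (f g : 'rV[R]_d -> R) (U : set 'rV[R]_d) (y : 'rV[R]_d) (i : 'I_d).

Lemma partialE i f y : partial i f y = pd i f y.
Proof. by rewrite unlock. Qed.

Lemma partial_pd i f : partial i f = pd i f.
Proof. by apply/funext => y; exact: partialE. Qed.

Lemma pdD f g y i : derivable f y (delta_mx 0 i) -> derivable g y (delta_mx 0 i) ->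
  pd i (fun z => f z + g z) y = pd i f y + pd i g y.
Proof. by rewrite -!partialE; exact: partialD. Qed.

Lemma pdM f g y i : derivable f y (delta_mx 0 i) -> derivable g y (delta_mx 0 i) ->
  pd i (fun z => f z * g z) y = f y * pd i g y + g y * pd i f y.
Proof. by rewrite -!partialE; exact: partialM. Qed.

Lemma pd_cst (a : R) y i : pd i (fun=> a) y = 0.
Proof. by rewrite -partialE; exact: partial_cst. Qed.

Lemma pdZ f y i (a : R) : derivable f y (delta_mx 0 i) ->
  pd i (fun z => a * f z) y = a * pd i f y.
Proof.
by move=> df; rewrite (pdM (derivable_cst _ _ _) df) pd_cst mulr0 addr0.
Qed.

Lemma pd_near f g y i : {near y, f =1 g} -> pd i f y = pd i g y.
Proof. by rewrite -!partialE; exact: partial_near. Qed.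

Lemma pd_near_eq U f g y i : open U -> U y -> (forall z, U z -> f z = g z) ->
  pd i f y = pd i g y.
Proof. by rewrite -!partialE; exact: partial_near_eq. Qed.

Lemma Ck_pd k U f i : Ck k.+1 U f -> Ck k U (pd i f).
Proof. by rewrite -partial_pd; exact: Ck_partial. Qed.

Lemma pd_swap U f y i j : open U -> Ck 2 U f -> U y ->
  pd i (pd j f) y = pd j (pd i f) y.
Proof. by move=> oU hf Uy; rewrite -!partial_pd; exact: (partial_swap oU). Qed.

Lemma pd_comp1 (phi : R -> R) (a : R) g y i :
  differentiable g y -> is_derive (g y) 1 phi a ->
  derivable (phi \o g) y (delta_mx 0 i) /\ pd i (phi \o g) y = a * pd i g y.
Proof. by rewrite -!partialE; exact: partial_comp1. Qed.

End LockedPartial.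

Lemma pd_comp (R : realType) d e (F : 'rV[R]_e -> 'rV[R]_d) (g : 'rV[R]_d -> R) (y : 'rV[R]_e) (i : 'I_e) :
  differentiable F y -> differentiable g (F y) ->
  pd i (g \o F) y = \sum_j pd i (fun z => F z 0 j) y * pd j g (F y).
Proof.
move=> dF dg; rewrite -partialE (partial_comp i dF dg).
by apply: eq_bigr => j _; rewrite !partialE.
Qed.

HB.lock Definition tjac (R : realType) (d : nat) (M : manifold R d)
  (c c' : chart R d M) (y : 'rV[R]_d) : 'M[R]_d := 'J (transition c c') y.
HB.lock Definition gm (R : realType) (d : nat) (M : riemannian R d)
  (c : chart R d M) (y : 'rV[R]_d) : 'M[R]_d := gmx c y.
HB.lock Definition gi (R : realType) (d : nat) (M : riemannian R d)
  (c : chart R d M) (y : 'rV[R]_d) : 'M[R]_d := invmx (gmx c y).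
HB.lock Definition fld (R : realType) (d : nat) (M : manifold R d)
  (c : chart R d M) (X : M -> 'rV[R]_d) (y : 'rV[R]_d) : 'rV[R]_d := field_in c X y.
HB.lock Definition chris (R : realType) (d : nat) (M : riemannian R d)
  (c : chart R d M) (k i j : 'I_d) (y : 'rV[R]_d) : R := christoffel c k i j y.

Section LockedManifold.
Context {R : realType} {d : nat} {M : manifold R d}.
Implicit Types (c : chart R d M) (p : M) (y : 'rV[R]_d) (X : M -> 'rV[R]_d).

Lemma tjacE c c' y : 'J (transition c c') y = tjac c c' y.
Proof. by rewrite unlock. Qed.

Lemma fldE c X y : field_in c X y = fld c X y.
Proof. by rewrite unlock. Qed.

Lemma field_in_fld c X : field_in c X = fld c X.
Proof. by apply/funext => y; exact: fldE. Qed.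

Lemma tjac_pd c c' y i j : atlas c -> atlas c' -> chart_image c (cdom c') y ->
  tjac c c' y i j = pd i (fun z => transition c c' z 0 j) y.
Proof. by rewrite -tjacE -partialE; exact: jacobian_transition_partial. Qed.

Lemma tjac_Ck c c' k i j : atlas c -> atlas c' ->
  Ck k (chart_image c (cdom c')) (fun y => tjac c c' y i j).
Proof.
by move=> ac ac'; under eq_fun do rewrite -tjacE; exact: jacobian_transition_Ck.
Qed.

Lemma tjac_id c p : atlas c -> cdom c p -> tjac c c (cfun c p) = 1%:M.
Proof. by rewrite -tjacE; exact: jacobian_transition_id. Qed.

Lemma tjacK c c' p : atlas c -> atlas c' -> cdom c p -> cdom c' p ->
  tjac c c' (cfun c p) *m tjac c' c (cfun c' p) = 1%:M.
Proof. by rewrite -!tjacE; exact: jacobian_transitionK. Qed.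

Lemma tjac_unit c c' y : atlas c -> atlas c' -> chart_image c (cdom c') y ->
  tjac c c' y \in unitmx.
Proof.
move=> ac ac' yO; have [cp c'p E] := chart_imageP yO.
by have /mulmx1_unit[] := tjacK ac ac' cp c'p; rewrite E.
Qed.

Lemma fld_transition c c' X y : atlas c -> atlas c' -> chart_image c (cdom c') y ->
  fld c' X (transition c c' y) = fld c X y *m tjac c c' y.
Proof. by rewrite -!fldE -tjacE; exact: field_in_transition. Qed.

Lemma fld_cfun c X p : cdom c p -> fld c X (cfun c p) = tcomp c p (X p).
Proof. by rewrite -fldE; exact: field_in_cfun. Qed.

Lemma tcomp_tjac c c' p v : atlas c -> atlas c' -> cdom c p -> cdom c' p ->
  tcomp c' p v = tcomp c p v *m tjac c c' (cfun c p).
Proof. by rewrite -tjacE; exact: tcomp_transition. Qed.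

Lemma tcomp_tjac_at c p v : tcomp c p v = v *m tjac (chart_at p) c (cfun (chart_at p) p).
Proof. by rewrite -tjacE. Qed.

End LockedManifold.

Section LockedMetric.
Context {R : realType} {d : nat} {M : riemannian R d}.
Implicit Types (c : chart R d M) (p : M) (y : 'rV[R]_d) (X : M -> 'rV[R]_d).

Lemma gmE c y : gmx c y = gm c y.
Proof. by rewrite unlock. Qed.

Lemma giE c y : invmx (gmx c y) = gi c y.
Proof. by rewrite unlock. Qed.

Lemma invmx_gm c y : invmx (gm c y) = gi c y.
Proof. by rewrite -gmE giE. Qed.

Lemma gm_cfun c p : cdom c p -> gm c (cfun c p) =
  tjac c (chart_at p) (cfun c p) *m metric p *m (tjac c (chart_at p) (cfun c p))^T.
Proof. by rewrite -gmE -tjacE; exact: gmx_cfun. Qed.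

Lemma gm_chart_at p : gm (chart_at p) (cfun (chart_at p) p) = metric p.
Proof.
rewrite gm_cfun; last exact: chart_at_dom.
rewrite (tjac_id (chart_at_atlas p) (chart_at_dom p)).
by rewrite trmx1 mulmx1 mul1mx.
Qed.

Lemma gm_transition c c' y : atlas c -> atlas c' -> chart_image c (cdom c') y ->
  gm c y = tjac c c' y *m gm c' (transition c c' y) *m (tjac c c' y)^T.
Proof. by rewrite -!gmE -tjacE; exact: gmx_transition. Qed.

Lemma gm_sym c y : (gm c y)^T = gm c y.
Proof. by rewrite -gmE; exact: gmx_sym. Qed.

Lemma gm_pos c y (v : 'rV[R]_d) : atlas c -> chart_image c setT y -> v != 0 ->
  0 < (v *m gm c y *m v^T) 0 0.
Proof. by rewrite -gmE; exact: gmx_pos. Qed.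

Lemma gm_unit c y : atlas c -> chart_image c setT y -> gm c y \in unitmx.
Proof. by rewrite -gmE; exact: gmx_unit. Qed.

Lemma gm_Ck c k i j : atlas c -> Ck k (chart_image c setT) (fun y => gm c y i j).
Proof. by move=> ac; under eq_fun do rewrite -gmE; exact: gmx_Ck. Qed.

Lemma gi_sym c y : (gi c y)^T = gi c y.
Proof. by rewrite -giE trmx_inv gmx_sym. Qed.

Lemma gm_gi c y : atlas c -> chart_image c setT y -> gm c y *m gi c y = 1%:M.
Proof. by move=> ac yT; rewrite -invmx_gm mulmxV //; exact: gm_unit. Qed.

Lemma gi_gm c y : atlas c -> chart_image c setT y -> gi c y *m gm c y = 1%:M.
Proof. by move=> ac yT; rewrite -invmx_gm mulVmx //; exact: gm_unit. Qed.

Lemma inner_gm c p v w : atlas c -> cdom c p ->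
  inner p v w = (tcomp c p v *m gm c (cfun c p) *m (tcomp c p w)^T) 0 0.
Proof. by rewrite -gmE; exact: inner_chart. Qed.

End LockedMetric.

(** * Derivatives of matrix-valued maps and of determinants *)

Section MatrixPartial.
Context {R : realType} {d : nat}.
Implicit Types (y : 'rV[R]_d) (l : 'I_d).

Definition mpartial l m n (F : 'rV[R]_d -> 'M[R]_(m, n)) y : 'M[R]_(m, n) :=
  \matrix_(i, j) pd l (fun z => F z i j) y.

Definition mderivable l m n (F : 'rV[R]_d -> 'M[R]_(m, n)) y :=
  forall i j, derivable (fun z => F z i j) y (delta_mx 0 l).

Lemma derivable_sumr l I (r : seq I) (P : pred I) (f : I -> 'rV[R]_d -> R) y :
  (forall i, P i -> derivable (f i) y (delta_mx 0 l)) ->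
  derivable (fun z => \sum_(i <- r | P i) f i z) y (delta_mx 0 l) /\
  pd l (fun z => \sum_(i <- r | P i) f i z) y = \sum_(i <- r | P i) pd l (f i) y.
Proof.
move=> df; elim: r => [|a r [IH1 IH2]].
  have -> : (fun z => \sum_(i <- [::] | P i) f i z) = (fun=> 0).
    by apply/funext => z; rewrite big_nil.
  by rewrite big_nil pd_cst; split => //; exact: derivable_cst.
have E : (fun z => \sum_(i <- a :: r | P i) f i z) =
   fun z => (if P a then f a z else 0) + \sum_(i <- r | P i) f i z.
  by apply/funext => z; rewrite big_cons; case: ifP => // _; rewrite add0r.
have da : derivable (fun z => if P a then f a z else 0) y (delta_mx 0 l).
  by case: (boolP (P a)) => [/df//|_]; exact: derivable_cst.
rewrite E; split; first exact: (derivableD da IH1).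
rewrite (pdD da IH1) IH2 big_cons; case: (boolP (P a)) => // _.
by rewrite pd_cst add0r.
Qed.

Lemma mderivableM l m n p (F : 'rV[R]_d -> 'M[R]_(m, n)) (G : 'rV[R]_d -> 'M[R]_(n, p)) y :
  mderivable l F y -> mderivable l G y -> mderivable l (fun z => F z *m G z) y.
Proof.
move=> dF dG i j.
have -> : (fun z => (F z *m G z) i j) = fun z => \sum_k F z i k * G z k j.
  by apply/funext => z; rewrite mxE.
apply: (derivable_sumr _ _).1 => k _; exact: (derivableM (dF i k) (dG k j)).
Qed.

Lemma mpartialM l m n p (F : 'rV[R]_d -> 'M[R]_(m, n)) (G : 'rV[R]_d -> 'M[R]_(n, p)) y :
  mderivable l F y -> mderivable l G y ->
  mpartial l (fun z => F z *m G z) y = mpartial l F y *m G y + F y *m mpartial l G y.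
Proof.
move=> dF dG; apply/matrixP => i j; rewrite !mxE.
have -> : (fun z => (F z *m G z) i j) = fun z => \sum_k F z i k * G z k j.
  by apply/funext => z; rewrite mxE.
rewrite (derivable_sumr _ _).2; last first.
  by move=> k _; exact: (derivableM (dF i k) (dG k j)).
rewrite -big_split; apply: eq_bigr => k _ /=.
by rewrite (pdM (dF i k) (dG k j)) !mxE addrC [G y k j * _]mulrC.
Qed.

Lemma mderivable_tr l m n (F : 'rV[R]_d -> 'M[R]_(m, n)) y :
  mderivable l F y -> mderivable l (fun z => (F z)^T) y.
Proof.
move=> dF i j; have -> : (fun z => (F z)^T i j) = fun z => F z j i by apply/funext => z; rewrite mxE.
exact: dF.
Qed.

Lemma mpartial_tr l m n (F : 'rV[R]_d -> 'M[R]_(m, n)) y :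
  mpartial l (fun z => (F z)^T) y = (mpartial l F y)^T.
Proof.
apply/matrixP => i j; rewrite !mxE; congr (pd l _ y).
by apply/funext => z; rewrite mxE.
Qed.

Lemma mpartial_near l m n (F G : 'rV[R]_d -> 'M[R]_(m, n)) (U : set 'rV[R]_d) y :
  open U -> U y -> (forall z, U z -> F z = G z) -> mpartial l F y = mpartial l G y.
Proof.
move=> oU Uy FG; apply/matrixP => i j; rewrite !mxE.
by apply: (pd_near_eq _ oU Uy) => z /FG ->.
Qed.

Lemma row_mulmxE n (v : 'rV[R]_n) m (A : 'M[R]_(n, m)) j :
  (v *m A) 0 j = \sum_i v 0 i * A i j.
Proof. by rewrite mxE. Qed.

(** Without repetitions in r, the differentiated factor can be removed by the condition [j != i]. *)
Lemma derivable_prodr l (I : eqType) (r : seq I) (f : I -> 'rV[R]_d -> R) y : uniq r ->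
  (forall i, derivable (f i) y (delta_mx 0 l)) ->
  derivable (fun z => \prod_(i <- r) f i z) y (delta_mx 0 l) /\
  pd l (fun z => \prod_(i <- r) f i z) y =
    \sum_(i <- r) pd l (f i) y * \prod_(j <- r | j != i) f j y.
Proof.
move=> + df; elim: r => [_|a r IH /= /andP[ar /IH[IH1 IH2]]].
  have -> : (fun z => \prod_(i <- [::]) f i z) = (fun=> 1).
    by apply/funext => z; rewrite big_nil.
  by rewrite big_nil pd_cst; split => //; exact: derivable_cst.
have E : (fun z => \prod_(i <- a :: r) f i z) = fun z => f a z * \prod_(i <- r) f i z.
  by apply/funext => z; rewrite big_cons.
rewrite E; split; first exact: (derivableM (df a) IH1).
rewrite (pdM (df a) IH1) IH2 big_cons addrC; congr (_ + _).
  rewrite mulrC big_cons eqxx /=; congr (_ * _).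
  rewrite big_seq_cond [RHS]big_seq_cond; apply: eq_bigl => i.
  by case: (boolP (i \in r)) => //= ir; rewrite (memPn ar i ir).
rewrite mulr_sumr; apply: eq_big_seq => i ir.
rewrite big_cons; have -> : a != i by apply: contraNneq ar => ->.
by rewrite mulrCA.
Qed.

(** Jacobi's formula. The terms in which row i is differentiated form the determinant of the matrix
    with row i replaced by its derivative; expanding along that row gives cofactors, that is,
    entries of the adjugate. *)
Lemma partial_det l n (F : 'rV[R]_d -> 'M[R]_n) y : mderivable l F y ->
  derivable (fun z => \det (F z)) y (delta_mx 0 l) /\
  pd l (fun z => \det (F z)) y = \tr (\adj (F y) *m mpartial l F y).
Proof.
move=> dF; rewrite /determinant.
have dp (s : 'S_n) := @derivable_prodr l _ (index_enum 'I_n)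
   (fun i z => F z i (s i)) y (index_enum_uniq _) (fun i => dF i (s i)).
have ds (s : 'S_n) : derivable (fun z => (-1) ^+ s * \prod_i F z i (s i)) y (delta_mx 0 l).
  exact: (derivableM (derivable_cst _ _ _) (dp s).1).
split; first exact: (derivable_sumr _ _).1.
rewrite (derivable_sumr _ _).2 //.
under eq_bigr => s _.
  rewrite (pdM (derivable_cst _ _ _) (dp s).1) pd_cst mulr0 addr0 (dp s).2.
  rewrite mulr_sumr; over.
rewrite exchange_big /= /mxtrace.
have E i : \sum_(s : 'S_n) (-1) ^+ s * (pd l (fun z => F z i (s i)) y *
    \prod_(j | j != i) F y j (s j)) = \sum_k mpartial l F y i k * cofactor (F y) i k.
  pose N : 'M[R]_n := \matrix_(a, b) if a == i then mpartial l F y i b else F y a b.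
  have -> : \sum_k mpartial l F y i k * cofactor (F y) i k = \det N.
    rewrite (expand_det_row N i); apply: eq_bigr => k _; rewrite [N i k]mxE eqxx.
    congr (_ * _); rewrite /cofactor; congr (_ * \det _).
    by apply/matrixP => a b; rewrite !mxE eq_sym (negbTE (neq_lift _ _)).
  rewrite /determinant; apply: eq_bigr => s _; congr (_ * _).
  rewrite [RHS](bigD1 i) //= [N i _]mxE eqxx mxE; congr (_ * _).
  by apply: eq_bigr => j /negbTE ji; rewrite !mxE ji.
under eq_bigr do rewrite E; rewrite exchange_big; apply: eq_bigr => k _ /=.
by rewrite mxE; apply: eq_bigr => i _; rewrite !mxE mulrC.
Qed.

End MatrixPartial.

(** * Positive definite matrices *)

Section Cholesky.
Context {R : rcfType}.

(** Induction on the size by the Schur complement. The factor plays the part of an orthonormal frame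
    at a point and also gives the positivity of det G. *)
Lemma cholesky n (G : 'M[R]_n) : G^T = G ->
  (forall v : 'rV[R]_n, v != 0 -> 0 < (v *m G *m v^T) 0 0) ->
  exists2 S : 'M[R]_n, S \in unitmx & G = S *m S^T.
Proof.
elim: n G => [|n IH] G sG pG.
  by exists 1%:M; [exact: unitmx1|apply/matrixP => -[]].
rewrite -[n.+1]/(1 + n)%N in G sG pG *.
pose a := ulsubmx G 0 0; pose b := ursubmx G; pose C := drsubmx G.
have GE : G = block_mx a%:M b b^T C.
  rewrite -[LHS]submxK; congr block_mx; first by rewrite [LHS]mx11_scalar.
  by rewrite -[in LHS]sG /b trmx_ursub.
have CT : C^T = C by rewrite /C trmx_drsub sG.
have a0 : 0 < a.
  have := pG (row_mx 1%:M 0); rewrite GE mul_row_block !mul1mx !mul0mx !addr0.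
  rewrite tr_row_mx mul_row_col trmx1 mulmx1 trmx0 mulmx0 addr0 !mxE eqxx mulr1n.
  apply; apply/negP => /eqP/rowP/(_ (lshift n 0)).
  by rewrite row_mxEl !mxE eqxx => /eqP; rewrite oner_eq0.
have an0 : a != 0 by rewrite gt_eqF.
pose C' := C - a^-1 *: (b^T *m b).
have sC' : C'^T = C' by rewrite /C' linearB /= linearZ /= trmx_mul trmxK CT.
have pC' (v : 'rV[R]_n) : v != 0 -> 0 < (v *m C' *m v^T) 0 0.
  (* The first entry of w makes the first block of w G vanish, so the value of G at w is that of the
     Schur complement at v. *)
  move=> v0; pose w := row_mx (- a^-1 *: (v *m b^T)) v.
  have w0 : w != 0.
    apply: contra_neq v0 => /(congr1 rsubmx); rewrite row_mxKr => ->.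
    by rewrite linear0.
  have := pG w w0; rewrite GE /w mul_row_block tr_row_mx mul_row_col.
  have -> : - a^-1 *: (v *m b^T) *m a%:M + v *m b^T = 0.
    by rewrite mul_mx_scalar scalerA mulrN mulfV // scaleN1r addNr.
  rewrite mul0mx add0r /C' mulmxBr -scalemxAr -scalemxAl mulmxA.
  by rewrite scaleNr addrC.
have [S uS ES] := IH C' sC' pC'.
have sa : Num.sqrt a != 0 by rewrite sqrtr_eq0 -ltNge.
have saa : Num.sqrt a * Num.sqrt a = a by rewrite -expr2 sqr_sqrtr // ltW.
exists (block_mx (Num.sqrt a)%:M 0 ((Num.sqrt a)^-1 *: b^T) S).
  by rewrite unitmxE det_lblock unitrM -!unitmxE uS andbT unitmxE det_scalar expr1 unitfE.
rewrite tr_block_mx mulmx_block !mul0mx !addr0 trmx0 !mulmx0 !addr0 GE.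
rewrite tr_scalar_mx linearZ /= trmxK.
congr block_mx.
- by rewrite -scalar_mxM saa.
- by rewrite mul_scalar_mx scalerA mulfV // scale1r.
- by rewrite mul_mx_scalar scalerA mulfV // scale1r.
- rewrite -scalemxAl -scalemxAr scalerA -invfM saa -ES /C' addrC subrK //.
Qed.

(** Symmetry of [A *m G] says that A is self-adjoint for G; conjugation by the Cholesky factor turns
    A into a symmetric H with the same traces of H and of H^2. Then tr H^2 is the sum of the squares
    of all entries, hence at least that of the diagonal ones, and the variance of the diagonal is
    non-negative. *)
Lemma sqr_trace_le n (G A : 'M[R]_n) : G^T = G ->
  (forall v : 'rV[R]_n, v != 0 -> 0 < (v *m G *m v^T) 0 0) ->
  (A *m G)^T = A *m G -> (\tr A) ^+ 2 <= n%:R * \tr (A *m A).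
Proof.
move=> sG pG sA; have [S uS ES] := cholesky sG pG.
pose H := invmx S *m A *m S.
have uST : S^T \in unitmx by rewrite unitmx_tr.
have HT : H^T = H.
  have : S^T *m A^T = invmx S *m A *m S *m S^T.
    by rewrite -mulmxA -ES -[invmx S *m A *m G]mulmxA -sA trmx_mul sG ES !mulmxA mulVmx // mul1mx.
  rewrite -/H => E; have -> : H^T = H *m S^T *m invmx S^T.
    by rewrite -E /H !trmx_mul trmx_inv mulmxA.
  by rewrite -mulmxA mulmxV // mulmx1.
have trH : \tr H = \tr A by rewrite /H mxtrace_mulC mulmxA mulmxV // mul1mx.
have trH2 : \tr (H *m H) = \tr (A *m A).
  have -> : H *m H = invmx S *m (A *m A) *m S.
    by rewrite /H -!mulmxA [S *m (invmx S *m _)]mulmxA mulmxV // mul1mx.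
  by rewrite mxtrace_mulC mulmxA mulmxV // mul1mx.
rewrite -trH -trH2 -{3}HT.
have -> : \tr (H *m H^T) = \sum_i \sum_j H i j ^+ 2.
  by apply: eq_bigr => i _; rewrite mxE; apply: eq_bigr => j _; rewrite [_^T _ _]mxE expr2.
(* The size 0 is set apart because the mean of the diagonal divides by n. *)
case: n G A sG pG sA S uS ES H uST HT trH trH2 => [|n] G A _ _ _ S _ _ H _ _ _ _.
  by rewrite /mxtrace big_ord0 expr0n mul0r.
pose m := \tr H / n.+1%:R.
have n0 : (n.+1%:R : R) != 0 by rewrite pnatr_eq0.
have : 0 <= \sum_i (H i i - m) ^+ 2 by apply: sumr_ge0 => i _; exact: sqr_ge0.
under eq_bigr do rewrite sqrrB.
rewrite big_split /= sumrB sumr_const card_ord sumrMnl -mulr_suml -/(\tr H) => h.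
have le : \sum_i H i i ^+ 2 <= \sum_i \sum_j H i j ^+ 2.
  apply: ler_sum => i _; rewrite (bigD1 i) //= lerDl.
  by apply: sumr_ge0 => j _; exact: sqr_ge0.
have {}h : (\tr H) ^+ 2 / n.+1%:R <= \sum_i H i i ^+ 2.
  rewrite -subr_ge0; move: h; congr (0 <= _); rewrite /m -[_ *+ n.+1]mulr_natl -mulr_natl.
  by field.
rewrite -ler_pdivrMl ?ltr0Sn // mulrC; exact: le_trans h le.
Qed.

End Cholesky.

(** * Differentials, gradients and connection under a change of charts *)

Section Differential.
Context {R : realType} {d : nat} {M : manifold R d}.
Implicit Types (c : chart R d M) (p : M) (y : 'rV[R]_d) (u : M -> R).

Definition differential_in c u y : 'rV[R]_d := \row_i pd i (u \o cinv c) y.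

Lemma differentialE u p :
  differential u p = differential_in (chart_at p) u (cfun (chart_at p) p).
Proof. by apply/rowP => i; rewrite !mxE partialE. Qed.

(** Covectors are written as rows as well, hence the transpose of the Jacobian. *)
Lemma differential_in_transition c c' u y : atlas c -> atlas c' ->
  chart_image c (cdom c') y ->
  differentiable (u \o cinv c') (transition c c' y) ->
  differential_in c u y = differential_in c' u (transition c c' y) *m (tjac c c' y)^T.
Proof.
move=> ac ac' yO du; apply/rowP => i.
have dt := transition_differentiable ac ac' yO.
rewrite [LHS]mxE (@pd_near_eq _ _ (chart_image c (cdom c')) _
   ((u \o cinv c') \o transition c c') _ _ (@overlap_open _ _ _ c c') yO); last first.
  by move=> z zO /=; rewrite (transition_image zO).2.
rewrite (pd_comp _ dt du) mxE; apply: eq_bigr => j _.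
by rewrite [_^T _ _]mxE (tjac_pd _ _ ac ac' yO) mxE mulrC.
Qed.

End Differential.

Section Connection.
Context {R : realType} {d : nat} {M : riemannian R d}.
Implicit Types (c : chart R d M) (p : M) (y : 'rV[R]_d) (u : M -> R)
  (X : M -> 'rV[R]_d).

Lemma congr_invmx n (J G : 'M[R]_n) : J \in unitmx -> G \in unitmx ->
  J^T *m invmx (J *m G *m J^T) *m J = invmx G.
Proof.
move=> uJ uG; have uT : J^T \in unitmx by rewrite unitmx_tr.
have uJG : J *m G \in unitmx by rewrite unitmx_mul uJ.
have uJGJ : J *m G *m J^T \in unitmx by rewrite unitmx_mul uJG.
have E : J^T *m invmx (J *m G *m J^T) *m J *m G = 1%:M.
  have -> : J^T *m invmx (J *m G *m J^T) *m J *m G =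
     J^T *m (invmx (J *m G *m J^T) *m (J *m G *m J^T)) *m invmx J^T.
    by rewrite !mulmxA -[RHS]mulmxA mulmxV // mulmx1.
  by rewrite mulVmx // mulmx1 mulmxV.
by rewrite -[LHS]mulmx1 -(mulmxV uG) mulmxA E mul1mx.
Qed.

Lemma gi_transition c c' y : atlas c -> atlas c' -> chart_image c (cdom c') y ->
  (tjac c c' y)^T *m gi c y *m tjac c c' y = gi c' (transition c c' y).
Proof.
move=> ac ac' yO; rewrite -invmx_gm (gm_transition ac ac' yO) congr_invmx ?invmx_gm //.
  exact: tjac_unit.
by apply: gm_unit => //; apply: chart_imageS (transition_image yO).1.
Qed.

Lemma fld_grad c u y : atlas c -> chart_image c setT y ->
  differentiable (u \o cinv c) y ->
  fld c (grad u) y = differential_in c u y *m gi c y.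
Proof.
move=> ac yT; have [cp _ E] := chart_imageP yT; move: (cinv c y) cp E => p cp <- du.
have aa := @chart_at_atlas _ _ M p; have ad := @chart_at_dom _ _ M p.
have pO : chart_image (chart_at p) (cdom c) (cfun (chart_at p) p) by exact: chart_image_cfun.
rewrite fld_cfun // tcomp_tjac_at /grad differentialE.
rewrite (differential_in_transition aa ac pO); last by rewrite transition_cfun.
rewrite -[in RHS](transition_cfun c ad) -(gi_transition aa ac pO) transition_cfun //.
by rewrite -gm_chart_at invmx_gm !mulmxA.
Qed.

(** [covD] uses at each point its own distinguished chart, which may jump from point to point; to
    differentiate the covariant derivative it has to be expressed in one fixed chart. *)
Definition cov_in c X y : 'M[R]_d :=
  \matrix_(i, k) (pd i (fun z => fld c X z 0 k) y
                  + \sum_(j < d) chris c k i j y * fld c X y 0 j).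

Lemma covD_cov_in X p : covD X p = cov_in (chart_at p) X (cfun (chart_at p) p).
Proof.
apply/matrixP => i k; rewrite !mxE -field_in_fld partialE.
by congr (_ + _); apply: eq_bigr => j _; rewrite unlock.
Qed.

(** The Christoffel symbols of the first kind, with the index l lowered. *)
Definition christoffel1 c (i j l : 'I_d) y : R :=
  2^-1 * (mpartial i (gm c) y j l + mpartial j (gm c) y i l - mpartial l (gm c) y i j).

Lemma chrisE c k i j y : chris c k i j y =
  ((\row_l christoffel1 c i j l y) *m gi c y) 0 k.
Proof.
rewrite chris.unlock /christoffel [RHS]mxE mulr_sumr; apply: eq_bigr => l _.
rewrite [(\row__ _) _ _]mxE /christoffel1 ![mpartial _ _ _ _ _]mxE giE -{1}gi_sym.
rewrite [(_^T) _ _]mxE !partialE.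
have E a b : (fun z => gmx c z a b) = (fun z => gm c z a b).
  by apply/funext => z; rewrite gmE.
rewrite !E; ring.
Qed.

Section Law.
Variables (c c' : chart R d M) (y : 'rV[R]_d).
Hypotheses (ac : atlas c) (ac' : atlas c') (yO : chart_image c (cdom c') y).
Let phi := transition c c'.
Let J := tjac c c'.
Let oO := @overlap_open _ _ _ c c'.
Let phiT : chart_image c' setT (phi y).
Proof. by apply: chart_imageS (transition_image yO).1. Qed.

Let dphi : differentiable phi y. Proof. exact: transition_differentiable. Qed.

Let dJ l : mderivable l J y.
Proof. by move=> i j; exact: (Ck_derivable (tjac_Ck 1%N i j ac ac') yO). Qed.

Lemma mpartial_jacobian_sym l i b : mpartial l J y i b = mpartial i J y l b.
Proof.
have E k m : mpartial k J y m b = pd k (pd m (fun z => phi z 0 b)) y.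
  rewrite mxE; apply: (pd_near_eq _ oO yO) => z zO.
  exact: tjac_pd.
by rewrite !E; exact: (pd_swap _ _ oO (transition_Ck 2%N b ac ac') yO).
Qed.

Let g' := gm c'.
Let dg' a b : differentiable (fun z => g' z a b) (phi y).
Proof.
apply: (Ck_differentiable _ (gm_Ck 1%N a b ac') phiT).
by apply: open_chart_image; exact: openT.
Qed.

(** Product rule for g = J g' J^T: [T] is the term where the left J is differentiated, its transpose
    the one for the right factor, and [W] the one where the derivative falls on g'. *)
Let W l i j := \sum_e \sum_a \sum_b J y l e * J y i a * J y j b * mpartial e g' (phi y) a b.
Let T l := mpartial l J y *m g' (phi y) *m (J y)^T.

Let mpartial_gmx l i j : mpartial l (gm c) y i j = T l i j + T l j i + W l i j.
Proof.
rewrite (@mpartial_near _ _ _ _ _ _ (fun z => J z *m g' (phi z) *m (J z)^T) _ _ oO yO); last first.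
  by move=> z zO; exact: gm_transition.
have dgp a b : derivable (fun z => g' (phi z) a b) y (delta_mx 0 l).
  apply: diff_derivable; exact: (differentiable_comp dphi (dg' a b)).
have dgp' : mderivable l (fun z => g' (phi z)) y := dgp.
rewrite (mpartialM (mderivableM (@dJ l) dgp') (mderivable_tr (@dJ l))).
rewrite (mpartialM (@dJ l) dgp') mpartial_tr mulmxDl.
have E : mpartial l (fun z => g' (phi z)) y = \sum_e J y l e *: mpartial e g' (phi y).
  apply/matrixP => a b; rewrite summxE [LHS]mxE (pd_comp _ dphi (dg' a b)).
  by apply: eq_bigr => e _; rewrite [RHS]mxE /J (tjac_pd _ _ ac ac' yO) mxE.
rewrite mxE [X in X + _]mxE addrAC; congr (_ + _ + _).
  have -> : T l j i = (T l)^T i j by rewrite [RHS]mxE.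
  by rewrite /T !trmx_mul trmxK gm_sym mulmxA.
rewrite E mulmx_sumr mulmx_suml summxE; apply: eq_bigr => e _.
rewrite -scalemxAr -scalemxAl mxE [X in _ * X]mxE mulr_sumr exchange_big /=.
apply: eq_bigr => b _; rewrite [(J y *m _) _ _]mxE [_^T _ _]mxE mulr_suml mulr_sumr.
by apply: eq_bigr => a _; ring.
Qed.

Let D i j : 'rV[R]_d :=
  \row_e \sum_a \sum_b J y i a * J y j b * christoffel1 c' a b e (phi y).

(** Six terms [T] occur. As J is itself a matrix of first derivatives, [T] is symmetric in its first
    two indices: four terms cancel and the other two coincide. *)
Let christoffel1_transition i j l : christoffel1 c i j l y =
  ((row j (mpartial i J y) *m g' (phi y) + D i j) *m (J y)^T) 0 l.
Proof.
rewrite /christoffel1 !mpartial_gmx mulmxDl [RHS]mxE.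
have -> : (row j (mpartial i J y) *m g' (phi y) *m (J y)^T) 0 l = T i j l.
  by rewrite -!row_mul mxE.
have Tsym a b e : T a b e = T b a e.
  rewrite /T -!mulmxA !mxE; apply: eq_bigr => k _; congr (_ * _).
  exact: mpartial_jacobian_sym.
have -> : (D i j *m (J y)^T) 0 l = 2^-1 * (W i j l + W j i l - W l i j).
  rewrite mxE /D.
  have -> : \sum_e (\row_e0 (\sum_a \sum_b J y i a * J y j b *
       christoffel1 c' a b e0 (phi y))) 0 e * (J y)^T e l =
     \sum_e \sum_a \sum_b 2^-1 * (
       J y i a * J y j b * J y l e * mpartial a g' (phi y) b e +
       J y j b * J y i a * J y l e * mpartial b g' (phi y) a e -
       J y l e * J y i a * J y j b * mpartial e g' (phi y) a b).
    apply: eq_bigr => e _; rewrite !mxE mulr_suml; apply: eq_bigr => a _.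
    rewrite mulr_suml; apply: eq_bigr => b _; rewrite /christoffel1 -/g'; ring.
  under eq_bigr do under eq_bigr do rewrite -mulr_sumr sumrB big_split /=.
  under eq_bigr do rewrite -mulr_sumr sumrB big_split /=.
  rewrite -mulr_sumr sumrB big_split /=; congr (_ * (_ + _ - _)).
    rewrite exchange_big; apply: eq_bigr => a _ /=; exact: exchange_big.
  rewrite /W; under eq_bigr do rewrite exchange_big.
  rewrite exchange_big; apply: eq_bigr => b _ /=; exact: exchange_big.
by rewrite (Tsym i l j) (Tsym j l i) (Tsym j i l); field.
Qed.

(** The transformation law of the Christoffel symbols, with the second derivatives of the transition
    map as inhomogeneous term. *)
Lemma christoffel_transition i j b :
  \sum_k chris c k i j y * J y k b = mpartial i J y j b +
  \sum_a \sum_a' J y i a * J y j a' * chris c' b a a' (phi y).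
Proof.
have -> : \sum_k chris c k i j y * J y k b =
    (row j (mpartial i J y) + D i j *m gi c' (phi y)) 0 b.
  under eq_bigr do rewrite chrisE.
  rewrite -row_mulmxE.
  have -> : \row_l christoffel1 c i j l y =
      (row j (mpartial i J y) *m g' (phi y) + D i j) *m (J y)^T.
    by apply/rowP => l; rewrite mxE christoffel1_transition.
  rewrite -!mulmxA [(J y)^T *m _]mulmxA (gi_transition ac ac' yO) mulmxDl -mulmxA gm_gi // mulmx1 //.
rewrite [LHS]mxE [row _ _ _ _]mxE [(D i j *m _) _ _]mxE; congr (_ + _).
under eq_bigr do rewrite mxE mulr_suml.
rewrite exchange_big; apply: eq_bigr => a _ /=.
under eq_bigr do rewrite mulr_suml.
rewrite exchange_big; apply: eq_bigr => a' _ /=.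
rewrite chrisE mxE mulr_sumr; apply: eq_bigr => e _.
by rewrite !mxE mulrA.
Qed.

(** The covariant derivative is a tensor: differentiating the components of X after the change of
    charts produces a second derivative of the transition map, which is exactly the inhomogeneous
    term in the law of the Christoffel symbols. *)
Lemma cov_in_transition X :
  (forall k, differentiable (fun z => fld c X z 0 k) y) ->
  (forall k, differentiable (fun z => fld c' X z 0 k) (phi y)) ->
  cov_in c X y *m J y = J y *m cov_in c' X (phi y).
Proof.
move=> dX dX'; apply/matrixP => i b; rewrite !mxE.
set x := fld c X; set x' := fld c' X.
have xE z : chart_image c (cdom c') z -> x' (phi z) = x z *m J z.
  by move=> zO; exact: fld_transition.
have H1 : \sum_a J y i a * pd a (fun z => x' z 0 b) (phi y) =
    \sum_k (pd i (fun z => x z 0 k) y * J y k b + x y 0 k * mpartial i J y k b).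
  transitivity (pd i ((fun z => x' z 0 b) \o phi) y).
    rewrite (pd_comp _ dphi (dX' b)); apply: eq_bigr => a _.
    by rewrite /J (tjac_pd _ _ ac ac' yO).
  rewrite (@pd_near_eq _ _ _ _ (fun z => \sum_k x z 0 k * J z k b) _ _ oO yO); last first.
    by move=> z zO /=; rewrite (xE z zO) mxE.
  have dxk k := diff_derivable (v := delta_mx 0 i) (dX k).
  rewrite (derivable_sumr _ _).2; last by move=> k _; exact: (derivableM (dxk k) (@dJ i k b)).
  apply: eq_bigr => k _; rewrite (pdM (dxk k) (@dJ i k b)) !mxE addrC; congr (_ + _).
  by rewrite mulrC.
under eq_bigr do rewrite !mxE mulrDl.
under [RHS]eq_bigr do rewrite !mxE mulrDr.
rewrite !big_split /= H1 big_split /= -addrA; congr (_ + _).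
under eq_bigr do rewrite mulr_suml.
rewrite exchange_big /=.
have -> : \sum_j \sum_k chris c k i j y * x y 0 j * J y k b =
   \sum_j (x y 0 j * mpartial i J y j b +
      \sum_a \sum_a' J y i a * (chris c' b a a' (phi y) * (x y 0 j * J y j a'))).
  apply: eq_bigr => j _.
  transitivity (x y 0 j * \sum_k chris c k i j y * J y k b).
    by rewrite mulr_sumr; apply: eq_bigr => k _; ring.
  rewrite christoffel_transition mulrDr; congr (_ + _).
  rewrite mulr_sumr; apply: eq_bigr => a _; rewrite mulr_sumr; apply: eq_bigr => a' _; ring.
rewrite big_split /=; congr (_ + _).
rewrite exchange_big; apply: eq_bigr => a _ /=.
rewrite exchange_big mulr_sumr; apply: eq_bigr => a' _ /=.
by rewrite -!mulr_sumr -[fld c' X (phi y)]/(x' (phi y)) (xE y yO) [(x y *m _) _ _]mxE.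
Qed.

End Law.
End Connection.

(** * Bochner's formula *)

Section ChartSmoothness.
Context {R : realType} {d : nat}.
Implicit Types (U : set 'rV[R]_d).

Lemma Ck_det k U n (F : 'rV[R]_d -> 'M[R]_n) : open U ->
  (forall i j, Ck k U (fun y => F y i j)) -> Ck k U (fun y => \det (F y)).
Proof.
move=> oU hF; rewrite /determinant; apply: (Ck_sum oU) => s _.
by apply: (Ck_mul oU); [exact: Ck_cst|apply: (Ck_prod oU)].
Qed.

Context {M : riemannian R d}.
Implicit Types (c : chart R d M) (y : 'rV[R]_d).

Lemma open_chart_imageT c : open (chart_image c setT).
Proof. by apply: open_chart_image; exact: openT. Qed.

Lemma gi_Ck c k i j : atlas c -> Ck k (chart_image c setT) (fun y => gi c y i j).
Proof.
move=> ac; have oT := @open_chart_imageT c.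
apply: (@Ck_eq _ _ k _ (fun y => (\det (gm c y))^-1 * cofactor (gm c y) j i)) => //.
  by move=> y yT; rewrite -invmx_gm /invmx gm_unit // mxE mxE.
apply: (Ck_mul oT).
  apply: (Ck_inv oT); last by apply: (Ck_det oT) => a b; exact: gm_Ck.
  by move=> y yT; rewrite -unitfE -unitmxE; exact: gm_unit.
apply: (Ck_mul oT); first exact: Ck_cst.
apply: (Ck_det oT) => a b.
have -> : (fun y => row' j (col' i (gm c y)) a b) = fun y => gm c y (lift j a) (lift i b).
  by apply/funext => y; rewrite !mxE.
exact: gm_Ck.
Qed.

Lemma chris_Ck c k l i j : atlas c -> Ck k (chart_image c setT) (chris c l i j).
Proof.
move=> ac; have oT := @open_chart_imageT c.
have -> : chris c l i j = fun y => \sum_m 2^-1 *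
   (pd i (fun z => gm c z j m) y + pd j (fun z => gm c z i m) y
    - pd m (fun z => gm c z i j) y) * gi c y m l.
  apply/funext => y; rewrite chrisE mxE; apply: eq_bigr => m _.
  by rewrite mxE /christoffel1 !mxE.
apply: (Ck_sum oT) => m _; apply: (Ck_mul oT); last exact: gi_Ck.
apply: (Ck_mul oT); first exact: Ck_cst.
apply: (Ck_add oT); last by apply: (Ck_opp oT); apply: Ck_pd; exact: gm_Ck.
by apply: (Ck_add oT); apply: Ck_pd; exact: gm_Ck.
Qed.

Lemma mpartial_gm_sym c l y i j : mpartial l (gm c) y i j = mpartial l (gm c) y j i.
Proof.
rewrite !mxE; congr (pd l _ y); apply/funext => z.
by rewrite -[in LHS]gm_sym mxE.
Qed.

Lemma chris_sym c k i j y : chris c k i j y = chris c k j i y.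
Proof.
rewrite !chrisE !mxE; apply: eq_bigr => l _; rewrite !mxE /christoffel1.
by rewrite (mpartial_gm_sym c l y j i) [X in X - _]addrC.
Qed.

Lemma chris_gm c i j l y : atlas c -> chart_image c setT y ->
  \sum_k chris c k i j y * gm c y k l = christoffel1 c i j l y.
Proof.
move=> ac yT; under eq_bigr do rewrite chrisE.
by rewrite -row_mulmxE -mulmxA gi_gm // mulmx1 mxE.
Qed.

(** By Jacobi's formula this contraction is the logarithmic derivative of the square root of det g.
    The two remaining terms of the symbol cancel when the summation indices are exchanged. *)
Lemma chris_trace c j y :
  \sum_k chris c k k j y = 2^-1 * \tr (gi c y *m mpartial j (gm c) y).
Proof.
under eq_bigr do rewrite chrisE mxE.
have E : \sum_k \sum_l mpartial k (gm c) y j l * gi c y l k =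
         \sum_k \sum_l mpartial l (gm c) y k j * gi c y l k.
  rewrite exchange_big /=; apply: eq_bigr => k _; apply: eq_bigr => l _.
  rewrite (mpartial_gm_sym c l y j k); congr (_ * _).
  by rewrite -[in LHS]gi_sym mxE.
transitivity (\sum_k \sum_l (2^-1 * (mpartial j (gm c) y k l * gi c y l k) +
    2^-1 * (mpartial k (gm c) y j l * gi c y l k - mpartial l (gm c) y k j * gi c y l k))).
  apply: eq_bigr => k _; apply: eq_bigr => l _; rewrite mxE /christoffel1; ring.
under eq_bigr do rewrite big_split /= -!mulr_sumr sumrB.
rewrite big_split /= -!mulr_sumr sumrB E subrr mulr0 addr0; congr (_ * _).
rewrite mxtrace_mulC /mxtrace; apply: eq_bigr => k _.
by rewrite mxE.
Qed.

Lemma gm_det_gt0 c y : atlas c -> chart_image c setT y -> 0 < \det (gm c y).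
Proof.
move=> ac yT; have [S uS ->] := cholesky (gm_sym c y) (fun v => gm_pos ac yT).
rewrite det_mulmx det_tr -expr2 lt_def sqr_ge0 andbT sqrf_eq0 -unitfE.
by rewrite -unitmxE.
Qed.

Definition dens c y : R := Num.sqrt (\det (gm c y)).

Lemma pd_dens c j y : atlas c -> chart_image c setT y ->
  derivable (dens c) y (delta_mx 0 j) /\
  pd j (dens c) y = dens c y * \sum_k chris c k k j y.
Proof.
move=> ac yT; have oT := @open_chart_imageT c.
have dd : differentiable (fun z => \det (gm c z)) y.
  by apply: (Ck_differentiable oT _ yT); apply: (Ck_det oT) => a b; exact: (gm_Ck 1%N).
have d0 := gm_det_gt0 ac yT.
have [D E] := pd_comp1 j dd (is_derive1_sqrt d0).
split; first exact: D.
rewrite [LHS]E chris_trace /dens.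
have mg : mderivable j (gm c) y.
  by move=> a b; exact: (Ck_derivable (gm_Ck 1%N a b ac) yT).
rewrite (partial_det mg).2.
have -> : \adj (gm c y) = \det (gm c y) *: gi c y.
  by rewrite -invmx_gm /invmx gm_unit // scalerA mulfV ?scale1r // gt_eqF.
rewrite -scalemxAl mxtraceZ mulrA; set s := Num.sqrt _.
have s0 : s != 0 by rewrite gt_eqF // sqrtr_gt0.
have -> : \det (gm c y) = s * s by rewrite -expr2 sqr_sqrtr // ltW.
by field.
Qed.

(** The formula of [pd_dens] shows the derivative to be continuous without differentiating the
    square root a second time. *)
Lemma dens_C1 c : atlas c -> Ck 1 (chart_image c setT) (dens c).
Proof.
move=> ac; have oT := @open_chart_imageT c.
have cd y : chart_image c setT y -> {for y, continuous (dens c)}.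
  move=> yT; apply: (@continuous_comp _ _ _ (fun z => \det (gm c z)) Num.sqrt).
    have h : Ck 0 (chart_image c setT) (fun z => \det (gm c z)).
      by apply: (Ck_det oT) => a b; exact: gm_Ck.
    exact: (Ck_continuous h yT).
  exact: sqrt_continuous.
split=> // i; split; first by move=> y yT; exact: (pd_dens i ac yT).1.
apply: (@Ck_eq _ _ 0 _ (fun y => dens c y * \sum_k chris c k k i y)) => //.
  by move=> y yT; rewrite partialE (pd_dens i ac yT).2.
apply: (Ck_mul oT); first by split.
by apply: (Ck_sum oT) => k _; exact: chris_Ck.
Qed.

Lemma tr_cov_in c Z y : \tr (cov_in c Z y) =
  \sum_i (pd i (fun z => fld c Z z 0 i) y + (\sum_k chris c k k i y) * fld c Z y 0 i).
Proof.
rewrite /mxtrace; under eq_bigr do rewrite mxE.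
rewrite !big_split /=; congr (_ + _); rewrite exchange_big; apply: eq_bigr => j _ /=.
by rewrite mulr_suml.
Qed.

(** The Voss-Weyl formula: multiplied by the density, the Riemannian divergence becomes a Euclidean
    one, which can be integrated coordinate by coordinate. *)
Lemma dens_divergence c Z y : atlas c -> chart_image c setT y ->
  (forall i, derivable (fun z => fld c Z z 0 i) y (delta_mx 0 i)) ->
  dens c y * \tr (cov_in c Z y) = \sum_i pd i (fun z => dens c z * fld c Z z 0 i) y.
Proof.
move=> ac yT dZ; rewrite tr_cov_in mulr_sumr; apply: eq_bigr => i _.
have [D E] := pd_dens i ac yT.
rewrite (pdM D (dZ i)) E; ring.
Qed.

End ChartSmoothness.

(** * Bochner's formula as an identity in a commutative ring *)

Section BochnerAlgebra.
Context {K : comPzRingType} {d : nat}.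
(** [x] stands for the components of the field at a point, [P] and [H] for their first and second
    partial derivatives, [G] and [DG] for the Christoffel symbols and their derivatives. [A] is then
    the covariant derivative and [DA] the derivative of its entries. *)
Variables (x : 'I_d -> K) (P : 'I_d -> 'I_d -> K) (H : 'I_d -> 'I_d -> 'I_d -> K)
  (G : 'I_d -> 'I_d -> 'I_d -> K) (DG : 'I_d -> 'I_d -> 'I_d -> 'I_d -> K).
Hypothesis Hsym : forall l i k, H l i k = H i l k.
Hypothesis Gsym : forall k i j, G k i j = G k j i.
Let N i k := \sum_j G k i j * x j.
Let A i k := P i k + N i k.
Let DA l i k := H l i k + \sum_j (G k i j * P l j + x j * DG l k i j).
Let gam j := \sum_k G k k j.
Let trA := \sum_i A i i.

(* With P, N the matrices of derivatives and of Christoffel terms, A = P + N,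
   every second derivative and every product P P cancels. *)
Lemma bochner_algebra :
  \sum_k (\sum_i (x i * DA k i k + A i k * P k i) -
          (trA * P k k + x k * \sum_i DA k i i)) +
  \sum_j gam j * (\sum_i x i * A i j - trA * x j) =
  \sum_i \sum_k A i k * A k i - trA ^+ 2 +
  \sum_j \sum_k x j * x k * \sum_i (DG i i j k - DG j i i k +
     \sum_m (G i i m * G m j k - G i j m * G m i k)).
Proof.
have trN : \sum_i N i i = \sum_j gam j * x j.
  rewrite /N exchange_big; apply: eq_bigr => j _ /=; by rewrite mulr_suml.
have trAE : trA = \sum_i P i i + \sum_i N i i by rewrite /trA -big_split.
(* [R1] is the part of the Ricci term that is linear in the derivatives of the Christoffel
   symbols. *)
pose R1 := \sum_i \sum_k \sum_j x i * x j * (DG k k i j - DG i k k j).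
(* Here the second derivatives of the field cancel, by [Hsym]. *)
have E1 : \sum_k \sum_i x i * DA k i k - \sum_k x k * \sum_i DA k i i =
    R1 + \sum_k \sum_j P k j * N j k - \sum_i \sum_j x i * P i j * gam j.
  rewrite exchange_big /= -sumrB.
  transitivity (\sum_i \sum_k (\sum_j x i * x j * (DG k k i j - DG i k k j) +
     (\sum_j x i * (G k i j * P k j) - \sum_j x i * (G k k j * P i j)))).
    apply: eq_bigr => i _; rewrite mulr_sumr -sumrB; apply: eq_bigr => k _.
    rewrite -mulrBr /DA Hsym opprD addrACA subrr add0r mulrBr !mulr_sumr.
    rewrite -!sumrB -big_split; apply: eq_bigr => j _ /=; ring.
  transitivity (R1 + (\sum_i \sum_k \sum_j x i * (G k i j * P k j) -
      \sum_i \sum_k \sum_j x i * (G k k j * P i j))).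
    rewrite /R1 -sumrB -big_split; apply: eq_bigr => i _ /=.
    by rewrite -sumrB -big_split.
  rewrite -addrA; congr (_ + (_ - _)).
    rewrite exchange_big; apply: eq_bigr => k _ /=; rewrite exchange_big.
    apply: eq_bigr => j _ /=; rewrite /N mulr_sumr; apply: eq_bigr => i _.
    rewrite (Gsym k j i); ring.
  apply: eq_bigr => i _; rewrite exchange_big; apply: eq_bigr => j _ /=.
  rewrite /gam mulr_sumr; apply: eq_bigr => k _; ring.
have E2 : \sum_j gam j * (\sum_i x i * A i j - trA * x j) =
    \sum_i \sum_j x i * P i j * gam j + \sum_i \sum_j x i * N i j * gam j
    - trA * \sum_i N i i.
  rewrite trN mulr_sumr -big_split /=.
  transitivity (\sum_j (\sum_i (x i * P i j * gam j + x i * N i j * gam j) - trA * (gam j * x j))).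
    apply: eq_bigr => j _; rewrite mulrBr mulr_sumr mulrCA; congr (_ - _).
    by apply: eq_bigr => i _; rewrite /A; ring.
  rewrite sumrB; congr (_ - _); rewrite exchange_big; apply: eq_bigr => i _ /=.
  by rewrite big_split.
have E3 : \sum_i \sum_k A i k * A k i = \sum_k \sum_i A i k * P k i +
    \sum_k \sum_j P k j * N j k + \sum_i \sum_k N i k * N k i.
  rewrite [X in _ = X + _ + _]exchange_big -!big_split /=; apply: eq_bigr => i _.
  by rewrite -!big_split /=; apply: eq_bigr => k _; rewrite /A; ring.
have E4 : \sum_j \sum_k x j * x k * \sum_i (DG i i j k - DG j i i k +
     \sum_m (G i i m * G m j k - G i j m * G m i k)) =
   R1 + \sum_i \sum_j x i * N i j * gam j - \sum_i \sum_k N i k * N k i.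
  transitivity (\sum_j \sum_k (\sum_i x j * x k * (DG i i j k - DG j i i k) +
     (\sum_i \sum_m x j * x k * (G i i m * G m j k) -
      \sum_i \sum_m x j * x k * (G i j m * G m i k)))).
    apply: eq_bigr => j _; apply: eq_bigr => k _.
    rewrite mulr_sumr -sumrB -big_split; apply: eq_bigr => i _ /=.
    rewrite mulrDr; congr (_ + _); rewrite mulr_sumr -sumrB.
    by apply: eq_bigr => m _; rewrite mulrBr.
  transitivity (\sum_j \sum_k \sum_i x j * x k * (DG i i j k - DG j i i k) +
     (\sum_j \sum_k \sum_i \sum_m x j * x k * (G i i m * G m j k) -
      \sum_j \sum_k \sum_i \sum_m x j * x k * (G i j m * G m i k))).
    rewrite -sumrB -big_split; apply: eq_bigr => j _ /=.
    by rewrite -sumrB -big_split.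
  rewrite -addrA; congr (_ + (_ - _)).
  - by apply: eq_bigr => j _; exact: exchange_big.
  - apply: eq_bigr => j _.
    transitivity (\sum_m \sum_i \sum_k x j * x k * (G i i m * G m j k)).
      under eq_bigr do rewrite exchange_big.
      rewrite exchange_big; apply: eq_bigr => m _ /=; exact: exchange_big.
    apply: eq_bigr => m _; rewrite /gam mulr_sumr; apply: eq_bigr => i _.
    rewrite /N mulr_sumr mulr_suml; apply: eq_bigr => k _; ring.
  - transitivity (\sum_i \sum_m \sum_j \sum_k x j * x k * (G i j m * G m i k)).
      rewrite exchange_big /=.
      transitivity (\sum_j \sum_i \sum_m \sum_k x j * x k * (G i j m * G m i k)).
        rewrite exchange_big; apply: eq_bigr => j _ /=; rewrite exchange_big.
        by apply: eq_bigr => i _ /=; exact: exchange_big.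
      by rewrite exchange_big; apply: eq_bigr => i _ /=; exact: exchange_big.
    rewrite exchange_big; apply: eq_bigr => m _ /=; apply: eq_bigr => i _.
    rewrite /N mulr_suml; apply: eq_bigr => j _; rewrite mulr_sumr.
    apply: eq_bigr => k _; rewrite (Gsym i m j); ring.
rewrite E2 E3 E4.
have -> : \sum_k (\sum_i (x i * DA k i k + A i k * P k i) -
          (trA * P k k + x k * \sum_i DA k i i)) =
  (\sum_k \sum_i x i * DA k i k - \sum_k x k * \sum_i DA k i i) +
  (\sum_k \sum_i A i k * P k i - trA * \sum_k P k k).
  rewrite mulr_sumr -!sumrB -big_split; apply: eq_bigr => k _ /=.
  rewrite big_split /=; ring.
rewrite E1 trAE; ring.
Qed.

End BochnerAlgebra.

Section Bochner.
Context {R : realType} {d : nat} {M : riemannian R d}.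
Implicit Types (c : chart R d M) (y : 'rV[R]_d) (X : M -> 'rV[R]_d) (u : M -> R).

Definition ricci_in c (v w : 'rV[R]_d) y : R :=
  \sum_j \sum_k v 0 j * w 0 k * \sum_i
    (pd i (chris c i j k) y - pd j (chris c i i k) y +
     \sum_m (chris c i i m y * chris c m j k y - chris c i j m y * chris c m i k y)).

Lemma ricciE p v w :
  ricci p v w = ricci_in (chart_at p) v w (cfun (chart_at p) p).
Proof.
rewrite /ricci /ricci_in /curvature.
have E k i j : christoffel (chart_at p) k i j = chris (chart_at p) k i j.
  by apply/funext => y; rewrite unlock.
apply: eq_bigr => j _; apply: eq_bigr => k _; congr (_ * _); apply: eq_bigr => i _.
by rewrite !E !partialE; congr (_ + _); apply: eq_bigr => m _; rewrite !E.
Qed.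

(** The field D_X X - (div X) X in the chart c. *)
Definition boch c X y : 'rV[R]_d :=
  fld c X y *m cov_in c X y - \tr (cov_in c X y) *: fld c X y.

Section Local.
Variables (c : chart R d M) (U : set 'rV[R]_d).
Hypotheses (ac : atlas c) (oU : open U) (UT : U `<=` chart_image c setT).

Lemma cov_in_Ck k X i j : (forall l, Ck k.+1 U (fun z => fld c X z 0 l)) ->
  Ck k U (fun z => cov_in c X z i j).
Proof.
move=> hX; under eq_fun do rewrite mxE.
apply: (Ck_add oU); first exact: Ck_pd.
apply: (Ck_sum oU) => l _; apply: (Ck_mul oU); last exact: CkW.
exact: CkSub UT (chris_Ck k j i l ac).
Qed.

Lemma boch_Ck k X j : (forall l, Ck k.+1 U (fun z => fld c X z 0 l)) ->
  Ck k U (fun z => boch c X z 0 j).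
Proof.
move=> hX; under eq_fun do rewrite /boch !mxE -mulNr.
have hc i l := cov_in_Ck i l hX.
apply: (Ck_add oU).
  by apply: (Ck_sum oU) => l _; apply: (Ck_mul oU) => //; exact: CkW.
apply: (Ck_mul oU); last exact: CkW.
by apply: (Ck_opp oU); apply: (Ck_sum oU).
Qed.

(** The left side is the coordinate form of the divergence of [boch]. The identity is one for
    arbitrary C^2 fields; that X is a gradient matters later, when the symmetry of D X bounds tr ((D
    X)^2) from below. *)
Lemma bochner_in X y : U y -> (forall l, Ck 2 U (fun z => fld c X z 0 l)) ->
  \sum_k (pd k (fun z => boch c X z 0 k) y + (\sum_l chris c l l k y) * boch c X y 0 k) =
  \tr (cov_in c X y *m cov_in c X y) - (\tr (cov_in c X y)) ^+ 2 +
  ricci_in c (fld c X y) (fld c X y) y.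
Proof.
move=> Uy hX.
pose x i := fld c X y 0 i.
pose P i k := pd i (fun z => fld c X z 0 k) y.
pose H l i k := pd l (pd i (fun z => fld c X z 0 k)) y.
pose G k i j := chris c k i j y.
pose DG l k i j := pd l (chris c k i j) y.
have Hsym l i k : H l i k = H i l k by exact: (pd_swap _ _ oU (hX k) Uy).
have Gsym k i j : G k i j = G k j i by exact: chris_sym.
have AE i k : cov_in c X y i k = P i k + \sum_j G k i j * x j by rewrite mxE.
have dX l i : derivable (fun z => fld c X z 0 i) y (delta_mx 0 l).
  exact: (Ck_derivable (hX i) Uy).
have dch l k i j : derivable (chris c k i j) y (delta_mx 0 l).
  exact: (Ck_derivable (chris_Ck 1%N k i j ac) (UT Uy)).
have hA i k : Ck 1 U (fun z => cov_in c X z i k) by exact: cov_in_Ck.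
have dA l i k : derivable (fun z => cov_in c X z i k) y (delta_mx 0 l).
  exact: (Ck_derivable (hA i k) Uy).
have DAE l i k : pd l (fun z => cov_in c X z i k) y =
    H l i k + \sum_j (G k i j * P l j + x j * DG l k i j).
  have -> : (fun z => cov_in c X z i k) = fun z => pd i (fun z' => fld c X z' 0 k) z +
      \sum_j chris c k i j z * fld c X z 0 j by apply/funext => z; rewrite mxE.
  have dp : derivable (pd i (fun z' => fld c X z' 0 k)) y (delta_mx 0 l).
    exact: (Ck_derivable (Ck_pd i (hX k)) Uy).
  have [ds Es] := @derivable_sumr _ _ l _ (index_enum 'I_d) xpredT
    (fun j z => chris c k i j z * fld c X z 0 j) y
    (fun j _ => derivableM (dch l k i j) (dX l j)).
  rewrite (pdD dp ds) Es; congr (_ + _); apply: eq_bigr => j _.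
  by rewrite (pdM (dch l k i j) (dX l j)).
have trE : \tr (cov_in c X y) = \sum_i (P i i + \sum_j G i i j * x j).
  by apply: eq_bigr => i _; exact: AE.
have bE k : boch c X y 0 k = \sum_i x i * (P i k + \sum_j G k i j * x j) -
    (\sum_i (P i i + \sum_j G i i j * x j)) * x k.
  rewrite /boch mxE [X in _ + X]mxE [X in _ - X]mxE trE mxE; congr (_ - _).
  by apply: eq_bigr => i _; rewrite AE.
have dbE k : pd k (fun z => boch c X z 0 k) y =
   \sum_i (x i * (H k i k + \sum_j (G k i j * P k j + x j * DG k k i j)) +
           (P i k + \sum_j G k i j * x j) * P k i) -
   ((\sum_i (P i i + \sum_j G i i j * x j)) * P k k +
     x k * \sum_i (H k i i + \sum_j (G i i j * P k j + x j * DG k i i j))).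
  have -> : (fun z => boch c X z 0 k) = fun z =>
      \sum_i fld c X z 0 i * cov_in c X z i k +
      -1 * ((\sum_i cov_in c X z i i) * fld c X z 0 k).
    by apply/funext => z; rewrite /boch !mxE mulN1r.
  have [ds Es] := @derivable_sumr _ _ k _ (index_enum 'I_d) xpredT
    (fun i z => fld c X z 0 i * cov_in c X z i k) y
    (fun i _ => derivableM (dX k i) (dA k i k)).
  have [dt Et] := @derivable_sumr _ _ k _ (index_enum 'I_d) xpredT
    (fun i z => cov_in c X z i i) y (fun i _ => dA k i i).
  have dm := derivableM dt (dX k k).
  rewrite (pdD ds (derivableM (derivable_cst _ _ _) dm)) (pdZ _ dm) (pdM dt (dX k k)).
  rewrite Es Et mulN1r -/(\tr (cov_in c X y)) trE; congr (_ - (_ + _ * _)).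
    by apply: eq_bigr => i _; rewrite (pdM (dX k i) (dA k i k)) DAE AE.
  by apply: eq_bigr => i _; rewrite DAE.
have trA2 : \tr (cov_in c X y *m cov_in c X y) =
    \sum_i \sum_k (P i k + \sum_j G k i j * x j) * (P k i + \sum_j G i k j * x j).
  by apply: eq_bigr => i _; rewrite mxE; apply: eq_bigr => k _; rewrite !AE.
rewrite big_split /= trA2 trE.
under eq_bigr do rewrite dbE.
under [X in _ + X = _]eq_bigr do rewrite bE.
exact: (bochner_algebra x P DG Hsym Gsym).
Qed.

Section Gradient.
Variables (u : M -> R) (y : 'rV[R]_d).
Hypotheses (Uy : U y) (hu : Ck 3 U (u \o cinv c)).
Let X := grad u.
Let x z := fld c X z.

Lemma fld_gradE z : U z -> x z = differential_in c u z *m gi c z.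
Proof.
move=> Uz; apply: fld_grad => //; first exact: UT.
exact: (Ck_differentiable oU hu Uz).
Qed.

Lemma fld_grad_gm z : U z -> x z *m gm c z = differential_in c u z.
Proof. by move=> Uz; rewrite fld_gradE // -mulmxA gi_gm ?mulmx1 //; exact: UT. Qed.

Lemma fld_grad_Ck j : Ck 2 U (fun z => x z 0 j).
Proof.
apply: (@Ck_eq _ _ 2 U (fun z => \sum_i pd i (u \o cinv c) z * gi c z i j)) => //.
  by move=> z Uz; rewrite fld_gradE // mxE; apply: eq_bigr => i _; rewrite mxE.
apply: (Ck_sum oU) => i _; apply: (Ck_mul oU); first exact: Ck_pd.
exact: CkSub UT (gi_Ck 2%N i j ac).
Qed.

Let dx l k : derivable (fun z => x z 0 k) y (delta_mx 0 l).
Proof. exact: (Ck_derivable (fld_grad_Ck k) Uy). Qed.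

Let dg l i j : derivable (fun z => gm c z i j) y (delta_mx 0 l).
Proof. exact: (Ck_derivable (gm_Ck 1%N i j ac) (UT Uy)). Qed.

Let u2 i j := pd i (pd j (u \o cinv c)) y.
Let u2sym i j : u2 i j = u2 j i.
Proof. exact: (pd_swap _ _ oU (CkW hu) Uy). Qed.

Let u2E i j : u2 i j = \sum_k (x y 0 k * mpartial i (gm c) y k j +
  gm c y k j * pd i (fun z => x z 0 k) y).
Proof.
rewrite /u2 (@pd_near_eq _ _ U _ (fun z => \sum_k x z 0 k * gm c z k j) _ _ oU Uy); last first.
  by move=> z Uz; rewrite -row_mulmxE fld_grad_gm // mxE.
rewrite (derivable_sumr _ _).2; last by move=> k _; exact: (derivableM (@dx i k) (@dg i k j)).
by apply: eq_bigr => k _; rewrite (pdM (@dx i k) (@dg i k j)) mxE.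
Qed.

(** With its index lowered, the covariant derivative of the gradient is the Hessian: second partial
    derivatives of u minus Christoffel symbols of the first kind contracted with grad u. In this
    form the symmetry in i and j is visible. *)
Lemma cov_grad_gm i j : (cov_in c X y *m gm c y) i j = u2 i j +
  \sum_m x y 0 m * (2^-1 * (mpartial m (gm c) y i j - mpartial i (gm c) y m j -
    mpartial j (gm c) y m i)).
Proof.
rewrite mxE; under eq_bigr do rewrite mxE mulrDl.
rewrite big_split /=.
have -> : \sum_k (\sum_m chris c k i m y * fld c X y 0 m) * gm c y k j =
    \sum_m x y 0 m * christoffel1 c i m j y.
  under eq_bigr do rewrite mulr_suml.
  rewrite exchange_big; apply: eq_bigr => m _ /=.
  rewrite -(chris_gm _ _ _ ac (UT Uy)) mulr_sumr; apply: eq_bigr => k _.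
  by rewrite /x; ring.
have -> : \sum_k pd i (fun z => fld c X z 0 k) y * gm c y k j =
    u2 i j - \sum_k x y 0 k * mpartial i (gm c) y k j.
  rewrite u2E -sumrB; apply: eq_bigr => k _; rewrite /x; ring.
rewrite -addrA; congr (_ + _); rewrite addrC -sumrB; apply: eq_bigr => m _.
by rewrite -mulrBr; congr (_ * _); rewrite /christoffel1 (mpartial_gm_sym c j y m i); field.
Qed.

Lemma cov_grad_sym : (cov_in c X y *m gm c y)^T = cov_in c X y *m gm c y.
Proof.
apply/matrixP => i j; rewrite mxE !cov_grad_gm u2sym; congr (_ + _).
apply: eq_bigr => m _; congr (_ * (_ * _)).
by rewrite (mpartial_gm_sym c m y j i) addrAC.
Qed.

Definition sqn c X z : R := (fld c X z *m gm c z *m (fld c X z)^T) 0 0.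

Lemma pd_sqn_grad i : pd i (sqn c X) y =
  2 * (cov_in c X y *m gm c y *m (x y)^T) i 0.
Proof.
have -> : pd i (sqn c X) y = \sum_j (x y 0 j * u2 i j +
    (\sum_k x y 0 k * gm c y k j) * pd i (fun z => x z 0 j) y).
  rewrite (@pd_near_eq _ _ U _ (fun z => \sum_j x z 0 j * pd j (u \o cinv c) z) _ _ oU Uy); last first.
    move=> z Uz; rewrite /sqn -/X -/(x z) fld_grad_gm // mxE.
    by apply: eq_bigr => j _; rewrite !mxE mulrC.
  have du j : derivable (pd j (u \o cinv c)) y (delta_mx 0 i).
    exact: (Ck_derivable (Ck_pd j hu) Uy).
  rewrite (derivable_sumr _ _).2; last by move=> j _; exact: (derivableM (@dx i j) (du j)).
  apply: eq_bigr => j _; rewrite (pdM (@dx i j) (du j)) -/(u2 i j); congr (_ + _ * _).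
  by rewrite -row_mulmxE fld_grad_gm // mxE.
rewrite big_split /=.
have E1 : \sum_j (\sum_k x y 0 k * gm c y k j) * pd i (fun z => x z 0 j) y =
   \sum_j x y 0 j * u2 i j - \sum_j \sum_k x y 0 j * (x y 0 k * mpartial i (gm c) y k j).
  rewrite -sumrB.
  transitivity (\sum_j \sum_k x y 0 j * (gm c y k j * pd i (fun z => x z 0 k) y)).
    rewrite exchange_big; apply: eq_bigr => j _ /=; rewrite mulr_suml.
    apply: eq_bigr => k _; rewrite -[in LHS]gm_sym mxE; ring.
  apply: eq_bigr => j _; rewrite u2E mulr_sumr -sumrB; apply: eq_bigr => k _; ring.
have E2 : (cov_in c X y *m gm c y *m (x y)^T) i 0 = \sum_j x y 0 j * u2 i j -
   2^-1 * \sum_j \sum_k x y 0 j * (x y 0 k * mpartial i (gm c) y k j).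
  (* The bracket is antisymmetric in j and k and is contracted with a symmetric expression. *)
  have Z : \sum_j \sum_k x y 0 j * (x y 0 k * (mpartial k (gm c) y i j - mpartial j (gm c) y k i)) = 0.
    under eq_bigr do under eq_bigr do rewrite mulrBr mulrBr.
    under eq_bigr do rewrite sumrB.
    rewrite sumrB [X in _ - X]exchange_big /= -sumrB big1 // => j _.
    rewrite -sumrB big1 // => k _; rewrite (mpartial_gm_sym c k y i j); ring.
  transitivity (\sum_j x y 0 j * u2 i j - 2^-1 * \sum_j \sum_k x y 0 j * (x y 0 k * mpartial i (gm c) y k j) +
     2^-1 * \sum_j \sum_k x y 0 j * (x y 0 k * (mpartial k (gm c) y i j - mpartial j (gm c) y k i))); last first.
    by rewrite Z mulr0 addr0.
  rewrite mxE -addrA -mulrN -mulrDr -sumrN -big_split /= mulr_sumr -big_split /=.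
  apply: eq_bigr => j _; rewrite [_^T _ _]mxE cov_grad_gm mulrDl mulrC; congr (_ + _).
  rewrite -sumrN -big_split /= mulr_sumr mulr_suml; apply: eq_bigr => k _; by field.
by rewrite E1 E2; field.
Qed.

End Gradient.
End Local.
End Bochner.

(** * Lebesgue measure on row vectors *)

Definition box (R : realType) (n : nat) (r : R) : set 'rV[R]_n := [set y | `|y| <= r].
Arguments box {R} n r.

Section Borel.
Context {R : realType}.

Lemma borel_open (T : ptopologicalType) (A : set T) : open A ->
  measurable (A : set (borel T)).
Proof. by move=> oA; apply: sub_sigma_algebra. Qed.

Lemma cont_measurable (T : ptopologicalType) (D : set T) (f : T -> R) : open D ->
  (forall p, D p -> {for p, continuous f}) ->
  measurable_fun (D : set (borel T)) (f : borel T -> R).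
Proof.
move=> oD cf; apply: (measurability _ (RGenOpens.measurableE R)).
move=> _ [_ [a [b ->] <-]]; apply: borel_open; rewrite openE => p [Dp fp].
apply: filterI; first by apply: open_nbhs_nbhs.
apply: (cf p Dp); apply: open_nbhs_nbhs; split => //; exact: interval_open.
Qed.

Lemma cont_measurableT (T : ptopologicalType) (f : T -> R) : continuous f ->
  measurable_fun (setT : set (borel T)) (f : borel T -> R).
Proof. by move=> cf; apply: cont_measurable; [exact: openT|move=> p _; exact: cf]. Qed.

(** Every open set of row vectors is a countable union of boxes with rational centre, and the
    preimage of a box is a finite intersection of preimages of intervals under the coordinates. *)
Lemma rV_measurable n dd (X : measurableType dd) (f : X -> 'rV[R]_n) :
  (forall i, measurable_fun setT (fun x => f x 0 i)) ->
  measurable_fun setT (f : X -> borel 'rV[R]_n).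
Proof.
move=> mf; apply: (@measurability _ _ X (borel 'rV[R]_n) setT f (@open 'rV[R]_n) erefl).
move=> _ [W oW <-]; rewrite setTI.
(* Boxes of radius 1 / (m + 1) about rational points, a countable family. *)
pose B (qm : 'rV[rat]_n * nat) : set 'rV[R]_n :=
  [set y | forall i, `|y 0 i - ratr (qm.1 0 i)| < qm.2.+1%:R^-1].
have mB qm : measurable (f @^-1` (B qm)).
  have -> : f @^-1` (B qm) = \bigcap_(i in [set: 'I_n])
      ((fun x => f x 0 i) @^-1` (ball (ratr (qm.1 0 i) : R) qm.2.+1%:R^-1)).
    rewrite eqEsubset; split => x /= h.
      by move=> i _; rewrite /= -ball_normE /= distrC; exact: h.
    by move=> i; have := h i I; rewrite /= -ball_normE /= distrC.
  apply: fin_bigcap_measurable => // i _; rewrite -[X in measurable X]setTI.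
  by apply: mf => //; apply: open_measurable; exact: ball_open.
have -> : W = \bigcup_(qm in [set qm | B qm `<=` W]) B qm.
  rewrite eqEsubset; split => [y Wy|y [qm /= h /h]//].
  have /nbhs_ballP[e /= e0 he] : nbhs y W by exact: open_nbhs_nbhs.
  have [m hm] : exists m : nat, (m.+1%:R^-1 : R) < e / 2.
    have e20 : 0 < e / 2 by rewrite divr_gt0.
    case: (near_infty_natSinv_lt (PosNum e20)) => m _ hm; exists m; exact: (hm m (leqnn m)).
  have hq i : exists q : rat, `|y 0 i - ratr q| < (m.+1%:R^-1 : R).
    have m0 : (0 : R) < m.+1%:R^-1 by rewrite invr_gt0.
    have [|q] := @rat_in_itvoo R (y 0 i - m.+1%:R^-1) (y 0 i + m.+1%:R^-1).
      by rewrite ltrD2l (lt_trans _ m0) // oppr_lt0.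
    by rewrite in_itv /= -ltr_distlC => hqi; exists q.
  have [q hq'] := choice hq.
  exists (\row_i q i, m) => /=; last by move=> i; rewrite mxE; exact: hq'.
  move=> z hz; apply: he; rewrite -ball_normE /=.
  apply: (@le_lt_trans _ _ (m.+1%:R^-1 + m.+1%:R^-1)); last by rewrite [ltRHS]splitr ltrD.
  apply: normr_row_le => [|i]; first by rewrite addr_ge0 // invr_ge0.
  have := hz i; rewrite !mxE /= => hzi; have hyi := hq' i.
  have -> : y 0 i - z 0 i = (y 0 i - ratr (q i)) - (z 0 i - ratr (q i)) by ring.
  by apply: le_trans (ler_normB _ _) _; rewrite lerD // ltW.
rewrite preimage_bigcup bigcup_mkcond; apply: countable_bigcupT_measurable.
  exact: countableP.
by move=> qm; case: ifP.
Qed.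

Lemma coord_measurable n (i : 'I_n) :
  measurable_fun setT ((fun y => y 0 i) : borel 'rV[R]_n -> R).
Proof. by apply: cont_measurableT; exact: coord_continuous. Qed.

Lemma box_measurable n (r : R) : measurable (box n r : set (borel 'rV[R]_n)).
Proof.
have mn : measurable_fun setT ((fun y => `|y|) : borel 'rV[R]_n -> R).
  by apply: cont_measurableT; exact: norm_continuous.
have := mn measurableT `]-oo, r]%classic (measurable_itv _).
rewrite setTI; congr measurable; rewrite eqEsubset.
Qed.

Lemma box_compact n (r : R) : compact (box n r).
Proof.
apply: bounded_closed_compact; first by exists r; split; [exact: num_real|move=> s rs y /= yr; exact: le_trans yr (ltW rs)].
have -> : box n r = (fun y => `|y|) @^-1` [set x | x <= r] by [].
by apply: (@preimage_closed _ _ (fun y : 'rV[R]_n => `|y|)); [move=> y _; exact: norm_continuous|exact: closed_le].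
Qed.

Lemma supp_integrable n (mu : {measure set (borel 'rV[R]_n) -> \bar R})
    (f : 'rV[R]_n -> R) (r : R) : (mu (box n r) < +oo)%E -> continuous f ->
  (forall y, r < `|y| -> f y = 0) -> mu.-integrable setT (EFin \o f).
Proof.
move=> mur cf f0; have mB : measurable (box n r : set (borel 'rV[R]_n)) by exact: box_measurable.
have mf : measurable_fun setT (f : borel 'rV[R]_n -> R) by exact: cont_measurableT.
have iB : mu.-integrable (box n r : set (borel 'rV[R]_n)) (EFin \o f).
  apply: measurable_bounded_integrable => //; first exact: measurable_funTS.
  have [K [_ hK]] : bounded_set (f @` box n r).
    apply: compact_bounded; apply: continuous_compact (@box_compact n r).
    exact: continuous_subspaceT.
  exists K; split; first exact: num_real.
  by move=> s Ks y yB; apply: (hK s Ks); exists y.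
move/(integrable_mkcond (EFin \o f : borel 'rV[R]_n -> \bar R) mB): iB.
congr (mu.-integrable setT _).
apply/funext => y; rewrite patchE; case: ifPn => // yB /=; rewrite f0 //.
by rewrite ltNge; apply: contraNN yB => yr; rewrite inE.
Qed.

Lemma box_sigma_finite n (mu : set (borel 'rV[R]_n) -> \bar R) :
  (forall r : R, (mu (box n r) < +oo)%E) -> sigma_finite setT mu.
Proof.
move=> mub; exists (fun k : nat => box n k%:R).
  apply/esym; rewrite -subTset => y _; exists (Num.truncn `|y|).+1 => //=.
  by rewrite /box /= ltW // truncnS_gt.
by move=> k; split; [exact: box_measurable|exact: mub].
Qed.

End Borel.

Section RowCons.
Context {R : realType} {d : nat}.
Implicit Types (H : 'rV[R]_(d.+1) -> R) (t : R) (y : 'rV[R]_d).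

(** The same concatenation as in [lebesgue_int], so that the two match when the iterated integral is
    unfolded. *)
Definition rcons0 (t : R) (y : 'rV[R]_d) : 'rV[R]_(d.+1) := row_mx (t%:M : 'rV[R]_1) y.

Lemma rcons00 t y : rcons0 t y 0 ord0 = t.
Proof.
rewrite /rcons0 mxE; case: splitP => [j _|j /= E]; last by [].
by rewrite mxE ord1 mulr1n.
Qed.

Lemma rcons0S t y (j : 'I_d) : rcons0 t y 0 (lift ord0 j) = y 0 j.
Proof.
rewrite /rcons0 mxE; case: splitP => [k|k] /=; first by case: k => -[].
by rewrite /bump /= !add1n => -[] jk; congr (y 0 _); exact: val_inj.
Qed.

Lemma rcons0P (P : 'I_(d.+1) -> Prop) : P ord0 -> (forall j, P (lift ord0 j)) -> forall i, P i.
Proof. by move=> P0 PS i; case: (unliftP ord0 i) => [j ->|->]. Qed.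

Lemma rcons0_eq t y (z : 'rV[R]_(d.+1)) :
  z 0 ord0 = t -> (forall j, z 0 (lift ord0 j) = y 0 j) -> z = rcons0 t y.
Proof.
by move=> z0 zS; apply/rowP; apply: rcons0P => [|j]; rewrite ?rcons00 ?rcons0S.
Qed.

Lemma norm_rcons0 t y r : 0 <= r -> (`|rcons0 t y| <= r) = (`|t| <= r) && (`|y| <= r).
Proof.
move=> r0; apply/idP/andP => [h|[ht hy]].
  split; first by rewrite -(rcons00 t y); exact: le_trans (normr_coord_le _ _) h.
  apply: normr_row_le => // j; rewrite -(rcons0S t y).
  exact: le_trans (normr_coord_le _ _) h.
apply: normr_row_le => //; apply: rcons0P => [|j]; rewrite ?rcons00 ?rcons0S //.
exact: le_trans (normr_coord_le _ _) hy.
Qed.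

Lemma rcons0_measurable : measurable_fun setT
  ((fun z => rcons0 z.1 z.2) : (measurableTypeR R * borel 'rV[R]_d)%type -> borel 'rV[R]_(d.+1)).
Proof.
apply: rV_measurable; apply: rcons0P => [|j].
  by under eq_fun do rewrite rcons00; exact: measurable_fst.
under eq_fun do rewrite rcons0S.
exact: (measurableT_comp (@coord_measurable R d j) measurable_snd).
Qed.

Lemma rcons0_continuous t : continuous (rcons0 t).
Proof.
move=> y; apply: rV_cvg; apply: rcons0P => [|j].
  by under eq_fun do rewrite rcons00; rewrite rcons00; exact: cvg_cst.
by under eq_fun do rewrite rcons0S; rewrite rcons0S; exact: coord_continuous.
Qed.

Lemma rcons0_continuousl y : continuous (rcons0 ^~ y).
Proof.
move=> t; apply: rV_cvg; apply: rcons0P => [|j].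
  by under eq_fun do rewrite rcons00; rewrite rcons00; exact: cvg_id.
by under eq_fun do rewrite rcons0S; rewrite rcons0S; exact: cvg_cst.
Qed.

(** The difference quotients agree as functions of the increment, so derivability and value of the
    derivative transfer together. *)
Let lineS H t y (j : 'I_d) :
  (fun h : R => h^-1 *: (((H \o rcons0 t) \o shift y) (h *: delta_mx 0 j) - (H \o rcons0 t) y)) =
  (fun h : R => h^-1 *: ((H \o shift (rcons0 t y)) (h *: delta_mx 0 (lift ord0 j)) - H (rcons0 t y))).
Proof.
apply/funext => h /=; congr (_ *: (H _ - _)).
apply/esym/rcons0_eq => [|k]; rewrite mxE mxE mxE.
  by rewrite rcons00 /= mulr0 add0r.
by rewrite rcons0S !mxE (inj_eq lift_inj).
Qed.

Let line0 H t y :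
  (fun h : R => h^-1 *: (((fun s => H (rcons0 s y)) \o shift t) (h *: 1) - H (rcons0 t y))) =
  (fun h : R => h^-1 *: ((H \o shift (rcons0 t y)) (h *: delta_mx 0 ord0) - H (rcons0 t y))).
Proof.
apply/funext => h /=; congr (_ *: (H _ - _)).
apply/esym/rcons0_eq => [|k]; rewrite mxE mxE mxE.
  by rewrite rcons00 eqxx /= [h *: 1]mulr1 mulr1.
by rewrite rcons0S /= mulr0 add0r.
Qed.

Lemma rcons0_Ck1 H t : Ck 1 setT H -> Ck 1 setT (H \o rcons0 t) /\
  forall j y, pd j (H \o rcons0 t) y = pd (lift ord0 j) H (rcons0 t y).
Proof.
move=> hH.
have E j y : pd j (H \o rcons0 t) y = pd (lift ord0 j) H (rcons0 t y).
  by rewrite -!partialE /partial /derive lineS.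
have cc (G : 'rV[R]_(d.+1) -> R) : Ck 0 setT G -> forall y, setT y -> {for y, continuous (G \o rcons0 t)}.
  move=> hG y _; apply: continuous_comp; first exact: rcons0_continuous.
  exact: (Ck_continuous hG I).
split; last by [].
split; first exact: cc (CkW hH).
move=> j; split.
  move=> y _; rewrite /derivable lineS; exact: (Ck_derivable hH I).
split; last by [].
have -> : partial j (H \o rcons0 t) = pd (lift ord0 j) H \o rcons0 t.
  by apply/funext => y; rewrite partialE E.
exact: cc (Ck_pd _ hH).
Qed.

Lemma rcons0_derive H y t : Ck 1 setT H ->
  is_derive t 1 (fun s => H (rcons0 s y)) (pd ord0 H (rcons0 t y)).
Proof.
move=> hH; split; first by rewrite /derivable line0; exact: (Ck_derivable hH I).
by rewrite -partialE /partial /derive line0.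
Qed.

End RowCons.

Section SuppPartial.
Context {R : realType} {d : nat}.

Lemma pd_supp (H : 'rV[R]_d -> R) r i : (forall y, r < `|y| -> H y = 0) ->
  forall y, r < `|y| -> pd i H y = 0.
Proof.
move=> H0 y ry; rewrite (@pd_near_eq _ _ [set z | r < `|z|] H (fun=> 0)) //.
- exact: pd_cst.
- have -> : [set z : 'rV[R]_d | r < `|z|] = (fun z => `|z|) @^-1` [set x | r < x] by [].
  by apply: (@open_comp _ _ (fun z : 'rV[R]_d => `|z|)); [move=> z _; exact: norm_continuous|exact: open_gt].
Qed.

(** The fundamental theorem on [- a, a] with a = r + 1, so that both endpoints lie strictly outside
    the support. *)
Lemma integral_derive_supp (g g' : R -> R) (r : R) : 0 <= r ->
  (forall t : R, is_derive t 1 g (g' t)) -> continuous g' ->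
  (forall t, r < `|t| -> g t = 0) -> (forall t, r < `|t| -> g' t = 0) ->
  (\int[lebesgue_measure]_t (g' t)%:E = 0)%E.
Proof.
move=> r0 dg cg' g0 g'0; pose a := r + 1.
have cg : continuous g.
  by move=> t; apply: differentiable_continuous; apply/derivable1_diffP; case: (dg t).
have ab : - a < a by rewrite /a; lra.
have na (t : R) : t \notin `[- a, a] -> r < `|t|.
  rewrite in_itv /= => h; apply: lt_le_trans (_ : a <= `|t|); first by rewrite /a; lra.
  by rewrite leNgt; apply: contra h => /ltW; rewrite ler_norml.
have -> : (\int[lebesgue_measure]_t (g' t)%:E = \int[lebesgue_measure]_(t in `[(- a)%R, a]) (g' t)%:E)%E.
  rewrite [RHS]integral_mkcond; apply: eq_integral => t _; rewrite patchE.
  by case: ifPn => // tB; rewrite g'0 //; apply: na; move: tB; rewrite mem_setE.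
rewrite (@continuous_FTC2 _ g' g) //.
- rewrite !g0 ?subee // ?normrN; rewrite ger0_norm /a; lra.
- exact: continuous_subspaceT.
- split => [t _||].
  + by case: (dg t).
  + exact/cvg_at_right_filter/cg.
  + exact/cvg_at_left_filter/cg.
- by move=> t _; rewrite derive1E; case: (dg t).
Qed.

End SuppPartial.

(** Product measures are formed from bundled sigma-finite measures, whereas the induction below
    yields sigma-finiteness as a proposition. *)
Lemma sigma_finite_pack dd (T : measurableType dd) (R : realType)
    (m : {measure set T -> \bar R}) : sigma_finite setT m ->
  exists m' : {sigma_finite_measure set T -> \bar R}, (m' : set T -> \bar R) = m.
Proof.
move=> sm; pose H2 := isSFinite.Build _ _ _ _ (sfinite_measure_sigma_finite sm).
pose H3 := isSigmaFinite.Build _ _ _ _ sm.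
by exists (HB.pack_for {sigma_finite_measure set T -> \bar R} (Measure.sort m) H2 H3).
Qed.

Section LebesgueRV.
Context {R : realType}.

(** The iterated integral is integration against a genuine measure, built by induction on d as the
    image of the product of the line with the previous one, starting from a Dirac mass. Finiteness
    on boxes and integration by parts are proved along the way; these three properties are all that
    is used about Lebesgue measure in dimension d. *)
Lemma lebesgue_int_measure (d : nat) :
  exists mu : {measure set (borel 'rV[R]_d) -> \bar R},
  [/\ forall r : R, (mu (box d r) < +oo)%E,
      forall F : borel 'rV[R]_d -> \bar R,
        measurable_fun (setT : set (borel 'rV[R]_d)) F ->
        (forall y, (0 <= F y)%E) -> lebesgue_int F = (\int[mu]_y F y)%E &
      forall (H : 'rV[R]_d -> R) i r, Ck 1 setT H -> (forall y, r < `|y| -> H y = 0) ->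
        (\int[mu]_y (pd i H y)%:E = 0)%E].
Proof.
elim: d => [|d [mu [mub muF muH]]].
  exists (@dirac _ (borel 'rV[R]_0) 0 R); split.
  - by move=> r; rewrite /dirac ltry.
  - by move=> F mF F0; rewrite integral_dirac // diracT mul1e.
  - by move=> H [].
have [mus Es] := sigma_finite_pack (box_sigma_finite mub).
pose leb : {sigma_finite_measure set (measurableTypeR R) -> \bar R} := @lebesgue_measure R.
pose phi := (fun z => rcons0 z.1 z.2) : (measurableTypeR R * borel 'rV[R]_d)%type -> borel 'rV[R]_(d.+1).
have mphi : measurable_fun setT phi := rcons0_measurable.
pose nu := measure_function_pushforward__canonical__measure_function_Measure (leb \x mus)%E mphi.
have nub r : (nu (box d.+1 r) < +oo)%E.
  have [r0|r0] := leP 0 r; last first.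
    have -> : box d.+1 r = set0.
      by rewrite -subset0 => y; rewrite /box /= leNgt (lt_le_trans r0).
    by rewrite measure0.
  rewrite /nu /= /pushforward.
  have -> : phi @^-1` (box d.+1 r) = (`[- r, r]%classic `*` box d r).
    rewrite eqEsubset; split => -[t y]; rewrite /box /phi /= norm_rcons0 // in_itv /= ler_norml.
      by move=> /andP[].
    by move=> [-> ->].
  rewrite product_measure1E //; last exact: box_measurable.
  apply: lte_mul_pinfty => //; last by rewrite Es.
  by rewrite /leb /= lebesgue_measure_itv /=; case: ifP => _; rewrite ?ltry // -EFinD ltry.
exists nu; split => //.
- move=> F mF F0 /=.
  rewrite ge0_integral_pushforward //= preimage_setT fubini_tonelli1 //; last first.
    exact: measurableT_comp mF mphi.
  apply: eq_integral => t _; apply: (@etrans _ _ (\int[mu]_y F (rcons0 t y))%E); last by rewrite -Es.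
  apply: (muF (fun y => F (rcons0 t y))) => [|y //].
  have m1 : measurable_fun setT ((fun y => rcons0 t y) : borel 'rV[R]_d -> borel 'rV[R]_(d.+1)).
    apply: rV_measurable; apply: rcons0P => [|j].
      by under eq_fun do rewrite rcons00; exact: measurable_cst.
    by under eq_fun do rewrite rcons0S; exact: coord_measurable.
  exact: (measurableT_comp mF m1).
- move=> H i r hH H0; have [r0|r0] := leP 0 r; last first.
    have E y : pd i H y = 0 by exact: (pd_supp i H0 (lt_le_trans r0 (normr_ge0 y))).
    by under eq_integral do rewrite E; rewrite integral0.
  have cp : continuous (pd i H) by move=> y; exact: (Ck_continuous (Ck_pd i hH) I).
  have p0 := pd_supp i H0.
  have ip : nu.-integrable setT (EFin \o pd i H) := supp_integrable (nub r) cp p0.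
  have mp : measurable_fun setT (EFin \o pd i H : borel 'rV[R]_(d.+1) -> \bar R).
    by apply/measurable_EFinP; exact: cont_measurableT.
  have ip2 : (leb \x mus)%E.-integrable setT ((EFin \o pd i H) \o phi).
    apply/integrableP; split; first exact: measurableT_comp mp mphi.
    have /integrableP[_ /=] := ip.
    have ma : measurable_fun setT ((fun y => `|pd i H y|%:E) : borel 'rV[R]_(d.+1) -> \bar R).
      apply/measurable_EFinP; apply: (@cont_measurableT _ _ (fun y => `|pd i H y|)) => y.
      apply: cvg_norm; exact: cp.
    by rewrite ge0_integral_pushforward // => y _; rewrite lee_fin.
  rewrite /=.
  rewrite integral_pushforward // preimage_setT.
  (* Fubini in the order that integrates first in the direction of differentiation: the induction
     hypothesis for a later coordinate, the one-dimensional theorem for the first. *)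
  case: (unliftP ord0 i) ip2 p0 cp {ip mp} => [j ->|->] ip2 p0 cp.
    rewrite -(integral12_prod_meas1 ip2).
    rewrite integral0_eq // => t _; rewrite /fubini_F /=.
    have [hHt Et] := rcons0_Ck1 t hH.
    apply: (@etrans _ _ (\int[mu]_y (pd j (H \o rcons0 t) y)%:E)%E).
      by rewrite -Es; apply: eq_integral => y _; rewrite Et.
    apply: (muH _ _ r) => // y ry; apply: H0; rewrite ltNge norm_rcons0 // negb_and -!ltNge ry.
    by rewrite orbT.
  rewrite -(integral21_prod_meas1 ip2).
  rewrite integral0_eq // => y _; rewrite /fubini_G /=.
  apply: (@integral_derive_supp R (fun t => H (rcons0 t y)) _ r) => //.
  - by move=> t; exact: rcons0_derive.
  - by move=> t; apply: (@continuous_comp _ _ _ (rcons0 ^~ y) (pd ord0 H)); [exact: rcons0_continuousl|exact: cp].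
  - by move=> t rt; apply: H0; rewrite ltNge norm_rcons0 // negb_and -!ltNge rt.
  - by move=> t rt; apply: p0; rewrite ltNge norm_rcons0 // negb_and -!ltNge rt.
Qed.

End LebesgueRV.

(** * Smooth cut-offs *)

Section SmoothStep.
Context {R : realType}.

(** The derivative of p(1/t) exp (- 1/t) is t^(-2) (p - p')(1/t) exp (- 1/t), whence the
    recursion. *)
Fixpoint flatpoly (n : nat) : {poly R} :=
  if n is m.+1 then 'X^2 * (flatpoly m - (flatpoly m)^`()) else 1.

(* [flat 0] is exp (- 1 / t) extended by 0, and [flat n] its n-th derivative. *)
Definition flat (n : nat) (t : R) : R :=
  if 0 < t then (flatpoly n).[t^-1] * expR (- t^-1) else 0.

(** From exp x >= x^(m + 1) / (m + 1)! with m the size of p. At x = 1 / h the bound is linear in h,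
    which is what the differentiability of [flat] at 0 requires. *)
Lemma poly_expR_bound (p : {poly R}) : exists2 C : R, 0 <= C &
  forall x, 1 <= x -> `|p.[x]| * expR (- x) <= C / x.
Proof.
pose S := \sum_(i < size p) `|p`_i|; pose m := (size p).
have S0 : 0 <= S by apply: sumr_ge0.
exists (S * m.+1`!%:R); first by rewrite mulr_ge0.
move=> x x1; have x0 : 0 < x by exact: lt_le_trans x1.
have h1 : `|p.[x]| <= S * x ^+ m.
  rewrite horner_coef (le_trans (ler_norm_sum _ _ _)) // mulr_suml.
  apply: ler_sum => i _; rewrite normrM ler_wpM2l // normrX (gtr0_norm x0).
  by apply: ler_weXn2l => //; exact: ltnW.
have h2 : x ^+ m.+1 <= m.+1`!%:R * expR x.
  have := @expR_ge1Dxn _ x m (ltW x0).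
  move=> h; have : x ^+ m.+1 / m.+1`!%:R <= expR x by apply: le_trans h; rewrite lerDr.
  by rewrite ler_pdivrMr ?ltr0n ?fact_gt0 // mulrC.
apply: (@le_trans _ _ (S * x ^+ m * expR (- x))); first by rewrite ler_wpM2r // expR_ge0.
rewrite -!mulrA ler_wpM2l // ler_pdivlMr // mulrAC -exprSr expRN ler_pdivrMr ?expR_gt0 //.
Qed.

Lemma flat_le0 n t : t <= 0 -> flat n t = 0.
Proof. by move=> t0; rewrite /flat ltNge t0. Qed.

Lemma flat_derive n (t : R) : is_derive t 1 (flat n) (flat n.+1 t).
Proof.
have [t0|t0|->] := ltgtP t 0.
- rewrite [X in is_derive _ _ _ X]flat_le0; last exact: ltW.
  apply: (@near_eq_is_derive _ _ _ (cst (0 : R)) (flat n) t 1 0).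
    near=> s; rewrite flat_le0 // ltW //; near: s; exact: lt_nbhsl.
- rewrite [X in is_derive _ _ _ X]/flat t0.
  have hs : \forall s \near t, (flatpoly n).[s^-1] * expR (- s^-1) = flat n s.
    near=> s; rewrite /flat; suff -> : 0 < s by []. near: s; exact: lt_nbhsr.
  have tn0 : t != 0 by rewrite gt_eqF.
  have dV : is_derive t 1 (fun s : R => s^-1) (- t^-2).
    have := @is_deriveV R id t 1 1 tn0 (is_derive_id _ _).
    by move=> /is_derive_eq; apply; rewrite [_ *: _]mulr1.
  have dp : is_derive t 1 (fun s => (flatpoly n).[s^-1]) ((flatpoly n)^`().[t^-1] * (- t^-2)).
    exact: (@is_derive1_comp _ (horner (flatpoly n)) (fun s => s^-1)).
  have dN : is_derive t 1 (fun s : R => - s^-1) (t^-2).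
    have := is_deriveN dV; by rewrite opprK.
  have de : is_derive t 1 (fun s => expR (- s^-1)) (expR (- t^-1) * t^-2).
    exact: (@is_derive1_comp _ expR (fun s => - s^-1)).
  apply: (@near_eq_is_derive _ _ _ (fun s : R => (flatpoly n).[s^-1] * expR (- s^-1)) (flat n) t 1
    ((flatpoly n.+1).[t^-1] * expR (- t^-1))); first exact: hs.
  have := is_deriveM dp de; move=> /is_derive_eq; apply.
  rewrite /= hornerM hornerXn hornerD hornerN exprVn /GRing.scale /=.
  by rewrite -exprVn; ring.
- rewrite [X in is_derive _ _ _ X]flat_le0 //.
  (* The extra factor X accounts for the division by h in the difference quotient. *)
  have [C C0 hC] := poly_expR_bound ('X * flatpoly n).
  suff lim0 : (fun h : R => h^-1 *: ((flat n \o shift 0) (h *: 1) - flat n 0)) @ 0^' --> (0 : R).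
    by split; [apply/cvg_ex; exists 0|exact/cvg_lim].
  apply/cvgrPdist_le => e e0; near=> h.
  rewrite sub0r normrN /= [h *: 1]mulr1 addr0 (flat_le0 n (lexx 0)) subr0.
  have [h0|h0] := leP h 0; first by rewrite flat_le0 // scaler0 normr0 ltW.
  rewrite /flat h0.
  have h1 : 1 <= h^-1.
    rewrite invf_ge1 //; apply: le_trans (ler_norm h) _; near: h.
    by apply: dnbhs0_le.
  have := hC _ h1; rewrite hornerM hornerX invrK => hh.
  have -> : `|h^-1 *: ((flatpoly n).[h^-1] * expR (- h^-1))| =
     `|h^-1 * (flatpoly n).[h^-1]| * expR (- h^-1).
    by rewrite [_ *: _]mulrA normrM [X in _ * X]ger0_norm // expR_ge0.
  apply: le_trans hh _; apply: (@le_trans _ _ ((C + 1) * h)).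
    by rewrite ler_wpM2r ?ltW // ltrDl.
  rewrite -ler_pdivlMl; last by rewrite ltr_wpDl.
  rewrite mulrC; apply: le_trans (ler_norm h) _; near: h; apply: dnbhs0_le.
  by rewrite divr_gt0 // ltr_wpDl.
Unshelve. all: by end_near. Qed.

Lemma flat_gt0 t : 0 < t -> 0 < flat 0 t.
Proof. by move=> t0; rewrite /flat t0 hornerC mul1r expR_gt0. Qed.

Lemma flat_ge0 t : 0 <= flat 0 t.
Proof. by rewrite /flat; case: ifP => // _; rewrite hornerC mul1r expR_ge0. Qed.

Lemma flat1_ge0 t : 0 <= flat 1 t.
Proof.
rewrite /flat; case: ifP => // t0; rewrite mulr_ge0 ?expR_ge0 //=.
by rewrite derivC subr0 mulr1 hornerXn sqr_ge0.
Qed.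

Lemma flat_continuous n : continuous (flat n).
Proof.
move=> t; apply: differentiable_continuous; apply/derivable1_diffP.
by case: (flat_derive n t).
Qed.

Definition step (t : R) : R := flat 0 t / (flat 0 t + flat 0 (1 - t)).

Lemma step_den t : 0 < flat 0 t + flat 0 (1 - t).
Proof.
have [t0|t0] := ltP 0 t; first by rewrite ltr_wpDr // ?flat_ge0 // flat_gt0.
rewrite ltr_wpDl // ?flat_ge0 // flat_gt0 // subr_gt0; exact: le_lt_trans t0 ltr01.
Qed.

Lemma step_le0 t : t <= 0 -> step t = 0.
Proof. by move=> t0; rewrite /step flat_le0 // mul0r. Qed.

Lemma step_ge1 t : 1 <= t -> step t = 1.
Proof.
move=> t1; have := step_den t; rewrite /step [flat 0 (1 - t)]flat_le0 ?subr_le0 //.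
by rewrite addr0 => /gt_eqF t0; rewrite divff // t0.
Qed.

Lemma step_ge0 t : 0 <= step t.
Proof. by rewrite divr_ge0 ?flat_ge0 // ltW // step_den. Qed.

Lemma step_le1 t : step t <= 1.
Proof. by rewrite ler_pdivrMr ?step_den // mul1r lerDl flat_ge0. Qed.

(** Of the derivative only the sign is kept: it decides the sign of the boundary layer terms in the
    divergence inequality. *)
Lemma step_derive (t : R) : exists2 a : R, 0 <= a & is_derive t 1 step a.
Proof.
pose D := flat 0 t + flat 0 (1 - t).
have D0 : D != 0 by rewrite gt_eqF // step_den.
have d1 := flat_derive 0 t.
have d2 : is_derive t 1 (fun s => flat 0 (1 - s)) (- flat 1 (1 - t)).
  have h : is_derive t 1 (fun s : R => 1 - s) (- 1).
    have := is_deriveB (is_derive_cst (1 : R) t 1) (is_derive_id t 1).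
    by move=> /is_derive_eq; apply; rewrite sub0r.
  have := @is_derive1_comp _ (flat 0) (fun s => 1 - s) t _ _ (flat_derive 0 (1 - t)) h.
  by rewrite mulrN1.
have d3 := @is_deriveV R (flat 0 \+ (fun s => flat 0 (1 - s))) t _ 1 D0 (is_deriveD d1 d2).
have := is_deriveM d1 d3.
set a := (X in is_derive _ _ _ X) => h; exists a; last exact: h.
rewrite /a {a h} /GRing.scale /= -/D.
have -> : flat 0 t * (- D ^- 2 * (flat 1 t + - flat 1 (1 - t))) + D^-1 * flat 1 t =
   D ^- 2 * (flat 0 t * flat 1 (1 - t) + flat 0 (1 - t) * flat 1 t).
  by rewrite /D; field.
rewrite mulr_ge0 ?invr_ge0 ?sqr_ge0 // addr_ge0 // mulr_ge0 ?flat_ge0 ?flat1_ge0 //.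
Qed.

Lemma step_Ck d k (U : set 'rV[R]_d) (l : 'rV[R]_d -> R) : open U ->
  Ck k U l -> Ck k U (fun y => step (l y)).
Proof.
move=> oU hl.
have h1 (l' : 'rV[R]_d -> R) : Ck k U l' -> Ck k U (fun y => flat 0 (l' y)).
  move=> hl'; apply: (Ck_comp1 oU (n := 0%N) (F := flat)) hl' => [m t _|].
    exact: flat_derive.
  exact: flat_continuous.
have h2 : Ck k U (fun y => flat 0 (1 - l y)).
  by apply: h1; apply: (Ck_add oU); [exact: Ck_cst|exact: Ck_opp].
apply: (Ck_mul oU); first exact: h1.
apply: (Ck_inv oU); last by apply: (Ck_add oU) => //; exact: h1.
by move=> y _; rewrite gt_eqF // step_den.
Qed.

Definition plateau (t : R) : R := step (2 - t) * step (2 + t).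

Lemma plateau1 t : `|t| <= 1 -> plateau t = 1.
Proof.
by rewrite ler_norml => /andP[h1 h2]; rewrite /plateau !step_ge1 ?mul1r; lra.
Qed.

Lemma plateau0 t : 2 <= `|t| -> plateau t = 0.
Proof.
rewrite ler_normr => /orP[h|h]; rewrite /plateau.
  by rewrite step_le0 ?mul0r //; lra.
by rewrite [step (2 + t)]step_le0 ?mulr0 //; lra.
Qed.

(** A product over the coordinates, since balls of the sup norm are boxes: it is 1 on the ball of
    radius r about a and 0 outside that of radius 2 r. *)
Definition cutoff d (a : 'rV[R]_d) (r : R) (y : 'rV[R]_d) : R :=
  \prod_i plateau ((y 0 i - a 0 i) / r).

Lemma cutoff_smooth d (a : 'rV[R]_d) r k (U : set 'rV[R]_d) : open U -> Ck k U (cutoff a r).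
Proof.
move=> oU; apply: (Ck_prod oU) => i _.
have h : Ck k U (fun y => (y 0 i - a 0 i) / r).
  apply: (Ck_mul oU); last exact: Ck_cst.
  by apply: (Ck_add oU); [exact: Ck_coord|exact: Ck_cst].
by apply: (Ck_mul oU); apply: (step_Ck oU); apply: (Ck_add oU) => //;
  [exact: Ck_cst|exact: Ck_opp|exact: Ck_cst].
Qed.

Lemma cutoff1 d (a y : 'rV[R]_d) r : 0 < r -> `|y - a| <= r -> cutoff a r y = 1.
Proof.
move=> r0 h; rewrite /cutoff big1 // => i _; apply: plateau1.
rewrite normrM normfV (gtr0_norm r0) ler_pdivrMr // mul1r.
by apply: le_trans h; have := normr_coord_le (y - a) i; rewrite !mxE.
Qed.

Lemma cutoff0 d (a y : 'rV[R]_d) r : 0 < r -> 2 * r <= `|y - a| -> cutoff a r y = 0.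
Proof.
move=> r0 h; have [i hi] : exists i, 2 * r <= `|(y - a) 0 i|.
  have [nz|nz] := eqVneq `|y - a| 0.
    by move: h; rewrite nz leNgt mulr_gt0.
  have [[j i] /= E] := @mx_norm_neq0 _ _ _ (y - a) nz.
  by exists i; move: h; rewrite [ `|y - a| ]E /= ord1.
rewrite /cutoff (bigD1 i) //= plateau0 ?mul0r //.
rewrite normrM normfV (gtr0_norm r0) ler_pdivlMr //.
by move: hi; rewrite !mxE.
Qed.

Lemma cutoff_ge0 d (a y : 'rV[R]_d) r : 0 <= cutoff a r y.
Proof. by apply: prodr_ge0 => i _; rewrite mulr_ge0 // step_ge0. Qed.

Lemma cutoff_le1 d (a y : 'rV[R]_d) r : cutoff a r y <= 1.
Proof.
apply: (@le_trans _ _ (\prod_(i < d) 1)); last by rewrite prodr_const expr1n.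
apply: ler_prod => i _; rewrite mulr_ge0 ?step_ge0 //=.
by rewrite -[leRHS]mulr1 ler_pM ?step_ge0 ?step_le1.
Qed.

End SmoothStep.

(** * Change of variables *)

Section Transfer.
Context d1 d2 (T1 : measurableType d1) (T2 : measurableType d2) (R : realType).
Variables (m1 : {measure set T1 -> \bar R}) (m2 : {measure set T2 -> \bar R}).
Variables (D : set T1) (phi : T1 -> T2) (G : T2 -> R).
Hypotheses (mD : measurable D) (mphi : measurable_fun D phi).
Hypotheses (mG : measurable_fun setT G) (G0 : forall y, 0 <= G y).
Hypothesis m12 : forall A, measurable A ->
  m1 (D `&` phi @^-1` A) = (\int[m2]_y (\1_A y * G y)%:E)%E.
Local Open Scope ereal_scope.
Import HBNNSimple.

(** [m12] says that the image of m1 restricted to D under phi has density G with respect to m2. The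
    formula holds for simple functions and passes to the limit by monotone convergence. *)
Lemma ge0_integral_transfer (F : T2 -> R) : measurable_fun setT F ->
  (forall y, (0 <= F y)%R) ->
  \int[m1]_(x in D) (F (phi x))%:E = \int[m2]_y (F y * G y)%:E.
Proof.
move=> mF F0.
have mEF : measurable_fun setT (EFin \o F) by exact/measurable_EFinP.
pose f_ := nnsfun_approx measurableT mEF.
have cvgf y : EFin \o f_ ^~ y @ \oo --> (F y)%:E.
  by apply: (@cvg_nnsfun_approx _ _ _ _ measurableT _ mEF) => // z _; rewrite lee_fin.
have cvgfR y : f_ ^~ y @ \oo --> F y by have /fine_cvgP[] := cvgf y.
have step1 (f : {nnsfun T2 >-> R}) :
    \int[m1]_(x in D) (f (phi x))%:E = \int[m2]_y (f y * G y)%:E.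
  have mA r : measurable (f @^-1` [set r]) by exact: measurable_funPTI.
  have mphiA r : measurable (D `&` phi @^-1` (f @^-1` [set r])) by exact: mphi.
  transitivity (\sum_(r \in range f) \int[m1]_(x in D) (r * \1_(f @^-1` [set r]) (phi x))%:E).
    under eq_integral do rewrite fimfunE -fsumEFin//.
    rewrite ge0_integral_fsum //.
      move=> r; apply/measurable_EFinP; apply: measurable_funM => //.
      exact: (measurableT_comp (measurable_indic (mA r)) mphi).
    by move=> r x _; rewrite nnfun_muleindic_ge0.
  transitivity (\sum_(r \in range f) \int[m2]_y (r * \1_(f @^-1` [set r]) y * G y)%:E); last first.
    rewrite -ge0_integral_fsum //; last 2 first.
    - move=> r; apply/measurable_EFinP; apply: measurable_funM => //.
      by apply: measurable_funM => //; exact: measurable_indic.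
    - by move=> r y _; rewrite EFinM mule_ge0 ?nnfun_muleindic_ge0 // lee_fin.
    apply: eq_integral => y _; rewrite fsumEFin // -mulr_fsuml //.
    by rewrite -fimfunE.
  apply: eq_fsbigr => r /[!inE] -[z _ rz].
  have r0 : (0 <= r)%R by rewrite -rz.
  have -> : \int[m1]_(x in D) (r * \1_(f @^-1` [set r]) (phi x))%:E =
      r%:E * m1 (D `&` phi @^-1` (f @^-1` [set r])).
    under eq_integral do rewrite EFinM.
    rewrite ge0_integralZl_EFin //; last first.
      apply/measurable_EFinP.
      exact: (measurableT_comp (measurable_indic (mA r)) mphi).
    congr (_ * _); transitivity (m1 ((D `&` phi @^-1` (f @^-1` [set r])) `&` D)).
      rewrite -integral_indic //.
      apply: eq_integral => x; rewrite inE => xD; congr (_%:E).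
      rewrite !indicE; congr (_%:R); congr (nat_of_bool _).
      by apply/idP/idP => [/set_mem h|/set_mem[_ h]]; apply/mem_set.
    by rewrite setIAC setIid.
  rewrite m12 // -ge0_integralZl_EFin //.
  - by apply: eq_integral => y _; rewrite -EFinM mulrA.
  - by move=> y _; rewrite lee_fin mulr_ge0.
  - apply/measurable_EFinP; apply: measurable_funM => //; exact: measurable_indic.
transitivity (limn (fun n => \int[m1]_(x in D) (f_ n (phi x))%:E)).
  rewrite -monotone_convergence//.
  - by apply: eq_integral => x _; apply/esym/cvg_lim => //; exact: cvgf.
  - move=> n; apply/measurable_EFinP; exact: (measurableT_comp _ mphi).
  - by move=> n x _; rewrite lee_fin.
  - by move=> x _ m n mn; rewrite lee_fin; exact/lefP/nd_nnsfun_approx.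
under eq_fun do rewrite step1.
rewrite -monotone_convergence//.
- apply: eq_integral => y _; apply/cvg_lim => //.
  rewrite (_ : (fun n => _) = EFin \o (fun n => f_ n y * G y)%R) //.
  by apply: cvg_EFin; [exact: nearW|apply: cvgMl; exact: cvgfR].
- by move=> n; apply/measurable_EFinP; apply: measurable_funM.
- by move=> n y _; rewrite lee_fin mulr_ge0.
- by move=> y _ m n mn; rewrite lee_fin ler_wpM2r //; exact/lefP/nd_nnsfun_approx.
Qed.

(** Positive and negative parts are transferred separately; as G is non-negative, taking them
    commutes with multiplication by G. *)
Lemma integral_transfer (F : T2 -> R) : measurable_fun setT F ->
  \int[m1]_(x in D) (F (phi x))%:E = \int[m2]_y (F y * G y)%:E.
Proof.
move=> mF; rewrite integralE [RHS]integralE.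
pose Fp y := Num.max (F y) (0 : R)%R; pose Fn y := Num.max (- F y)%R (0 : R)%R.
have mFp : measurable_fun setT Fp by apply: measurable_maxr.
have mFn : measurable_fun setT Fn by apply: measurable_maxr => //; exact: measurableT_comp.
congr (_ - _).
- rewrite (_ : (fun x => _)^\+ = fun x => (Fp (phi x))%:E); last first.
    by apply/funext => x; rewrite funeposE /Fp EFin_max.
  rewrite (ge0_integral_transfer mFp) => [|y]; last by rewrite le_max lexx orbT.
  by apply: eq_integral => y _; rewrite funeposE /Fp maxr_pMl // mul0r EFin_max.
- rewrite (_ : (fun x => _)^\- = fun x => (Fn (phi x))%:E); last first.
    by apply/funext => x; rewrite funenegE /Fn EFin_max.
  rewrite (ge0_integral_transfer mFn) => [|y]; last by rewrite le_max lexx orbT.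
  by apply: eq_integral => y _; rewrite funenegE /Fn maxr_pMl // mul0r EFin_max mulNr.
Qed.

End Transfer.

(** * The divergence inequality *)

Section RealIntegral.
Context dd (T : measurableType dd) (R : realType).
Variables (m : {measure set T -> \bar R}) (D : set T).
Hypothesis mD : measurable D.
Implicit Types (f g : T -> R).

Definition rintegrable f : Prop := m.-integrable D (EFin \o f).

Lemma rintegrableD f g : rintegrable f -> rintegrable g -> rintegrable (fun x => f x + g x).
Proof. by move=> hf hg; apply: (integrableD mD hf hg). Qed.

Lemma rintegrableZ a f : rintegrable f -> rintegrable (fun x => a * f x).
Proof. by move=> hf; apply: (@integrableZl _ _ _ m D mD a _ hf). Qed.

Lemma rintegrableN f : rintegrable f -> rintegrable (fun x => - f x).
Proof. by move=> hf; apply: (integrableN hf). Qed.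

Lemma rintegrable_norm f : rintegrable f -> rintegrable (fun x => `|f x|).
Proof. by move=> /integrable_norm. Qed.

Lemma rintegrable0 : rintegrable (fun=> 0).
Proof. exact: integrable0. Qed.

Lemma rintegrable_sum I (r : seq I) (P : pred I) (f : I -> T -> R) :
  (forall i, P i -> rintegrable (f i)) -> rintegrable (fun x => \sum_(i <- r | P i) f i x) /\
  \int[m]_(x in D) (\sum_(i <- r | P i) f i x) = \sum_(i <- r | P i) \int[m]_(x in D) f i x.
Proof.
move=> hf; elim: r => [|i r [IH1 IH2]].
  have -> : (fun x => \sum_(i <- [::] | P i) f i x) = fun=> 0.
    by apply/funext => x; rewrite big_nil.
  by split; [exact: rintegrable0|rewrite Rintegral_cst // mul0r big_nil].
rewrite big_cons; have E x : \sum_(j <- i :: r | P j) f j x =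
    if P i then f i x + \sum_(j <- r | P j) f j x else \sum_(j <- r | P j) f j x.
  by rewrite big_cons.
have -> : (fun x => \sum_(j <- i :: r | P j) f j x) =
    fun x => if P i then f i x + \sum_(j <- r | P j) f j x else \sum_(j <- r | P j) f j x.
  by apply/funext => x; exact: E.
case: ifPn => Pi; last by split; [apply: IH1|apply: IH2].
split; first by apply: rintegrableD => //; exact: hf.
by rewrite -IH2 -RintegralD //; exact: hf.
Qed.

Lemma le_rintegrable f g : measurable_fun D f -> rintegrable g -> (forall x, D x -> `|f x| <= g x) -> rintegrable f.
Proof.
move=> mf ig h; apply: le_integrable ig => //; first exact/measurable_EFinP.
by move=> x Dx; rewrite lee_fin; apply: le_trans (h x Dx) (ler_norm _).
Qed.

Lemma rintegrable_bounded f (C : R) : (m D < +oo)%E -> measurable_fun D f ->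
  (forall x, D x -> `|f x| <= C) -> rintegrable f.
Proof.
move=> mDoo mf h; apply: measurable_bounded_integrable => //.
exists C; split; first exact: num_real.
by move=> s Cs x Dx; apply: le_trans (h x Dx) (ltW Cs).
Qed.

Lemma rintegrable_dominated (F : nat -> T -> R) f g : (forall n, measurable_fun D (F n)) ->
  measurable_fun D f -> (forall x, D x -> F ^~ x @ \oo --> f x) -> rintegrable g ->
  (forall x n, D x -> `|F n x| <= g x) ->
  rintegrable f /\ (\int[m]_(x in D) F n x @[n --> \oo] --> \int[m]_(x in D) f x).
Proof.
move=> mF mf Ff ig Fg.
have [] := @dominated_convergence _ _ _ m D mD (fun n => EFin \o F n) (EFin \o f) (EFin \o g).
- by move=> n; exact/measurable_EFinP.
- exact/measurable_EFinP.
- by apply: aeW => x Dx; apply: cvg_EFin; [exact: nearW|exact: Ff].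
- exact: ig.
- by apply: aeW => x n Dx /=; rewrite lee_fin; exact: Fg.
move=> ifl _ cv; split => //.
have ff : (\int[m]_(x in D) (f x)%:E)%E \is a fin_num by exact: integrable_fin_num.
by apply: fine_cvg; rewrite /Rintegral fineK.
Qed.

End RealIntegral.

(** * The divergence inequality in a half-space *)

Section HalfSpace.
Context {R : realType} {d : nat}.
Variables (k : 'I_d) (a : R).
Implicit Types (y : 'rV[R]_d) (n : nat).

(** It vanishes within distance 1 / (n + 1) of the face y_k = a and is 1 at distance at least 2 / (n
    + 1) inside. *)
Definition ramp n y : R := step (n.+1%:R * (a - y 0 k) - 1).

Let lin n y : R := n.+1%:R * (a - y 0 k) - 1.

Let lin_Ck n j (U : set 'rV[R]_d) : open U -> Ck j U (lin n).
Proof.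
move=> oU; apply: (Ck_add oU); last exact: Ck_cst.
apply: (Ck_mul oU); first exact: Ck_cst.
by apply: (Ck_add oU); [exact: Ck_cst|apply: (Ck_opp oU); exact: Ck_coord].
Qed.

Lemma ramp_Ck n j (U : set 'rV[R]_d) : open U -> Ck j U (ramp n).
Proof. by move=> oU; apply: (@step_Ck R d j U (lin n) oU); exact: lin_Ck. Qed.

Lemma pd_ramp i n y : exists2 b : R, 0 <= b &
  pd i (ramp n) y = - (b * n.+1%:R * (i == k)%:R).
Proof.
have [b b0 hb] := step_derive (lin n y).
have dl : differentiable (lin n) y.
  by apply: (@Ck_differentiable R d 0%N setT (lin n) y openT) => //; apply: lin_Ck; exact: openT.
exists b => //; have [_] := pd_comp1 i dl hb; rewrite -[_ \o _]/(ramp n) => ->.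
have -> : lin n = (fun z => (n.+1%:R * a - 1) + (- n.+1%:R) * z 0 k).
  by apply/funext => z; rewrite /lin; ring.
have dk : derivable (fun z : 'rV[R]_d => z 0 k) y (delta_mx 0 i).
  exact: (@Ck_derivable _ _ 0%N setT _ (Ck_coord setT 1 k) i y I).
rewrite pdD; last 2 first.
- exact: (@Ck_derivable _ _ 0%N setT _ (Ck_cst setT 1 _) i y I).
- exact: (@Ck_derivable _ _ 0%N setT _ (Ck_mul openT (Ck_cst setT 1 _) (Ck_coord setT 1 k)) i y I).
by rewrite pd_cst add0r (pdZ _ dk) -partialE partial_coord; ring.
Qed.

Lemma pd_ramp_le0 n y : pd k (ramp n) y <= 0.
Proof. by have [b b0 ->] := pd_ramp k n y; rewrite oppr_le0 !mulr_ge0. Qed.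

Lemma ramp_ge0 n y : 0 <= ramp n y. Proof. exact: step_ge0. Qed.
Lemma ramp_le1 n y : ramp n y <= 1. Proof. exact: step_le1. Qed.

Lemma ramp1 n y : 2 <= n.+1%:R * (a - y 0 k) -> ramp n y = 1.
Proof. by move=> h; apply: step_ge1; lra. Qed.

Lemma ramp0 n y : n.+1%:R * (a - y 0 k) <= 1 -> ramp n y = 0.
Proof. by move=> h; apply: step_le0; lra. Qed.

Lemma open_lin_gt n (b : R) : open [set y : 'rV[R]_d | b < n.+1%:R * (a - y 0 k)].
Proof.
apply: (@open_comp _ _ (fun y : 'rV[R]_d => n.+1%:R * (a - y 0 k)) [set x | b < x]); last exact: open_gt.
move=> y _; apply: cvgM; first exact: cvg_cst.
by apply: cvgB; [exact: cvg_cst|exact: coord_continuous].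
Qed.

Lemma open_lin_lt n (b : R) : open [set y : 'rV[R]_d | n.+1%:R * (a - y 0 k) < b].
Proof.
apply: (@open_comp _ _ (fun y : 'rV[R]_d => n.+1%:R * (a - y 0 k)) [set x | x < b]); last exact: open_lt.
move=> y _; apply: cvgM; first exact: cvg_cst.
by apply: cvgB; [exact: cvg_cst|exact: coord_continuous].
Qed.

Lemma pd_ramp0 n y : 2 < n.+1%:R * (a - y 0 k) -> pd k (ramp n) y = 0.
Proof.
move=> h; rewrite -(@pd_cst R d 1 y k); apply: (pd_near_eq _ (@open_lin_gt n 2)) => // z hz.
by apply: ramp1; exact: ltW.
Qed.

Variable mu : {measure set (borel 'rV[R]_d) -> \bar R}.
Hypothesis mubox : forall r : R, (mu (box d r) < +oo)%E.
Hypothesis muibp : forall (H : 'rV[R]_d -> R) i r, Ck 1 setT H ->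
  (forall y, r < `|y| -> H y = 0) -> (\int[mu]_y (pd i H y)%:E = 0)%E.

Variables (U K : set 'rV[R]_d) (W : 'I_d -> 'rV[R]_d -> R) (C : R).
Let Q := U `&` [set y : 'rV[R]_d | y 0 k < a].
Hypotheses (oU : open U) (cK : compact K) (KU : K `<=` U).
Hypothesis W1 : forall i, Ck 1 Q (W i).
Hypothesis W0 : forall i y, Q y -> ~ K y -> W i y = 0.
Hypothesis dWC : forall y, Q y -> `|\sum_i pd i (W i) y| <= C.
Hypothesis Wbd : forall y, K y -> y 0 k = a -> forall e, 0 < e ->
  \forall z \near y, Q z -> W k z <= e.

Let oQ : open Q.
Proof.
apply: openI => //; apply: (@open_comp _ _ (fun y : 'rV[R]_d => y 0 k) [set x | x < a]); last exact: open_lt.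
by move=> y _; exact: coord_continuous.
Qed.

Let clK : closed K. Proof. by apply: compact_closed cK; exact: norm_hausdorff. Qed.
Let oK : open (~` K). Proof. by rewrite openC. Qed.

Let rad : exists2 r, 0 < r & forall y, K y -> `|y| <= r.
Proof.
have [r [_ hr]] := compact_bounded cK.
exists (Num.max 1 (r + 1)); first by rewrite lt_max ltr01.
by move=> y Ky; apply: hr => //; rewrite lt_max (@ltrDl R) ltr01 orbT.
Qed.

(** W is known only on the open side Q of the face and may have no derivative at the face; the ramp
    makes its extension by zero a C^1 field on the whole space. *)
Let V (n : nat) (i : 'I_d) y : R := if y \in Q then ramp n y * W i y else 0.
Let f y : R := if y \in Q then \sum_i pd i (W i) y else 0.

Let V0K n i y : ~ K y -> V n i y = 0.
Proof. by move=> nK; rewrite /V; case: ifPn => // /set_mem Qy; rewrite W0 // mulr0. Qed.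

(** Around a point of Q the field is a product of C^1 functions; off U it vanishes near the point
    because K is closed and contained in U; in U on or beyond the face it vanishes because the ramp
    does. *)
Let V1 n i : Ck 1 setT (V n i).
Proof.
apply: Ck_local => y _; have [Qy|nQ] := pselect (Q y).
  exists Q => //; apply: (Ck_eq oQ) (Ck_mul oQ (ramp_Ck n 1 oQ) (W1 i)) => z Qz.
  by rewrite /V mem_set.
have [Uy|nU] := pselect (U y); last first.
  exists (~` K); first by move/KU.
  apply: (@Ck_eq _ _ 1%N (~` K) (fun=> 0) _ oK) => [z nK|]; [by rewrite V0K|exact: Ck_cst].
pose A := [set z : 'rV[R]_d | n.+1%:R * (a - z 0 k) < 1].
exists A.
  rewrite /A /= (le_lt_trans _ ltr01) // mulr_ge0_le0 // subr_le0 leNgt.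
  by apply/negP => h; apply: nQ.
apply: (@Ck_eq _ _ 1%N A (fun=> 0) _ (@open_lin_lt n 1)) => [z hz|]; last by apply: Ck_cst; exact: open_lin_lt.
by rewrite /V; case: ifP => // _; rewrite ramp0 ?mul0r // ltW.
Qed.

Let sum_pd_V n y : \sum_i pd i (V n i) y =
  if y \in Q then ramp n y * f y + pd k (ramp n) y * W k y else 0.
Proof.
case: ifPn => [/set_mem Qy|/negP nQ].
  have -> : f y = \sum_i pd i (W i) y by rewrite /f mem_set.
  have dr i : derivable (ramp n) y (delta_mx 0 i).
    by apply: (@Ck_derivable _ _ 0%N Q) => //; exact: ramp_Ck.
  have hp i : pd i (V n i) y = ramp n y * pd i (W i) y + W i y * pd i (ramp n) y.
    rewrite -pdM //; last exact: (Ck_derivable (W1 i)).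
    by apply: (pd_near_eq _ oQ) => // z Qz; rewrite /V mem_set.
  rewrite (eq_bigr _ (fun i _ => hp i)) big_split /= -mulr_sumr; congr (_ + _).
  rewrite (bigD1 k) //= big1 ?addr0 1?mulrC // => i ik.
  suff -> : pd i (ramp n) y = 0 by rewrite mulr0.
  by have [b _ ->] := pd_ramp i n y; rewrite (negbTE ik) mulr0 oppr0.
rewrite big1 // => i _; have nQy : ~ Q y by move=> Qy; apply: nQ; rewrite inE.
have [Uy|nU] := pselect (U y); last first.
  rewrite -(@pd_cst R d 0 y i); apply: (pd_near_eq _ oK); first by move/KU.
  by move=> z; exact: V0K.
rewrite -(@pd_cst R d 0 y i); apply: (pd_near_eq _ (@open_lin_lt n 1)).
  rewrite /= (le_lt_trans _ ltr01) // mulr_ge0_le0 // subr_le0 leNgt.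
  by apply/negP => h; apply: nQy.
by move=> z hz; rewrite /V; case: ifP => // _; rewrite ramp0 ?mul0r // ltW.
Qed.

Let f0 y : ~ K y -> f y = 0.
Proof.
move=> nK; rewrite /f; case: ifPn => // /set_mem Qy; apply: big1 => i _.
rewrite -(@pd_cst R d 0 y i); apply: (pd_near_eq _ (openI oQ oK)) => // z [Qz nKz].
exact: W0.
Qed.

Let f_measurable : measurable_fun setT (f : borel 'rV[R]_d -> R).
Proof.
have -> : f = patch (cst 0) Q (fun y => \sum_i pd i (W i) y) by [].
apply/(measurable_restrictT _ (borel_open oQ)); apply: cont_measurable => // y Qy.
have h : Ck 0 Q (fun y => \sum_i pd i (W i) y).
  by apply: (Ck_sum oQ) => i _; exact: Ck_pd.
exact: (Ck_continuous h).
Qed.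

Let fC y : `|f y| <= Num.max C 0.
Proof.
rewrite /f le_max; case: ifPn => [/set_mem /dWC ->//|_].
by rewrite normr0 lexx orbT.
Qed.

(** Compactness of K makes the boundary condition uniform in the layer where the ramp varies. Near a
    point on the face [Wbd] applies, near a point beyond it Q is missed, and near a point inside the
    layer has receded for large n. *)
Let eventually_le (e : R) : 0 < e -> \forall n \near \oo,
  forall z, Q z -> n.+1%:R * (a - z 0 k) <= 2 -> W k z <= e.
Proof.
move=> e0; have /compact_near_coveringP hK := cK.
have := hK nat \oo (fun n z => Q z -> n.+1%:R * (a - z 0 k) <= 2 -> W k z <= e) (@eventually_filter).
suff hh : forall y, K y -> \forall z \near y & n \near \oo,
    Q z -> n.+1%:R * (a - z 0 k) <= 2 -> W k z <= e.
  move=> /(_ hh); apply: filterS => n hn z Qz h.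
  have [Kz|nK] := pselect (K z); first exact: hn.
  by rewrite W0 // ltW.
move=> y Ky; have [ya|ya|ya] := ltgtP (y 0 k) a; last first.
- have := Wbd Ky ya e0 => h.
  exists ([set z | Q z -> W k z <= e], setT) => /=; first by split => //; exact: filterT.
  by move=> [z n] /= [h1 _] Qz _; exact: h1.
- exists ([set z : 'rV[R]_d | a < z 0 k], setT) => /=.
    split; last exact: filterT.
    apply: open_nbhs_nbhs; split => //.
    apply: (@open_comp _ _ (fun y : 'rV[R]_d => y 0 k) [set x | a < x]); last exact: open_gt.
    by move=> z _; exact: coord_continuous.
  by move=> [z n] /= [h1 _] [_ /= h2]; move: (lt_trans h1 h2); rewrite ltxx.
- pose dl := (a - y 0 k) / 2.
  have dl0 : 0 < dl by rewrite divr_gt0 // subr_gt0.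
  exists ([set z : 'rV[R]_d | z 0 k < y 0 k + dl], [set n | 2 < n.+1%:R * dl]) => /=.
    split.
      apply: open_nbhs_nbhs; split => /=; last by rewrite ltrDl.
      apply: (@open_comp _ _ (fun y : 'rV[R]_d => y 0 k) [set x | x < y 0 k + dl]); last exact: open_lt.
      by move=> z _; exact: coord_continuous.
    have := near_infty_natSinv_lt (PosNum (divr_gt0 dl0 (ltr0Sn R 1))).
    apply: filterS => n /=; rewrite ltr_pdivlMr ?ltr0Sn // -(@ltr_pM2l _ n.+1%:R) //.
    by rewrite mulrA divff // mul1r.
  move=> [z n] /= [h1 h2] Qz h3.
  have : 2 < n.+1%:R * (a - z 0 k).
    apply: (lt_le_trans h2); rewrite ler_wpM2l //.
    by move: h1; rewrite /dl => h1; lra.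
  by rewrite ltNge h3.
Qed.

(* The fields V n are C^1 with compact support, so their divergence integrates to
   0; the derivative of the ramp falls on W k with a sign that makes its
   contribution negligible. *)
Lemma halfspace_div : rintegrable mu setT f /\ \int[mu]_y f y <= 0.
Proof.
have [r r0 hr] := rad.
(* Equal to 1 on K: it gives an integrable majorant for the dominated convergence, and e b bounds W
   k from above in the layer. *)
pose b y : R := cutoff 0 r y.
have bC j : Ck j setT b by apply: cutoff_smooth; exact: openT.
have bK y : K y -> b y = 1.
  by move=> Ky; apply: cutoff1 => //; rewrite subr0; exact: hr.
have bs y : 2 * r < `|y| -> b y = 0 by move=> h; apply: cutoff0 => //; rewrite subr0 ltW.
have bge y : 0 <= b y by exact: cutoff_ge0.
have cont0 (g : 'rV[R]_d -> R) : Ck 0 setT g -> continuous g by move=> h y; exact: (Ck_continuous h).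
have supp (g : 'rV[R]_d -> R) : Ck 0 setT g -> (forall y, 2 * r < `|y| -> g y = 0) -> rintegrable mu setT g.
  by move=> gC g0; apply: (supp_integrable (r := 2 * r)) => //; exact: cont0.
have pds (g : 'rV[R]_d -> R) i : Ck 1 setT g -> (forall y, 2 * r < `|y| -> g y = 0) ->
    rintegrable mu setT (pd i g) /\ \int[mu]_y pd i g y = 0.
  move=> gC g0; split; first by apply: supp; [exact: Ck_pd|exact: pd_supp].
  by rewrite /Rintegral (muibp _ gC g0).
have iC : rintegrable mu setT (fun y => Num.max C 0 * b y).
  by apply: rintegrableZ => //; apply: supp => //; exact: bC.
have [ipb _] := pds b k (bC 1%N) bs.
pose B : R := \int[mu]_y `|pd k b y|.
have B0 : 0 <= B by exact: Rintegral_ge0.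
pose F n y : R := ramp n y * f y.
have mF n : measurable_fun setT (F n : borel 'rV[R]_d -> R).
  apply: measurable_funM => //; apply: cont_measurableT; apply: cont0.
  by apply: ramp_Ck; exact: openT.
have FC n y : `|F n y| <= Num.max C 0 * b y.
  have [Ky|nK] := pselect (K y); last first.
    by rewrite /F f0 // mulr0 normr0 mulr_ge0 // le_max lexx orbT.
  rewrite bK // mulr1 /F normrM (ger0_norm (ramp_ge0 _ _)) -[leRHS]mul1r.
  by rewrite ler_pM ?ramp_ge0 ?ramp_le1.
have iF n : rintegrable mu setT (F n) by apply: le_rintegrable iC _ => // y _; exact: FC.
(* The integral of the k-th derivative of the ramp times b is zero, so that of minus b times the
   derivative of the ramp equals that of the ramp times the derivative of b, at most B whatever n.
   Thus the steep ramp costs only e B. *)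
have key e n : 0 < e -> (forall z, Q z -> n.+1%:R * (a - z 0 k) <= 2 -> W k z <= e) ->
    \int[mu]_y F n y <= e * B.
  move=> e0 hn.
  pose rb y := ramp n y * b y.
  have rbC : Ck 1 setT rb by apply: (Ck_mul openT) => //; apply: ramp_Ck; exact: openT.
  have rb0 y : 2 * r < `|y| -> rb y = 0 by move=> /bs h; rewrite /rb h mulr0.
  pose S y := \sum_i pd i (V n i) y.
  have Vs i y : 2 * r < `|y| -> V n i y = 0.
    move=> h; apply: V0K => Ky; have := hr _ Ky; rewrite leNgt => /negP; apply.
    by apply: lt_trans h; rewrite mulr2n mulrDl mul1r ltrDl.
  have iV i : rintegrable mu setT (pd i (V n i)) by have [] := pds _ i (V1 n i) (Vs i).
  have [irb Erb] := pds _ k rbC rb0.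
  have [iS ES] := @rintegrable_sum _ _ _ mu setT measurableT _ (index_enum _) xpredT _ (fun i _ => iV i).
  have ptw y : F n y <= S y + (- e * pd k rb y + e * `|pd k b y|).
    have r0' := ramp_ge0 n y; have r1' := ramp_le1 n y; have b0' := bge y.
    have h0 := pd_ramp_le0 n y.
    have -> : pd k rb y = ramp n y * pd k b y + b y * pd k (ramp n) y.
      apply: pdM; first exact: (@Ck_derivable _ _ 0%N setT _ (ramp_Ck n 1 openT) k y I).
      exact: (@Ck_derivable _ _ 0%N setT _ (bC 1%N) k y I).
    have h1 : 0 <= e * (`|pd k b y| - ramp n y * pd k b y).
      rewrite mulr_ge0 ?(ltW e0) // subr_ge0; apply: le_trans (ler_norm _) _.
      by rewrite normrM (ger0_norm r0') -[leRHS]mul1r ler_wpM2r.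
    rewrite /S sum_pd_V; case: ifPn => [/set_mem Qy|/negP nQ]; last first.
      rewrite /F {1}/f ifF ?mulr0 ?add0r; last exact/negP.
      have h2 : 0 <= - (e * (b y * pd k (ramp n) y)).
        by rewrite oppr_ge0 mulr_ge0_le0 ?(ltW e0) // mulr_ge0_le0.
      lra.
    rewrite -/(F n y).
    suff : 0 <= pd k (ramp n) y * (W k y - e * b y) by lra.
    have [/pd_ramp0 ->|h2] := ltP 2 (n.+1%:R * (a - y 0 k)); first by rewrite mul0r.
    rewrite mulr_le0 // subr_le0; have [Ky|nK] := pselect (K y).
      by rewrite bK // mulr1; exact: hn.
    by rewrite W0 // mulr_ge0 // ltW.
  have i1 : rintegrable mu setT (fun y => - e * pd k rb y) by exact: rintegrableZ.
  have i2 : rintegrable mu setT (fun y => e * `|pd k b y|) by apply: rintegrableZ => //; exact: rintegrable_norm.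
  have i3 : rintegrable mu setT (fun y => - e * pd k rb y + e * `|pd k b y|) by exact: rintegrableD.
  apply: (@le_trans _ _ (\int[mu]_y (S y + (- e * pd k rb y + e * `|pd k b y|)))).
    by apply: (le_Rintegral measurableT (iF n) (rintegrableD measurableT iS i3)) => y _; exact: ptw.
  rewrite RintegralD // ES big1 ?add0r; last by move=> i _; have [] := pds _ i (V1 n i) (Vs i).
  rewrite RintegralD // !RintegralZl //; last exact: rintegrable_norm.
  by rewrite Erb mulr0 add0r.
have Ff y : F ^~ y @ \oo --> f y.
  have [ya|ya] := ltP (y 0 k) a; last first.
    have -> : f y = 0 by rewrite /f ifF //; apply/negP => /set_mem [_ /=]; rewrite ltNge ya.
    rewrite /F; have -> : (fun n => ramp n y * f y) = cst 0; last exact: cvg_cst.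
    apply/funext => n /=.
    have -> : f y = 0 by rewrite /f ifF //; apply/negP => /set_mem [_ /=]; rewrite ltNge ya.
    by rewrite mulr0.
  have dl0 : 0 < (a - y 0 k) / 2 by rewrite divr_gt0 // subr_gt0.
  apply: cvg_near_cst; have := near_infty_natSinv_lt (PosNum dl0).
  apply: filterS => n /= hn; apply/eqP; rewrite /F ramp1 ?mul1r //.
  move: hn; rewrite ltr_pdivlMr // -(@ltr_pM2l _ n.+1%:R) // mulrA divff // mul1r.
  exact: ltW.
have [ibf cvF] := @rintegrable_dominated _ _ _ mu setT measurableT F f _ mF f_measurable
  (fun y _ => Ff y) iC (fun y n _ => FC n y).
split => //; apply/ler_addgt0Pr => e e0; rewrite add0r.
(* B + 1 because B may vanish. *)
have e1 : 0 < e / (B + 1) by rewrite divr_gt0 // ltr_wpDl.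
have h : \forall n \near \oo, \int[mu]_y F n y <= e / (B + 1) * B.
  by have := eventually_le e1; apply: filterS => n; exact: key.
have := cvgr_to_le cvF h => /(_ eventually_filter).
move=> /le_trans; apply; have B1 : 0 < B + 1 by rewrite ltr_wpDl.
by rewrite mulrAC ler_pdivrMr // ler_pM2l // lerDl.
Qed.

End HalfSpace.

(** * Compact sets in charts and cut-offs on the manifold *)

Section ChartCompact.
Context {R : realType} {d : nat}.

Definition cball (a : 'rV[R]_d) (r : R) : set 'rV[R]_d := [set y | `|y - a| <= r].

Lemma cball_compact a r : compact (cball a r).
Proof.
have -> : cball a r = (fun y => y + a) @` box d r.
  rewrite eqEsubset; split => y /=; first by exists (y - a) => //; rewrite subrK.
  by move=> [z zr <-]; rewrite /cball /= addrK.
apply: continuous_compact (@box_compact R d r); apply: continuous_subspaceT => y.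
by apply: cvgD; [exact: cvg_id|exact: cvg_cst].
Qed.

Lemma cball_nbhs a (W : set 'rV[R]_d) : open W -> W a ->
  exists2 r : R, 0 < r & cball a r `<=` W.
Proof.
move=> oW Wa; have /nbhs_ballP[e /= e0 he] : nbhs a W by exact: open_nbhs_nbhs.
exists (e / 2); first by rewrite divr_gt0.
move=> y /= ya; apply: he; rewrite -ball_normE /= distrC; apply: le_lt_trans ya _.
by rewrite ltr_pdivrMr // ltr_pMr // ltr1n.
Qed.

Context {T : topologicalType}.
Implicit Type c : chart R d T.

Lemma cinv_compact c K : compact K -> K `<=` chart_image c setT -> compact (cinv c @` K).
Proof.
move=> cK KU; apply: continuous_compact cK.
apply: (@continuous_in_subspaceT _ _ K) => y; rewrite inE => Ky.
by apply: cinv_continuous_at; exact: KU.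
Qed.

Lemma cinv_image c K p : K `<=` chart_image c setT -> cdom c p ->
  (cinv c @` K) p -> K (cfun c p).
Proof. by move=> KU cp [y Ky <-]; have [_ _ ->] := chart_imageP (KU _ Ky). Qed.

Lemma continuous_chart c (f : T -> R) (g : 'rV[R]_d -> R) p : cdom c p ->
  {for cfun c p, continuous g} -> (\forall q \near p, f q = g (cfun c q)) ->
  {for p, continuous f}.
Proof.
move=> cp cg fg; have h : (g \o cfun c) x @[x --> p] --> g (cfun c p).
  by apply: (@continuous_comp _ _ _ (cfun c) g p); [exact: (cfun_continuous_at cp)|exact: cg].
rewrite /prop_for /continuous_at (nbhs_singleton fg); apply: cvg_trans h; apply: near_eq_cvg.
by apply: filterS fg => q ->.
Qed.

(** Used with A the closure of O and f controlled only inside O: the bounds are local around every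
    point of A but concern only values on O. *)
Lemma bounded_of_local (A O : set T) (f : T -> R) : compact A ->
  (forall p, A p -> exists C : R, \forall q \near p, O q -> `|f q| <= C) ->
  exists2 C : R, 0 <= C & forall q, A q -> O q -> `|f q| <= C.
Proof.
move=> /compact_near_coveringP cA hf.
have h := cA R +oo (fun C q => O q -> `|f q| <= C) _.
have [|C [C0 hC]] := @filter_ex _ (+oo) _ (fun C : R => 0 <= C /\ A `<=` (fun q => O q -> `|f q| <= C)).
  apply: filterI; first exact: nbhs_pinfty_ge.
  apply: h => p Ap; have [C hC] := hf p Ap.
  exists ([set q | O q -> `|f q| <= C], [set C' | C <= C']) => /=.
    by split => //; apply: nbhs_pinfty_ge; exact: num_real.
  by move=> [q C'] /= [h1 h2] Oq; apply: le_trans h2; exact: h1.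
by exists C => // q Aq; exact: hC.
Qed.

End ChartCompact.

Section Cutoff.
Context {R : realType} {d : nat} {M : manifold R d}.
Implicit Types (c : chart R d M) (p : M).

Definition mcut c (a : 'rV[R]_d) (r : R) (p : M) : R :=
  if p \in cdom c then cutoff a r (cfun c p) else 0.

Lemma mcut_cfun c a r p : cdom c p -> mcut c a r p = cutoff a r (cfun c p).
Proof. by move=> cp; rewrite /mcut mem_set. Qed.

Lemma mcut_ge0 c a r p : 0 <= mcut c a r p.
Proof. by rewrite /mcut; case: ifP => // _; exact: cutoff_ge0. Qed.

Lemma mcut_le1 c a r p : mcut c a r p <= 1.
Proof. by rewrite /mcut; case: ifP => // _; exact: cutoff_le1. Qed.

Section Supp.
Variables (c : chart R d M) (a : 'rV[R]_d) (r : R).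
Hypotheses (ac : atlas c) (r0 : 0 < r) (KU : cball a (2 * r) `<=` chart_image c setT).
Let K := cinv c @` cball a (2 * r).

(** Here the Hausdorff property enters: off the closed support, which lies in the chart domain, the
    function extended by zero is locally zero, hence smooth on the whole manifold. *)
Lemma supp_closed : closed K.
Proof.
apply: compact_closed; first exact: mspace_hausdorff.
by apply: cinv_compact => //; exact: cball_compact.
Qed.

Lemma mcut0 p : ~ K p -> mcut c a r p = 0.
Proof.
move=> nK; rewrite /mcut; case: ifPn => // /set_mem cp; apply: cutoff0 => //.
rewrite leNgt; apply/negP => h; apply: nK; exists (cfun c p); last exact: cfunK.
exact: ltW.
Qed.

Lemma mcut_near1 p : cdom c p -> cfun c p = a -> \forall q \near p, mcut c a r q = 1.
Proof.
move=> cp pa; have h : \forall y \near cfun c p, cutoff a r y = 1.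
  near=> y; apply: cutoff1 => //; rewrite -pa distrC.
  by near: y; apply: (@cvgr_dist_le _ _ _ (nbhs (cfun c p)) _ id) => //; exact: cvg_id.
have hd : \forall q \near p, cdom c q by apply: open_nbhs_nbhs; split => //; exact: cdom_open.
have h' := near_cfun cp h.
by near=> q; rewrite mcut_cfun; near: q.
Unshelve. all: by end_near. Qed.

Lemma mcut_Ck k : Ck_fun k setT (mcut c a r).
Proof.
move=> c' ac'; apply: Ck_local => y /chart_imageP [c'y _ Ey].
have [cy|ncy] := pselect (cdom c (cinv c' y)).
  exists (chart_image c' (cdom c)); first by rewrite -Ey; exact: chart_image_cfun.
  apply: (@Ck_eq _ _ k _ (cutoff a r \o transition c' c) _ (@overlap_open _ _ _ c' c)).
    by move=> z /chart_imageP [_ cz _]; rewrite /= mcut_cfun.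
  apply: (@Ck_comp _ _ _ k _ setT _ _ (@overlap_open _ _ _ c' c) openT) => //.
    by move=> j; exact: transition_Ck.
  by apply: cutoff_smooth; exact: openT.
have oK : open (chart_image c' (~` K)) by apply: open_chart_image; rewrite openC; exact: supp_closed.
exists (chart_image c' (~` K)).
  rewrite -Ey; apply: chart_image_cfun => // -[z Kz Ez]; apply: ncy; rewrite -Ez.
  by have [] := chart_imageP (KU Kz).
apply: (@Ck_eq _ _ k _ (fun=> 0) _ oK); last exact: Ck_cst.
by move=> z /chart_imageP [_ nK _]; rewrite /= mcut0.
Qed.

End Supp.
End Cutoff.

(** * Calculus of the divergence *)

Section FieldAlgebra.
Context {R : realType} {d : nat} {M : riemannian R d}.
Implicit Types (c : chart R d M) (p : M) (y : 'rV[R]_d) (u v : M -> R) (X Z : M -> 'rV[R]_d)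
  (O : set M).

Lemma fldZ c v Z y : fld c (fun p => v p *: Z p) y = v (cinv c y) *: fld c Z y.
Proof. by rewrite -!fldE /field_in tcompZ. Qed.

Lemma fldD c X Z y : fld c (fun p => X p + Z p) y = fld c X y + fld c Z y.
Proof. by rewrite -!fldE /field_in tcompD. Qed.

Lemma Ck_field_fld k O Z c i : Ck_field k O Z -> atlas c ->
  Ck k (chart_image c O) (fun y => fld c Z y 0 i).
Proof. by move=> hZ ac; have := hZ c ac i; rewrite -field_in_fld. Qed.

Lemma fld_Ck_field k O Z :
  (forall c, atlas c -> forall i, Ck k (chart_image c O) (fun y => fld c Z y 0 i)) ->
  Ck_field k O Z.
Proof. by move=> hZ c ac i; have := hZ c ac i; rewrite -field_in_fld. Qed.

Lemma Ck_fieldZ k O v Z : open O -> Ck_fun k O v -> Ck_field k O Z ->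
  Ck_field k O (fun p => v p *: Z p).
Proof.
move=> oO hv hZ; apply: fld_Ck_field => c ac i.
have oU : open (chart_image c O) by exact: open_chart_image.
have -> : (fun y => fld c (fun p => v p *: Z p) y 0 i) =
  (fun y => (v \o cinv c) y * fld c Z y 0 i) by apply/funext => y; rewrite fldZ mxE.
by apply: (Ck_mul oU); [exact: hv|exact: Ck_field_fld].
Qed.

Lemma Ck_fieldD k O X Z : open O -> Ck_field k O X -> Ck_field k O Z ->
  Ck_field k O (fun p => X p + Z p).
Proof.
move=> oO hX hZ; apply: fld_Ck_field => c ac i.
have oU : open (chart_image c O) by exact: open_chart_image.
have -> : (fun y => fld c (fun p => X p + Z p) y 0 i) =
  (fun y => fld c X y 0 i + fld c Z y 0 i) by apply/funext => y; rewrite fldD mxE.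
by apply: (Ck_add oU); exact: Ck_field_fld.
Qed.

Lemma Ck_funS k O O' u : O' `<=` O -> Ck_fun k O u -> Ck_fun k O' u.
Proof. by move=> h hu c ac; apply: CkSub (hu c ac); exact: chart_imageS. Qed.

Definition dirD c v Z y : R := \sum_i fld c Z y 0 i * pd i (v \o cinv c) y.

Section At.
Variables (O : set M) (c : chart R d M) (p : M).
Hypotheses (oO : open O) (Op : O p) (ac : atlas c) (cp : cdom c p).
Let y := cfun c p.
Let U := chart_image c O.
Let oU : open U. Proof. exact: open_chart_image. Qed.
Let Uy : U y. Proof. exact: chart_image_cfun. Qed.

Lemma fld_derivable Z i j : Ck_field 1 O Z -> derivable (fun z => fld c Z z 0 i) y (delta_mx 0 j).
Proof. move=> hZ; apply: (@Ck_derivable _ _ 0%N U _ _ j y Uy); exact: (@Ck_field_fld 1). Qed.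

Lemma fld_differentiable Z i : Ck_field 1 O Z -> differentiable (fun z => fld c Z z 0 i) y.
Proof. move=> hZ; apply: (@Ck_differentiable _ _ 0%N U _ y oU _ Uy); exact: (@Ck_field_fld 1). Qed.

Lemma cinv_derivable v j : Ck_fun 1 O v -> derivable (v \o cinv c) y (delta_mx 0 j).
Proof. by move=> hv; exact: (@Ck_derivable _ _ 0%N U _ (hv c ac) j y Uy). Qed.

Lemma cinv_cfun : cinv c y = p. Proof. exact: cfunK. Qed.

Lemma cov_inZ v Z i k : Ck_fun 1 O v -> Ck_field 1 O Z ->
  cov_in c (fun p => v p *: Z p) y i k =
  v p * cov_in c Z y i k + pd i (v \o cinv c) y * fld c Z y 0 k.
Proof.
move=> hv hZ; rewrite !mxE.
have -> : (fun z => fld c (fun p => v p *: Z p) z 0 k) =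
  (fun z => (v \o cinv c) z * fld c Z z 0 k) by apply/funext => z; rewrite fldZ mxE.
rewrite (pdM (@cinv_derivable v i hv) (@fld_derivable Z k i hZ)) fldZ /= cinv_cfun.
rewrite mulrDr mulr_sumr (mulrC (fld c Z y 0 k)) addrAC; congr (_ + _ + _).
by apply: eq_bigr => j _; rewrite mxE; ring.
Qed.

Lemma tr_cov_inZ v Z : Ck_fun 1 O v -> Ck_field 1 O Z ->
  \tr (cov_in c (fun p => v p *: Z p) y) = v p * \tr (cov_in c Z y) + dirD c v Z y.
Proof.
move=> hv hZ; rewrite /mxtrace mulr_sumr /dirD -big_split /=; apply: eq_bigr => i _.
by rewrite cov_inZ // [X in _ + X]mulrC.
Qed.

Lemma tr_cov_inD X Z : Ck_field 1 O X -> Ck_field 1 O Z ->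
  \tr (cov_in c (fun p => X p + Z p) y) = \tr (cov_in c X y) + \tr (cov_in c Z y).
Proof.
move=> hX hZ; rewrite /mxtrace -big_split /=; apply: eq_bigr => i _; rewrite !mxE.
have -> : (fun z => fld c (fun p => X p + Z p) z 0 i) =
  (fun z => fld c X z 0 i + fld c Z z 0 i) by apply/funext => z; rewrite fldD mxE.
rewrite pdD; [|exact: fld_derivable|exact: fld_derivable].
rewrite addrACA -big_split /=; congr (_ + _); apply: eq_bigr => j _.
by rewrite fldD mxE mulrDr.
Qed.

(** By tensoriality the matrices of D Z in two charts are conjugate under the Jacobian, so their
    traces agree. *)
Lemma divergence_in Z : Ck_field 1 O Z -> divergence Z p = \tr (cov_in c Z y).
Proof.
move=> hZ; rewrite /divergence covD_cov_in.
have ac' := chart_at_atlas p; have c'p := chart_at_dom p.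
have yO' : chart_image c (cdom (chart_at p)) y by exact: chart_image_cfun.
have := @cov_in_transition _ _ _ c (chart_at p) y ac ac' yO' Z.
have E : transition c (chart_at p) y = cfun (chart_at p) p by rewrite transition_cfun.
rewrite E => /(_ (fun k => @fld_differentiable Z k hZ)).
have h2 k : differentiable (fun z => fld (chart_at p) Z z 0 k) (cfun (chart_at p) p).
  apply: (@Ck_differentiable _ _ 0%N (chart_image (chart_at p) O)).
  - exact: open_chart_image.
  - exact: (@Ck_field_fld 1).
  - exact: chart_image_cfun.
move=> /(_ h2) h; have uJ := tjac_unit ac ac' yO'.
have -> : cov_in (chart_at p) Z (cfun (chart_at p) p) =
  invmx (tjac c (chart_at p) y) *m (cov_in c Z y *m tjac c (chart_at p) y).
  by rewrite h mulKmx.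
by rewrite mxtrace_mulC -mulmxA mulmxV // mulmx1.
Qed.

End At.

Lemma divergenceZ O v Z p : open O -> O p -> Ck_fun 1 O v -> Ck_field 1 O Z ->
  divergence (fun p => v p *: Z p) p = v p * divergence Z p +
    dirD (chart_at p) v Z (cfun (chart_at p) p).
Proof.
move=> oO Op hv hZ; have ac := chart_at_atlas p; have cp := chart_at_dom p.
by rewrite /divergence !covD_cov_in (@tr_cov_inZ O (chart_at p) p Op ac cp v Z hv hZ).
Qed.

Lemma divergenceD O X Z p : open O -> O p -> Ck_field 1 O X -> Ck_field 1 O Z ->
  divergence (fun p => X p + Z p) p = divergence X p + divergence Z p.
Proof.
move=> oO Op hv hZ; have ac := chart_at_atlas p; have cp := chart_at_dom p.
by rewrite /divergence !covD_cov_in (@tr_cov_inD O (chart_at p) p Op ac cp X Z hv hZ).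
Qed.

Lemma divergence_near O X Z p : open O -> O p -> (forall q, O q -> X q = Z q) ->
  divergence X p = divergence Z p.
Proof.
move=> oO Op h; have ac := chart_at_atlas p; have cp := chart_at_dom p.
rewrite /divergence !covD_cov_in /mxtrace; apply: eq_bigr => i _; rewrite !mxE.
have hf z : chart_image (chart_at p) O z -> fld (chart_at p) X z = fld (chart_at p) Z z.
  by move=> /chart_imageP [_ Oz _]; rewrite -!fldE /field_in h.
have Uy := chart_image_cfun cp Op.
have oU : open (chart_image (chart_at p) O) by exact: open_chart_image.
rewrite (@pd_near_eq _ _ _ _ _ _ i oU Uy (fun z Uz => congr1 (fun v : 'rV_d => v 0 i) (hf z Uz))).
by congr (_ + _); apply: eq_bigr => j _; rewrite hf.
Qed.

Lemma divergence0 O Z p : open O -> O p -> (forall q, O q -> Z q = 0) -> divergence Z p = 0.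
Proof.
move=> oO Op h; rewrite (@divergence_near O Z (fun q => (0 : R) *: Z q) p oO Op) => [|q Oq]; last first.
  by rewrite scale0r h.
rewrite /divergence covD_cov_in /mxtrace; apply: big1 => i _; rewrite !mxE.
have f0 z : fld (chart_at p) (fun q => (0 : R) *: Z q) z = 0 by rewrite (fldZ _ (fun=> 0)) scale0r.
have -> : (fun z => fld (chart_at p) (fun q => (0 : R) *: Z q) z 0 i) = (fun=> 0).
  by apply/funext => z; rewrite f0 mxE.
by rewrite pd_cst add0r big1 // => j _; rewrite f0 mxE mulr0.
Qed.

Lemma divergence_continuous O Z p : open O -> Ck_field 1 O Z -> O p ->
  {for p, continuous (divergence Z)}.
Proof.
move=> oO hZ Op; have ac := chart_at_atlas p; have cp := chart_at_dom p.
have oU : open (chart_image (chart_at p) O) by exact: open_chart_image.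
apply: (@continuous_chart _ _ _ (chart_at p) _ (fun y => \tr (cov_in (chart_at p) Z y)) p cp).
  have h : Ck 0 (chart_image (chart_at p) O) (fun y => \tr (cov_in (chart_at p) Z y)).
    apply: (Ck_sum oU) => i _; apply: (cov_in_Ck ac oU) => [|l]; first exact: chart_imageS.
    exact: Ck_field_fld.
  exact: (@Ck_continuous _ _ 0%N _ _ h _ (chart_image_cfun cp Op)).
have h1 : \forall q \near p, cdom (chart_at p) q.
  by apply: open_nbhs_nbhs; split; [exact: cdom_open|exact: cp].
have h2 : \forall q \near p, O q by exact: open_nbhs_nbhs.
apply: filterS2 h1 h2 => q cq Oq; exact: (@divergence_in O (chart_at p) q oO Oq ac cq Z hZ).
Qed.

End FieldAlgebra.

Lemma continuous_near_bounded (R : realType) (T : topologicalType) (f : T -> R) p :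
  {for p, continuous f} -> \forall q \near p, `|f q| <= `|f p| + 1.
Proof.
move=> /cvgrPdist_le /(_ _ ltr01); apply: filterS => q hq.
have -> : f q = f p - (f p - f q) by ring.
by apply: le_trans (ler_normB _ _) _; rewrite lerD2l.
Qed.

(** * The Riemannian volume in a chart *)

Section Volume.
Context {R : realType} {d : nat} {M : riemannian R d}.
Implicit Types (c : chart R d M).

Lemma cfun_measurable c :
  measurable_fun (cdom c : set (borel M)) (cfun c : borel M -> borel 'rV[R]_d).
Proof.
apply: (@measurability _ _ (borel M) (borel 'rV[R]_d) (cdom c) (cfun c) (@open 'rV[R]_d) erefl).
move=> _ [W oW <-]; apply: borel_open; rewrite openE => p [cp Wp].
apply: filterI; first by apply: open_nbhs_nbhs; split; [exact: cdom_open|].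
by apply: (cfun_continuous_at cp); apply: open_nbhs_nbhs.
Qed.

(** The density is set to 0 off the image of the chart, where [dens] has no meaning, so that
    integrals can be taken over the whole space. *)
Definition cdens c (y : 'rV[R]_d) : R :=
  if y \in chart_image c setT then dens c y else 0.

Lemma cdens_ge0 c y : 0 <= cdens c y.
Proof. by rewrite /cdens; case: ifP => // _; exact: sqrtr_ge0. Qed.

Lemma cdens_measurable c : atlas c -> measurable_fun setT (cdens c : borel 'rV[R]_d -> R).
Proof.
move=> ac; have oU : open (chart_image c setT) by exact: open_chart_imageT.
have -> : cdens c = patch (cst 0) (chart_image c setT) (dens c) by [].
apply/(measurable_restrictT _ (borel_open oU)); apply: cont_measurable => // y Uy.
exact: (Ck_continuous (dens_C1 ac)).
Qed.

Variables (vol : {measure set (borel M) -> \bar R}).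
Hypothesis volP : riemannian_volume vol.
Variables (mu : {measure set (borel 'rV[R]_d) -> \bar R}).
Hypothesis muP : forall F : borel 'rV[R]_d -> \bar R,
  measurable_fun (setT : set (borel 'rV[R]_d)) F ->
  (forall y, (0 <= F y)%E) -> lebesgue_int F = (\int[mu]_y F y)%E.

Lemma vol_chart c (A : set (borel 'rV[R]_d)) : atlas c -> measurable A ->
  vol (cdom c `&` cfun c @^-1` A) = (\int[mu]_y (\1_A y * cdens c y)%:E)%E.
Proof.
move=> ac mA; have mE : measurable (cdom c `&` cfun c @^-1` A : set (borel M)).
  by apply: cfun_measurable => //; apply: borel_open; exact: cdom_open.
rewrite (volP ac mE) => [|p []//].
have -> : (fun y : 'rV[R]_d =>
    (\1_(cfun c @` (cdom c `&` cfun c @^-1` A)) y * Num.sqrt (\det (gmx c y)))%:E) =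
  (fun y => (\1_A y * cdens c y)%:E).
  apply/funext => y; congr (_%:E); rewrite /cdens.
  have -> : cfun c @` (cdom c `&` cfun c @^-1` A) = A `&` chart_image c setT.
    rewrite eqEsubset; split => [_ [p [cp Ap] <-]|z [Az [p [cp _] pz]]].
      by split => //; exact: chart_image_cfun.
    by exists p => //; split => //; rewrite /preimage /= pz.
  rewrite indicI /=; case: ifPn => [yU|yU].
    by rewrite [X in _ * X * _]indicE yU mulr1 /dens gmE.
  by rewrite [X in _ * X * _]indicE (negbTE yU) !(mulr0, mul0r).
apply: muP => [|y]; last by rewrite lee_fin mulr_ge0 // cdens_ge0.
apply/measurable_EFinP; apply: measurable_funM; last exact: cdens_measurable.
exact: measurable_indic.
Qed.

Lemma integral_chart c (F : 'rV[R]_d -> R) : atlas c ->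
  measurable_fun setT (F : borel 'rV[R]_d -> R) ->
  \int[vol]_(p in cdom c) F (cfun c p) = \int[mu]_y (F y * cdens c y).
Proof.
move=> ac mF; rewrite /Rintegral.
have mD : measurable (cdom c : set (borel M)) by apply: borel_open; exact: cdom_open.
have := @integral_transfer _ _ (borel M) (borel 'rV[R]_d) R vol mu (cdom c) (cfun c) (cdens c)
  mD (@cfun_measurable c) (cdens_measurable ac) (@cdens_ge0 c)
  (fun A mA => vol_chart ac mA) F mF.
by move=> ->.
Qed.

End Volume.

(** * From charts to the whole domain *)

Section Divergence.
Context {R : realType} {d : nat} {M : riemannian R d}.
Variables (vol : {measure set (borel M) -> \bar R}) (O : set M).
Hypothesis volP : riemannian_volume vol.
Hypotheses (d0 : (0 < d)%N) (oO : open O) (cO : compact (closure O)) (volO : (vol O < +oo)%E).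
Implicit Types (c : chart R d M) (Z : M -> 'rV[R]_d) (k : 'I_d).

(** [halfspace_div] for the components of Z multiplied by the density. Interior points are covered
    too: if K does not meet y_k = a, the condition at the face is void. *)
Lemma chart_div Z c k (a C : R) (U K : set 'rV[R]_d) : Ck_field 1 O Z ->
  (forall q, O q -> `|divergence Z q| <= C) -> atlas c ->
  open U -> U `<=` chart_image c setT -> compact K -> K `<=` U ->
  (forall q, cdom c q -> U (cfun c q) -> (O q <-> cfun c q 0 k < a)) ->
  (forall q, O q -> ~ (cinv c @` K) q -> Z q = 0) ->
  (forall y, K y -> y 0 k = a -> forall e : R, 0 < e ->
     \forall z \near y, U z -> z 0 k < a -> fld c Z z 0 k <= e) ->
  \int[vol]_(q in O) divergence Z q <= 0.
Proof.
move=> hZ hC ac oU UT cK KU OU Z0 Zbd.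
have [mu [mubox muP muibp]] := lebesgue_int_measure (R := R) d.
pose Q := U `&` [set y : 'rV[R]_d | y 0 k < a].
have QO y : Q y -> chart_image c O y.
  move=> [Uy ya]; have [cy _ Ey] := chart_imageP (UT _ Uy).
  by rewrite -Ey; apply: chart_image_cfun => //; apply/OU => //; rewrite Ey.
have oQ : open Q.
  apply: openI => //; apply: (@open_comp _ _ (fun y : 'rV[R]_d => y 0 k) [set x | x < a]); last exact: open_lt.
  by move=> y _; exact: coord_continuous.
pose KM := cinv c @` K.
have clK : closed KM.
  apply: compact_closed; first exact: mspace_hausdorff.
  by apply: cinv_compact => //; exact: subset_trans KU UT.
have oOK : open (O `&` ~` KM) by apply: openI => //; rewrite openC.
have div0 q : O q -> ~ KM q -> divergence Z q = 0.
  by move=> Oq nK; apply: (@divergence0 _ _ _ (O `&` ~` KM)) => // z [Oz nz]; exact: Z0.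
pose W i y := dens c y * fld c Z y 0 i.
have QT : Q `<=` chart_image c setT by move=> y [/UT].
have W1 i : Ck 1 Q (W i).
  apply: (Ck_mul oQ); first exact: CkSub (dens_C1 ac).
  exact: CkSub (@Ck_field_fld _ _ _ 1 O Z c i hZ ac).
have inK y : Q y -> ~ K y -> ~ KM (cinv c y).
  move=> Qy nK [z Kz Ez]; apply: nK; have [_ _ Ey] := chart_imageP (QT _ Qy).
  by rewrite -Ey -Ez; have [_ _ ->] := chart_imageP (UT _ (KU _ Kz)).
have W0 i y : Q y -> ~ K y -> W i y = 0.
  move=> Qy nK; have [cy Oy Ey] := chart_imageP (QO _ Qy).
  by rewrite /W -fldE /field_in (Z0 _ Oy (inK _ Qy nK)) /tcomp mul0mx mxE mulr0.
have dW y : Q y -> \sum_i pd i (W i) y = dens c y * \tr (cov_in c Z y) /\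
    \tr (cov_in c Z y) = divergence Z (cinv c y).
  move=> Qy; have [cy Oy Ey] := chart_imageP (QO _ Qy); split.
    rewrite -dens_divergence //; first exact: QT.
    move=> i; apply: (@Ck_derivable _ _ 0%N (chart_image c O)); last exact: QO.
    exact: (@Ck_field_fld _ _ _ 1).
  by rewrite (@divergence_in _ _ _ O c (cinv c y) oO Oy ac cy Z hZ) Ey.
have cD y : K y -> {for y, continuous (dens c)}.
  by move=> Ky; exact: (@Ck_continuous _ _ 1 _ _ (dens_C1 ac) y (UT _ (KU _ Ky))).
have [D D0 hD] : exists2 D : R, 0 <= D & forall y, K y -> setT y -> `|dens c y| <= D.
  apply: (bounded_of_local cK) => y Ky; exists (`|dens c y| + 1).
  by have := continuous_near_bounded (cD _ Ky); apply: filterS.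
have dWC y : Q y -> `|\sum_i pd i (W i) y| <= D * C.
  move=> Qy; have [-> ->] := dW _ Qy; have [_ Oy _] := chart_imageP (QO _ Qy).
  have [Ky|nK] := pselect (K y); last first.
    rewrite div0 //; last exact: inK.
    by rewrite mulr0 normr0 mulr_ge0 //; apply: le_trans (hC _ Oy).
  by rewrite normrM ler_pM //; [exact: hD|exact: hC].
have Wbd y : K y -> y 0 k = a -> forall e : R, 0 < e -> \forall z \near y, Q z -> W k z <= e.
  move=> Ky ya e e0; have cy := cD _ Ky.
  have D1 : 0 < `|dens c y| + 1 by rewrite ltr_wpDl.
  have h1 := continuous_near_bounded cy.
  have h2 := Zbd y Ky ya _ (divr_gt0 e0 D1).
  apply: filterS2 h1 h2 => z h1 h2 [Uz za].
  have dz : 0 <= dens c z by exact: sqrtr_ge0.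
  apply: (@le_trans _ _ (dens c z * (e / (`|dens c y| + 1)))); first by rewrite ler_wpM2l // h2.
  rewrite mulrCA ger_pMr // ler_pdivrMr // mul1r.
  by apply: le_trans (ler_norm _) h1.
have [ibf hf] := @halfspace_div R d k a mu mubox muibp U K W (D * C) oU cK KU W1 W0 dWC Wbd.
pose F y := if y \in Q then \tr (cov_in c Z y) else 0.
have mF : measurable_fun setT (F : borel 'rV[R]_d -> R).
  have -> : F = patch (cst 0) Q (fun y => \tr (cov_in c Z y)) by [].
  apply/(measurable_restrictT _ (borel_open oQ)); apply: (cont_measurable oQ) => y Qy.
  have h : Ck 0 Q (fun y => \tr (cov_in c Z y)).
    apply: (Ck_sum oQ) => i _; apply: (cov_in_Ck ac oQ) => [|l]; first exact: QT.
    exact: CkSub (@Ck_field_fld _ _ _ 1 O Z c l hZ ac).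
  exact: (Ck_continuous h).
suff -> : \int[vol]_(q in O) divergence Z q = \int[vol]_(q in cdom c) F (cfun c q).
  rewrite (@integral_chart _ _ _ _ volP mu muP) //.
  rewrite (@eq_Rintegral _ _ _ mu setT (fun y => if y \in Q then \sum_i pd i (W i) y else 0)) // => y _.
  rewrite /F; case: ifPn => [/set_mem Qy|_]; last by rewrite mul0r.
  by have [-> _] := dW _ Qy; rewrite /cdens mem_set; [rewrite mulrC|exact: QT].
rewrite Rintegral_mkcond [RHS]Rintegral_mkcond; apply: eq_Rintegral => q _.
rewrite !patchE; case: ifPn => [/set_mem Oq|nO].
  case: ifPn => [/set_mem cq|/negP ncq]; last first.
    apply: div0 => // -[y Ky Ey]; apply: ncq; rewrite inE -Ey.
    by have [] := chart_imageP (UT _ (KU _ Ky)).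
  rewrite /F; case: ifPn => [/set_mem Qq|/negP nQ].
    by have [_ ->] := dW _ Qq; rewrite cfunK.
  apply: div0 => // Kq; apply: nQ; rewrite inE.
  have Uq := KU _ (cinv_image (subset_trans KU UT) cq Kq).
  by split => //; apply/OU.
case: ifPn => [/set_mem cq|//]; rewrite /F ifF //; apply/negP => /set_mem [Uq qa].
by move/negP: nO; apply; rewrite inE; apply/OU.
Qed.

(** A slice chart alone does not say on which side of the hypersurface O lies; the charts that come
    with an outward vector do. *)
Definition one_sided k c : Prop :=
  slice_chart O k c /\ forall x, cdom c x -> (O x <-> cfun c x 0 k < 0).

Hypothesis one_sidedP : forall p, bdry O p -> exists k c, one_sided k c /\ cdom c p.

(* The last condition says that the outer normal component of Z is
   asymptotically non-positive at the boundary. *)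
Definition admissible Z : Prop :=
  [/\ Ck_field 1 O Z,
      forall c p, atlas c -> cdom c p -> exists C : R,
        \forall q \near p, O q -> forall i, `|fld c Z (cfun c q) 0 i| <= C,
      forall p : M, exists C : R, \forall q \near p, O q -> `|divergence Z q| <= C &
      forall c k p, one_sided k c -> cdom c p -> cfun c p 0 k = 0 ->
        forall e : R, 0 < e -> \forall q \near p, O q -> fld c Z (cfun c q) 0 k <= e].

Let mO : measurable (O : set (borel M)). Proof. exact: borel_open. Qed.

Lemma admissible_div_bounded Z : admissible Z -> exists2 C : R, 0 <= C & forall q, O q -> `|divergence Z q| <= C.
Proof.
move=> [_ _ hC _].
have [C C0 h] := @bounded_of_local R M (closure O) O (divergence Z) cO (fun p _ => hC p).
by exists C => // q Oq; apply: h => //; exact: subset_closure.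
Qed.

Lemma admissible_rintegrable Z : admissible Z -> rintegrable vol (O : set (borel M)) (divergence Z : borel M -> R).
Proof.
move=> aZ; have [C _ hC] := admissible_div_bounded aZ; have [hZ _ _ _] := aZ.
apply: (rintegrable_bounded mO volO _ hC); apply: (cont_measurable oO) => p Op.
exact: (divergence_continuous oO hZ Op).
Qed.

(** The bounds 0 <= psi <= 1 preserve the sign condition at the boundary, and the extra term in the
    divergence is locally bounded because psi is C^1 across the boundary. *)
Lemma admissible_mul psi Z : Ck_fun 1 setT psi -> (forall p, 0 <= psi p <= 1) -> admissible Z ->
  admissible (fun p => psi p *: Z p).
Proof.
move=> hpsi psi01 [hZ lbZ ldZ bcZ].
have hpsiO : Ck_fun 1 O psi by apply: Ck_funS hpsi.
have npsi p : `|psi p| <= 1 by have /andP[h1 h2] := psi01 p; rewrite ger0_norm.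
split.
- exact: Ck_fieldZ.
- move=> c p ac cp; have [C hC] := lbZ c p ac cp; exists C.
  apply: filterS hC => q hq Oq i; rewrite fldZ mxE normrM -[leRHS]mul1r.
  by rewrite ler_pM // hq.
- move=> p; pose c := chart_at p; have ac : atlas c := chart_at_atlas p.
  have cp : cdom c p := chart_at_dom p.
  have [C1 h1] := ldZ p; have [C2 h2] := lbZ c p ac cp.
  have pdC i : {for cfun c p, continuous (pd i (psi \o cinv c))}.
    apply: (@Ck_continuous _ _ 0%N (chart_image c setT)); last exact: chart_image_cfun.
    by apply: Ck_pd; exact: (hpsi c ac).
  have h3 : \forall q \near p, forall i, `|pd i (psi \o cinv c) (cfun c q)| <=
      `|pd i (psi \o cinv c) (cfun c p)| + 1.
    have h i := near_cfun cp (continuous_near_bounded (pdC i)).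
    exact: (@filter_forall _ _ (fun i q => `|pd i (psi \o cinv c) (cfun c q)| <=
      `|pd i (psi \o cinv c) (cfun c p)| + 1) (nbhs p) _ h).
  have h4 : \forall q \near p, cdom c q by apply: open_nbhs_nbhs; split; [exact: cdom_open|].
  exists (C1 + \sum_i C2 * (`|pd i (psi \o cinv c) (cfun c p)| + 1)).
  apply: filterS2 (filterI h1 h2) (filterI h3 h4) => q [h1q h2q] [h3q cq] Oq.
  rewrite (@divergence_in _ _ _ O c q oO Oq ac cq) //; last exact: Ck_fieldZ.
  rewrite (@tr_cov_inZ _ _ _ O c q Oq ac cq) // -(@divergence_in _ _ _ O c q oO Oq ac cq Z hZ).
  apply: le_trans (ler_normD _ _) _; apply: lerD.
    by rewrite normrM -[leRHS]mul1r ler_pM // h1q.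
  apply: le_trans (ler_norm_sum _ _ _) _; apply: ler_sum => i _; rewrite normrM.
  by apply: (ler_pM (normr_ge0 _) (normr_ge0 _) (h2q Oq i) (h3q i)).
- move=> c k p sc cp p0 e e0; have := bcZ c k p sc cp p0 e e0.
  apply: filterS => q hq Oq; rewrite fldZ mxE; have /andP[h1 h2] := psi01 (cinv c (cfun c q)).
  have [h|h] := leP 0 (fld c Z (cfun c q) 0 k); last first.
    by apply: le_trans (ltW e0); rewrite mulr_ge0_le0 // ltW.
  by apply: le_trans (hq Oq); rewrite -[leRHS]mul1r ler_wpM2r.
Qed.

(** The cut-off depends on the point only and serves all admissible fields at once, which the later
    induction needs. Interior and boundary points are unified by the data c, k, a, U of a possibly
    fictitious face. *)
Lemma local_div p : closure O p -> exists psi : M -> R,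
  [/\ Ck_fun 1 setT psi, forall q, 0 <= psi q <= 1, \forall q \near p, psi q = 1 &
   forall Z, admissible Z -> \int[vol]_(q in O) divergence (fun q => psi q *: Z q) q <= 0].
Proof.
move=> clp.
suff [c [k [a [U [[ac cp] [oU UT Up] OU bU]]]]] : exists c k a (U : set 'rV[R]_d),
  [/\ atlas c /\ cdom c p, [/\ open U, U `<=` chart_image c setT & U (cfun c p)],
      forall q, cdom c q -> U (cfun c q) -> (O q <-> cfun c q 0 k < a) &
      forall y, U y -> y 0 k = a -> a = 0 /\ one_sided k c].
  have [r0 r00 hr] := cball_nbhs oU Up; pose r := r0 / 2.
  have r_gt0 : 0 < r by rewrite divr_gt0.
  have r2 : 2 * r = r0 by rewrite /r; field.
  have KU : cball (cfun c p) (2 * r) `<=` U by rewrite r2.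
  have KT := subset_trans KU UT.
  pose psi := mcut c (cfun c p) r.
  have hpsi : Ck_fun 1 setT psi by exact: mcut_Ck.
  have psi01 q : 0 <= psi q <= 1 by rewrite mcut_ge0 mcut_le1.
  exists psi; split => //; first exact: mcut_near1.
  move=> Z aZ; have aZ' := admissible_mul hpsi psi01 aZ.
  have [C _ hC] := admissible_div_bounded aZ'; have [hZ _ _ bZ] := aZ'.
  apply: (@chart_div _ c k a C U (cball (cfun c p) (2 * r)) hZ hC ac oU UT) => //.
  - exact: cball_compact.
  - by move=> q Oq nK; rewrite /psi mcut0 // scale0r.
  - move=> y Ky ya e e0; have [a0 sc] := bU _ (KU _ Ky) ya.
    have [cy _ Ey] := chart_imageP (KT _ Ky).
    have := bZ c k (cinv c y) sc cy; rewrite Ey ya a0 => /(_ erefl e e0) h.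
    have h2 : \forall z \near cfun c (cinv c y), O (cinv c z) -> fld c (fun q => psi q *: Z q) (cfun c (cinv c z)) 0 k <= e.
      exact: (near_chart cy h).
    rewrite Ey in h2; apply: filterS h2 => z hz Uz za.
    have [cz _ Ez] := chart_imageP (UT _ Uz).
    by move: hz; rewrite Ez; apply; apply/OU => //; rewrite Ez // a0.
(* At an interior point the face is placed at distance 1 from p in the first coordinate, and U is
   cut off before it, so that it is never reached. *)
have [Op|nOp] := pselect (O p).
  pose c := chart_at p; have ac : atlas c := chart_at_atlas p.
  have cp : cdom c p := chart_at_dom p.
  pose k := Ordinal d0; pose a := cfun c p 0 k + 1.
  exists c, k, a, (chart_image c O `&` [set y | y 0 k < a]); split => //.
  - split.
    + apply: openI; first exact: open_chart_image.
      apply: (@open_comp _ _ (fun y : 'rV[R]_d => y 0 k) [set x | x < a]); last exact: open_lt.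
      by move=> z _; exact: coord_continuous.
    + by move=> y [/chart_imageS + _]; apply.
    + by split; [exact: chart_image_cfun|rewrite /= /a ltrDl].
  - move=> q cq [/chart_imageP [_ Oq _] qa]; split => // _.
    by move: Oq; rewrite cfunK.
  - by move=> y [_ /= ya] yE; move: ya; rewrite yE ltxx.
have bp : bdry O p.
  by split => //; move=> /interior_subset.
have [k [c [sc cp]]] := one_sidedP bp; have [[ac _] hO] := sc.
exists c, k, 0, (chart_image c setT); split => //.
- by split => //; [exact: open_chart_imageT|exact: chart_image_cfun].
- by move=> q cq _; exact: hO.
Qed.

(** No partition of unity is built. Over a finite subcover, Y is split into psi Y, handled by
    [local_div], and (1 - psi) Y, which vanishes wherever psi = 1; after the last cut-off nothing is
    left on O. *)
Theorem divergence_le0 Z : admissible Z -> \int[vol]_(q in O) divergence Z q <= 0.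
Proof.
have [psi hpsi] : {psi : M -> M -> R & forall p, closure O p ->
  [/\ Ck_fun 1 setT (psi p), forall q, 0 <= psi p q <= 1, \forall q \near p, psi p q = 1 &
   forall Z, admissible Z -> \int[vol]_(q in O) divergence (fun q => psi p q *: Z q) q <= 0]}.
  apply: (@choice _ _ (fun p psi => closure O p -> [/\ Ck_fun 1 setT psi, forall q, 0 <= psi q <= 1, \forall q \near p, psi q = 1 &
   forall Z, admissible Z -> \int[vol]_(q in O) divergence (fun q => psi q *: Z q) q <= 0])) => p.
  have [/local_div [psi h]|nc] := pselect (closure O p); first by exists psi.
  by exists (fun=> 0).
pose N p : set M := interior [set q | psi p q = 1].
have : cover_compact (closure O) by rewrite -compact_cover.
move=> /(_ M (closure O) N) [||D DO Dcov].
- by move=> p _; exact: open_interior.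
- by move=> p clp; exists p => //; have [_ _ h _] := hpsi p clp.
(* Invariant: wherever Y is non-zero, some cut-off of the list equals 1. *)
have main (s : seq M) : (forall p, p \in s -> closure O p) -> forall Y, admissible Y ->
    (forall q, O q -> Y q <> 0 -> exists2 p, p \in s & psi p q = 1) ->
    \int[vol]_(q in O) divergence Y q <= 0.
  elim: s => [|p s IH] hs Y aY hY.
    rewrite (@eq_Rintegral _ _ _ vol O (fun=> 0)) => [|q /set_mem Oq].
      by rewrite Rintegral_cst // mul0r.
    apply: (@divergence0 _ _ _ O) => // z Oz; apply: contrapT => nz.
    by have [p] := hY z Oz nz.
  have [C1 psi01 _ hp] := hpsi p (hs p (mem_head _ _)).
  pose phi q := 1 - psi p q.
  have phiC : Ck_fun 1 setT phi.
    move=> c ac; have oU : open (chart_image c setT) by exact: open_chart_imageT.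
    apply: (Ck_add oU); first exact: Ck_cst.
    by apply: (Ck_opp oU); exact: (C1 c ac).
  have phi01 q : 0 <= phi q <= 1 by have := psi01 q; rewrite /phi => /andP[h1 h2]; apply/andP; split; lra.
  have a1 := admissible_mul C1 psi01 aY; have a2 := admissible_mul phiC phi01 aY.
  have h1 := hp Y aY.
  have h2 : \int[vol]_(q in O) divergence (fun q => phi q *: Y q) q <= 0.
    apply: IH => // [q qs|q Oq nz]; first by apply: hs; rewrite inE qs orbT.
    have [|p' + hp'] := hY q Oq; first by move=> Y0; apply: nz; rewrite Y0 scaler0.
    rewrite inE => /orP[/eqP E|p's]; last by exists p'.
    by exfalso; apply: nz; rewrite /phi -E hp' subrr scale0r.
  have [hY1 _ _ _] := a1; have [hY2 _ _ _] := a2.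
  have E q : O q -> divergence Y q = divergence (fun q => psi p q *: Y q) q + divergence (fun q => phi q *: Y q) q.
    move=> Oq; rewrite -(@divergenceD _ _ _ O _ _ q oO Oq hY1 hY2).
    apply: (@divergence_near _ _ _ O) => // z _; rewrite -scalerDl /phi.
    by rewrite addrC subrK scale1r.
  rewrite (@eq_Rintegral _ _ _ vol O (fun q => divergence (fun q => psi p q *: Y q) q + divergence (fun q => phi q *: Y q) q)); last first.
    by move=> q /set_mem; exact: E.
  rewrite RintegralD //; [|exact: admissible_rintegrable|exact: admissible_rintegrable].
  by rewrite -[leRHS]addr0 lerD.
move=> aZ; apply: (main (finmap.enum_fset D)) => // [p pD|q Oq _].
  by apply/set_mem; exact: DO.
have [p pD Np] := Dcov q (subset_closure Oq).
by exists p => //; exact: (interior_subset Np).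
Qed.

End Divergence.

(** * Boundary limits and the second fundamental form *)

Lemma within_cvgP (R : realType) (T : topologicalType) (A : set T) (f : T -> R) (p : T) (l : R) :
  f q @[q --> within A (nbhs p)] --> l <->
  forall e : R, 0 < e -> \forall q \near p, A q -> `|l - f q| <= e.
Proof.
split=> [/cvgrPdist_le h e e0|h]; first exact: h.
by apply/cvgrPdist_le => e e0; exact: h.
Qed.

Section Tangential.
Context {R : realType} {d : nat}.
Variables (k : 'I_d) (U : set 'rV[R]_d).
Hypothesis oU : open U.
Let Q := U `&` [set z : 'rV[R]_d | z 0 k < 0].

(** If f tends to 0 at the face, so do its tangential derivatives as soon as they converge: along a
    short segment parallel to the face, pushed slightly inside, the mean value theorem compares the
    derivative with two small end values. *)
Lemma tangential_derivative (f : 'rV[R]_d -> R) (y : 'rV[R]_d) (i : 'I_d) (A : R) :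
  i != k -> Ck 1 Q f -> U y -> y 0 k = 0 ->
  pd i f z @[z --> within Q (nbhs y)] --> A ->
  (forall z, U z -> z 0 k = 0 -> f z @[z --> within Q (nbhs z)] --> (0 : R)) -> A = 0.
Proof.
move=> ik fC Uy yk0 hA h0; apply/eqP; rewrite -normr_le0; apply/ler_addgt0Pr => e e0.
rewrite add0r; pose e2 := e / 2; have e20 : 0 < e2 by rewrite divr_gt0.
have hA' := (within_cvgP _ _ _ _).1 hA e2 e20.
have : nbhs y (U `&` [set z | Q z -> `|A - pd i f z| <= e2]).
  by apply: filterI; [exact: open_nbhs_nbhs|exact: hA'].
move=> /nbhs_ballP[D /= D0 hD].
pose t := D / 2; have t0 : 0 < t by rewrite divr_gt0.
have tD : t < D by rewrite ltr_pdivrMr // ltr_pMr // ltr1n.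
(* End values of size t e2 / 2 make the difference quotient over the length t at most e2. *)
have te0 : 0 < t * e2 / 2 by rewrite divr_gt0 // mulr_gt0.
pose y1 := y + t *: delta_mx 0 i.
have nd (s r : R) : `|s *: delta_mx 0 i - r *: delta_mx 0 k : 'rV[R]_d| <= Num.max `|s| `|r|.
  apply: normr_row_le => [|j]; first by rewrite le_max normr_ge0.
  rewrite !mxE /= le_max; have [->|ji] := eqVneq j i.
    by rewrite (negbTE ik) mulr1 mulr0 subr0 lexx.
  rewrite mulr0 sub0r normrN; have [_|_] := eqVneq j k; first by rewrite mulr1 lexx orbT.
  by rewrite mulr0 normr0 normr_ge0.
have ballU z : `|z - y| < D -> ball y D z by rewrite -ball_normE /= distrC.
have Uy1 : U y1.
  apply: (hD y1 _).1; apply: ballU; rewrite /y1 addrC addKr.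
  by apply: le_lt_trans tD; have := nd t 0; rewrite scale0r subr0 normr0 (gtr0_norm t0) (max_l (ltW t0)).
have y1k : y1 0 k = 0 by rewrite !mxE yk0 eq_sym (negbTE ik) mulr0 addr0.
have small z : U z -> z 0 k = 0 -> exists2 r : R, 0 < r &
    forall s, 0 < s -> s < r -> Q (z - s *: delta_mx 0 k) -> `|f (z - s *: delta_mx 0 k)| <= t * e2 / 2.
  move=> Uz zk; have := (within_cvgP _ _ _ _).1 (h0 z Uz zk) _ te0.
  move=> /nbhs_ballP[r /= r0 hr]; exists r => // s s0 sr Qz.
  have := hr (z - s *: delta_mx 0 k); rewrite sub0r normrN; apply => //.
  rewrite -ball_normE /= opprD opprK addNKr; apply: le_lt_trans sr.
  by have := nd 0 (- s); rewrite scale0r sub0r scaleNr opprK normr0 normrN (gtr0_norm s0) (max_r (ltW s0)).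
have [r1 r10 hr1] := small y Uy yk0; have [r2 r20 hr2] := small y1 Uy1 y1k.
(* The depth of the segment is chosen after its length t, small enough for both end values. *)
pose s := Num.min t (Num.min r1 r2) / 2.
have m0 : 0 < Num.min t (Num.min r1 r2) by rewrite !lt_min t0 r10 r20.
have s0 : 0 < s by rewrite divr_gt0.
have sm : s < Num.min t (Num.min r1 r2) by rewrite ltr_pdivrMr // ltr_pMr // ltr1n.
move: (sm); rewrite !lt_min => /andP[st /andP[sr1 sr2]].
pose a := y - s *: delta_mx 0 k.
have Qa (x : R) : 0 <= x <= 1 -> ball y D (a + (x * t) *: delta_mx 0 i) /\ Q (a + (x * t) *: delta_mx 0 i).
  move=> /andP[x0 x1]; have b : ball y D (a + (x * t) *: delta_mx 0 i).
    apply: ballU; rewrite /a (_ : _ - y = (x * t) *: delta_mx 0 i - s *: delta_mx 0 k); last first.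
      by rewrite addrC addrA addKr addrC.
    apply: le_lt_trans (nd _ _) _; rewrite gt_max (ger0_norm (mulr_ge0 x0 (ltW t0))) (gtr0_norm s0).
    by rewrite (lt_trans st tD) andbT; apply: le_lt_trans tD; rewrite -[leRHS]mul1r ler_wpM2r // ltW.
  split => //; split; first by exact: (hD _ b).1.
  by rewrite /= /a !mxE yk0 !eqxx /= mulr1 [k == i]eq_sym (negbTE ik) mulr0 addr0 add0r oppr_lt0.
have [x x01] : exists2 x : R, 0 <= x <= 1 &
    f (a + t *: delta_mx 0 i) - f a = t * 'D_(delta_mx 0 i) f (a + (x * t) *: delta_mx 0 i).
  apply: mvt_line => x x01; apply: (@Ck_derivable _ _ 0%N Q) => //; exact: (Qa x x01).2.
rewrite -[X in t * X]/(partial i f _) partialE => E.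
have [bx Qx] := Qa x x01; have hx := (hD _ bx).2 Qx.
have Q0 : Q a by have := (Qa 0 _).2; rewrite mul0r scale0r addr0; apply; rewrite lexx ler01.
have Q1 : Q (a + t *: delta_mx 0 i) by have := (Qa 1 _).2; rewrite mul1r; apply; rewrite lexx ler01.
have f0 := hr1 s s0 sr1 Q0.
have Ea : a + t *: delta_mx 0 i = y1 - s *: delta_mx 0 k by rewrite /a /y1 addrAC.
have f1 : `|f (a + t *: delta_mx 0 i)| <= t * e2 / 2 by rewrite Ea; apply: hr2 => //; rewrite -Ea.
have : `|pd i f (a + (x * t) *: delta_mx 0 i)| <= e2.
  rewrite -(ler_pM2l t0) -{1}(gtr0_norm t0) -normrM -E [t * e2]splitr.
  by apply: le_trans (ler_normB _ _) _; rewrite lerD.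
move=> h; have -> : A = (A - pd i f (a + (x * t) *: delta_mx 0 i)) + pd i f (a + (x * t) *: delta_mx 0 i).
  by rewrite subrK.
by apply: le_trans (ler_normD _ _) _; rewrite [e]splitr lerD.
Qed.

End Tangential.

Section Limits.
Context {R : realType} {d : nat} {M : riemannian R d}.
Variables (O : set M).
Implicit Types (c : chart R d M) (p q : M) (f g : M -> R).

(** A limit from inside O. It trivially exists at points off the closure, so the condition can be
    required at all points; it replaces an explicit extension to the closure. *)
Definition CV f p : Prop := exists l : R, f q @[q --> within O (nbhs p)] --> l.

Lemma cvg_within_bounded f p (l : R) : f q @[q --> within O (nbhs p)] --> l ->
  \forall q \near p, O q -> `|f q| <= `|l| + 1.
Proof.
move=> /within_cvgP /(_ 1 ltr01); apply: filterS => q hq Oq.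
have -> : f q = l - (l - f q) by ring.
by apply: le_trans (ler_normB _ _) _; rewrite lerD2l; exact: hq.
Qed.

Lemma CV_continuous f p : {for p, continuous f} -> f q @[q --> within O (nbhs p)] --> f p.
Proof. by move=> cf; apply: cvg_within_filter. Qed.

Lemma CV_chart c (g : 'rV[R]_d -> R) p : cdom c p -> {for cfun c p, continuous g} ->
  g (cfun c q) @[q --> within O (nbhs p)] --> g (cfun c p).
Proof.
move=> cp cg; apply: cvg_within_filter.
by apply: (@continuous_comp _ _ _ (cfun c) g p); [exact: (cfun_continuous_at cp)|exact: cg].
Qed.

Lemma cvg_O f g p (l : R) : (\forall q \near p, O q -> f q = g q) ->
  f q @[q --> within O (nbhs p)] --> l -> g q @[q --> within O (nbhs p)] --> l.
Proof.
move=> h /within_cvgP hf; apply/within_cvgP => e e0.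
by apply: filterS2 h (hf e e0) => q h1 h2 Oq; rewrite -h1 //; exact: h2.
Qed.

Lemma CV_outside f p : ~ closure O p -> f q @[q --> within O (nbhs p)] --> (0 : R).
Proof.
move=> nc; apply: (@cvg_O (cst 0)); last exact: cvg_cst.
have : nbhs p (~` closure O).
  by apply: open_nbhs_nbhs; split => //; rewrite openC; exact: closed_closure.
by apply: filterS => q nq Oq; exfalso; apply: nq; exact: subset_closure.
Qed.

Lemma within_proper p : closure O p -> ProperFilter (within O (nbhs p)).
Proof.
move=> clp; apply: Build_ProperFilter_ex => A; rewrite /within /= => hA.
by have [q [Oq Aq]] := clp _ hA; exists q; exact: Aq.
Qed.

(** The limit is stated both on the manifold and in the chart, since [differential_closure] takes
    its limits in the chart. *)
Lemma Ck_ext_cvg c k (f : 'rV[R]_d -> R) p : cdom c p -> closure O p ->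
  Ck_ext k (chart_image c O) (chart_image c (closure O)) f ->
  exists l : R, f (cfun c q) @[q --> within O (nbhs p)] --> l /\
    f z @[z --> within (chart_image c O) (nbhs (cfun c p))] --> l.
Proof.
move=> cp clp hf; have [h hc fh] : exists2 h : 'rV[R]_d -> R,
  {within (chart_image c (closure O)), continuous h} & forall y, chart_image c O y -> f y = h y.
  by case: k hf => [|k] [].
have /subspace_continuousP hc' := hc.
have /within_cvgP hl := hc' (cfun c p) (chart_image_cfun cp clp).
have hl' : f z @[z --> within (chart_image c O) (nbhs (cfun c p))] --> h (cfun c p).
  apply/within_cvgP => e e0; apply: filterS (hl e e0) => z hz zO; rewrite fh //; apply: hz.
  by apply: chart_imageS zO; exact: subset_closure.
exists (h (cfun c p)); split => //.
apply/within_cvgP => e e0; have h1 := near_cfun cp ((within_cvgP _ _ _ _).1 hl' e e0).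
have h2 : \forall q \near p, cdom c q by apply: open_nbhs_nbhs; split; [exact: cdom_open|].
by apply: filterS2 h1 h2 => q h1 cq Oq; apply: h1; exact: chart_image_cfun.
Qed.

End Limits.

Lemma pd_quotient (R : realType) (d : nat) (f : 'rV[R]_d -> R) (y : 'rV[R]_d) (i : 'I_d) :
  derivable f y (delta_mx 0 i) ->
  h^-1 * (f (h *: delta_mx 0 i + y) - f y) @[h --> 0^'] --> pd i f y.
Proof. by move=> df; rewrite -partialE; exact: df. Qed.

(** * The outward normal and the second fundamental form in slice charts *)

Section Normal.
Context {R : realType} {d : nat} {M : riemannian R d}.
Variables (O : set M) (nu : M -> 'rV[R]_d).
Implicit Types (c : chart R d M) (p q : M) (k : 'I_d).

(** The transverse coordinate of one chart, as a function on the other, has the sign of the other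
    transverse coordinate. So its tangential derivatives vanish at the boundary and its transverse
    derivative, the factor alpha, is non-negative. *)
Lemma one_sided_tcomp k c k' c' p : one_sided O k c -> one_sided O k' c' ->
  cdom c p -> cdom c' p -> cfun c p 0 k = 0 ->
  exists2 alpha : R, 0 <= alpha & forall v, tcomp c' p v 0 k' = alpha * tcomp c p v 0 k.
Proof.
move=> [[ac bc] Oc] [[ac' bc'] Oc'] cp c'p pk.
pose f (z : 'rV[R]_d) := transition c c' z 0 k'; pose y := cfun c p.
pose W := chart_image c (cdom c').
have oW : open W by exact: overlap_open.
have Wy : W y by exact: chart_image_cfun.
have fneg z : W z -> (f z < 0) = (z 0 k < 0).
  move=> /chart_imageP [cz c'z Ez]; rewrite /f /transition /=.
  apply/idP/idP => [/Oc' h|h]; first by rewrite -Ez; apply/Oc => //; exact: h.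
  by apply/(Oc' _ c'z)/(Oc _ cz); rewrite Ez.
have f0 z : W z -> (f z == 0) = (z 0 k == 0).
  move=> /chart_imageP [cz c'z Ez]; rewrite /f /transition /=.
  apply/eqP/eqP => h; first by rewrite -Ez; apply/(bc _ cz)/(bc' _ c'z).
  by apply/(bc' _ c'z)/(bc _ cz); rewrite Ez.
have fy : f y = 0 by apply/eqP; rewrite f0 //; apply/eqP.
have df i : derivable f y (delta_mx 0 i).
  by apply: (@Ck_derivable _ _ 0%N W) => //; exact: transition_Ck.
have nW i : \forall h \near (0 : R)^', W (h *: delta_mx 0 i + y).
  have /nbhs_ballP[r /= r0 hr] : nbhs y W by exact: open_nbhs_nbhs.
  apply: filterS (dnbhs0_lt r0) => h hlt; apply: hr; rewrite -ball_normE /=.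
  rewrite distrC addrK; apply: le_lt_trans hlt; apply: normr_row_le => // j; rewrite !mxE normrM -[leRHS]mulr1.
  by rewrite ler_wpM2l // eqxx /=; case: (_ == _); rewrite ?normr1 ?normr0.
have yk0 (h : R) i : (h *: delta_mx 0 i + y) 0 k = h * (i == k)%:R.
  by rewrite !mxE pk addr0 eqxx eq_sym.
have pd0 i : i != k -> pd i f y = 0.
  move=> ik.
  have q0 : \forall h \near (0 : R)^', h^-1 * (f (h *: delta_mx 0 i + y) - f y) = 0.
    apply: filterS (nW i) => h hW; have /eqP -> : f (h *: delta_mx 0 i + y) == 0.
      by rewrite f0 // yk0 (negbTE ik) mulr0.
    by rewrite fy subr0 mulr0.
  have h1 : \forall h \near (0 : R)^', 0 <= h^-1 * (f (h *: delta_mx 0 i + y) - f y).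
    by apply: filterS q0 => h ->.
  have h2 : \forall h \near (0 : R)^', h^-1 * (f (h *: delta_mx 0 i + y) - f y) <= 0.
    by apply: filterS q0 => h ->.
  apply/eqP; rewrite eq_le; apply/andP; split.
    exact: (cvgr_to_le (pd_quotient (df i)) h2).
  exact: (cvgr_to_ge (pd_quotient (df i)) h1).
have pdk : 0 <= pd k f y.
  have h1 : \forall h \near (0 : R)^', 0 <= h^-1 * (f (h *: delta_mx 0 k + y) - f y).
    apply: filterS (nW k) => h hW; rewrite fy subr0.
    have [h0|h0] := ltP h 0.
      by rewrite mulr_le0 ?invr_le0 ?(ltW h0) // ltW // fneg // yk0 eqxx mulr1.
    by rewrite mulr_ge0 ?invr_ge0 // leNgt fneg // yk0 eqxx mulr1 -leNgt.
  exact: (cvgr_to_ge (pd_quotient (df k)) h1).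
exists (pd k f y) => // v; rewrite (tcomp_tjac v ac ac' cp c'p) row_mulmxE.
rewrite (bigD1 k) //= big1 ?addr0 => [|i ik]; rewrite tjac_pd // -/y -/f.
  by rewrite mulrC.
by rewrite [pd _ _ _]pd0 // mulr0.
Qed.

Hypothesis nuP : outward_unit_normal O nu.

(** Subtracting from v the multiple of nu that removes its k-th component leaves a tangent vector,
    orthogonal to nu. The factor is the inverse of the k-th component of nu, positive because nu
    points outward in some one-sided chart and hence in all. *)
Lemma normal_coord p k c : bdry O p -> one_sided O k c -> cdom c p ->
  exists2 lam : R, 0 < lam & forall v, inner p v (nu p) = lam * tcomp c p v 0 k.
Proof.
move=> bp sc cp; have [h1 h2 [k' [c' [sc' c'p Oc' m']]]] := nuP bp.
have pk : cfun c p 0 k = 0 by have [[_ h] _] := sc; apply/h.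
have [al al0 hal] := one_sided_tcomp sc (conj sc' Oc') cp c'p pk.
pose m := tcomp c p (nu p) 0 k.
have m0 : 0 < m.
  rewrite ltNge; apply/negP => m0; move: m'; rewrite hal ltNge.
  by rewrite mulr_ge0_le0.
exists m^-1; first by rewrite invr_gt0.
move=> v; pose w := v + (- (tcomp c p v 0 k / m)) *: nu p.
have : inner p (nu p) w = 0.
  apply: h2; exists k, c; split => //; first by have [] := sc.
  rewrite /w tcompD tcompZ mxE [X in _ + X]mxE -/m mulNr divfK ?subrr //.
  by rewrite gt_eqF.
rewrite /w innerDr innerZr h1 mulr1 => /eqP; rewrite addr_eq0 opprK => /eqP E.
by rewrite inner_sym E mulrC.
Qed.

Lemma tcomp_covD (U : set M) c p v X : open U -> U p -> atlas c -> cdom c p -> Ck_field 1 U X ->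
  tcomp c p (v *m covD X p) = tcomp c p v *m cov_in c X (cfun c p).
Proof.
move=> oU Up ac cp hX; rewrite covD_cov_in !tcomp_tjac_at -!mulmxA; congr (_ *m _).
pose c0 := chart_at p; have ac0 : atlas c0 := chart_at_atlas p.
have c0p : cdom c0 p := chart_at_dom p.
have yO : chart_image c0 (cdom c) (cfun c0 p) by exact: chart_image_cfun.
rewrite (@cov_in_transition _ _ _ c0 c _ ac0 ac yO X).
- by rewrite transition_cfun.
- by move=> k; exact: (@fld_differentiable _ _ _ U c0 p oU Up ac0 c0p X k hX).
- by move=> k; rewrite transition_cfun //; exact: (@fld_differentiable _ _ _ U c p oU Up ac cp X k hX).
Qed.

(* class_Oplus tests the second fundamental form on globally smooth fields only,
   hence the cut-off of a field that is constant in a chart. *)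
Section ConstantField.
Variables (c : chart R d M) (a x0 : 'rV[R]_d) (r : R).
Hypotheses (ac : atlas c) (r0 : 0 < r) (KU : cball a (2 * r) `<=` chart_image c setT).

Definition cfield (q : M) : 'rV[R]_d :=
  mcut c a r q *: (x0 *m tjac c (chart_at q) (cfun c q)).

Lemma tcomp_cfield c' q : atlas c' -> cdom c q -> cdom c' q ->
  tcomp c' q (cfield q) = mcut c a r q *: (x0 *m tjac c c' (cfun c q)).
Proof.
move=> ac' cq c'q; rewrite /cfield tcompZ; congr (_ *: _).
have aq := chart_at_atlas q; have dq := chart_at_dom q.
have E : tcomp c q (x0 *m tjac c (chart_at q) (cfun c q)) = x0.
  by rewrite tcomp_tjac_at -mulmxA tjacK // mulmx1.
by rewrite (tcomp_tjac _ ac ac' cq c'q) E.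
Qed.

Lemma cfield_smooth : smooth_field cfield.
Proof.
move=> n; apply: fld_Ck_field => c' ac' i.
pose K := cinv c @` cball a (2 * r).
apply: Ck_local => z /chart_imageP [c'z _ Ez].
have [cz|ncz] := pselect (cdom c (cinv c' z)).
  pose W := chart_image c' (cdom c); have oW : open W by exact: overlap_open.
  exists W; first by rewrite -Ez; exact: chart_image_cfun.
  apply: (@Ck_eq _ _ n W (fun y => (mcut c a r \o cinv c') y *
    \sum_j x0 0 j * ((fun y => tjac c c' y j i) \o transition c' c) y) _ oW).
    move=> y /chart_imageP [c'y cy Ey]; rewrite -fldE /field_in tcomp_cfield // mxE /=.
    by rewrite row_mulmxE.
  apply: (Ck_mul oW); first by apply: CkSub (mcut_Ck ac r0 KU n ac'); exact: chart_imageS.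
  apply: (Ck_sum oW) => j _; apply: (Ck_mul oW); first exact: Ck_cst.
  apply: (@Ck_comp _ _ _ n W (chart_image c (cdom c'))) => //.
  - exact: overlap_open.
  - by move=> y /transition_image [].
  - by move=> l; exact: transition_Ck.
  - exact: tjac_Ck.
have oK : open (chart_image c' (~` K)).
  by apply: open_chart_image; rewrite openC; exact: supp_closed.
exists (chart_image c' (~` K)).
  rewrite -Ez; apply: chart_image_cfun => // -[w Kw Ew]; apply: ncz; rewrite -Ew.
  by have [] := chart_imageP (KU Kw).
apply: (@Ck_eq _ _ n _ (fun=> 0) _ oK); last exact: Ck_cst.
move=> y /chart_imageP [_ nK _]; rewrite -fldE /field_in /cfield mcut0 //.
by rewrite scale0r /tcomp mul0mx mxE.
Qed.

End ConstantField.

(** For a field Y equal to the constant x0 near p in the chart, D_Y Y consists of Christoffel terms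
    only, and its product with nu is a positive multiple of its k-th component. *)
Lemma second_ff_chris p k c (x0 : 'rV[R]_d) : class_Oplus O nu ->
  bdry O p -> one_sided O k c -> cdom c p -> x0 0 k = 0 ->
  \sum_i \sum_j x0 0 i * (chris c k i j (cfun c p) * x0 0 j) <= 0.
Proof.
move=> [[_ _ emb _] II] bp sc cp xk; have [[ac bc] Oc] := sc.
have oU : open (chart_image c setT) by exact: open_chart_imageT.
have [r2 r20 hr] := cball_nbhs oU (chart_image_cfun cp I); pose r := r2 / 2.
have r0 : 0 < r by rewrite divr_gt0.
have KU : cball (cfun c p) (2 * r) `<=` chart_image c setT by rewrite mulrC divfK.
pose Y := cfield c (cfun c p) x0 r.
have sY : smooth_field Y by exact: cfield_smooth.
have fY q : cdom c q -> fld c Y (cfun c q) = mcut c (cfun c p) r q *: x0.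
  by move=> cq; rewrite fld_cfun // tcomp_cfield // tjac_id // mulmx1.
have tY q : bdry O q -> bdry_tangent O q (Y q).
  move=> bq; have [cq|ncq] := pselect (cdom c q).
    exists k, c; split; [exact: (conj ac bc)|exact: cq|].
    by rewrite -fld_cfun // fY // mxE xk mulr0.
  have [k' [c' [sc' c'q]]] := emb q bq; exists k', c'; split => //.
  by rewrite /Y /cfield /mcut ifF ?scale0r ?/tcomp ?mul0mx ?mxE //; apply/negP => /set_mem.
have := II Y sY tY p bp; rewrite /second_ff oppr_ge0.
have [lam lam0 ->] := normal_coord bp sc cp.
rewrite pmulr_rle0 // (@tcomp_covD setT c p (Y p) Y openT I ac cp (sY 1%N)).
rewrite -fld_cfun // row_mulmxE.
have n1 := mcut_near1 r0 cp erefl.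
have fYp : fld c Y (cfun c p) = x0 by rewrite fY // (nbhs_singleton n1) scale1r.
have n2 : \forall z \near cfun c p, fld c Y z = x0.
  have h1 := near_chart cp n1.
  have h2 : \forall z \near cfun c p, chart_image c setT z.
    by apply: open_nbhs_nbhs; split => //; exact: chart_image_cfun.
  apply: filterS2 h1 h2 => z h1 /chart_imageP [cz _ Ez].
  by rewrite -Ez fY // h1 scale1r.
rewrite fYp; congr (_ <= 0); apply: eq_bigr => i _; rewrite -mulr_sumr; congr (_ * _).
rewrite mxE fYp (_ : pd i _ _ = 0) ?add0r //.
rewrite -(@pd_cst R d (x0 0 k) (cfun c p) i); apply: pd_near.
by apply: filterS n2 => z ->.
Qed.

End Normal.

Section CVTheory.
Context {R : realType} {d : nat} {M : riemannian R d}.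
Variables (O : set M) (p : M).
Implicit Types (f g : M -> R).
Local Notation CV := (CV O).

Lemma CV_cst (a : R) : CV (fun=> a) p.
Proof. by exists a; exact: cvg_cst. Qed.

Lemma CV_add f g : CV f p -> CV g p -> CV (fun q => f q + g q) p.
Proof. by move=> [a ha] [b hb]; exists (a + b); exact: cvgD. Qed.

Lemma CV_opp f : CV f p -> CV (fun q => - f q) p.
Proof. by move=> [a ha]; exists (- a); exact: cvgN. Qed.

Lemma CV_mul f g : CV f p -> CV g p -> CV (fun q => f q * g q) p.
Proof. by move=> [a ha] [b hb]; exists (a * b); exact: cvgM. Qed.

Lemma CV_sum I (r : seq I) (f : I -> M -> R) :
  (forall i, CV (f i) p) -> CV (fun q => \sum_(i <- r) f i q) p.
Proof.
move=> hf; elim: r => [|i r IH].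
  have -> : (fun q => \sum_(i <- [::]) f i q) = fun=> 0 by apply/funext => q; rewrite big_nil.
  exact: CV_cst.
have -> : (fun q => \sum_(j <- i :: r) f j q) = fun q => f i q + \sum_(j <- r) f j q.
  by apply/funext => q; rewrite big_cons.
exact: CV_add.
Qed.

Lemma CV_O f g : (\forall q \near p, O q -> f q = g q) -> CV f p -> CV g p.
Proof. by move=> h [l hl]; exists l; exact: (cvg_O h hl). Qed.

Lemma CV_comp f (h : R -> R) : continuous h -> CV f p -> CV (fun q => h (f q)) p.
Proof. by move=> ch [l hl]; exists (h l); apply: continuous_cvg => //; exact: ch. Qed.

Lemma CV_smooth c (g : 'rV[R]_d -> R) : cdom c p -> {for cfun c p, continuous g} ->
  CV (fun q => g (cfun c q)) p.
Proof. by move=> cp cg; exists (g (cfun c p)); exact: CV_chart. Qed.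

Lemma CV_bounded f : CV f p -> exists C : R, \forall q \near p, O q -> `|f q| <= C.
Proof. by move=> [l hl]; exists (`|l| + 1); exact: (cvg_within_bounded hl). Qed.

End CVTheory.

(** * Limits of the gradient and of its derivatives at the boundary *)

Section GradientLimits.
Context {R : realType} {d : nat} {M : riemannian R d}.
Variables (O : set M) (u : M -> R).
Hypotheses (oO : open O) (hu : Ck_fun 3 O u) (huc : Ck_fun_closure 2 O u).
Implicit Types (c : chart R d M) (p q : M).
Let X := grad u.
Local Notation CV := (CV O).

Section Chart.
Variables (c : chart R d M) (p : M).
Hypotheses (ac : atlas c) (cp : cdom c p).

Let U := chart_image c O.
Let oU : open U. Proof. exact: open_chart_image. Qed.
Let UT : U `<=` chart_image c setT. Proof. exact: chart_imageS. Qed.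
Let u3 : Ck 3 U (u \o cinv c). Proof. exact: hu. Qed.

Lemma near_cdom : \forall q \near p, cdom c q.
Proof. by apply: open_nbhs_nbhs; split; [exact: cdom_open|exact: cp]. Qed.

Lemma CV_inchart (f : M -> R) (g : 'rV[R]_d -> R) : (forall y, U y -> f (cinv c y) = g y) ->
  CV (fun q => g (cfun c q)) p -> CV f p.
Proof.
move=> h; apply: CV_O; apply: filterS near_cdom => q cq Oq.
have := h _ (chart_image_cfun cq Oq); rewrite cfunK // => ->.
Qed.

Lemma CV_eqchart (f g : 'rV[R]_d -> R) : (forall y, U y -> f y = g y) ->
  CV (fun q => g (cfun c q)) p -> CV (fun q => f (cfun c q)) p.
Proof.
move=> h; apply: CV_O; apply: filterS near_cdom => q cq Oq.
by rewrite h //; exact: chart_image_cfun.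
Qed.

Lemma CV_Ck (g : 'rV[R]_d -> R) k : Ck k (chart_image c setT) g -> CV (fun q => g (cfun c q)) p.
Proof.
move=> hg; apply: CV_smooth => //.
exact: (@Ck_continuous _ _ k _ _ hg _ (chart_image_cfun cp I)).
Qed.

Lemma CV_pd i : CV (fun q => pd i (u \o cinv c) (cfun c q)) p.
Proof.
have [clp|nc] := pselect (closure O p); last by exists 0; exact: CV_outside.
have [_ he] := huc.2 c ac; have := he i; rewrite partial_pd => h.
by have [l [hl _]] := @Ck_ext_cvg _ _ _ O c 1%N _ p cp clp h; exists l.
Qed.

Lemma CV_pd2 i j : CV (fun q => pd j (pd i (u \o cinv c)) (cfun c q)) p.
Proof.
have [clp|nc] := pselect (closure O p); last by exists 0; exact: CV_outside.
have [_ he] := huc.2 c ac; have [_ h] := he i; have := h j; rewrite !partial_pd => {}h.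
by have [l [hl _]] := @Ck_ext_cvg _ _ _ O c 0%N _ p cp clp h; exists l.
Qed.

Let fldE' y k : U y -> fld c X y 0 k = \sum_i pd i (u \o cinv c) y * gi c y i k.
Proof.
move=> Uy; rewrite (fld_gradE ac oU UT u3 Uy) row_mulmxE.
by apply: eq_bigr => i _; rewrite mxE.
Qed.

Lemma CV_fld k : CV (fun q => fld c X (cfun c q) 0 k) p.
Proof.
apply: (@CV_eqchart (fun y => fld c X y 0 k) (fun y => \sum_i pd i (u \o cinv c) y * gi c y i k)).
  by move=> y; exact: fldE'.
apply: CV_sum => i; apply: CV_mul; first exact: CV_pd.
exact: (CV_Ck (gi_Ck 0 i k ac)).
Qed.

Let dgi y i k j : U y -> derivable (fun z => gi c z i k) y (delta_mx 0 j).
Proof. by move=> Uy; exact: (@Ck_derivable _ _ 0%N _ _ (gi_Ck 1 i k ac) j y (UT Uy)). Qed.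

Let dpd y i j : U y -> derivable (pd i (u \o cinv c)) y (delta_mx 0 j).
Proof. by move=> Uy; apply: (@Ck_derivable _ _ 1%N U) => //; exact: Ck_pd. Qed.

Lemma CV_pd_fld j k : CV (fun q => pd j (fun z => fld c X z 0 k) (cfun c q)) p.
Proof.
apply: (@CV_eqchart (pd j (fun z => fld c X z 0 k)) (fun y => \sum_i (pd i (u \o cinv c) y * pd j (fun z => gi c z i k) y +
  gi c y i k * pd j (pd i (u \o cinv c)) y))).
  move=> y Uy; rewrite (pd_near_eq j oU Uy (fun z Uz => @fldE' z k Uz)).
  have hd i : true -> derivable (fun z => pd i (u \o cinv c) z * gi c z i k) y (delta_mx 0 j).
    by move=> _; apply: derivableM; [exact: dpd|exact: dgi].
  have [_ ->] := @derivable_sumr _ _ j _ (index_enum _) xpredT _ y hd.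
  by apply: eq_bigr => i _; rewrite (pdM (@dpd y i j Uy) (@dgi y i k j Uy)).
apply: CV_sum => i; apply: CV_add; apply: CV_mul.
- exact: CV_pd.
- by apply: (@CV_Ck _ 0); apply: Ck_pd; exact: gi_Ck.
- exact: (CV_Ck (gi_Ck 0 i k ac)).
- exact: CV_pd2.
Qed.

Lemma CV_cov i k : CV (fun q => cov_in c X (cfun c q) i k) p.
Proof.
have -> : (fun q => cov_in c X (cfun c q) i k) = fun q =>
  pd i (fun z => fld c X z 0 k) (cfun c q) + \sum_j chris c k i j (cfun c q) * fld c X (cfun c q) 0 j.
  by apply/funext => q; rewrite mxE.
apply: CV_add; first exact: CV_pd_fld.
apply: CV_sum => j; apply: CV_mul; last exact: CV_fld.
exact: (CV_Ck (chris_Ck 0 k i j ac)).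
Qed.

Lemma CV_gm i j : CV (fun q => gm c (cfun c q) i j) p.
Proof. exact: (CV_Ck (gm_Ck 0 i j ac)). Qed.

Lemma fld_grad_C2 k : Ck 2 U (fun z => fld c X z 0 k).
Proof. exact: (fld_grad_Ck ac oU UT u3). Qed.

Lemma sqn_Ck : Ck 2 U (sqn c X).
Proof.
have -> : sqn c X = fun z => \sum_j (\sum_i fld c X z 0 i * gm c z i j) * fld c X z 0 j.
  apply/funext => z; rewrite /sqn mxE; apply: eq_bigr => j _.
  by rewrite row_mulmxE [X in _ * X]mxE.
apply: (Ck_sum oU) => j _; apply: (Ck_mul oU); last exact: fld_grad_C2.
apply: (Ck_sum oU) => i _; apply: (Ck_mul oU); first exact: fld_grad_C2.
exact: CkSub UT (gm_Ck 2 i j ac).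
Qed.

End Chart.

Definition wgrad p : R := inner p (X p) (X p).

Lemma wgrad_ge0 p : 0 <= wgrad p. Proof. exact: inner_ge0. Qed.

Lemma wgrad_sqn c y : atlas c -> chart_image c setT y -> wgrad (cinv c y) = sqn c X y.
Proof.
move=> ac /chart_imageP [cy _ Ey].
by rewrite /wgrad (inner_gm _ _ ac cy) /sqn Ey -fldE /field_in.
Qed.

Lemma wgrad_Ck : Ck_fun 2 O wgrad.
Proof.
move=> c ac; have oU : open (chart_image c O) by exact: open_chart_image.
apply: (@Ck_eq _ _ 2 _ (sqn c X) _ oU) => [y yO|]; last exact: (sqn_Ck ac).
by rewrite /= wgrad_sqn //; exact: chart_imageS yO.
Qed.

Lemma CV_wgrad p : CV wgrad p.
Proof.
have ac := chart_at_atlas p; have cp := chart_at_dom p; set c := chart_at p in ac cp.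
apply: (@CV_inchart c p cp wgrad (sqn c X)) => [y yO|]; first by apply: wgrad_sqn => //; exact: chart_imageS yO.
have -> : (fun q => sqn c X (cfun c q)) = fun q => \sum_j (\sum_i fld c X (cfun c q) 0 i * gm c (cfun c q) i j) * fld c X (cfun c q) 0 j.
  apply/funext => z; rewrite /sqn mxE; apply: eq_bigr => j _.
  by rewrite row_mulmxE [X in _ * X]mxE.
apply: CV_sum => j; apply: CV_mul; last exact: CV_fld.
by apply: CV_sum => i; apply: CV_mul; [exact: CV_fld|exact: CV_gm].
Qed.

Lemma pd_wgrad c y i : atlas c -> chart_image c O y ->
  pd i (wgrad \o cinv c) y = 2 * (cov_in c X y *m gm c y *m (fld c X y)^T) i 0.
Proof.
move=> ac yO; have oU : open (chart_image c O) by exact: open_chart_image.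
have UT : chart_image c O `<=` chart_image c setT by exact: chart_imageS.
rewrite -(@pd_sqn_grad _ _ _ c (chart_image c O) ac oU UT u y yO (hu ac)).
by apply: (pd_near_eq _ oU yO) => z zO; rewrite /= wgrad_sqn //; exact: UT.
Qed.

Lemma CV_pd_wgrad c p i : atlas c -> cdom c p -> CV (fun q => pd i (wgrad \o cinv c) (cfun c q)) p.
Proof.
move=> ac cp; apply: (@CV_eqchart c p cp (pd i (wgrad \o cinv c)) (fun y => 2 * \sum_j (\sum_l cov_in c X y i l * gm c y l j) * fld c X y 0 j)).
  move=> y yO; rewrite pd_wgrad // mxE; congr (_ * _); apply: eq_bigr => j _.
  by congr (_ * _); rewrite ?mxE.
apply: CV_mul; first exact: CV_cst.
apply: CV_sum => j; apply: CV_mul; last exact: CV_fld.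
by apply: CV_sum => l; apply: CV_mul; [exact: CV_cov|exact: CV_gm].
Qed.

(* D_X X - (div X) X, whose divergence is given by Bochner's formula *)
Definition bvec p : 'rV[R]_d := X p *m covD X p - divergence X p *: X p.

Lemma gradC2 : Ck_field 2 O X.
Proof. by apply: fld_Ck_field => c ac i; exact: fld_grad_C2. Qed.

Lemma gradC1 : Ck_field 1 O X.
Proof. by move=> c ac i; apply: CkW; exact: gradC2. Qed.

Lemma fld_bvec c y : atlas c -> chart_image c O y -> fld c bvec y = boch c X y.
Proof.
move=> ac /chart_imageP [cy Oy Ey]; rewrite -fldE /field_in /bvec tcompD tcompN tcompZ.
rewrite (tcomp_covD (X (cinv c y)) oO Oy ac cy gradC1) Ey.
rewrite (@divergence_in _ _ _ O c (cinv c y) oO Oy ac cy X gradC1) Ey.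
by rewrite -[tcomp _ _ _]/(field_in c X y) fldE.
Qed.

Lemma bvecC1 : Ck_field 1 O bvec.
Proof.
apply: fld_Ck_field => c ac i; have oU : open (chart_image c O) by exact: open_chart_image.
apply: (@Ck_eq _ _ 1 _ (fun y => boch c X y 0 i) _ oU).
  by move=> y yO; rewrite fld_bvec.
have UT : chart_image c O `<=` chart_image c setT by exact: chart_imageS.
by apply: (boch_Ck ac oU UT) => l; exact: fld_grad_C2.
Qed.

Lemma CV_bvec c p k : atlas c -> cdom c p -> CV (fun q => fld c bvec (cfun c q) 0 k) p.
Proof.
move=> ac cp; apply: (@CV_eqchart c p cp (fun y => fld c bvec y 0 k) (fun y => \sum_i fld c X y 0 i * cov_in c X y i k
  - (\sum_i cov_in c X y i i) * fld c X y 0 k)).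
  by move=> y yO; rewrite fld_bvec // /boch mxE row_mulmxE [X in _ + X]mxE [X in _ - X]mxE.
apply: CV_add; first by apply: CV_sum => i; apply: CV_mul; [exact: CV_fld|exact: CV_cov].
by apply: CV_opp; apply: CV_mul; [apply: CV_sum => i; exact: CV_cov|exact: CV_fld].
Qed.

Lemma tr_cov_bvec c y : atlas c -> chart_image c O y ->
  \tr (cov_in c bvec y) = \tr (cov_in c X y *m cov_in c X y) - (\tr (cov_in c X y)) ^+ 2 +
    ricci_in c (fld c X y) (fld c X y) y.
Proof.
move=> ac yO; have oU : open (chart_image c O) by exact: open_chart_image.
have UT : chart_image c O `<=` chart_image c setT by exact: chart_imageS.
rewrite -(bochner_in ac oU UT yO (fun l => fld_grad_C2 ac l)) tr_cov_in.
apply: eq_bigr => k _; rewrite fld_bvec //; congr (_ + _).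
by apply: (pd_near_eq _ oU yO) => z zO; rewrite fld_bvec.
Qed.

(** The derivatives of [bvec] involve third derivatives of u, about which nothing is known at the
    boundary; Bochner's formula rewrites the trace in terms of at most second ones. *)
Lemma CV_tr_cov_bvec c p : atlas c -> cdom c p -> CV (fun q => \tr (cov_in c bvec (cfun c q))) p.
Proof.
move=> ac cp; apply: (@CV_eqchart c p cp _ _ (fun y yO => tr_cov_bvec ac yO)).
apply: CV_add; first apply: CV_add.
- apply: (@CV_sum _ _ _ O p _ _ (fun i q => (cov_in c X (cfun c q) *m cov_in c X (cfun c q)) i i)) => i.
  have -> : (fun q => (cov_in c X (cfun c q) *m cov_in c X (cfun c q)) i i) =
    fun q => \sum_j cov_in c X (cfun c q) i j * cov_in c X (cfun c q) j i.
    by apply/funext => q; rewrite mxE.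
  by apply: CV_sum => j; apply: CV_mul; exact: CV_cov.
- by apply: CV_opp; apply: CV_mul; apply: CV_sum => i; exact: CV_cov.
apply: CV_sum => i; apply: CV_sum => j; apply: CV_mul; first by apply: CV_mul; exact: CV_fld.
have chC k l m n : Ck n (chart_image c setT) (chris c k l m) by exact: chris_Ck.
apply: CV_sum => l; apply: CV_add; first apply: CV_add.
- by apply: (@CV_Ck c p cp _ 0); apply: Ck_pd; exact: chC.
- by apply: CV_opp; apply: (@CV_Ck c p cp _ 0); apply: Ck_pd; exact: chC.
apply: CV_sum => m; apply: CV_add; last apply: CV_opp.
  by apply: CV_mul; apply: (@CV_Ck c p cp _ 0); exact: chC.
by apply: CV_mul; apply: (@CV_Ck c p cp _ 0); exact: chC.
Qed.

End GradientLimits.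

(** * The Neumann condition and the sign of the normal component *)

Section Boundary.
Context {R : realType} {d : nat} {M : riemannian R d}.
Variables (O : set M) (u : M -> R) (nu : M -> 'rV[R]_d).
Hypotheses (oO : open O) (hu : Ck_fun 3 O u) (huc : Ck_fun_closure 2 O u).
Hypotheses (nuP : outward_unit_normal O nu) (II : class_Oplus O nu).
Hypothesis neumann : forall p, bdry O p -> normal_derivative O nu u p = 0.
Implicit Types (c : chart R d M) (p q : M) (k : 'I_d).
Let X := grad u.

Lemma within_chart_proper c p : cdom c p -> closure O p ->
  ProperFilter (within (chart_image c O) (nbhs (cfun c p))).
Proof.
move=> cp clp; apply: Build_ProperFilter_ex => A hA.
have h1 : \forall q \near p, chart_image c O (cfun c q) -> A (cfun c q).
  exact: (near_cfun cp (Q := fun z => chart_image c O z -> A z)).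
have [q [Oq [h cq]]] := clp _ (filterI h1 (near_cdom cp)).
by exists (cfun c q); apply: h; exact: chart_image_cfun.
Qed.

(** The Neumann condition is expressed through [lim], which carries information only once
    convergence is known; here the boundary gradient is identified with the true limit. *)
Lemma grad_limit_at p k : closure O p ->
  fld (chart_at p) X (cfun (chart_at p) q) 0 k @[q --> within O (nbhs p)] -->
  grad_closure O u p 0 k.
Proof.
move=> clp; have ac := chart_at_atlas p; have cp := chart_at_dom p; set c := chart_at p in ac cp *.
have hl i : pd i (u \o cinv c) (cfun c q) @[q --> within O (nbhs p)] --> differential_closure O u p 0 i.
  have [_ he] := huc.2 c ac; have := he i; rewrite partial_pd => h.
  have [l [h1 h2]] := @Ck_ext_cvg _ _ _ O c 1%N _ p cp clp h.
  rewrite mxE -/c partial_pd; have FF := within_chart_proper cp clp.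
  by rewrite (cvg_lim _ h2).
apply: (@cvg_O _ _ _ O (fun q => \sum_i pd i (u \o cinv c) (cfun c q) * gi c (cfun c q) i k)).
  apply: filterS (near_cdom cp) => q cq Oq.
  have oU : open (chart_image c O) by exact: open_chart_image.
  have UT : chart_image c O `<=` chart_image c setT by exact: chart_imageS.
  rewrite (fld_gradE ac oU UT (hu ac) (chart_image_cfun cq Oq)) row_mulmxE.
  by apply: eq_bigr => i _; rewrite mxE.
rewrite /grad_closure row_mulmxE; apply: cvg_sumr => i _; apply: cvgM; first exact: hl.
have -> : invmx (metric p) i k = gi c (cfun c p) i k by rewrite -invmx_gm gm_chart_at.
apply: (@CV_chart _ _ _ O c (fun y => gi c y i k) p cp).
exact: (@Ck_continuous _ _ 0%N _ _ (gi_Ck 0 i k ac) _ (chart_image_cfun cp I)).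
Qed.

Lemma grad_limit c p k : closure O p -> atlas c -> cdom c p ->
  fld c X (cfun c q) 0 k @[q --> within O (nbhs p)] --> tcomp c p (grad_closure O u p) 0 k.
Proof.
move=> clp ac cp; have ac0 := chart_at_atlas p; have c0p := chart_at_dom p.
set c0 := chart_at p in ac0 c0p.
apply: (@cvg_O _ _ _ O (fun q => \sum_j fld c0 X (cfun c0 q) 0 j * tjac c0 c (cfun c0 q) j k)).
  apply: filterS2 (near_cdom cp) (near_cdom c0p) => q cq c0q Oq.
  have yO : chart_image c0 (cdom c) (cfun c0 q) by exact: chart_image_cfun.
  have := fld_transition X ac0 ac yO; rewrite transition_cfun // => ->.
  by rewrite row_mulmxE.
rewrite tcomp_tjac_at row_mulmxE; apply: cvg_sumr => j _; apply: cvgM.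
  exact: grad_limit_at.
have yO : chart_image c0 (cdom c) (cfun c0 p) by exact: chart_image_cfun.
apply: (@CV_chart _ _ _ O c0 (fun y => tjac c0 c y j k) p c0p).
exact: (@Ck_continuous _ _ 0%N _ _ (tjac_Ck 0 j k ac0 ac) _ yO).
Qed.

Lemma bdry_closure p : bdry O p -> closure O p.
Proof. by move=> []. Qed.

Lemma grad_tangent k c p : bdry O p -> one_sided O k c -> cdom c p ->
  tcomp c p (grad_closure O u p) 0 k = 0.
Proof.
move=> bp sc cp; have [lam lam0 h] := normal_coord nuP bp sc cp.
have := neumann bp; rewrite /normal_derivative h => /eqP.
by rewrite mulf_eq0 (gt_eqF lam0) /= => /eqP.
Qed.

Lemma grad_normal_limit k c p : bdry O p -> one_sided O k c -> cdom c p ->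
  fld c X (cfun c q) 0 k @[q --> within O (nbhs p)] --> (0 : R).
Proof.
move=> bp sc cp; have [[ac _] _] := sc.
by rewrite -(grad_tangent bp sc cp); apply: grad_limit => //; exact: bdry_closure.
Qed.

Lemma within_chart_cvg c p (f : 'rV[R]_d -> R) (l : R) : cdom c p ->
  f (cfun c q) @[q --> within O (nbhs p)] --> l ->
  f z @[z --> within (chart_image c O) (nbhs (cfun c p))] --> l.
Proof.
move=> cp /within_cvgP h; apply/within_cvgP => e e0.
have := near_chart cp (h e e0); apply: filterS => z hz /chart_imageP [cz Oz Ez].
by rewrite -Ez; exact: hz.
Qed.

(** The coordinate form of g(D_X X, nu) = - II (X, X). As the k-th component of X tends to 0, the
    term (div X) X and the summand i = k disappear, and of the covariant derivative in the
    tangential directions only Christoffel terms remain. *)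
Lemma bvec_normal_limit k c p : bdry O p -> one_sided O k c -> cdom c p ->
  exists2 l : R, l <= 0 & fld c (bvec u) (cfun c q) 0 k @[q --> within O (nbhs p)] --> l.
Proof.
move=> bp sc cp; have [[ac bc] Oc] := sc; pose x0 := tcomp c p (grad_closure O u p).
have xk : x0 0 k = 0 by exact: grad_tangent.
have xl i := @grad_limit c p i (bdry_closure bp) ac cp.
have pk : cfun c p 0 k = 0 by apply/bc.
have oU : open (chart_image c setT) by exact: open_chart_imageT.
have QE : chart_image c O = chart_image c setT `&` [set z : 'rV[R]_d | z 0 k < 0].
  rewrite eqEsubset; split => z.
    move=> zO; split; first exact: chart_imageS zO.
    by move/chart_imageP: zO => [cz Oz <-]; apply/Oc.
  move=> [/chart_imageP [cz _ Ez] zk]; rewrite -Ez; apply: chart_image_cfun => //.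
  by apply/Oc => //; rewrite Ez.
(* The k-th component of X vanishes along the boundary, hence so do the limits of its tangential
   derivatives. *)
have D0 i : i != k -> pd i (fun z => fld c X z 0 k) (cfun c q) @[q --> within O (nbhs p)] --> (0 : R).
  move=> ik; have [A hA] := CV_pd_fld oO hu huc ac cp i k.
  suff -> : 0 = A by [].
  apply/esym; apply: (@tangential_derivative R d k (chart_image c setT) oU (fun z => fld c X z 0 k) (cfun c p) i A ik).
  - by rewrite -QE; apply: CkW; exact: (fld_grad_C2 oO hu ac).
  - exact: chart_image_cfun.
  - exact: pk.
  - by rewrite -QE; exact: within_chart_cvg.
  move=> z /chart_imageP [cz _ Ez] zk; rewrite -QE -Ez.
  apply: (@within_chart_cvg c (cinv c z) (fun z => fld c X z 0 k)) => //.
  by apply: grad_normal_limit => //; apply/bc => //; rewrite Ez.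
have covl i : i != k -> cov_in c X (cfun c q) i k @[q --> within O (nbhs p)] -->
    0 + \sum_j chris c k i j (cfun c p) * x0 0 j.
  move=> ik; have -> : (fun q => cov_in c X (cfun c q) i k) = fun q =>
    pd i (fun z => fld c X z 0 k) (cfun c q) + \sum_j chris c k i j (cfun c q) * fld c X (cfun c q) 0 j.
    by apply/funext => q; rewrite mxE.
  apply: cvgD; first exact: D0.
  apply: cvg_sumr => j _; apply: cvgM; last exact: xl.
  apply: (@CV_chart _ _ _ O c (chris c k i j) p cp).
  exact: (@Ck_continuous _ _ 0%N _ _ (chris_Ck 0 k i j ac) _ (chart_image_cfun cp I)).
have [Ck hCk] := CV_cov oO hu huc ac cp k k.
have [t ht] : CV O (fun q => \sum_i cov_in c X (cfun c q) i i) p.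
  by apply: CV_sum => i; exact: (CV_cov oO hu huc ac cp).
exists (\sum_(i | i != k) x0 0 i * (0 + \sum_j chris c k i j (cfun c p) * x0 0 j)).
  have := second_ff_chris nuP II bp sc cp xk; congr (_ <= 0).
  rewrite (bigD1 k) //= big1 ?add0r => [|j _]; last by rewrite xk mul0r.
  by apply: eq_bigr => i _; rewrite add0r mulr_sumr.
apply: (@cvg_O _ _ _ O (fun q => (fld c X (cfun c q) 0 k * cov_in c X (cfun c q) k k +
   \sum_(i | i != k) fld c X (cfun c q) 0 i * cov_in c X (cfun c q) i k)
  - (\sum_i cov_in c X (cfun c q) i i) * fld c X (cfun c q) 0 k)).
  apply: filterS (near_cdom cp) => q cq Oq.
  rewrite (fld_bvec oO hu ac (chart_image_cfun cq Oq)) /boch [RHS]mxE row_mulmxE.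
  by rewrite [X in _ = _ + X]mxE [X in _ = _ - X]mxE [in RHS](bigD1 k).
have E (s : R) : s = (0 * Ck + s) - t * 0 by rewrite mul0r mulr0 add0r subr0.
rewrite [X in _ --> X]E; have xk0 := grad_normal_limit bp sc cp.
apply: cvgB; last by apply: cvgM.
apply: cvgD; first by apply: cvgM.
by apply: cvg_sumr => i ik; apply: cvgM; [exact: xl|exact: covl].
Qed.

(** The weights allowed in front of [bvec] and of X: products with them keep the boundary limits and
    the sign. *)
Definition reg (v : M -> R) : Prop :=
  [/\ Ck_fun 1 O v, forall q, 0 <= v q, forall p, CV O v p &
   forall c p i, atlas c -> cdom c p -> CV O (fun q => pd i (v \o cinv c) (cfun c q)) p].

(** At the boundary the normal component tends to a l + b 0 with a >= 0 and l <= 0; the term in X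
    only contributes a limit 0. *)
Lemma admissible_fields v1 v2 : reg v1 -> reg v2 ->
  admissible O (fun q => v1 q *: bvec u q + v2 q *: X q).
Proof.
move=> [C1 p1 l1 d1] [C2 p2 l2 d2].
have V1 : Ck_field 1 O (bvec u) by exact: bvecC1.
have X1 : Ck_field 1 O X by exact: gradC1.
have Z1 : Ck_field 1 O (fun q => v1 q *: bvec u q) by exact: Ck_fieldZ.
have Z2 : Ck_field 1 O (fun q => v2 q *: X q) by exact: Ck_fieldZ.
have fE c q k : cdom c q -> fld c (fun q => v1 q *: bvec u q + v2 q *: X q) (cfun c q) 0 k =
    v1 q * fld c (bvec u) (cfun c q) 0 k + v2 q * fld c X (cfun c q) 0 k.
  by move=> cq; rewrite (fldD _ (fun q => v1 q *: bvec u q)) !fldZ cfunK // !mxE.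
split.
- exact: Ck_fieldD.
- move=> c p ac cp.
  have h i : exists C : R, \forall q \near p, O q ->
      `|fld c (fun q => v1 q *: bvec u q + v2 q *: X q) (cfun c q) 0 i| <= C.
    apply: CV_bounded; apply: (@CV_O _ _ _ O p (fun q => v1 q * fld c (bvec u) (cfun c q) 0 i + v2 q * fld c X (cfun c q) 0 i)).
      by apply: filterS (near_cdom cp) => q cq _; rewrite fE.
    apply: CV_add; apply: CV_mul => //; first exact: (CV_bvec oO hu huc).
    exact: (CV_fld oO hu huc).
  have [C hC] := choice h; exists (\sum_i `|C i|).
  have := @filter_forall _ _ (fun i q => O q ->
      `|fld c (fun q => v1 q *: bvec u q + v2 q *: X q) (cfun c q) 0 i| <= C i) (nbhs p) _ hC.
  move=> /(_ (nbhs_filter p)); apply: filterS => q hq Oq i; apply: le_trans (hq i Oq) _.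
  by rewrite (bigD1 i) //=; apply: le_trans (ler_norm _) _; rewrite lerDl sumr_ge0.
- move=> p; apply: CV_bounded; have ac := chart_at_atlas p; have cp := chart_at_dom p.
  set c := chart_at p in ac cp.
  apply: (@CV_O _ _ _ O p (fun q =>
    (v1 q * \tr (cov_in c (bvec u) (cfun c q)) + \sum_i fld c (bvec u) (cfun c q) 0 i * pd i (v1 \o cinv c) (cfun c q)) +
    (v2 q * (\sum_i cov_in c X (cfun c q) i i) + \sum_i fld c X (cfun c q) 0 i * pd i (v2 \o cinv c) (cfun c q)))).
    apply: filterS (near_cdom cp) => q cq Oq.
    rewrite (@divergence_in _ _ _ O c q oO Oq ac cq _ (Ck_fieldD oO Z1 Z2)).
    rewrite (@tr_cov_inD _ _ _ O c q Oq ac cq _ _ Z1 Z2).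
    rewrite (@tr_cov_inZ _ _ _ O c q Oq ac cq v1 _ C1 V1).
    by rewrite (@tr_cov_inZ _ _ _ O c q Oq ac cq v2 _ C2 X1).
  apply: CV_add; apply: CV_add.
  + by apply: CV_mul => //; exact: (CV_tr_cov_bvec oO hu huc).
  + by apply: CV_sum => i; apply: CV_mul; [exact: (CV_bvec oO hu huc)|exact: d1].
  + by apply: CV_mul => //; apply: CV_sum => i; exact: (CV_cov oO hu huc).
  + by apply: CV_sum => i; apply: CV_mul; [exact: (CV_fld oO hu huc)|exact: d2].
- move=> c k p sc cp pk e e0; have bp : bdry O p by have [[_ bc] _] := sc; apply/bc.
  have [l l0 hl] := bvec_normal_limit bp sc cp; have hx := grad_normal_limit bp sc cp.
  have [a ha] := l1 p; have [b hb] := l2 p.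
  have a0 : 0 <= a.
    have FF := within_proper (bdry_closure bp).
    apply: (cvgr_to_ge ha); apply: filterS (@filterT _ _ _) => q _; exact: p1.
  have lim : v1 q * fld c (bvec u) (cfun c q) 0 k + v2 q * fld c X (cfun c q) 0 k
      @[q --> within O (nbhs p)] --> a * l + b * 0 by apply: cvgD; apply: cvgM.
  have := (within_cvgP _ _ _ _).1 lim e e0.
  move=> h; apply: filterS2 h (near_cdom cp) => q h cq Oq; rewrite fE //.
  have := h Oq; rewrite mulr0 addr0 ler_distl => /andP[h1 h2].
  by have := mulr_ge0_le0 a0 l0; lra.
Qed.

End Boundary.

(** * The integral Bernstein inequality *)

Section PositivePower.
Context {R : realType}.
Implicit Types (a t : R).

(* For a >= 2 this is a C^1 function on the line, unlike powR *)
Definition ppow a t : R := if 0 < t then t `^ a else 0.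

Lemma ppow_ge0 a t : 0 <= ppow a t.
Proof. by rewrite /ppow; case: ifP => // _; exact: powR_ge0. Qed.

Lemma ppowE a t : 0 < a -> 0 <= t -> ppow a t = t `^ a.
Proof.
move=> a0; rewrite le_eqVlt => /orP[/eqP <-|t0]; last by rewrite /ppow t0.
by rewrite /ppow ltxx powR0 // gt_eqF.
Qed.

Lemma ppow_le0 a t : t <= 0 -> ppow a t = 0.
Proof. by move=> t0; rewrite /ppow ltNge t0. Qed.

Lemma ppow_derive a (t : R) : 2 <= a -> is_derive t 1 (ppow a) (a * ppow (a - 1) t).
Proof.
move=> a2; have [t0|t0|->] := ltgtP t 0.
- rewrite [X in is_derive _ _ _ X](_ : _ = 0); last by rewrite ppow_le0 ?mulr0 // ltW.
  apply: (@near_eq_is_derive _ _ _ (cst (0 : R)) (ppow a) t 1 0).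
    near=> s; rewrite ppow_le0 // ltW //; near: s; exact: lt_nbhsl.
- rewrite [X in is_derive _ _ _ X](_ : _ = a * t `^ (a - 1)); last by rewrite /ppow t0.
  apply: (@near_eq_is_derive _ _ _ (fun s : R => s `^ a) (ppow a) t 1 (a * t `^ (a - 1))).
    near=> s; rewrite /ppow; suff -> : 0 < s by []. near: s; exact: lt_nbhsr.
  exact: is_derive1_powR.
- rewrite [X in is_derive _ _ _ X](_ : _ = 0); last by rewrite ppow_le0 ?mulr0.
  suff lim0 : (fun h : R => h^-1 *: ((ppow a \o shift 0) (h *: 1) - ppow a 0)) @ 0^' --> (0 : R).
    by split; [apply/cvg_ex; exists 0|exact/cvg_lim].
  apply/cvgrPdist_le => e e0; near=> h.
  rewrite sub0r normrN /= [h *: 1]mulr1 addr0 (ppow_le0 a (lexx 0)) subr0.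
  have [h0|h0] := leP h 0; first by rewrite ppow_le0 // scaler0 normr0 ltW.
  have h1 : h <= 1.
    apply: le_trans (ler_norm h) _; near: h; exact: dnbhs0_le.
  rewrite /ppow h0 -[_ *: _]/(h^-1 * h `^ a) ger0_norm; last first.
    by rewrite mulr_ge0 ?invr_ge0 ?powR_ge0 // ltW.
  apply: (@le_trans _ _ h); last by apply: le_trans (ler_norm h) _; near: h; exact: dnbhs0_le.
  (* This is where a >= 2 enters: h^a <= h^2 for 0 < h <= 1, so the quotient is at most h. *)
  rewrite ler_pdivrMl //; apply: (@le_trans _ _ (h `^ 2%:R)).
    by apply: ger_powR; rewrite ?h0.
  by rewrite powR_mulrn; [rewrite expr2|exact: ltW].
Unshelve. all: by end_near. Qed.

Lemma ppow_continuous a : 2 <= a -> continuous (ppow a).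
Proof.
move=> a2 t; apply: differentiable_continuous; apply/derivable1_diffP.
by case: (ppow_derive t a2).
Qed.

End PositivePower.

Section BoundedMeasurable.
Context dd (T : measurableType dd) (R : realType).
Variables (m : {measure set T -> \bar R}) (D : set T).
Hypotheses (mD : measurable D) (mDoo : (m D < +oo)%E).
Implicit Types (f g : T -> R).

(** On a set of finite measure these functions are integrable and stable under sums, products and
    non-negative powers, so integrability never has to be discussed term by term. *)
Definition bmeasurable f : Prop := measurable_fun D f /\ exists C : R, forall x, D x -> `|f x| <= C.

Lemma bmeasurable_rintegrable f : bmeasurable f -> rintegrable m D f.
Proof. by move=> [mf [C hC]]; exact: (rintegrable_bounded mD mDoo mf hC). Qed.

Lemma bmeasurable_cst (a : R) : bmeasurable (fun=> a).
Proof. by split; [exact: measurable_cst|exists `|a|]. Qed.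

Lemma bmeasurable_add f g : bmeasurable f -> bmeasurable g -> bmeasurable (fun x => f x + g x).
Proof.
move=> [mf [C hC]] [mg [E hE]]; split; first exact: measurable_funD.
exists (C + E) => x Dx; apply: le_trans (ler_normD _ _) _.
by apply: lerD; [exact: hC|exact: hE].
Qed.

Lemma bmeasurable_mul f g : bmeasurable f -> bmeasurable g -> bmeasurable (fun x => f x * g x).
Proof.
move=> [mf [C hC]] [mg [E hE]]; split; first exact: measurable_funM.
by exists (C * E) => x Dx; rewrite normrM ler_pM //; [exact: hC|exact: hE].
Qed.

Lemma bmeasurable_norm f : bmeasurable f -> bmeasurable (fun x => `|f x|).
Proof.
move=> [mf [C hC]]; split; first exact: measurableT_comp.
by exists C => x Dx; rewrite normr_id; exact: hC.
Qed.

Lemma bmeasurable_powR f (p : R) : 0 <= p -> (forall x, D x -> 0 <= f x) -> bmeasurable f -> bmeasurable (fun x => f x `^ p).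
Proof.
move=> p0 f0 [mf [C hC]]; split.
  exact: (measurableT_comp (measurable_powR p)).
exists (C `^ p) => x Dx; rewrite ger0_norm ?powR_ge0 //.
have h : f x <= C by apply: le_trans (ler_norm _) (hC x Dx).
by apply: ge0_ler_powR; rewrite ?nnegrE // ?f0 //; apply: le_trans h; exact: f0.
Qed.

Lemma bmeasurable_eq f g : (forall x, D x -> f x = g x) -> bmeasurable f -> bmeasurable g.
Proof.
move=> fg [mf [C hC]]; split; last by exists C => x Dx; rewrite -fg //; exact: hC.
by apply: eq_measurable_fun mf => x /set_mem; exact: fg.
Qed.

Lemma LnormE (h : T -> R) (p : R) : 0 < p -> rintegrable m D (fun x => `|h x| `^ p) ->
  ('N[m]_(p%:E)[(EFin \o h) \_ D] = ((\int[m]_(x in D) (`|h x| `^ p)) `^ p^-1)%:E)%E.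
Proof.
move=> p0 ih; rewrite unlock /Lnorm.
have -> : (\int[m]_x (`|((EFin \o h) \_ D) x| `^ p) = \int[m]_(x in D) (`|h x| `^ p)%:E)%E.
  rewrite [RHS]integral_mkcond; apply: eq_integral => x _; rewrite !patchE.
  (* Off D the restriction takes the default value [point], which is 0 here and contributes nothing
     as p > 0. *)
  by case: ifP => // _; rewrite -[point]/(0%E) abse0 poweR0r ?gt_eqF.
have ff : (\int[m]_(x in D) (`|h x| `^ p)%:E)%E \is a fin_num by exact: integrable_fin_num.
by rewrite -[in LHS](fineK ff) poweR_EFin.
Qed.

Lemma hoelder_bmeasurable f g (p q : R) : bmeasurable f -> bmeasurable g -> (forall x, D x -> 0 <= f x) ->
  (forall x, D x -> 0 <= g x) -> 0 < p -> 0 < q -> p^-1 + q^-1 = 1 ->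
  \int[m]_(x in D) (f x * g x) <=
  (\int[m]_(x in D) (f x `^ p)) `^ p^-1 * (\int[m]_(x in D) (g x `^ q)) `^ q^-1.
Proof.
move=> bf bg f0 g0 p0 q0 pq.
have ib h r : 0 < r -> bmeasurable h -> (forall x, D x -> 0 <= h x) -> rintegrable m D (fun x => `|h x| `^ r).
  by move=> r0 bh h0; apply: bmeasurable_rintegrable; apply: bmeasurable_powR => //; [exact: ltW|exact: bmeasurable_norm].
have E h r : (forall x, D x -> 0 <= h x) -> \int[m]_(x in D) (`|h x| `^ r) = \int[m]_(x in D) (h x `^ r).
  by move=> h0; apply: eq_Rintegral => x /set_mem Dx; rewrite ger0_norm // h0.
have mr h : bmeasurable h -> measurable_fun setT (h \_ D).
  by move=> [mh _]; apply/(measurable_restrictT _ mD).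
have := hoelder m (mr f bf) (mr g bg) p0 q0 pq.
have -> : EFin \o ((f \_ D) \* (g \_ D)) = (EFin \o (fun x => f x * g x)) \_ D.
  apply/funext => x /=; rewrite !patchE; case: ifP => // _.
  by rewrite -[point]/(0 : R) mul0r.
have rE (h : T -> R) : EFin \o (h \_ D) = (EFin \o h) \_ D by rewrite restrict_EFin.
have bfg : bmeasurable (fun x => f x * g x) by exact: bmeasurable_mul.
have fg0 x : D x -> 0 <= f x * g x by move=> Dx; rewrite mulr_ge0 ?f0 ?g0.
rewrite !rE (LnormE p0 (ib f p p0 bf f0)) (LnormE q0 (ib g q q0 bg g0)).
rewrite (LnormE ltr01 (ib _ 1 ltr01 bfg fg0)).
have i0 : 0 <= \int[m]_(x in D) (`|f x * g x| `^ 1).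
  by apply: Rintegral_ge0 => x _; exact: powR_ge0.
rewrite -EFinM lee_fin invr1 (powRr1 i0).
rewrite (E f p f0) (E g q g0) (E _ 1 fg0).
congr (_ <= _); apply: eq_Rintegral => x /set_mem Dx.
by rewrite powRr1 // fg0.
Qed.

End BoundedMeasurable.

Section Pointwise.
Context {R : realType}.

(* The choice of c cancels the two terms s * ax. Young's inequality absorbs the
   terms in G, and a positive multiple of t^2 survives because
   1 - c * gamma = (gamma / 2) / b' <= 1 / (8 * D). *)
Lemma pointwise_ineq (D gamma b b' c kappa w s t G ric tr2 a2 ax P : R) :
  1 <= D -> 0 < gamma -> 4 * D * gamma <= b -> b' = b + gamma / 2 ->
  c = b / (gamma * b') -> 0 <= w -> 0 <= P -> 0 <= a2 -> t = s / gamma + G ->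
  t ^+ 2 <= D * tr2 -> ax ^+ 2 <= a2 * w -> - kappa * w <= ric ->
  3 / (8 * D * gamma ^+ 2) * (P * w * s ^+ 2) + b * (P * a2) - kappa * (P * w * w)
    - (2 * D + 1 + b) * (G ^+ 2 * (P * w)) <=
  P * w * (tr2 - t ^+ 2 + ric) + b * P * (2 * a2 - 2 * t * ax) +
  (c * (P * w * s) * t + c * b' * (P * s) * (2 * ax)).
Proof.
move=> D1 g0 hb eb' ec w0 P0 a20 et htr hax hric.
have D0 : 0 < D by lra.
have b0 : 0 < b by apply: lt_le_trans hb; rewrite !mulr_gt0.
have b'0 : 0 < b' by rewrite eb' addr_gt0 // divr_gt0.
have cb : c * b' = b / gamma by rewrite ec; field; rewrite !gt_eqF.
pose del := (gamma / 2) / b'.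
have del0 : 0 <= del by rewrite divr_ge0 ?divr_ge0 // ltW.
have delD : 8 * D * del <= 1.
  rewrite /del mulrA ler_pdivrMr // mul1r eb'.
  have -> : 8 * D * (gamma / 2) = 4 * D * gamma by field.
  by apply: le_trans hb _; rewrite lerDl divr_ge0 // ltW.
have es : s = gamma * (t - G) by rewrite et addrK mulrC divfK // gt_eqF.
have ecs : c * s = (1 - del) * (t - G).
  have bE : b = b' - gamma / 2 by rewrite eb' addrK.
  by rewrite ec es /del [in LHS]bE; field; rewrite !gt_eqF.
have h1 : - (a2 + G ^+ 2 * w) <= - (2 * G * ax) .
  rewrite lerN2; have h2 : (2 * G * ax) ^+ 2 <= (a2 + G ^+ 2 * w) ^+ 2.
    have h3 : (G * ax) ^+ 2 <= G ^+ 2 * (a2 * w) by rewrite exprMn ler_wpM2l // sqr_ge0.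
    have : 0 <= (a2 - G ^+ 2 * w) ^+ 2 by exact: sqr_ge0.
    rewrite -!mulrA ![(2 * (_)) ^+ 2]exprMn; move: h3; set x := (G * ax) ^+ 2.
    by move=> h3 h4; nra.
  have p0 : 0 <= a2 + G ^+ 2 * w by rewrite addr_ge0 // mulr_ge0 // sqr_ge0.
  apply: le_trans (ler_norm _) _; rewrite -(ger0_norm p0).
  by rewrite -ler_sqr ?nnegrE // !real_normK ?num_real.
(* The trace term supplies t^2 / D. The defect [del] and the mixed term in G t cost at most t^2 / (8
   D) each, and the remaining 3/4 of t^2 / D dominates 3/8 of (t - G)^2 / D up to a multiple of G^2;
   with s = gamma (t - G) this is the coefficient of s^2. *)
have h2 : 3 / (8 * D * gamma ^+ 2) * s ^+ 2 - (2 * D + 1) * G ^+ 2 <=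
    tr2 - t ^+ 2 + (1 - del) * (t - G) * t.
  have e1 : 3 / (8 * D * gamma ^+ 2) * s ^+ 2 = 3 / (8 * D) * (t - G) ^+ 2.
    by rewrite es; field; rewrite !gt_eqF.
  rewrite e1; pose iD := D^-1; have iD0 : 0 < iD by rewrite invr_gt0.
  have iDD : iD * D = 1 by rewrite /iD mulVf // gt_eqF.
  have t1 : t ^+ 2 * iD <= tr2 by rewrite ler_pdivrMr // mulrC.
  have t2 : del <= iD / 8.
    rewrite -(ler_pM2l D0); have -> : D * (iD / 8) = iD * D / 8 by field.
    by rewrite iDD; lra.
  have t3 : 3 / (8 * D) = 3 / 8 * iD by rewrite /iD; field; rewrite gt_eqF.
  rewrite t3.
  have iD1 : iD <= 1 by rewrite invf_le1.
  have del1 : del <= 1 by lra.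
  have u1 : del * t ^+ 2 <= iD / 8 * t ^+ 2 by rewrite ler_wpM2r // sqr_ge0.
  have u2 : (1 - del) * (G * t) <= iD / 8 * t ^+ 2 + 2 * D * G ^+ 2.
    apply: (@le_trans _ _ `|G * t|).
      apply: le_trans (ler_norm _) _; rewrite normrM -[leRHS]mul1r ler_wpM2r //.
      by rewrite ger0_norm; lra.
    have q0 : 0 <= iD / 8 * t ^+ 2 + 2 * D * G ^+ 2.
      by rewrite addr_ge0 // mulr_ge0 ?sqr_ge0 // ?divr_ge0 ?mulr_ge0 // ltW.
    rewrite -(ger0_norm q0) -ler_sqr ?nnegrE // !real_normK ?num_real //.
    have : 0 <= (iD / 8 * t ^+ 2 - 2 * D * G ^+ 2) ^+ 2 by exact: sqr_ge0.
    have -> : (iD / 8 * t ^+ 2 + 2 * D * G ^+ 2) ^+ 2 =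
      (iD / 8 * t ^+ 2 - 2 * D * G ^+ 2) ^+ 2 + (iD * D) * (G * t) ^+ 2 by field.
    by rewrite iDD mul1r lerDr.
  have u3 : (t - G) ^+ 2 <= 2 * t ^+ 2 + 2 * G ^+ 2.
    have := sqr_ge0 (t + G); rewrite sqrrB sqrrD => h; lra.
  have u4 : 3 / 8 * iD * (t - G) ^+ 2 <= 3 / 8 * iD * (2 * t ^+ 2 + 2 * G ^+ 2).
    by rewrite ler_wpM2l // mulr_ge0 // ltW.
  have u5 : iD * G ^+ 2 <= G ^+ 2 by rewrite -[leRHS]mul1r ler_wpM2r // sqr_ge0.
  have -> : (1 - del) * (t - G) * t = t ^+ 2 - del * t ^+ 2 - (1 - del) * (G * t) by ring.
  have u6 : 0 <= G ^+ 2 by exact: sqr_ge0.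
  have u7 : 0 <= iD * t ^+ 2 by rewrite mulr_ge0 ?sqr_ge0 // ltW.
  nra.
have -> : c * (P * w * s) * t = P * w * ((c * s) * t) by ring.
rewrite ecs cb.
have -> : b / gamma * (P * s) * (2 * ax) = b * P * (2 * (t - G) * ax).
  by rewrite es; field; rewrite gt_eqF.
have Pw : 0 <= P * w by rewrite mulr_ge0.
have k1 := ler_wpM2l Pw h2; have k2 := ler_wpM2l Pw hric.
have bP : 0 <= b * P by rewrite mulr_ge0 // ltW.
have k3 := ler_wpM2l bP h1.
have := lerD (lerD k1 k2) k3; rewrite -subr_ge0 => h; rewrite -subr_ge0.
by apply: le_trans h _; rewrite le_eqVlt; apply/orP; left; apply/eqP; field; rewrite !gt_eqF.
Qed.

End Pointwise.

(** Both sides vanish for t <= 0, so the law is free of conditions on the exponents. *)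
Lemma ppowD (R : realType) (a e t : R) : ppow a t * t `^ e = ppow (a + e) t.
Proof.
rewrite /ppow; case: ifP => [t0|_]; last by rewrite mul0r.
by rewrite powRD // (gt_eqF t0) implybT.
Qed.

Lemma ppowS (R : realType) (a t : R) : 0 <= t -> ppow a t * t = ppow (a + 1) t.
Proof. by move=> t0; rewrite -ppowD powRr1. Qed.

Section Good.
Context {R : realType} {d : nat} {M : riemannian R d}.
Variables (O : set M).
Hypotheses (oO : open O) (cO : compact (closure O)).
Implicit Types (f g : M -> R) (Y Z : M -> 'rV[R]_d).

(** Continuity inside O gives measurability, and limits at all points of the compact closure give
    boundedness. *)
Definition tame f : Prop := (forall p, O p -> {for p, continuous f}) /\ forall p, CV O f p.

Lemma tame_bmeasurable f : tame f -> bmeasurable (O : set (borel M)) (f : borel M -> R).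
Proof.
move=> [cf hf]; split; first exact: (cont_measurable oO).
have [C _ h] := @bounded_of_local R M (closure O) O f cO (fun p _ => CV_bounded (hf p)).
by exists C => q Oq; apply: h => //; exact: subset_closure.
Qed.

Lemma tame_Ck_fun f : Ck_fun 0 O f -> (forall p, CV O f p) -> tame f.
Proof.
move=> h hf; split=> // p Op; have cp := chart_at_dom p.
apply: (@continuous_chart _ _ _ (chart_at p) _ (f \o cinv (chart_at p)) p cp).
  exact: (@Ck_continuous _ _ 0%N _ _ (h _ (chart_at_atlas p)) _ (chart_image_cfun cp Op)).
by apply: filterS (near_cdom cp) => q cq; rewrite /= cfunK.
Qed.

Lemma tame_inner Y Z : Ck_field 0 O Y -> Ck_field 0 O Z ->
  (forall c p i, atlas c -> cdom c p -> CV O (fun q => fld c Y (cfun c q) 0 i) p) ->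
  (forall c p i, atlas c -> cdom c p -> CV O (fun q => fld c Z (cfun c q) 0 i) p) ->
  tame (fun p => inner p (Y p) (Z p)).
Proof.
move=> hY hZ lY lZ.
have E c q : atlas c -> cdom c q -> inner q (Y q) (Z q) =
    \sum_j (\sum_i fld c Y (cfun c q) 0 i * gm c (cfun c q) i j) * fld c Z (cfun c q) 0 j.
  move=> ac cq; rewrite (inner_gm _ _ ac cq) -!fld_cfun // mxE.
  by apply: eq_bigr => j _; rewrite row_mulmxE [X in _ * X]mxE.
apply: tame_Ck_fun.
  move=> c ac; have oU : open (chart_image c O) by exact: open_chart_image.
  apply: (@Ck_eq _ _ 0%N _ (fun y => \sum_j (\sum_i fld c Y y 0 i * gm c y i j) * fld c Z y 0 j) _ oU).
    by move=> y /chart_imageP [cy Oy Ey]; rewrite /= (E c _ ac cy) Ey.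
  apply: (Ck_sum oU) => j _; apply: (Ck_mul oU); last exact: (@Ck_field_fld _ _ _ 0).
  apply: (Ck_sum oU) => i _; apply: (Ck_mul oU); first exact: (@Ck_field_fld _ _ _ 0).
  by apply: CkSub (gm_Ck 0 i j ac); exact: chart_imageS.
move=> p; have ac := chart_at_atlas p; have cp := chart_at_dom p; set c := chart_at p in ac cp.
apply: (@CV_O _ _ _ O p (fun q => \sum_j (\sum_i fld c Y (cfun c q) 0 i * gm c (cfun c q) i j) * fld c Z (cfun c q) 0 j)).
  by apply: filterS (near_cdom cp) => q cq _; rewrite (E c).
apply: CV_sum => j; apply: CV_mul; last exact: lZ.
by apply: CV_sum => i; apply: CV_mul; [exact: lY|exact: CV_gm].
Qed.

End Good.

(** * The field Z and the integrated inequality *)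

Section Bernstein.
Context {R : realType} {d : nat} {M : riemannian R d}.
Variables (vol : {measure set (borel M) -> \bar R}) (O : set M) (u : M -> R) (nu : M -> 'rV[R]_d).
Hypothesis volP : riemannian_volume vol.
Hypotheses (d0 : (0 < d)%N) (oO : open O) (cO : compact (closure O)) (volO : (vol O < +oo)%E).
Hypotheses (hu : Ck_fun 3 O u) (huc : Ck_fun_closure 2 O u).
Hypotheses (nuP : outward_unit_normal O nu) (II : class_Oplus O nu).
Hypothesis neumann : forall p, bdry O p -> normal_derivative O nu u p = 0.
Let X := grad u.
Let w := wgrad u.
Local Notation bmO f := (bmeasurable (O : set (borel M)) (f : borel M -> R)).

Let mO : measurable (O : set (borel M)). Proof. exact: borel_open. Qed.

Definition accel p : 'rV[R]_d := X p *m covD X p.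

Lemma outward_one_sided p : bdry O p -> exists k c, one_sided O k c /\ cdom c p.
Proof. by move=> bp; have [_ _ [k [c [h1 h2 h3 _]]]] := nuP bp; exists k, c. Qed.

Lemma pd_ppow a c y i : 2 <= a -> atlas c -> chart_image c O y ->
  pd i ((fun q => ppow a (w q)) \o cinv c) y =
  a * ppow (a - 1) (w (cinv c y)) * pd i (w \o cinv c) y.
Proof.
move=> a2 ac yO; have oU : open (chart_image c O) by exact: open_chart_image.
have dw : differentiable (w \o cinv c) y.
  by apply: (@Ck_differentiable _ _ 1%N _ _ _ oU _ yO); exact: (wgrad_Ck oO hu ac).
by have [_] := pd_comp1 i dw (ppow_derive (w (cinv c y)) a2).
Qed.

Lemma ppow_Ck1 a : 3 <= a -> Ck_fun 1 O (fun q => ppow a (w q)).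
Proof.
move=> a3 c ac; have oU : open (chart_image c O) by exact: open_chart_image.
have a2 : 2 <= a by lra.
pose F n := if n is 0%N then ppow a else fun t => a * ppow (a - 1) t.
apply: (@Ck_comp1 _ _ _ oU 1 0 F (w \o cinv c)).
- by move=> [|m] t; rewrite ?ltnS // => _; exact: ppow_derive.
- move=> t; apply: cvgM; first exact: cvg_cst.
  by apply: ppow_continuous; lra.
- by apply: CkW; exact: (wgrad_Ck oO hu ac).
Qed.

Lemma CV_ppow a p : 2 <= a -> CV O (fun q => ppow a (w q)) p.
Proof. by move=> a2; apply: CV_comp; [exact: ppow_continuous|exact: CV_wgrad]. Qed.

Lemma CV_pd_ppow a c p i : 3 <= a -> atlas c -> cdom c p ->
  CV O (fun q => pd i ((fun q => ppow a (w q)) \o cinv c) (cfun c q)) p.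
Proof.
move=> a3 ac cp.
apply: (@CV_O _ _ _ O p (fun q => a * ppow (a - 1) (w q) * pd i (w \o cinv c) (cfun c q))).
  apply: filterS (near_cdom cp) => q cq Oq.
  by rewrite pd_ppow ?cfunK //; [lra|exact: chart_image_cfun].
apply: CV_mul; last exact: CV_pd_wgrad.
by apply: CV_mul; [exact: CV_cst|apply: CV_ppow; lra].
Qed.

Lemma reg_ppow a : 3 <= a -> reg O (fun q => ppow a (w q)).
Proof.
move=> a3; split; first exact: ppow_Ck1.
- by move=> q; exact: ppow_ge0.
- by move=> p; apply: CV_ppow; lra.
- by move=> c p i ac cp; exact: CV_pd_ppow.
Qed.

Lemma reg_scale (e : R) v : 0 <= e -> reg O v -> reg O (fun q => e * v q).
Proof.
move=> e0 [C1 p1 l1 d1]; split.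
- move=> c ac; have oU : open (chart_image c O) by exact: open_chart_image.
  by apply: (Ck_mul oU); [exact: Ck_cst|exact: (C1 c ac)].
- by move=> q; rewrite mulr_ge0.
- by move=> p; apply: CV_mul => //; exact: CV_cst.
- move=> c p i ac cp.
  apply: (@CV_O _ _ _ O p (fun q => e * pd i (v \o cinv c) (cfun c q))).
    apply: filterS (near_cdom cp) => q cq Oq.
    rewrite -pdZ //; apply: (@Ck_derivable _ _ 0%N _ _ (C1 c ac)).
    exact: chart_image_cfun.
  by apply: CV_mul; [exact: CV_cst|exact: d1].
Qed.

Section AtPoint.
Variable p : M.
Hypothesis Op : O p.
Let c := chart_at p.
Let y := cfun c p.
Let ac : atlas c. Proof. exact: chart_at_atlas. Qed.
Let cp : cdom c p. Proof. exact: chart_at_dom. Qed.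
Let yO : chart_image c O y. Proof. exact: chart_image_cfun. Qed.
Let oU : open (chart_image c O). Proof. exact: open_chart_image. Qed.
Let UT : chart_image c O `<=` chart_image c setT. Proof. exact: chart_imageS. Qed.

Lemma fld_at (Y : M -> 'rV[R]_d) : fld c Y y = Y p.
Proof. by rewrite fld_cfun // tcomp_chart_at. Qed.

Lemma hess_sym : (covD X p *m metric p)^T = covD X p *m metric p.
Proof.
rewrite covD_cov_in -(gm_chart_at p).
exact: (@cov_grad_sym _ _ _ c (chart_image c O) ac oU UT u y yO (hu ac)).
Qed.

Lemma sqr_laplacian_le : divergence X p ^+ 2 <= d%:R * \tr (covD X p *m covD X p).
Proof.
apply: (@sqr_trace_le R d (metric p)); first exact: Defs.metric_sym.
  by move=> v v0; exact: Defs.metric_pos.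
exact: hess_sym.
Qed.

(** The derivative of w along Y is 2 g(D_Y X, X), which by symmetry of the Hessian is 2 g(D_X X,
    Y). *)
Lemma dirD_wgrad (Y : M -> 'rV[R]_d) : dirD c w Y y = 2 * inner p (accel p) (Y p).
Proof.
rewrite /dirD fld_at (eq_bigr (fun i => 2 * (Y p 0 i * (covD X p *m metric p *m (X p)^T) i 0))).
  rewrite -mulr_sumr; congr (_ * _).
  rewrite -(row_mulmxE (Y p) (covD X p *m metric p *m (X p)^T) 0).
  transitivity (((Y p *m (covD X p *m metric p *m (X p)^T))^T) 0 0); first by rewrite [RHS]mxE.
  by rewrite trmx_mul trmx_mul trmxK hess_sym /inner /accel !mulmxA.
move=> i _; rewrite (pd_wgrad oO hu i ac yO) fld_at covD_cov_in gm_chart_at.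
by rewrite mulrCA.
Qed.

Lemma dirD_ppow a (Y : M -> 'rV[R]_d) : 2 <= a ->
  dirD c (fun q => ppow a (w q)) Y y = a * ppow (a - 1) (w p) * (2 * inner p (accel p) (Y p)).
Proof.
move=> a2; rewrite -dirD_wgrad /dirD mulr_sumr; apply: eq_bigr => i _.
by rewrite (pd_ppow i a2 ac yO) cfunK // mulrCA.
Qed.

Lemma divergence_bvec : divergence (bvec u) p =
  \tr (covD X p *m covD X p) - divergence X p ^+ 2 + ricci p (X p) (X p).
Proof.
rewrite (@divergence_in _ _ _ O c p oO Op ac cp _ (bvecC1 oO hu)).
by rewrite (tr_cov_bvec oO hu ac yO) fld_at ricciE /divergence covD_cov_in.
Qed.

End AtPoint.

Lemma lap_tame : tame O (divergence X).
Proof.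
split=> p; first by move=> Op; exact: (divergence_continuous oO (gradC1 oO hu) Op).
have ac := chart_at_atlas p; have cp := chart_at_dom p; set c := chart_at p in ac cp.
apply: (@CV_O _ _ _ O p (fun q => \sum_i cov_in c X (cfun c q) i i)).
  apply: filterS (near_cdom cp) => q cq Oq.
  by rewrite (@divergence_in _ _ _ O c q oO Oq ac cq _ (gradC1 oO hu)).
by apply: CV_sum => i; exact: (CV_cov oO hu huc).
Qed.

Lemma w_tame : tame O w.
Proof.
apply: tame_Ck_fun; last by move=> p; exact: CV_wgrad.
by move=> c ac; apply: (@Ck_leq _ _ 0 2) => //; exact: (wgrad_Ck oO hu ac).
Qed.

Lemma fld_accel c y : atlas c -> chart_image c O y ->
  fld c accel y = fld c X y *m cov_in c X y.
Proof.
move=> ac /chart_imageP [cy Oy Ey]; rewrite -fldE /field_in /accel.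
rewrite (tcomp_covD (X (cinv c y)) oO Oy ac cy (gradC1 oO hu)) Ey.
by rewrite -[tcomp _ _ _]/(field_in c X y) fldE.
Qed.

Lemma accelC1 : Ck_field 1 O accel.
Proof.
apply: fld_Ck_field => c ac i; have oU : open (chart_image c O) by exact: open_chart_image.
have UT : chart_image c O `<=` chart_image c setT by exact: chart_imageS.
apply: (@Ck_eq _ _ 1 _ (fun y => \sum_j fld c X y 0 j * cov_in c X y j i) _ oU).
  by move=> y yO; rewrite fld_accel // row_mulmxE.
apply: (Ck_sum oU) => j _; apply: (Ck_mul oU).
  by apply: CkW; exact: (fld_grad_C2 oO hu ac).
by apply: (cov_in_Ck ac oU UT) => l; exact: (fld_grad_C2 oO hu ac).
Qed.

Lemma CV_accel c p i : atlas c -> cdom c p -> CV O (fun q => fld c accel (cfun c q) 0 i) p.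
Proof.
move=> ac cp; apply: (@CV_eqchart _ _ _ O c p cp (fun y => fld c accel y 0 i)
  (fun y => \sum_j fld c X y 0 j * cov_in c X y j i)).
  by move=> y yO; rewrite fld_accel // row_mulmxE.
by apply: CV_sum => j; apply: CV_mul; [exact: (CV_fld oO hu huc)|exact: (CV_cov oO hu huc)].
Qed.

Definition a2 p : R := inner p (accel p) (accel p).

Lemma a2_ge0 p : 0 <= a2 p. Proof. exact: inner_ge0. Qed.

Lemma a2_tame : tame O a2.
Proof.
apply: tame_inner => //; try exact: CV_accel.
  by move=> c ac i; apply: CkW; exact: accelC1.
by move=> c ac i; apply: CkW; exact: accelC1.
Qed.

Variables (gamma kappa b : R) (f : M -> R) (B : M -> 'rV[R]_d).
Hypothesis gamma1 : 1 < gamma.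
Hypothesis ricP : forall (x : M) (xi : 'rV[R]_d), O x ->
  - kappa * tnorm x xi ^+ 2 <= ricci x xi xi.
Hypothesis pde : forall x : M, O x ->
  - laplacian u x + gamma^-1 * tnorm x (grad u x) `^ gamma + inner x (B x) (grad u x) = f x.
Hypotheses (b4 : 4 * d%:R * gamma <= b) (b_ge4 : 4 <= b).

(** Drift and right-hand side together, so that the equation reads div X = w^(gamma / 2) / gamma +
    [force]. *)
Definition force p : R := inner p (B p) (X p) - f p.

Lemma w_ge0 p : 0 <= w p. Proof. exact: wgrad_ge0. Qed.

Lemma tnorm_powR p (e : R) : tnorm p (X p) `^ e = w p `^ (e / 2).
Proof.
by rewrite /tnorm -[inner p _ _]/(w p) -powR12_sqrt ?w_ge0 // -powRrM mulrC.
Qed.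

Lemma lap_eq p : O p -> divergence X p = w p `^ (gamma / 2) / gamma + force p.
Proof.
move=> Op; have := pde Op; rewrite tnorm_powR /force -/X -[laplacian u p]/(divergence X p) => h.
by rewrite -h; ring.
Qed.

Let wb : bmO w. Proof. exact: (tame_bmeasurable oO cO w_tame). Qed.

Lemma bmeasurable_wpow (e : R) : 0 <= e -> bmO (fun p => w p `^ e).
Proof. by move=> e0; apply: bmeasurable_powR => // x _; exact: w_ge0. Qed.

(** Read off from the equation, which expresses the force by the Laplacian and w. *)
Lemma force_bmeasurable : bmO force.
Proof.
apply: (@bmeasurable_eq _ _ _ (O : set (borel M)) (fun p => divergence X p + (- gamma^-1) * w p `^ (gamma / 2))).
  by move=> p Op; rewrite lap_eq //; ring.
apply: bmeasurable_add => //; first exact: (tame_bmeasurable oO cO lap_tame).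
apply: bmeasurable_mul; first exact: bmeasurable_cst.
by apply: bmeasurable_wpow; rewrite divr_ge0 // ltW // (lt_trans ltr01).
Qed.

Let ge3 (e : R) : 4 <= e -> 3 <= e. Proof. by apply: le_trans; rewrite ler_nat. Qed.
Let ge2 (e : R) : 4 <= e -> 2 <= e. Proof. by apply: le_trans; rewrite ler_nat. Qed.
Let gam0 : 0 < gamma. Proof. exact: lt_trans ltr01 gamma1. Qed.

Let b' := b + gamma / 2.
Let c0 := b / (gamma * b').
Let b'4 : 4 <= b'.
Proof. by apply: le_trans b_ge4 _; rewrite lerDl divr_ge0 // ltW. Qed.
Let c00 : 0 <= c0.
Proof.
have h1 : 0 <= b by apply: le_trans b_ge4.
have h2 : 0 <= b' by apply: le_trans b'4.
by rewrite divr_ge0 // mulr_ge0 // ltW.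
Qed.

(* c0 is such that the terms of div Z in w^(gamma / 2) g(D_X X, X) cancel *)
Let Z p : 'rV[R]_d := ppow b (w p) *: bvec u p + (c0 * ppow b' (w p)) *: X p.

Let Zadm : admissible O Z.
Proof.
apply: (admissible_fields oO hu huc nuP II neumann); first by apply: reg_ppow; exact: ge3.
by apply: reg_scale => //; apply: reg_ppow; exact: ge3.
Qed.

Let divZ p : O p -> divergence Z p =
  ppow b (w p) * (\tr (covD X p *m covD X p) - divergence X p ^+ 2 + ricci p (X p) (X p)) +
  b * ppow (b - 1) (w p) * (2 * a2 p - 2 * divergence X p * inner p (accel p) (X p)) +
  (c0 * ppow b' (w p) * divergence X p +
   c0 * b' * ppow (b' - 1) (w p) * (2 * inner p (accel p) (X p))).
Proof.
move=> Op.
have rb : reg O (fun q => ppow b (w q)) by apply: reg_ppow; exact: ge3.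
have rb' : reg O (fun q => ppow b' (w q)) by apply: reg_ppow; exact: ge3.
have [C1 _ _ _] := rb; have [C2 _ _ _] := reg_scale c00 rb'; have [C3 _ _ _] := rb'.
have V1 : Ck_field 1 O (bvec u) by exact: bvecC1.
have X1 : Ck_field 1 O X by exact: gradC1.
rewrite (divergenceD oO Op (Ck_fieldZ oO C1 V1) (Ck_fieldZ oO C2 X1)).
rewrite (divergenceZ oO Op C1 V1) (divergenceZ oO Op C2 X1) (divergence_bvec Op).
rewrite (dirD_ppow Op (bvec u)); last exact: ge2.
have -> : dirD (chart_at p) (fun q => c0 * ppow b' (w q)) X (cfun (chart_at p) p) =
    c0 * dirD (chart_at p) (fun q => ppow b' (w q)) X (cfun (chart_at p) p).
  rewrite /dirD mulr_sumr; apply: eq_bigr => i _; rewrite mulrCA; congr (_ * _).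
  rewrite -pdZ //; apply: (@Ck_derivable _ _ 0%N _ _ (C3 _ (chart_at_atlas p))).
  by apply: chart_image_cfun => //; exact: chart_at_dom.
rewrite (dirD_ppow Op X); last exact: ge2.
have -> : inner p (accel p) (bvec u p) = a2 p - divergence X p * inner p (accel p) (X p).
  rewrite /bvec -/X -/(accel p) innerDr -scaleNr innerZr mulNr.
  by [].
by ring.
Qed.

Let c1 := 3 / (8 * d%:R * gamma ^+ 2).
Let C2 := 2 * d%:R + 1 + b.

Let lower p : O p ->
  c1 * w p `^ (b + gamma) + b * (w p `^ (b - 1) * a2 p) - kappa * w p `^ (b + 1)
    - C2 * (force p ^+ 2 * w p `^ b) <= divergence Z p.
Proof.
move=> Op; rewrite (divZ Op).
have bp : 0 < b by apply: lt_le_trans b_ge4.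
have b1 : 0 < b - 1 by rewrite subr_gt0 (lt_le_trans _ b_ge4) // ltr1n.
have w0 := w_ge0 p; pose P := ppow (b - 1) (w p); pose s := w p `^ (gamma / 2).
have P0 : 0 <= P by exact: ppow_ge0.
have E1 : ppow b (w p) = P * w p by rewrite ppowS // subrK.
have E2 : ppow b' (w p) = P * w p * s by rewrite -E1 ppowD.
have E3 : ppow (b' - 1) (w p) = P * s by rewrite ppowD; congr ppow; rewrite /b'; ring.
have E4 : w p `^ b = P * w p by rewrite -E1 ppowE.
have E5 : w p `^ (b - 1) = P by rewrite /P ppowE.
have E6 : w p `^ (b + 1) = P * w p * w p by rewrite -E1 ppowS // ppowE // addr_gt0.
have E7 : w p `^ (b + gamma) = P * w p * s ^+ 2.
  rewrite expr2 mulrA -E2 ppowD ppowE //; last by rewrite /b' !addr_gt0 // divr_gt0.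
  by congr (_ `^ _); rewrite /b'; field.
rewrite E1 E2 E3 E4 E5 E6 E7.
have h1 : inner p (accel p) (X p) ^+ 2 <= a2 p * w p by exact: inner_cauchy_schwarz.
have h2 : - kappa * w p <= ricci p (X p) (X p).
  by have := ricP (X p) Op; rewrite /tnorm sqr_sqrtr // inner_ge0.
have D1 : (1 : R) <= d%:R by rewrite ler1n.
have := @pointwise_ineq R d%:R gamma b b' c0 kappa (w p) s (divergence X p) (force p)
  (ricci p (X p) (X p)) (\tr (covD X p *m covD X p)) (a2 p) (inner p (accel p) (X p)) P
  D1 gam0 b4 erefl erefl w0 P0 (a2_ge0 p) (lap_eq Op) (sqr_laplacian_le Op) h1 h2.
by [].
Qed.

Let a2b : bmO a2. Proof. exact: (tame_bmeasurable oO cO a2_tame). Qed.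

(** The pointwise bound [lower] is integrated and combined with the non-positivity of the integral
    of div Z. *)
Lemma bernstein_integral :
  c1 * \int[vol]_(p in O) (w p `^ (b + gamma)) + b * \int[vol]_(p in O) (w p `^ (b - 1) * a2 p)
  <= kappa * \int[vol]_(p in O) (w p `^ (b + 1)) + C2 * \int[vol]_(p in O) (force p ^+ 2 * w p `^ b).
Proof.
have b0 : 0 <= b by apply: le_trans b_ge4.
have i1 : rintegrable vol (O : set (borel M)) (fun p => w p `^ (b + gamma)).
  by apply: bmeasurable_rintegrable => //; apply: bmeasurable_wpow; rewrite addr_ge0 // ltW.
have i2 : rintegrable vol (O : set (borel M)) (fun p => w p `^ (b - 1) * a2 p).
  by apply: bmeasurable_rintegrable => //; apply: bmeasurable_mul => //; apply: bmeasurable_wpow; rewrite subr_ge0 (le_trans _ b_ge4) // ler1n.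
have i3 : rintegrable vol (O : set (borel M)) (fun p => w p `^ (b + 1)).
  by apply: bmeasurable_rintegrable => //; apply: bmeasurable_wpow; rewrite addr_ge0.
have i4 : rintegrable vol (O : set (borel M)) (fun p => force p ^+ 2 * w p `^ b).
  apply: bmeasurable_rintegrable => //; apply: bmeasurable_mul; last exact: bmeasurable_wpow.
  by apply: bmeasurable_mul; exact: force_bmeasurable.
have j1 := rintegrableZ mO c1 i1; have j2 := rintegrableZ mO b i2.
have j3 := rintegrableZ mO kappa i3; have j4 := rintegrableZ mO C2 i4.
have j12 := rintegrableD mO j1 j2.
have j123 : rintegrable vol (O : set (borel M)) (fun p => c1 * w p `^ (b + gamma) + b * (w p `^ (b - 1) * a2 p) - kappa * w p `^ (b + 1)).
  by apply: rintegrableD => //; exact: rintegrableN.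
have j1234 : rintegrable vol (O : set (borel M)) (fun p => c1 * w p `^ (b + gamma) + b * (w p `^ (b - 1) * a2 p) - kappa * w p `^ (b + 1) - C2 * (force p ^+ 2 * w p `^ b)).
  by apply: rintegrableD => //; exact: rintegrableN.
have h0 := divergence_le0 volP d0 oO cO volO outward_one_sided Zadm.
have h1 := le_Rintegral mO j1234 (admissible_rintegrable oO cO volO Zadm) (fun p Op => lower Op).
have := le_trans h1 h0.
rewrite (RintegralB mO j123 j4) (RintegralB mO j12 j3) (RintegralD mO j1 j2).
rewrite (RintegralZl c1 mO i1) (RintegralZl b mO i2) (RintegralZl kappa mO i3) (RintegralZl C2 mO i4).
by rewrite -addrA -opprD subr_le0.
Qed.

End Bernstein.

(** * Sobolev's inequality for powers of the gradient *)

Section CompactSupport.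
Context {R : realType} {d : nat} {M : riemannian R d}.
Variables (O : set M).
Hypothesis oO : open O.

(** The product vanishes near the boundary, so both it and its opposite are admissible, and the
    divergence inequality becomes an equality. *)
Lemma compact_support_admissible (v : M -> R) (Y : M -> 'rV[R]_d) (K : set M) :
  Ck_fun 1 O v -> Ck_field 1 O Y -> compact K -> K `<=` O -> (forall p, ~ K p -> Y p = 0) ->
  admissible O (fun p => v p *: Y p).
Proof.
move=> hv hY cK KO Y0.
have clK : closed K by apply: compact_closed cK; exact: mspace_hausdorff.
have oK : open (~` K) by rewrite openC.
have Z1 : Ck_field 1 O (fun p => v p *: Y p) by exact: Ck_fieldZ.
have near0 p : ~ O p -> \forall q \near p, v q *: Y q = 0.
  move=> nO; have : nbhs p (~` K) by apply: open_nbhs_nbhs; split => // /KO.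
  by apply: filterS => q nK; rewrite Y0 // scaler0.
have fld0 c q i : v q *: Y q = 0 -> cdom c q -> fld c (fun p => v p *: Y p) (cfun c q) 0 i = 0.
  by move=> E cq; rewrite fld_cfun // E /tcomp mul0mx mxE.
split=> //.
- move=> c p ac cp; have [Op|nO] := pselect (O p); last first.
    exists 0; apply: filterS2 (near0 p nO) (near_cdom cp) => q E cq _ i.
    by rewrite fld0 // normr0.
  have ci i : {for cfun c p, continuous (fun y => fld c (fun p => v p *: Y p) y 0 i)}.
    exact: (@Ck_continuous _ _ 1%N _ _ (Ck_field_fld i Z1 ac) _ (chart_image_cfun cp Op)).
  pose C i := `|fld c (fun p => v p *: Y p) (cfun c p) 0 i| + 1.
  exists (\sum_i C i).
  have h i := near_cfun cp (continuous_near_bounded (ci i)).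
  have := @filter_forall _ _ (fun i q => `|fld c (fun p => v p *: Y p) (cfun c q) 0 i| <= C i) (nbhs p) _ h.
  move=> /(_ (nbhs_filter p)); apply: filterS => q hq _ i; apply: le_trans (hq i) _.
  by rewrite (bigD1 i) //= lerDl sumr_ge0 // => j _; rewrite addr_ge0.
- move=> p; have [Op|nO] := pselect (O p).
    exists (`|divergence (fun p => v p *: Y p) p| + 1).
    have := continuous_near_bounded (divergence_continuous oO Z1 Op).
    by apply: filterS => q.
  exists 0; have : nbhs p (~` K) by apply: open_nbhs_nbhs; split => // /KO.
  apply: filterS => q nK _; rewrite (@divergence0 _ _ _ (~` K)) ?normr0 //.
  by move=> z nz; rewrite Y0 // scaler0.
- move=> c k p [[_ bc] _] cp pk e e0; have nO : ~ O p.
    by have [_ nI] := (bc p cp).2 pk => Op; apply: nI; exact: open_nbhs_nbhs.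
  apply: filterS2 (near0 p nO) (near_cdom cp) => q E cq _.
  by rewrite fld0 // ltW.
Qed.

End CompactSupport.

Section WeakGradient.
Context {R : realType} {d : nat} {M : riemannian R d}.
Variables (vol : {measure set (borel M) -> \bar R}) (O : set M) (u : M -> R) (nu : M -> 'rV[R]_d).
Hypothesis volP : riemannian_volume vol.
Hypotheses (d0 : (0 < d)%N) (oO : open O) (cO : compact (closure O)) (volO : (vol O < +oo)%E).
Hypotheses (hu : Ck_fun 3 O u) (huc : Ck_fun_closure 2 O u).
Hypotheses (nuP : outward_unit_normal O nu).
Let w := wgrad u.
Local Notation bmO f := (bmeasurable (O : set (borel M)) (f : borel M -> R)).
Let mO : measurable (O : set (borel M)). Proof. exact: borel_open. Qed.

Variable m : R.
Hypothesis m4 : 4 <= m.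
Let m3 : 3 <= m. Proof. by apply: le_trans m4; rewrite ler_nat. Qed.
Let m2 : 2 <= m. Proof. by apply: le_trans m4; rewrite ler_nat. Qed.
Let m13 : 3 <= m - 1. Proof. by rewrite lerBrDr natr1. Qed.
Let m12 : 2 <= m - 1. Proof. by apply: le_trans m13; rewrite ler_nat. Qed.

(** The condition m >= 4 leaves the exponent m - 1 of the gradient at least 3, where [ppow] of w is
    C^1. *)
Definition wpow p : R := ppow m (w p).
(** Chain rule with grad w = 2 D_X X. *)
Definition wpow_grad p : 'rV[R]_d := (2 * m * ppow (m - 1) (w p)) *: accel u p.

Let scal_C1 : Ck_fun 1 O (fun p => 2 * m * ppow (m - 1) (w p)).
Proof.
move=> c ac; have oU : open (chart_image c O) by exact: open_chart_image.
by apply: (Ck_mul oU); [exact: Ck_cst|exact: (ppow_Ck1 oO hu m13 ac)].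
Qed.

Let gradC : Ck_field 1 O wpow_grad.
Proof. by apply: Ck_fieldZ => //; exact: accelC1. Qed.

Let CV_grad c p i : atlas c -> cdom c p -> CV O (fun q => fld c wpow_grad (cfun c q) 0 i) p.
Proof.
move=> ac cp.
apply: (@CV_O _ _ _ O p (fun q => 2 * m * ppow (m - 1) (w q) * fld c (accel u) (cfun c q) 0 i)).
  apply: filterS (near_cdom cp) => q cq Oq.
  by rewrite (fldZ _ (fun p => 2 * m * ppow (m - 1) (w p))) mxE cfunK.
apply: CV_mul; last exact: (CV_accel oO hu huc).
by apply: CV_mul; [exact: CV_cst|exact: (CV_ppow oO hu huc)].
Qed.

Let wpow_tame : tame O wpow.
Proof.
apply: tame_Ck_fun; last by move=> p; exact: (CV_ppow oO hu huc).
by move=> c ac; apply: CkW; exact: (ppow_Ck1 oO hu m3 ac).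
Qed.

Let continuous_tame (f : M -> R) : (forall p, {for p, continuous f}) -> tame O f.
Proof.
move=> cf; split=> p; first by move=> _; exact: cf.
by exists (f p); exact: CV_continuous.
Qed.

(** The divergence inequality for wpow Y and for - wpow Y gives that the integral of div (wpow Y) is
    zero; the product rule then yields the defining identity. *)
Lemma wpow_weak_gradient : weak_gradient vol O wpow wpow_grad.
Proof.
move=> Y sY [K [cK KO Y0]].
have YT : Ck_field 1 setT Y := sY 1%N.
have YO : Ck_field 1 O Y by move=> c ac i; apply: CkSub (YT c ac i); exact: chart_imageS.
have vC : Ck_fun 1 O wpow by exact: ppow_Ck1.
have nvC : Ck_fun 1 O (fun p => - wpow p).
  move=> c ac; have oU : open (chart_image c O) by exact: open_chart_image.
  by apply: (Ck_opp oU); exact: (vC c ac).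
have a1 := compact_support_admissible oO vC YO cK KO Y0.
have a2 := compact_support_admissible oO nvC YO cK KO Y0.
have E p : O p -> divergence (fun p => wpow p *: Y p) p =
    wpow p * divergence Y p + inner p (wpow_grad p) (Y p).
  move=> Op; rewrite (divergenceZ oO Op vC YO) (dirD_ppow oO hu Op Y m2); congr (_ + _).
  by rewrite /wpow_grad innerZl; ring.
have EN p : O p -> divergence (fun p => - wpow p *: Y p) p =
    - divergence (fun p => wpow p *: Y p) p.
  move=> Op; have V1 : Ck_field 1 O (fun p => wpow p *: Y p) by exact: Ck_fieldZ.
  have V2 : Ck_field 1 O (fun p => - wpow p *: Y p) by exact: Ck_fieldZ.
  apply/eqP; rewrite -addr_eq0 -(divergenceD oO Op V2 V1); apply/eqP.
  by apply: (@divergence0 _ _ _ O) => // q _; rewrite scaleNr addNr.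
have b1 : bmO (fun p => wpow p * divergence Y p).
  apply: bmeasurable_mul; first exact: (tame_bmeasurable oO cO wpow_tame).
  apply: (tame_bmeasurable oO cO); apply: continuous_tame => p.
  exact: (divergence_continuous openT YT I).
have b2 : bmO (fun p => inner p (wpow_grad p) (Y p)).
  apply: (tame_bmeasurable oO cO); apply: tame_inner => //.
  - by move=> c ac i; apply: CkW; exact: gradC.
  - by move=> c ac i; apply: CkW; exact: YO.
  - move=> c p i ac cp.
    by apply: (@CV_Ck _ _ _ O c p cp (fun y => fld c Y y 0 i) 1); exact: (@Ck_field_fld _ _ _ 1).
have i1 := bmeasurable_rintegrable mO volO b1; have i2 := bmeasurable_rintegrable mO volO b2.
have one := outward_one_sided nuP.
have h1 := divergence_le0 volP d0 oO cO volO one a1.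
have h2 := divergence_le0 volP d0 oO cO volO one a2.
have E1 : \int[vol]_(p in O) divergence (fun p => wpow p *: Y p) p =
   \int[vol]_(p in O) (wpow p * divergence Y p) + \int[vol]_(p in O) inner p (wpow_grad p) (Y p).
  rewrite -(RintegralD mO i1 i2); apply: eq_Rintegral => p /set_mem; exact: E.
have E2 : \int[vol]_(p in O) divergence (fun p => - wpow p *: Y p) p =
   - \int[vol]_(p in O) divergence (fun p => wpow p *: Y p) p.
  rewrite -mulN1r -(RintegralZl _ mO (admissible_rintegrable oO cO volO a1)).
  by apply: eq_Rintegral => p /set_mem Op; rewrite EN // mulN1r.
have E3 : \int[vol]_(p in O) (wpow p * divergence Y p) = - \int[vol]_(p in O) inner p (wpow_grad p) (Y p).
  apply/eqP; rewrite -addr_eq0 -E1 eq_le h1 /=; move: h2; rewrite E2 oppr_le0.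
  by [].
have F1 : (\int[vol]_(p in O) (wpow p * divergence Y p)%:E)%E \is a fin_num by exact: integrable_fin_num.
have F2 : (\int[vol]_(p in O) (inner p (wpow_grad p) (Y p))%:E)%E \is a fin_num by exact: integrable_fin_num.
by rewrite -(fineK F1) -(fineK F2) -EFinN; congr (_%:E).
Qed.

Lemma wpow_bmeasurable : bmO wpow. Proof. exact: (tame_bmeasurable oO cO wpow_tame). Qed.

Lemma tnorm_grad_bmeasurable : bmO (fun p => tnorm p (wpow_grad p)).
Proof.
have h : bmO (fun p => inner p (wpow_grad p) (wpow_grad p)).
  apply: (tame_bmeasurable oO cO); apply: tame_inner => //; try exact: CV_grad.
    by move=> c ac i; apply: CkW; exact: gradC.
  by move=> c ac i; apply: CkW; exact: gradC.
apply: (@bmeasurable_eq _ _ _ (O : set (borel M)) (fun p => inner p (wpow_grad p) (wpow_grad p) `^ 2^-1)).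
  by move=> p _; rewrite powR12_sqrt // inner_ge0.
by apply: bmeasurable_powR => // p _; exact: inner_ge0.
Qed.

Let bmeasurable_norm_rintegrable (f : M -> R) (e : R) : 0 < e -> bmO f ->
  rintegrable vol (O : set (borel M)) (fun p => `|f p| `^ e).
Proof.
move=> e0 bf; apply: bmeasurable_rintegrable => //; apply: bmeasurable_powR => //; first exact: ltW.
exact: bmeasurable_norm.
Qed.

Lemma wpow_W12 : W12 vol O wpow wpow_grad.
Proof.
have two0 : (0 : R) < 2 by [].
split; last exact: wpow_weak_gradient.
- split; first by have [] := wpow_bmeasurable.
  move=> c ac i; have oD : open (O `&` cdom c) by apply: openI => //; exact: cdom_open.
  apply: (cont_measurable oD) => p [Op cp].
  apply: (@continuous_chart _ _ _ c _ (fun y => fld c wpow_grad y 0 i) p cp).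
    exact: (@Ck_continuous _ _ 1%N _ _ (Ck_field_fld i gradC ac) _ (chart_image_cfun cp Op)).
  by apply: filterS (near_cdom cp) => q cq; rewrite fld_cfun.
- by rewrite /Lp_norm (LnormE mO two0 (bmeasurable_norm_rintegrable two0 wpow_bmeasurable)) ltry.
- by rewrite /Lp_norm_field /Lp_norm (LnormE mO two0 (bmeasurable_norm_rintegrable two0 tnorm_grad_bmeasurable)) ltry.
Qed.

Lemma sobolev_wpow (S e : R) : 0 < e -> sobolev_constant vol O S ->
  e = 2 * d%:R / (d%:R - 2) ->
  (\int[vol]_(p in O) (w p `^ (m * e))) `^ e^-1 <=
  S * ((\int[vol]_(p in O) (4 * m ^+ 2 * (w p `^ (2 * (m - 1)) * a2 u p))) `^ 2^-1 +
       (\int[vol]_(p in O) (w p `^ (2 * m))) `^ 2^-1).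
Proof.
move=> e0 [S0 hS] eE; have two0 : (0 : R) < 2 by [].
have mp : 0 < m by apply: lt_le_trans m4.
have m1p : 0 < m - 1 by apply: lt_le_trans m13.
have := hS _ _ wpow_W12; rewrite -eE /Lp_norm_field /Lp_norm.
rewrite (LnormE mO e0 (bmeasurable_norm_rintegrable e0 wpow_bmeasurable)) (LnormE mO two0 (bmeasurable_norm_rintegrable two0 wpow_bmeasurable)).
rewrite (LnormE mO two0 (bmeasurable_norm_rintegrable two0 tnorm_grad_bmeasurable)) -EFinD -EFinM lee_fin.
have w0 p : 0 <= w p by exact: wgrad_ge0.
have E1 x : \int[vol]_(p in O) (`|wpow p| `^ x) = \int[vol]_(p in O) (w p `^ (m * x)).
  apply: eq_Rintegral => p _; rewrite ger0_norm ?ppow_ge0 // /wpow ppowE //.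
  by rewrite -powRrM.
rewrite !E1 [m * 2]mulrC.
have -> : \int[vol]_(p in O) (`|tnorm p (wpow_grad p)| `^ 2) =
   \int[vol]_(p in O) (4 * m ^+ 2 * (w p `^ (2 * (m - 1)) * a2 u p)).
  apply: eq_Rintegral => p _; rewrite ger0_norm ?sqrtr_ge0 // powR_mulrn ?sqrtr_ge0 //.
  rewrite /tnorm sqr_sqrtr ?inner_ge0 // /wpow_grad innerZl innerZr -/(a2 u p).
  rewrite ppowE //; have -> : w p `^ (2 * (m - 1)) = w p `^ (m - 1) * w p `^ (m - 1).
    by rewrite mulrC powRrM powR_mulrn ?powR_ge0 // expr2.
  by ring.
by [].
Qed.

End WeakGradient.

(** * Closing the estimate *)

Section Absorption.
Context {R : realType}.

(** If 4 K F is at most N^(1 / (b + 1)) the product is at most N / 4; otherwise N^(b / (b + 1)) is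
    at most (4 K F)^b. *)
Lemma absorb_power (b K F N : R) : 0 < b -> 0 <= K -> 0 <= F -> 0 <= N ->
  K * F * N `^ (b / (b + 1)) <= N / 4 + (4 * K * F) `^ (b + 1).
Proof.
move=> b0 K0 F0 N0; pose z := 4 * K * F; have z0 : 0 <= z by rewrite !mulr_ge0.
have b1 : 0 < b + 1 by rewrite addr_gt0.
have b1n : b + 1 != 0 by rewrite gt_eqF.
have E : b / (b + 1) = (b + 1)^-1 * b by rewrite mulrC.
have KE : K * F = z / 4 by rewrite /z; field.
rewrite KE -/z; have [h|h] := leP z (N `^ (b + 1)^-1).
  have : z * N `^ (b / (b + 1)) <= N.
    apply: (@le_trans _ _ (N `^ (b + 1)^-1 * N `^ (b / (b + 1)))).
      by rewrite ler_wpM2r // powR_ge0.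
    rewrite -powRD; last by rewrite -{1}[(b + 1)^-1]mul1r -mulrDl addrC divff // oner_eq0.
    by rewrite -{1}[(b + 1)^-1]mul1r -mulrDl addrC divff // powRr1.
  by have := powR_ge0 z (b + 1); lra.
have h2 : N `^ (b / (b + 1)) <= z `^ b.
  rewrite E powRrM; apply: ge0_ler_powR; rewrite ?nnegrE ?powR_ge0 //.
  - exact: ltW.
  - exact: ltW.
have h3 : z * N `^ (b / (b + 1)) <= z `^ (b + 1).
  apply: (@le_trans _ _ (z * z `^ b)); first by rewrite ler_wpM2l.
  by rewrite -(mulr_powRB1 z0 b1) addrK.
by have := powR_ge0 z (b + 1); lra.
Qed.

(** T is where the two powers balance, T^(gamma - 1) = e / k. Above T the higher power wins because
    gamma > 1; below T the left side is at most its value at T. *)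
Lemma absorb_growth (b gamma e k : R) : 0 < b -> 1 < gamma -> 0 <= e -> 0 < k ->
  exists2 C : R, 0 <= C & forall w, 0 <= w -> e * w `^ (b + 1) <= k * w `^ (b + gamma) + C.
Proof.
move=> b0 g1 e0 k0; pose T := (e / k) `^ (gamma - 1)^-1.
have g0 : 0 < gamma - 1 by rewrite subr_gt0.
have b1 : 0 < b + 1 by rewrite addr_gt0.
have TT : T `^ (gamma - 1) = e / k.
  by rewrite -powRrM mulVf ?gt_eqF // powRr1 // divr_ge0 // ltW.
exists (e * T `^ (b + 1)); first by rewrite mulr_ge0 // powR_ge0.
move=> w w0; have [wT|Tw] := leP w T.
  apply: (@le_trans _ _ (e * T `^ (b + 1))).
    rewrite ler_wpM2l //; apply: ge0_ler_powR; rewrite ?nnegrE ?powR_ge0 //; exact: ltW.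
  by rewrite lerDr mulr_ge0 ?powR_ge0 // ltW.
apply: (@le_trans _ _ (k * w `^ (b + gamma))); last first.
  by rewrite lerDl mulr_ge0 // powR_ge0.
have -> : b + gamma = (b + 1) + (gamma - 1) by ring.
rewrite [w `^ (b + 1 + (gamma - 1))]powRD; last by rewrite gt_eqF // addr_gt0.
rewrite mulrCA [leLHS]mulrC ler_wpM2l ?powR_ge0 //.
rewrite -ler_pdivrMl // mulrC -TT; apply: ge0_ler_powR; rewrite ?nnegrE ?powR_ge0 //; exact: ltW.
Qed.

(** The threshold is the solution of t = K^(-1) t^(s / D). With t = |B|^2 and D the dimension, small
    values of the drift act as a constant, and large ones carry the factor 1 / K, free to be made
    small because s > D. *)
Lemma split_power (D s K t : R) : 0 < D -> D < s -> 0 < K -> 0 <= t ->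
  t <= K `^ (D / (s - D)) + K^-1 * t `^ (s / D).
Proof.
move=> D0 Ds K0 t0; pose L := K `^ (D / (s - D)).
have sD : 0 < s - D by rewrite subr_gt0.
have [h|h] := leP t L; first by rewrite -[leLHS]addr0 lerD // mulr_ge0 ?powR_ge0 // invr_ge0 ltW.
apply: (@le_trans _ _ (K^-1 * t `^ (s / D))); last by rewrite lerDr powR_ge0.
have s0 : 0 < s by apply: lt_trans Ds.
have sD0 : 0 < s / D by rewrite divr_gt0.
rewrite -(mulr_powRB1 t0 sD0) mulrCA -[leLHS]mulr1 ler_wpM2l //.
rewrite ler_pdivlMl // mulr1.
have KE : K = L `^ (s / D - 1).
  rewrite /L -powRrM; have -> : D / (s - D) * (s / D - 1) = 1 by field; rewrite !gt_eqF.
  by rewrite powRr1 // ltW.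
rewrite KE; apply: ge0_ler_powR; rewrite ?nnegrE ?powR_ge0 //; last exact: ltW.
by rewrite subr_ge0 ler_pdivlMr // mul1r ltW.
Qed.

Lemma sqr_sobolev (x S sigma a c : R) : 0 <= x -> 0 < S -> S <= sigma -> 0 <= a -> 0 <= c ->
  x <= S * (a `^ 2^-1 + c `^ 2^-1) -> x ^+ 2 <= 2 * sigma ^+ 2 * (a + c).
Proof.
move=> x0 S0 Ss a0 c0; rewrite !powR12_sqrt // => h.
have sa := sqr_sqrtr a0; have sc := sqr_sqrtr c0.
have ga := sqrtr_ge0 a; have gc := sqrtr_ge0 c.
set y := Num.sqrt a in h sa ga; set z := Num.sqrt c in h sc gc.
have h1 : x <= sigma * (y + z) by apply: le_trans h _; rewrite ler_wpM2r // addr_ge0.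
have h2 : x ^+ 2 <= (sigma * (y + z)) ^+ 2.
  by rewrite ler_sqr ?nnegrE // mulr_ge0 ?addr_ge0 // (le_trans (ltW S0)).
apply: le_trans h2 _; rewrite exprMn -sa -sc.
have : 0 <= sigma ^+ 2 * (y - z) ^+ 2 by rewrite mulr_ge0 // sqr_ge0.
by rewrite -subr_ge0 => h3; rewrite -subr_ge0; apply: le_trans h3 _; rewrite le_eqVlt; apply/orP; left; apply/eqP; ring.
Qed.

(** Drift and data cost a quarter of N each; half of N survives, whence the two factors 2. *)
Lemma absorb_arith (N K1 c1 C2 kappa L sg J A E FO Ki T FF Z P : R) :
  K1 * (c1 * J + A) <= K1 * (kappa * E + C2 * FO) -> N <= K1 * A + sg * E ->
  K1 * C2 * FO <= K1 * C2 * (2 * L * E + 2 * Ki * T + 2 * FF) ->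
  K1 * C2 * (2 * Ki * T) = N / 4 ->
  2 * K1 * C2 * FF <= N / 4 + Z ->
  (K1 * (kappa + 2 * C2 * L) + sg) * E - K1 * c1 * J <= P -> N <= 2 * P + 2 * Z.
Proof. by move=> h1 h2 h3 h4 h5 h6; lra. Qed.

End Absorption.

Lemma hoelder_powR dd (T : measurableType dd) (R : realType) (m : {measure set T -> \bar R})
    (D : set T) (g h : T -> R) (a e p q : R) : measurable D -> (m D < +oo)%E ->
  bmeasurable D g -> bmeasurable D h -> (forall x, D x -> 0 <= g x) -> (forall x, D x -> 0 <= h x) ->
  0 <= a -> 0 <= e -> 0 < p -> 0 < q -> p^-1 + q^-1 = 1 ->
  \int[m]_(x in D) (g x `^ a * h x `^ e) <=
  (\int[m]_(x in D) (g x `^ (a * p))) `^ p^-1 * (\int[m]_(x in D) (h x `^ (e * q))) `^ q^-1.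
Proof.
move=> mD mDoo bg bh g0 h0 a0 e0 p0 q0 pq.
have := @hoelder_bmeasurable _ _ _ m D mD mDoo _ _ p q (bmeasurable_powR a0 g0 bg) (bmeasurable_powR e0 h0 bh)
  (fun x _ => powR_ge0 (g x) a) (fun x _ => powR_ge0 (h x) e) p0 q0 pq.
have E (k : T -> R) (x y : R) : \int[m]_(z in D) ((k z `^ x) `^ y) = \int[m]_(z in D) (k z `^ (x * y)).
  by apply: eq_Rintegral => z _; rewrite powRrM.
move/le_trans; apply; rewrite le_eqVlt; apply/orP; left; apply/eqP.
exact: (f_equal2 (fun x y : R => x `^ p^-1 * y `^ q^-1) (E g a p) (E h e q)).
Qed.

(** * The closing argument on an abstract measure space *)

Section IntegralClosure.
Context dd (T : measurableType dd) (R : realType).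
Variables (m : {measure set T -> \bar R}) (D : set T).
(** In the application w = |grad u|^2, al = |D_X X|^2, fo is the force, be = |B|^2 and n is the
    dimension. Geometry enters only through the inequalities assumed below, so the constants cannot
    depend on the manifold. *)
Variables (w al fo f be : T -> R) (n b r s gamma kappa rho sigma theta : R).
Hypotheses (mD : measurable D) (mDrho : (m D <= rho%:E)%E).
Hypotheses (bw : bmeasurable D w) (bfo : bmeasurable D fo) (bf : bmeasurable D f) (bbe : bmeasurable D be).
Hypotheses (w0 : forall x, 0 <= w x) (be0 : forall x, 0 <= be x).
Hypothesis fo_le : forall x, D x -> fo x ^+ 2 <= 2 * (be x * w x + f x ^+ 2).
Hypotheses (n3 : 3 <= n) (b0 : 0 < b) (gamma1 : 1 < gamma).
Hypotheses (sigma0 : 0 < sigma) (theta0 : 0 < theta) (ns : n < s).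
Hypothesis rE : r = 2 * n * (b + 1) / (n - 2).

Let mDoo : (m D < +oo)%E. Proof. by apply: le_lt_trans mDrho _; rewrite ltry. Qed.
Let n0 : 0 < n. Proof. by apply: lt_le_trans n3. Qed.
Let n2 : 0 < n - 2. Proof. by rewrite subr_gt0 (lt_le_trans _ n3) // ltr_nat. Qed.
Let b1 : 0 < b + 1. Proof. by rewrite addr_gt0. Qed.
Let s0 : 0 < s. Proof. exact: lt_trans n0 ns. Qed.
Let gam0 : 0 < gamma. Proof. exact: lt_trans ltr01 gamma1. Qed.
Let r0 : 0 < r. Proof. by rewrite rE divr_gt0 // !mulr_gt0. Qed.
Let ibw (e : R) : 0 <= e -> bmeasurable D (fun x => w x `^ e).
Proof. by move=> e0; apply: bmeasurable_powR. Qed.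

(** 1 / q = 1 / r + 1 / n, that is, r is the Sobolev conjugate of q. *)
Let q := r * n / (n + r).
(** As r / 2 = (b + 1) n / (n - 2), this is the square of the norm of w^((b + 1) / 2) in L^(2 n / (n
    - 2)), the left side of Sobolev's inequality. *)
Let N := (\int[m]_(x in D) (w x `^ (r / 2))) `^ ((n - 2) / n).
Let F := (\int[m]_(x in D) (`|f x| `^ q)) `^ q^-1.
Let E := \int[m]_(x in D) (w x `^ (b + 1)).
Let J := \int[m]_(x in D) (w x `^ (b + gamma)).
Let A := \int[m]_(x in D) (w x `^ (b - 1) * al x).

Let q0 : 0 < q. Proof. by rewrite divr_gt0 ?mulr_gt0 // addr_gt0. Qed.
Let N0 : 0 <= N. Proof. exact: powR_ge0. Qed.

Hypothesis be_le : \int[m]_(x in D) (be x `^ (s / 2)) <= theta `^ s.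

Let Theta := (theta `^ s) `^ (2 / n).
Let Theta0 : 0 < Theta. Proof. by rewrite !powR_gt0. Qed.

(** Exponents n / 2 and n / (n - 2): the power s / n of |B|^2 becomes |B|^s, and the power of w is
    the one in N. *)
Lemma drift_holder :
  \int[m]_(x in D) (be x `^ (s / n) * w x `^ (b + 1)) <= Theta * N.
Proof.
have p0 : 0 < n / 2 by rewrite divr_gt0.
have q0' : 0 < n / (n - 2) by rewrite divr_gt0.
have nn : n != 0 by rewrite gt_eqF.
have n2n : n - 2 != 0 by rewrite gt_eqF.
have pq : (n / 2)^-1 + (n / (n - 2))^-1 = 1 by rewrite !invf_div; field.
have sd : 0 <= s / n by rewrite divr_ge0 // ltW.
have := hoelder_powR mD mDoo bbe bw (fun x _ => be0 x) (fun x _ => w0 x) sd (ltW b1) p0 q0' pq.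
have -> : s / n * (n / 2) = s / 2 by field.
have -> : (b + 1) * (n / (n - 2)) = r / 2 by rewrite rE; field.
rewrite !invf_div -/N => h; apply: le_trans h _.
rewrite ler_wpM2r //; apply: ge0_ler_powR => //; rewrite ?nnegrE ?powR_ge0 //.
- by rewrite divr_ge0 // ltW.
- by apply: Rintegral_ge0 => p _; exact: powR_ge0.
Qed.

(** The exponents q / 2 and r / (2 b) are conjugate precisely for this q. The power of N that
    results is below 1, so it can be absorbed. *)
Lemma rhs_holder : \int[m]_(x in D) (f x ^+ 2 * w x `^ b) <= F ^+ 2 * N `^ (b / (b + 1)).
Proof.
have p0 : 0 < q / 2 by rewrite divr_gt0.
have q0' : 0 < r / (2 * b) by rewrite divr_gt0 // mulr_gt0.
have dr : n + r != 0 by rewrite gt_eqF // addr_gt0.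
have rn : r != 0 by rewrite gt_eqF.
have dn : n != 0 by rewrite gt_eqF.
have bn : b != 0 by rewrite gt_eqF.
have b1n : b + 1 != 0 by rewrite gt_eqF.
have d2n : n - 2 != 0 by rewrite gt_eqF.
have qn : q != 0 by rewrite gt_eqF.
have r1 : 2 * n * (b + 1) = r * (n - 2) by rewrite rE; field.
have pq : (q / 2)^-1 + (r / (2 * b))^-1 = 1.
  have bE : b = (r * (n - 2) - 2 * n) / (2 * n) by rewrite -r1; field.
  rewrite /q !invf_div bE; field.
  by rewrite rn dn.
have := hoelder_powR mD mDoo (bmeasurable_norm bf) bw (fun x _ => normr_ge0 _) (fun x _ => w0 x)
  (ler0n _ 2) (ltW b0) p0 q0' pq.
have -> : 2 * (q / 2) = q by field.
have -> : b * (r / (2 * b)) = r / 2 by field.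
have -> : \int[m]_(p in D) (`|f p| `^ 2 * w p `^ b) = \int[m]_(p in D) (f p ^+ 2 * w p `^ b).
  by apply: eq_Rintegral => p _; rewrite powR_mulrn // real_normK ?num_real.
have -> : F ^+ 2 = (\int[m]_(p in D) (`|f p| `^ q)) `^ (q / 2)^-1.
  by rewrite /F -powR_mulrn ?powR_ge0 // -powRrM; congr (_ `^ _); field.
have -> : N `^ (b / (b + 1)) = (\int[m]_(p in D) (w p `^ (r / 2))) `^ (r / (2 * b))^-1.
  rewrite /N -powRrM; congr (_ `^ _).
  have -> : (n - 2) / n = 2 * (b + 1) / r.
    by apply/eqP; rewrite eqr_div // [n - 2]lock mulrC -lock -r1; apply/eqP; ring.
  by field; rewrite rn bn b1n.
by [].
Qed.

Variables (c1 C2 C3 : R).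
Hypotheses (C20 : 0 < C2) (C30 : 0 <= C3).
Hypothesis bern : c1 * J + b * A <= kappa * E + C2 * \int[m]_(x in D) (fo x ^+ 2 * w x `^ b).
Hypothesis sob : N <= 2 * sigma ^+ 2 * ((b + 1) ^+ 2 * A + E).

(** K1 b is the coefficient of A in Sobolev's inequality, so K1 times the Bernstein inequality can
    be inserted there. Lam is the threshold of [split_power] for K = 8 K1 C2 Theta, the value for
    which the drift costs exactly N / 4. *)
Let K1 := 2 * sigma ^+ 2 * (b + 1) ^+ 2 / b.
Let Lam := (8 * K1 * C2 * Theta) `^ (n / (s - n)).
Hypothesis growth : forall x, 0 <= x ->
  (K1 * (kappa + 2 * C2 * Lam) + 2 * sigma ^+ 2) * x `^ (b + 1) <=
  K1 * c1 * x `^ (b + gamma) + C3.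

Let K10 : 0 < K1. Proof. by rewrite divr_gt0 // !mulr_gt0 // exprn_gt0. Qed.
Let M0 : 0 < 8 * K1 * C2 * Theta.
Proof. by apply: mulr_gt0 Theta0; apply: mulr_gt0 C20; apply: mulr_gt0 K10. Qed.

(** N is a real number, as w is bounded and D has finite measure, so multiples of N can be moved to
    the left. By [growth] the terms in w^(b + 1) are dominated pointwise, up to C3, whose integral
    is at most C3 rho. *)
Lemma closed_estimate :
  N <= 2 * C3 * rho + 2 * (4 * (2 * K1 * C2) * F ^+ 2) `^ (b + 1).
Proof.
have sn : 0 <= s / n by rewrite divr_ge0 // ltW.
have i1 : rintegrable m D (fun x => w x `^ (b + 1)) by apply: bmeasurable_rintegrable => //; apply: ibw; exact: ltW.
have i2 : rintegrable m D (fun x => w x `^ (b + gamma)).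
  by apply: bmeasurable_rintegrable => //; apply: ibw; rewrite addr_ge0 // ltW.
have i3 : rintegrable m D (fun x => be x `^ (s / n) * w x `^ (b + 1)).
  by apply: bmeasurable_rintegrable => //; apply: bmeasurable_mul; [exact: bmeasurable_powR|apply: ibw; exact: ltW].
have i4 : rintegrable m D (fun x => f x ^+ 2 * w x `^ b).
  by apply: bmeasurable_rintegrable => //; apply: bmeasurable_mul; [exact: bmeasurable_mul|apply: ibw; exact: ltW].
have i5 : rintegrable m D (fun x => fo x ^+ 2 * w x `^ b).
  by apply: bmeasurable_rintegrable => //; apply: bmeasurable_mul; [exact: bmeasurable_mul|apply: ibw; exact: ltW].
pose Ki := (8 * K1 * C2 * Theta)^-1.
have j1 := rintegrableZ mD (2 * Lam) i1; have j3 := rintegrableZ mD (2 * Ki) i3; have j4 := rintegrableZ mD 2 i4.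
have j13 := rintegrableD mD j1 j3; have j134 := rintegrableD mD j13 j4.
have G : \int[m]_(x in D) (fo x ^+ 2 * w x `^ b) <=
    2 * Lam * E + 2 * Ki * \int[m]_(x in D) (be x `^ (s / n) * w x `^ (b + 1)) +
    2 * \int[m]_(x in D) (f x ^+ 2 * w x `^ b).
  rewrite /E -(RintegralZl _ mD i1) -(RintegralZl _ mD i3) -(RintegralZl _ mD i4).
  rewrite -(RintegralD mD j1 j3) -(RintegralD mD j13 j4).
  apply: (le_Rintegral mD i5 j134) => x Dx.
  have wE : w x * w x `^ b = w x `^ (b + 1) by rewrite -(mulr_powRB1 (w0 x) b1) addrK.
  have wb0 : 0 <= w x `^ b by exact: powR_ge0.
  have wb1 : 0 <= w x `^ (b + 1) by exact: powR_ge0.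
  have h1 := ler_wpM2r wb0 (fo_le Dx).
  have h2 := ler_wpM2r wb1 (split_power n0 ns M0 (be0 x)).
  have e1 : 2 * (be x * w x + f x ^+ 2) * w x `^ b =
    2 * (be x * w x `^ (b + 1)) + 2 * (f x ^+ 2 * w x `^ b) by rewrite -wE; ring.
  have h3 : be x * w x `^ (b + 1) <=
    Lam * w x `^ (b + 1) + Ki * (be x `^ (s / n) * w x `^ (b + 1)).
    by rewrite [Ki * (_ * _)]mulrA -mulrDl; exact: h2.
  apply: le_trans h1 _; rewrite e1 lerD2r -[2 * Lam * _]mulrA -[2 * Ki * _]mulrA -mulrDr.
  by rewrite ler_wpM2l.
have H4 := drift_holder; have H5 := rhs_holder.
have Ki0 : 0 < Ki by rewrite invr_gt0; exact: M0.
have F0 : 0 <= F ^+ 2 by exact: sqr_ge0.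
have K50 : 0 <= 2 * K1 * C2.
  by apply: ltW; apply: mulr_gt0 C20; apply: mulr_gt0 K10; exact: ltr0n.
have H6 := absorb_power b0 K50 F0 N0.
have H7 : (K1 * (kappa + 2 * C2 * Lam) + 2 * sigma ^+ 2) * E - K1 * c1 * J <= C3 * rho.
  have ic : rintegrable m D (fun=> C3) by apply: bmeasurable_rintegrable => //; exact: bmeasurable_cst.
  have k1 := rintegrableZ mD (K1 * (kappa + 2 * C2 * Lam) + 2 * sigma ^+ 2) i1.
  have k2 := rintegrableZ mD (K1 * c1) i2.
  rewrite lerBlDl /E /J -(RintegralZl _ mD i1) -(RintegralZl _ mD i2).
  apply: (@le_trans _ _ (\int[m]_(x in D) (K1 * c1 * w x `^ (b + gamma) + C3))).
    by apply: (le_Rintegral mD k1 (rintegrableD mD k2 ic)) => x _; exact: growth.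
  rewrite (RintegralD mD k2 ic) (Rintegral_cst m mD) lerD2l ler_wpM2l //.
  have mfin : m D \is a fin_num by rewrite ge0_fin_numE.
  by rewrite -lee_fin fineK.
have KK : K1 * C2 * (2 * Ki * (Theta * N)) = N / 4.
  by rewrite /Ki; field; rewrite !gt_eqF.
have E0 : 0 <= E by apply: Rintegral_ge0 => x _; exact: powR_ge0.
have KC : 0 <= K1 * C2 by apply: ltW; apply: mulr_gt0 K10 C20.
have G1 : K1 * C2 * \int[m]_(x in D) (fo x ^+ 2 * w x `^ b) <=
   K1 * C2 * (2 * Lam * E + 2 * Ki * (Theta * N) + 2 * (F ^+ 2 * N `^ (b / (b + 1)))).
  rewrite ler_wpM2l //; apply: le_trans G _; apply: lerD.
    by rewrite lerD2l ler_wpM2l // mulr_ge0 // ltW.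
  by rewrite ler_wpM2l.
have K1b : K1 * b = 2 * sigma ^+ 2 * (b + 1) ^+ 2 by rewrite /K1 divfK // gt_eqF.
have B1 := ler_wpM2l (ltW K10) bern.
have S1 : N <= K1 * (b * A) + 2 * sigma ^+ 2 * E.
  by apply: le_trans sob _; rewrite mulrA K1b; lra.
rewrite -mulrA in H6; rewrite -[2 * C3 * rho]mulrA.
exact: (absorb_arith B1 S1 G1 KK H6 H7).
Qed.

End IntegralClosure.

Lemma sqr_sub_le (R : realFieldType) (x y z : R) :
  x ^+ 2 <= z -> (x - y) ^+ 2 <= 2 * (z + y ^+ 2).
Proof. by move=> h; have := sqr_ge0 (x + y); nra. Qed.

Section Estimate.
Context {R : realType} {d : nat} {M : riemannian R d}.
Variables (vol : {measure set (borel M) -> \bar R}) (O : set M) (u f : M -> R)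
  (nu B : M -> 'rV[R]_d).
Hypothesis volP : riemannian_volume vol.
Hypotheses (d3 : (3 <= d)%N) (oO : open O) (cO : compact (closure O)).
Hypotheses (hu : Ck_fun 3 O u) (huc : Ck_fun_closure 2 O u).
Hypotheses (nuP : outward_unit_normal O nu) (II : class_Oplus O nu).
Hypothesis neumann : forall p, bdry O p -> normal_derivative O nu u p = 0.
Variables (gamma kappa rho sigma theta r s S : R).
Hypotheses (gamma1 : 1 < gamma) (sigma0 : 0 < sigma) (theta0 : 0 < theta).
Hypothesis ds : d%:R < s.
Hypothesis volO : (vol O <= rho%:E)%E.
Hypothesis ricP : forall (x : M) (xi : 'rV[R]_d), O x ->
  - kappa * tnorm x xi ^+ 2 <= ricci x xi xi.
Hypothesis pde : forall x : M, O x ->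
  - laplacian u x + gamma^-1 * tnorm x (grad u x) `^ gamma + inner x (B x) (grad u x) = f x.
Hypotheses (hS : sobolev_constant vol O S) (Ss : S <= sigma).
Hypotheses (hf : Ck_fun 1 O f) (hfc : Ck_fun_closure 0 O f).
Hypotheses (hB : Ck_field 1 O B) (hBc : C0_field_closure O B).
Hypothesis hBs : (Lp_norm_field vol s O B <= theta%:E)%E.
Local Notation bmO f := (bmeasurable (O : set (borel M)) (f : borel M -> R)).
Let w := wgrad u.
(* chosen so that w^((b + 1) d / (d - 2)) = |grad u|^r *)
Let b := r * (d%:R - 2) / (2 * d%:R) - 1.
(** 4 d gamma is what the pointwise inequality asks for; the 7 gives (b + 1) / 2 >= 4, as the
    Sobolev step requires. *)
Hypothesis hb : 4 * d%:R * gamma + 7 <= b.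

Let d0 : (0 < d)%N. Proof. exact: leq_trans d3. Qed.
Let mO : measurable (O : set (borel M)). Proof. exact: borel_open. Qed.
Let volOoo : (vol O < +oo)%E. Proof. by apply: le_lt_trans volO _; rewrite ltry. Qed.
Let D0 : (0 : R) < d%:R. Proof. by rewrite ltr0n. Qed.
Let D3 : (3 : R) <= d%:R. Proof. by rewrite ler_nat. Qed.
Let D2 : (0 : R) < d%:R - 2. Proof. by rewrite subr_gt0 (lt_le_trans _ D3) // ltr_nat. Qed.
Let b4 : 4 * d%:R * gamma <= b. Proof. by apply: le_trans hb; rewrite lerDl. Qed.
Let b7 : 7 <= b.
Proof.
apply: le_trans hb; rewrite lerDr; apply: mulr_ge0; first by rewrite mulr_ge0.
by rewrite ltW // (lt_trans ltr01).
Qed.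
Let b_ge4 : 4 <= b. Proof. by apply: le_trans b7; rewrite ler_nat. Qed.
Let b0 : 0 < b. Proof. by apply: lt_le_trans b7. Qed.
Let b1 : 0 < b + 1. Proof. by rewrite addr_gt0. Qed.
Let r0 : 0 < r.
Proof.
have : 0 < r * ((d%:R - 2) / (2 * d%:R)) by rewrite mulrA; move: b1; rewrite /b subrK.
by rewrite pmulr_lgt0 // divr_gt0 // mulr_gt0.
Qed.
Let rE : r = 2 * d%:R * (b + 1) / (d%:R - 2).
Proof. by rewrite /b subrK; field; rewrite !gt_eqF. Qed.
Let w0 p : 0 <= w p. Proof. exact: wgrad_ge0. Qed.
Let bw (e : R) : 0 <= e -> bmO (fun p => w p `^ e).
Proof. by move=> e0; exact: (bmeasurable_wpow oO cO hu huc). Qed.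

Let wb : bmO w. Proof. exact: (tame_bmeasurable oO cO (w_tame oO hu huc)). Qed.

Lemma rhs_bmeasurable : bmO f.
Proof.
apply: (tame_bmeasurable oO cO); apply: tame_Ck_fun => [c ac|p]; first by apply: CkW; exact: hf.
have ac := chart_at_atlas p; have cp := chart_at_dom p.
have [clp|nc] := pselect (closure O p); last by exists 0; exact: CV_outside.
have [_ h] := hfc; have [l [hl _]] := @Ck_ext_cvg _ _ _ O _ 0%N _ p cp clp (h _ ac).
exists l; apply: (cvg_O _ hl); apply: filterS (near_cdom cp) => q cq _.
by rewrite /= cfunK.
Qed.

Definition drift2 p : R := inner p (B p) (B p).

Lemma drift2_bmeasurable : bmO drift2.
Proof.
apply: (tame_bmeasurable oO cO).
have hl c p i : atlas c -> cdom c p -> CV O (fun q => fld c B (cfun c q) 0 i) p.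
  move=> ac cp; have [clp|nc] := pselect (closure O p); last by exists 0; exact: CV_outside.
  have h : Ck_ext 0 (chart_image c O) (chart_image c (closure O)) (fun y => fld c B y 0 i).
    by split => //; exists (fun y => fld c B y 0 i) => //; have := @hBc c ac i; rewrite field_in_fld.
  by have [l [hl _]] := @Ck_ext_cvg _ _ _ O c 0%N _ p cp clp h; exists l.
by apply: tame_inner => // c ac i; apply: CkW; exact: hB.
Qed.

Let sobolev_step : (\int[vol]_(p in O) (w p `^ (r / 2))) `^ ((d%:R - 2) / d%:R) <=
  2 * sigma ^+ 2 * ((b + 1) ^+ 2 * (\int[vol]_(p in O) (w p `^ (b - 1) * a2 u p)) +
    \int[vol]_(p in O) (w p `^ (b + 1))).
Proof.
pose e := 2 * d%:R / (d%:R - 2) : R.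
have e0 : 0 < e by rewrite divr_gt0 // mulr_gt0.
(* With 2 m = b + 1 the gradient term carries w^(b - 1) |D_X X|^2, the same integral as in the
   Bernstein inequality. *)
pose m := (b + 1) / 2.
have m4 : 4 <= m by rewrite ler_pdivlMr // (_ : 4 * 2 = 7 + 1) ?lerD2r // -!natrM natr1.
have := sobolev_wpow volP d0 oO cO volOoo hu huc nuP m4 e0 hS erefl.
have [S0 _] := hS.
have -> : m * e = r / 2 by rewrite rE /m /e; field; rewrite gt_eqF.
have -> : 2 * (m - 1) = b - 1 by rewrite /m; field.
have -> : 2 * m = b + 1 by rewrite /m; field.
have -> : \int[vol]_(p in O) (4 * m ^+ 2 * (wgrad u p `^ (b - 1) * a2 u p)) = (b + 1) ^+ 2 * \int[vol]_(p in O) (w p `^ (b - 1) * a2 u p).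
  have ib : rintegrable vol (O : set (borel M)) (fun p => w p `^ (b - 1) * a2 u p).
    apply: bmeasurable_rintegrable => //; apply: bmeasurable_mul; last exact: (tame_bmeasurable oO cO (a2_tame oO hu huc)).
    by apply: bw; rewrite subr_ge0 (le_trans _ b_ge4) // ler1n.
  rewrite -(RintegralZl _ mO ib); apply: eq_Rintegral => p _.
  by rewrite /m; field.
move=> /(sqr_sobolev _ S0 Ss) h.
have -> : (d%:R - 2) / d%:R = e^-1 * 2 :> R by rewrite /e; field; rewrite !gt_eqF.
rewrite powRrM powR_mulrn ?powR_ge0 //; apply: h.
- exact: powR_ge0.
- by rewrite mulr_ge0 ?sqr_ge0 //; apply: Rintegral_ge0 => p _; rewrite mulr_ge0 ?powR_ge0 // a2_ge0.
- by apply: Rintegral_ge0 => p _; exact: powR_ge0.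
Qed.

Lemma drift2_ge0 p : 0 <= drift2 p. Proof. exact: inner_ge0. Qed.

Lemma force_le p : force u f B p ^+ 2 <= 2 * (drift2 p * w p + f p ^+ 2).
Proof.
have h : inner p (B p) (grad u p) ^+ 2 <= drift2 p * w p by exact: inner_cauchy_schwarz.
exact: sqr_sub_le h.
Qed.

Let q := r * d%:R / (d%:R + r).

Let q0 : 0 < q. Proof. by rewrite divr_gt0 ?mulr_gt0 // addr_gt0. Qed.

Lemma Lp_norm_rhs : Lp_norm vol q O f = ((\int[vol]_(p in O) (`|f p| `^ q)) `^ q^-1)%:E.
Proof.
apply: (LnormE mO q0); apply: bmeasurable_rintegrable => //; apply: bmeasurable_powR; [exact: ltW| |].
  by move=> p _; exact: normr_ge0.
by apply: bmeasurable_norm; exact: rhs_bmeasurable.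
Qed.

Lemma Lp_norm_grad :
  Lp_norm_field vol r O (grad u) = ((\int[vol]_(p in O) (w p `^ (r / 2))) `^ r^-1)%:E.
Proof.
have e : (fun p => `|tnorm p (grad u p)| `^ r) = (fun p => w p `^ (r / 2)).
  by apply/funext => p; rewrite ger0_norm ?sqrtr_ge0 // tnorm_powR.
have := @LnormE _ (borel M) _ vol O mO (fun p => tnorm p (grad u p)) r r0.
by rewrite e; apply; apply: bmeasurable_rintegrable => //; apply: bw; rewrite divr_ge0 // ltW.
Qed.

Let s0 : 0 < s. Proof. exact: lt_trans D0 ds. Qed.

Lemma drift_integral : \int[vol]_(p in O) (drift2 p `^ (s / 2)) <= theta `^ s.
Proof.
have e : (fun p => `|tnorm p (B p)| `^ s) = (fun p => drift2 p `^ (s / 2)).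
  apply/funext => p; rewrite ger0_norm ?sqrtr_ge0 // /tnorm -powR12_sqrt ?inner_ge0 //.
  by rewrite -powRrM mulrC.
have := @LnormE _ (borel M) _ vol O mO (fun p => tnorm p (B p)) s s0.
have := hBs; rewrite /Lp_norm_field /Lp_norm e => h1 h2; move: h1; rewrite h2.
  rewrite lee_fin => h3.
  set I := \int[_]_(_ in _) _ in h3 *.
  have I0 : 0 <= I by apply: Rintegral_ge0 => p _; exact: powR_ge0.
  have -> : I = (I `^ s^-1) `^ s by rewrite -powRrM mulVf ?gt_eqF // powRr1.
  by apply: ge0_ler_powR; rewrite ?nnegrE ?powR_ge0 //; exact: ltW.
apply: bmeasurable_rintegrable => //; apply: bmeasurable_powR; first by rewrite divr_ge0 // ltW.
  by move=> p _; exact: inner_ge0.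
exact: drift2_bmeasurable.
Qed.

Let K1 := 2 * sigma ^+ 2 * (b + 1) ^+ 2 / b.
Let C2 := 2 * d%:R + 1 + b.
Let Lam := (8 * K1 * C2 * (theta `^ s) `^ (2 / d%:R)) `^ (d%:R / (s - d%:R)).

Lemma gradient_power_estimate (C3 : R) : 0 <= C3 ->
  (forall x, 0 <= x -> (K1 * (kappa + 2 * C2 * Lam) + 2 * sigma ^+ 2) * x `^ (b + 1) <=
    K1 * (3 / (8 * d%:R * gamma ^+ 2)) * x `^ (b + gamma) + C3) ->
  (\int[vol]_(p in O) (w p `^ (r / 2))) `^ ((d%:R - 2) / d%:R) <=
  2 * C3 * rho +
  2 * (4 * (2 * K1 * C2) * ((\int[vol]_(p in O) (`|f p| `^ q)) `^ q^-1) ^+ 2) `^ (b + 1).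
Proof.
move=> C30 growth.
have C20 : 0 < C2 by rewrite addr_gt0 // addr_gt0 // mulr_gt0.
have bern := bernstein_integral volP d0 oO cO volOoo hu huc nuP II neumann gamma1 ricP pde b4 b_ge4.
exact: (closed_estimate mO volO wb (force_bmeasurable oO cO hu huc gamma1 pde) rhs_bmeasurable drift2_bmeasurable w0
  drift2_ge0 (fun p _ => force_le p) D3 b0 gamma1 sigma0 theta0 ds rE drift_integral
  C20 C30 bern sobolev_step growth).
Qed.

End Estimate.

Lemma exponent_cvg (R : realType) (n : R) : 0 < n ->
  (fun r => r * n / (n + r)) @ +oo --> n^'-.
Proof.
move=> n0 A [e /= e0 eA].
(* Since n - r n / (n + r) = n^2 / (n + r), this is below e once r exceeds n^2 / e. *)
exists (n ^+ 2 / e); split; first exact: num_real.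
move=> r hr; have r0 : 0 < r by apply: le_lt_trans hr; rewrite divr_ge0 ?sqr_ge0 // ltW.
have nr : 0 < n + r by rewrite addr_gt0.
have E : n - r * n / (n + r) = n ^+ 2 / (n + r) by field; rewrite gt_eqF.
have E0 : 0 < n - r * n / (n + r) by rewrite E divr_gt0 // exprn_gt0.
apply: (eA (r * n / (n + r))); last by rewrite -subr_gt0.
rewrite /= gtr0_norm // E ltr_pdivrMr //.
apply: (@lt_trans _ _ (e * r)); last by rewrite ltr_pM2l // ltrDr.
by rewrite mulrC -ltr_pdivrMr.
Qed.

(** The lower bound on r is the last inequality solved for r, up to strictness; it is large enough
    to force q > 1 as well, while q < n holds for every positive r. *)
Lemma exponent_bounds (R : realType) (n gamma r : R) : 3 <= n -> 1 < gamma ->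
  2 * n * (4 * n * gamma + 8) / (n - 2) < r ->
  [/\ 1 < r, 1 < r * n / (n + r), r * n / (n + r) < n &
      4 * n * gamma + 7 <= r * (n - 2) / (2 * n) - 1].
Proof.
move=> n3 g1; have n0 : 0 < n by apply: lt_le_trans n3.
have n2 : 0 < n - 2 by lra.
have ng : 0 < n * gamma by rewrite mulr_gt0 // (lt_trans ltr01).
rewrite ltr_pdivrMr // => h.
have r2 : 2 < r.
  rewrite -(ltr_pM2r n2); apply: le_lt_trans h; rewrite -[4 * n * gamma]mulrA.
  by have := mulr_gt0 n0 ng; nra.
have nr : 0 < n + r by lra.
split; first lra.
- by rewrite ltr_pdivlMr // mul1r; nra.
- by rewrite ltr_pdivrMr //; nra.
- by rewrite lerBrDr ler_pdivlMr ?mulr_gt0 //; nra.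
Qed.

(** Taking the root of order 2 beta turns the power (n - 2) / n into 1 / r, and (1 + F)^(2 beta)
    dominates both 1 and F^(2 beta), so a single factor 1 + F comes out. *)
Lemma growth_scale (R : realType) (n beta r I F P K : R) : 3 <= n -> 0 < beta -> 0 < r ->
  r = 2 * n * beta / (n - 2) -> 0 <= I -> 0 <= F -> 0 <= P -> 0 <= K ->
  I `^ ((n - 2) / n) <= P + 2 * (K * F ^+ 2) `^ beta ->
  I `^ r^-1 <= (P + 2 * K `^ beta) `^ (2 * beta)^-1 * (1 + F).
Proof.
move=> n3 be0 r0 rE I0 F0 P0 K0 h.
have n0 : 0 < n by apply: lt_le_trans n3.
have n2 : 0 < n - 2 by rewrite subr_gt0 (lt_le_trans _ n3) // ltr_nat.
have F1 : 0 <= 1 + F by rewrite addr_ge0.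
have b2 : 0 < 2 * beta by rewrite mulr_gt0.
have -> : r^-1 = (n - 2) / n * (2 * beta)^-1.
  by rewrite rE; field; rewrite !gt_eqF.
have -> : (P + 2 * K `^ beta) `^ (2 * beta)^-1 * (1 + F) =
  ((P + 2 * K `^ beta) * (1 + F) `^ (2 * beta)) `^ (2 * beta)^-1.
  rewrite powRM ?powR_ge0 ?addr_ge0 ?mulr_ge0 ?powR_ge0 //.
  by rewrite -[in RHS]powRrM divff ?gt_eqF // powRr1.
rewrite powRrM; apply: ge0_ler_powR; rewrite ?nnegrE ?powR_ge0 //.
- by rewrite invr_ge0 ltW.
- by rewrite mulr_ge0 ?powR_ge0 // addr_ge0 // mulr_ge0 ?powR_ge0.
apply: le_trans h _; rewrite [leRHS]mulrDl lerD //.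
  rewrite ler_peMr //; have E : 1 `^ (2 * beta) = 1 :> R by rewrite powR1.
  rewrite -[leLHS]E.
  by apply: ge0_ler_powR; rewrite ?nnegrE ?lerDl //; exact: ltW.
rewrite powRM ?sqr_ge0 // -mulrA ler_wpM2l // ler_wpM2l ?powR_ge0 //.
rewrite -powR_mulrn // -powRrM; apply: ge0_ler_powR; rewrite ?nnegrE ?lerDr //.
exact: ltW.
Qed.

Theorem theorem3p1 (R : realType) (d : nat) (hd : (3 <= d)%N) :
  exists q : R -> R,
    q @ +oo --> (d%:R : R)^'- /\
    forall gamma : R, 1 < gamma ->
    exists rbar : R, 1 < rbar /\
    forall r : R, rbar < r ->
    (1 < q r /\ q r < d%:R) /\
    forall kappa rho sigma theta s : R,
      0 < kappa -> 0 < rho -> 0 < sigma -> 0 < theta -> d%:R < s ->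
    exists C : R, 0 < C /\
    forall (M : riemannian R d)
      (vol : {measure set (borel M) -> \bar R})
      (Omega : set M) (nu : M -> 'rV[R]_d)
      (f u : M -> R) (B : M -> 'rV[R]_d),
      connected [set: M] -> orientable M -> riemannian_volume vol ->
      outward_unit_normal Omega nu -> class_Oplus Omega nu ->
      (vol Omega <= rho%:E)%E ->
      (forall (x : M) (xi : 'rV[R]_d), Omega x ->
         - kappa * tnorm x xi ^+ 2 <= ricci x xi xi) ->
      (exists2 S : R, sobolev_constant vol Omega S & S <= sigma) ->
      Ck_fun 1 Omega f -> Ck_fun_closure 0 Omega f ->
      Ck_field 1 Omega B -> C0_field_closure Omega B ->
      (Lp_norm_field vol s Omega B <= theta%:E)%E ->
      Ck_fun 3 Omega u -> Ck_fun_closure 2 Omega u ->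
      (forall x : M, Omega x ->
         - laplacian u x + gamma^-1 * tnorm x (grad u x) `^ gamma
         + inner x (B x) (grad u x) = f x) ->
      (forall x : M, bdry Omega x -> normal_derivative Omega nu u x = 0) ->
      (Lp_norm_field vol r Omega (grad u)
       <= C%:E * (1 + Lp_norm vol (q r) Omega f))%E.
Proof.
have d3 : (3 : R) <= d%:R by rewrite ler_nat.
have d0 : (0 : R) < d%:R by apply: lt_le_trans d3.
have d2 : (0 : R) < d%:R - 2 by rewrite subr_gt0 (lt_le_trans _ d3) // ltr_nat.
(* The exponent with 1 / q = 1 / r + 1 / d; it involves neither gamma nor the geometry. *)
exists (fun r => r * d%:R / (d%:R + r)); split; first exact: exponent_cvg.
move=> gamma g1; have g0 : 0 < gamma := lt_trans ltr01 g1.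
have dg : 0 < d%:R * gamma by rewrite mulr_gt0.
exists (2 * d%:R * (4 * d%:R * gamma + 8) / (d%:R - 2)); split.
  rewrite ltr_pdivlMr // mul1r; move: d3 dg; rewrite -[4 * d%:R * gamma]mulrA.
  by set n : R := d%:R; set m := n * gamma => n3 m0; nra.
move=> r hr; have [r1 q1 qd hb] := exponent_bounds d3 g1 hr; split=> //.
have r0 : 0 < r by apply: lt_trans r1.
move=> kappa rho sigma theta s kappa0 rho0 sigma0 theta0 ds.
set b := r * (d%:R - 2) / (2 * d%:R) - 1 in hb.
have b0 : 0 < b by apply: lt_le_trans hb; rewrite addr_gt0 // -mulrA mulr_gt0.
have b1 : 0 < b + 1 by rewrite addr_gt0.
have rE : r = 2 * d%:R * (b + 1) / (d%:R - 2).
  by rewrite /b subrK; field; rewrite !gt_eqF.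
pose K1 := 2 * sigma ^+ 2 * (b + 1) ^+ 2 / b.
pose C2 := 2 * d%:R + 1 + b.
pose Lam := (8 * K1 * C2 * (theta `^ s) `^ (2 / d%:R)) `^ (d%:R / (s - d%:R)).
have K10 : 0 < K1 by rewrite divr_gt0 // !mulr_gt0 // exprn_gt0.
have C20 : 0 < C2 by rewrite /C2 addr_gt0 // addr_gt0 // mulr_gt0.
have Lam0 : 0 <= Lam by exact: powR_ge0.
have c10 : 0 < K1 * (3 / (8 * d%:R * gamma ^+ 2)).
  by apply: mulr_gt0 K10 _; rewrite divr_gt0 // mulr_gt0 ?exprn_gt0 // mulr_gt0.
have e0 : 0 <= K1 * (kappa + 2 * C2 * Lam) + 2 * sigma ^+ 2.
  apply: addr_ge0; last by rewrite mulr_ge0 ?sqr_ge0.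
  apply: mulr_ge0 (ltW K10) _; apply: addr_ge0 (ltW kappa0) _.
  by apply: mulr_ge0 Lam0; apply: mulr_ge0 (ltW C20).
(* Obtained from a scalar inequality, before the manifold is introduced, so that the final constant
   depends on the listed data alone. *)
have [C3 C30 growth] := absorb_growth b0 g1 e0 c10.
have K50 : 0 < 4 * (2 * K1 * C2).
  by apply: mulr_gt0; rewrite // mulr_gt0 // mulr_gt0.
have P0 : 0 <= 2 * C3 * rho by apply: mulr_ge0 (ltW rho0); apply: mulr_ge0 C30.
exists ((2 * C3 * rho + 2 * (4 * (2 * K1 * C2)) `^ (b + 1)) `^ (2 * (b + 1))^-1); split.
  apply: powR_gt0; apply: ltr_wpDl P0 _; apply: mulr_gt0; first exact: ltr0n.
  exact: powR_gt0.
move=> M vol O nu f u B _ _ volP nuP II volO ricP [S hS Ss] hf hfc hB hBc hBs hu huc pde neumann.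
have [[[_ _ oO] cO _ _] _] := II.
have := gradient_power_estimate volP hd oO cO hu huc nuP II neumann g1 sigma0 theta0 ds volO
  ricP pde hS Ss hf hfc hB hBc hBs hb C30 growth.
rewrite (Lp_norm_grad hd oO cO hu huc g1 volO hb) (Lp_norm_rhs hd oO cO g1 volO hf hfc hb).
rewrite -EFinD -EFinM lee_fin.
apply: growth_scale d3 b1 r0 rE _ _ P0 (ltW K50).
- by apply: Rintegral_ge0 => p _; exact: powR_ge0.
- exact: powR_ge0.
Qed.
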